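(* Let $G$ be a countable free group or $G=\mathrm{PSL}_k(\mathbf{Z})$ for some $k\geq 2$. Then there is a continuum $\{(H^r_n)_n\}_{r\in\mathbf{R}}$ of normal chains (descending chains of finite index normal subgroups of $G$), whose associated profinite actions $a^{(H^r_n)}$ are free, such that for all $r,s\in\mathbf{R}$: $\mathrm{h}_{\Sigma_{(H^r_n)}}(a^{(H^s_n)})>-\infty$ if and only if $r=s$.
   Context: Fix a non-principal ultrafilter $\mathfrak{u}$ on $\mathbf{N}$. All actions are probability measure preserving; $(\mathfrak{X}_a,\mu_a)$ is the space of the action $a$. Profinite actions: for a descending chain $(H_n)_n$ of finite index subgroups of $G$, each $G/H_n$ carries the normalized counting measure and the left translation action; $a^{(H_n)}$ is the action of $G$ on $\varprojlim G/H_n$ with the inverse limit measure. Free means that for every $g\neq 1_G$ the set of points fixed by $g$ has measure $0$. Sofic approximations: let $\mathbf{F}$ be a countable free group, $\pi:\mathbf{F}\to G$ a surjective homomorphism and $\rho:G\to\mathbf{F}$ a section of $\pi$ with $\rho(1)=1$. A sofic approximation $\Sigma=(a_n)_n$ of $G$ is a sequence of actions of $\mathbf{F}$ on finite sets $\mathfrak{X}_{a_n}$ (with normalized counting measure $\mu_{a_n}$) such that $\lim_n\mu_{a_n}(\{x:gx=x\})=1$ for $g\in\ker\pi$ and $=0$ for $g\notin\ker\pi$. If $a^{(H_n)}$ is free, the sequence of actions of $G$ on $G/H_n$ (viewed as actions of $\mathbf{F}$ via $\pi$) is a sofic approximation, denoted $\Sigma_{(H_n)}$. Sofic entropy: let $a$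 be an action of $G$ on a standard probability space, $\alpha$ a finite partition of $\mathfrak{X}_a$, $F\subset G$ a finite subset containing $1_G$, $\delta>0$. Let $\alpha_F$ be the partition generated by the translates $f\alpha$, $f\in F$. Let $\mathrm{Hom}(a,\alpha,F,\delta,a_n)$ be the set of homomorphisms $\varphi$ from the finite measure algebra generated by $\alpha_F$ to the algebra of subsets of $\mathfrak{X}_{a_n}$ such that $\mu_{a_n}(\rho(f)\varphi(A)\,\Delta\,\varphi(fA))<\delta$ for all $A\in\alpha$, $f\in F$, and $\sum_{A\in\alpha_F}|\mu_{a_n}(\varphi(A))-\mu_a(A)|<\delta$. For a partition $\xi$ refined by $\alpha$, $|\mathrm{Hom}(a,\alpha,F,\delta,a_n)|_\xi$ is the number of distinct restrictions to $\xi$ of elements of this set. Define (with $\log 0=-\infty$) $$\mathrm{h}^\xi_\Sigma(\alpha,F,\delta,a)=\lim_{n\in\mathfrak{u}}\frac{1}{|\mathfrak{X}_{a_n}|}\log|\mathrm{Hom}(a,\alpha,F,\delta,a_n)|_\xi,\qquad \mathrm{h}_\Sigma(a)=\sup_\xi\ \inf_{\alpha}\ \inf_{F}\ \inf_{\delta>0}\ \mathrm{h}^\xi_\Sigma(\alpha,F,\delta,a),$$ where $\xi$ ranges over finite partitions of $\mathfrak{X}_a$, $\alpha$ over finite partitions refining $\xi$, and $F$ over finite subsets of $G$ containing $1_G$.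
   Formalization: ''Countable free group'' is taken to be non-abelian (rank at least 2): for the trivial group there is only one chain, and for Z, which is amenable, the entropy is 0 for all r, s, so the stated equivalence fails in ranks 0 and 1. *)

(* Defs.v *)
From HB Require Import structures.
From mathcomp Require Import all_boot all_order all_algebra finmap.
From mathcomp Require Import all_classical all_reals all_analysis.

Set Implicit Arguments.
Unset Strict Implicit.
Unset Printing Implicit Defensive.

Import Order.TTheory GRing.Theory Num.Theory.
Import numFieldNormedType.Exports.
Local Open Scope classical_set_scope.
Local Open Scope ring_scope.

Section Groups.
Variable G : groupType.
Implicit Types (H : set G) (g h x y : G).

Definition subgroup H : Prop :=
  [/\ H 1%g, forall x y, H x -> H y -> H (x * y)%g & forall x, H x -> H x^-1%g].

Definition normal H : Prop := forall g x, H x -> H (g * x * g^-1)%g.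

Definition lcoset H g : set G := [set (g * x)%g | x in H].

Definition lcosets H : set (set G) := range (lcoset H).

Definition center : set G := [set z | forall g, (z * g = g * z)%g].

Lemma center_subgroup : subgroup center.
Proof.
split=> [g|x y Zx Zy g|x Zx g]; first by rewrite mul1g mulg1.
  by rewrite -mulgA Zy !mulgA Zx.
by apply: (mulgI x); rewrite mulgA mulgV mul1g !mulgA Zx -mulgA mulgV mulg1.
Qed.

Lemma center_normal : normal center.
Proof. by move=> g x Zx; rewrite -Zx -mulgA mulgV mulg1. Qed.

Lemma lcosetE H (sH : subgroup H) g x : lcoset H g x <-> H (g^-1 * x)%g.
Proof.
split=> [[y Hy <-]|Hx]; first by rewrite mulgA mulVg mul1g.
by exists (g^-1 * x)%g => //; rewrite mulgA mulgV mul1g.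
Qed.

Lemma lcoset_refl H (sH : subgroup H) g : lcoset H g g.
Proof. by apply/lcosetE => //; rewrite mulVg; case: sH. Qed.

Lemma lcoset_eq H (sH : subgroup H) g x : lcoset H g x -> lcoset H x = lcoset H g.
Proof.
have [H1 HM HV] := sH.
move=> /(lcosetE sH) gx; apply/seteqP; split=> y /(lcosetE sH) Hy;
  apply/(lcosetE sH).
  by have := HM _ _ gx Hy; rewrite -mulgA [X in (_ * X)%g]mulgA mulgV mul1g.
have := HM _ _ (HV _ gx) Hy.
by rewrite invgM invgK -mulgA [X in (_ * X)%g]mulgA mulgV mul1g.
Qed.

End Groups.

Record normal_subgroup (G : groupType) := NormalSubgroup {
  normal_set :> set G;
  normal_subgroupP : subgroup normal_set;
  normal_normalP : normal normal_set }.

(* The group structure on the left cosets is the setwise product. *)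
Definition quotient (G : groupType) (N : normal_subgroup G) : Type :=
  lcosets N.

Section Quotient.
Variables (G : groupType) (N : normal_subgroup G).
Let sN := normal_subgroupP N.
Let nN := @normal_normalP _ N.

HB.instance Definition _ := Choice.on (quotient N).


Definition quotient_class (g : G) : quotient N :=
  exist _ (lcoset N g) (mem_set (ex_intro2 _ _ g I erefl)).

Lemma quotient_surj (c : quotient N) : exists g, c = quotient_class g.
Proof.
case: c => C CN; have [g _ gC] := set_mem CN; exists g.
by apply: val_inj => /=; rewrite gC.
Qed.

Lemma quotient_mul_subproof (C D : quotient N) :
  [set (x * y)%g | x in val C & y in val D] \in lcosets N.
Proof.
have [H1 HM HV] := sN.
have [g ->] := quotient_surj C; have [h ->] := quotient_surj D.
apply/mem_set; exists (g * h)%g => //=; apply/seteqP; split.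
  move=> z /(lcosetE sN) Nz; exists g; first exact: lcoset_refl.
  exists (g^-1 * z)%g; last by rewrite mulgA mulgV mul1g.
  by apply/(lcosetE sN); rewrite mulgA -invgM.
move=> _ [x /(lcosetE sN) Nx [y /(lcosetE sN) Ny <-]]; apply/(lcosetE sN).
have := HM _ _ (nN h^-1%g Nx) Ny.
by rewrite invgK invgM -!mulgA [X in (_ * (_ * (_ * X)))%g]mulgA mulgV mul1g.
Qed.

Definition quotient_mul (C D : quotient N) : quotient N :=
  exist _ [set (x * y)%g | x in val C & y in val D] (quotient_mul_subproof C D).

Lemma quotient_inv_subproof (C : quotient N) :
  [set x^-1%g | x in val C] \in lcosets N.
Proof.
have [H1 HM HV] := sN.
have [g ->] := quotient_surj C.
apply/mem_set; exists g^-1%g => //=; apply/seteqP; split.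
  move=> z /(lcosetE sN); rewrite invgK => Nz.
  exists z^-1%g; last by rewrite invgK.
  apply/(lcosetE sN); rewrite -invgM.
  by apply: HV; have := nN g^-1%g Nz; rewrite invgK mulgA mulVg mul1g.
move=> _ [x /(lcosetE sN) Nx <-]; apply/(lcosetE sN); rewrite invgK -[g]invgK -invgM.
apply: HV.
by have := nN g Nx; rewrite !mulgA mulgV mul1g.
Qed.

Definition quotient_inv (C : quotient N) : quotient N :=
  exist _ [set x^-1%g | x in val C] (quotient_inv_subproof C).

Lemma quotient_classM g h :
  quotient_mul (quotient_class g) (quotient_class h) = quotient_class (g * h)%g.
Proof.
have [H1 HM HV] := sN.
have [k Ek] := quotient_surj (quotient_mul (quotient_class g) (quotient_class h)).
rewrite Ek; apply: val_inj => /=; apply/esym/lcoset_eq => //.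
have /(congr1 val)/= <- := Ek.
by exists g; [exact: lcoset_refl|exists h => //; exact: lcoset_refl].
Qed.

Lemma quotient_classV g : quotient_inv (quotient_class g) = quotient_class g^-1%g.
Proof.
have [k Ek] := quotient_surj (quotient_inv (quotient_class g)).
rewrite Ek; apply: val_inj => /=; apply/esym/lcoset_eq => //.
have /(congr1 val)/= <- := Ek.
by exists g => //; exact: lcoset_refl.
Qed.

Lemma quotient_mulA : associative quotient_mul.
Proof.
move=> C D E; have [a ->] := quotient_surj C; have [b ->] := quotient_surj D.
by have [c ->] := quotient_surj E; rewrite !quotient_classM mulgA.
Qed.

Lemma quotient_mul1 : left_id (quotient_class 1%g) quotient_mul.
Proof.
by move=> C; have [a ->] := quotient_surj C; rewrite quotient_classM mul1g.
Qed.

Lemma quotient_1mul : right_id (quotient_class 1%g) quotient_mul.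
Proof.
by move=> C; have [a ->] := quotient_surj C; rewrite quotient_classM mulg1.
Qed.

Lemma quotient_mulV :
  left_inverse (quotient_class 1%g) quotient_inv quotient_mul.
Proof.
move=> C; have [a ->] := quotient_surj C.
by rewrite quotient_classV quotient_classM mulVg.
Qed.

Lemma quotient_Vmul :
  right_inverse (quotient_class 1%g) quotient_inv quotient_mul.
Proof.
move=> C; have [a ->] := quotient_surj C.
by rewrite quotient_classV quotient_classM mulgV.
Qed.

HB.instance Definition _ := isGroup.Build (quotient N)
  quotient_mulA quotient_mul1 quotient_1mul quotient_mulV quotient_Vmul.

End Quotient.

Definition SLZ (k : nat) : Type := {A : 'M[int]_k | \det A == 1}.

Section SLZ.
Variable k : nat.
HB.instance Definition _ := SubType.on (SLZ k).
HB.instance Definition _ := Choice.on (SLZ k).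

Lemma SLZ_mul_subproof (A B : SLZ k) : \det (val A *m val B) == 1.
Proof. by rewrite det_mulmx (eqP (valP A)) (eqP (valP B)) mulr1. Qed.

Lemma SLZ_unit (A : SLZ k) : val A \in unitmx.
Proof. by rewrite unitmxE (eqP (valP A)) unitr1. Qed.

Lemma SLZ_inv_subproof (A : SLZ k) : \det (invmx (val A)) == 1.
Proof. by rewrite det_inv (eqP (valP A)) invr1. Qed.

Lemma SLZ_one_subproof : \det (1%:M : 'M[int]_k) == 1.
Proof. by rewrite det1. Qed.

Definition SLZ_mul (A B : SLZ k) : SLZ k :=
  exist _ (val A *m val B) (SLZ_mul_subproof A B).
Definition SLZ_inv (A : SLZ k) : SLZ k := exist _ (invmx (val A)) (SLZ_inv_subproof A).
Definition SLZ_one : SLZ k := exist _ 1%:M SLZ_one_subproof.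

Lemma SLZ_mulA : associative SLZ_mul.
Proof. by move=> A B C; apply: val_inj; rewrite /= mulmxA. Qed.
Lemma SLZ_mul1 : left_id SLZ_one SLZ_mul.
Proof. by move=> A; apply: val_inj; rewrite /= mul1mx. Qed.
Lemma SLZ_1mul : right_id SLZ_one SLZ_mul.
Proof. by move=> A; apply: val_inj; rewrite /= mulmx1. Qed.
Lemma SLZ_mulV : left_inverse SLZ_one SLZ_inv SLZ_mul.
Proof. by move=> A; apply: val_inj; rewrite /= mulVmx ?SLZ_unit. Qed.
Lemma SLZ_Vmul : right_inverse SLZ_one SLZ_inv SLZ_mul.
Proof. by move=> A; apply: val_inj; rewrite /= mulmxV ?SLZ_unit. Qed.

HB.instance Definition _ := isGroup.Build (SLZ k)
  SLZ_mulA SLZ_mul1 SLZ_1mul SLZ_mulV SLZ_Vmul.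
End SLZ.

(* SL_k(Z) modulo its center. *)
Definition PSLZ (k : nat) : groupType :=
  quotient (NormalSubgroup (@center_subgroup (SLZ k)) (@center_normal (SLZ k))).


(* Universal property of the free group on S; only the restriction of f to S
   matters. *)
Definition free_basis (G : groupType) (S : set G) : Prop :=
  forall (K : groupType) (f : G -> K), exists h : {multiplicative G -> K},
    (forall s, S s -> h s = f s) /\
    forall h' : {multiplicative G -> K},
      (forall s, S s -> h' s = f s) -> h' =1 h.

Definition free_group (G : groupType) : Prop := exists S : set G, free_basis S.

Definition isomorphic (G K : groupType) : Prop :=
  exists f : {multiplicative G -> K}, bijective f.

Record chain (G : groupType) := Chain {
  chain_set :> nat -> set G;
  chain_subgroup : forall n, subgroup (chain_set n);
  chain_finite : forall n, finite_set (lcosets (chain_set n));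
  chain_desc : forall n, chain_set n.+1 `<=` chain_set n }.

Definition normal_chain (G : groupType) (H : chain G) : Prop :=
  forall n, normal (H n).

Definition ncounting (R : realType) (T : finType) (A : {set T}) : R :=
  #|A|%:R / #|T|%:R.

Section Levels.
Variables (G : groupType) (H : chain G).
Implicit Types (g h : G) (n m : nat).

(* G / H_n as a finite type; [fset_set] is faithful here since the set of left
   cosets is finite by [chain_finite]. *)
Definition level n : finType := fset_set (lcosets (H n)).

Let sH n := chain_subgroup H n.

Lemma level_subproof n g : lcoset (H n) g \in fset_set (lcosets (H n)).
Proof. by rewrite in_fset_set; [apply/mem_set; exists g|exact: chain_finite]. Qed.

Definition cls n g : level n := [` level_subproof n g]%fset.

Lemma val_cls n g : val (cls n g) = lcoset (H n) g. Proof. by []. Qed.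

Lemma cls_surj n (c : level n) : exists g, c = cls n g.
Proof.
have := valP c; rewrite in_fset_set; last exact: chain_finite.
by move=> /set_mem[g _ gc]; exists g; apply: val_inj; rewrite /= gc.
Qed.

Lemma cls_mem n (c : level n) g : val c g <-> c = cls n g.
Proof.
have [h ->] := cls_surj c; split=> [hg|->]; last exact: lcoset_refl.
by apply: val_inj => /=; apply/esym/lcoset_eq.
Qed.

Lemma cls_eq n g h : cls n g = cls n h <-> H n (g^-1 * h)%g.
Proof. by rewrite -cls_mem /= lcosetE. Qed.

Lemma cls_eqMl n k g h : cls n (k * g)%g = cls n (k * h)%g <-> cls n g = cls n h.
Proof. by rewrite !cls_eq invgM -!mulgA mulKg. Qed.

Lemma level_act_subproof n g (c : level n) :
  [set (g * x)%g | x in val c] \in fset_set (lcosets (H n)).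
Proof.
have [h ->] := cls_surj c; rewrite (_ : [set _ | _ in _] = lcoset (H n) (g * h)).
  exact: level_subproof.
apply/seteqP; split=> x.
  by move=> [y /lcosetE Hy <-]; apply/lcosetE => //;
    rewrite invgM -mulgA mulKg; apply: Hy.
move=> /lcosetE Hx; exists (g^-1 * x)%g; last by rewrite mulVKg.
by apply/lcosetE => //; rewrite mulgA -invgM; exact: Hx.
Qed.

Definition level_act n g (c : level n) : level n :=
  [` level_act_subproof g c]%fset.

Lemma level_act_cls n g h : level_act g (cls n h) = cls n (g * h)%g.
Proof. by apply/cls_mem => /=; exists h => //; exact: lcoset_refl. Qed.

Lemma level_act1 n (c : level n) : level_act 1%g c = c.
Proof. by have [h ->] := cls_surj c; rewrite level_act_cls mul1g. Qed.

Lemma level_actM n g h (c : level n) :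
  level_act (g * h)%g c = level_act g (level_act h c).
Proof. by have [k ->] := cls_surj c; rewrite !level_act_cls mulgA. Qed.

Lemma level_gt0 n : (0 < #|level n|)%N.
Proof. by apply/card_gt0P; exists (cls n 1%g). Qed.

Lemma chain_le n m : (n <= m)%N -> H m `<=` H n.
Proof.
move=> /subnK <-; elim: (m - n)%N => [//|k IH].
by rewrite addSn; apply: subset_trans IH; exact: chain_desc.
Qed.

Definition down n m (c : level m) : level n := cls n (xget 1%g (val c)).

Lemma down_cls n m g : (n <= m)%N -> down n (cls m g) = cls n g.
Proof.
move=> nm; rewrite /down; case: xgetP => [h _ /= /lcosetE gh|/(_ g)[]].
  by apply/esym/cls_eq/(chain_le nm); exact: gh.
exact: lcoset_refl.
Qed.

Lemma down_sub n m (c : level m) (d : level n) : (n <= m)%N ->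
  val c `<=` val d <-> down n c = d.
Proof.
move=> nm; have [g ->] := cls_surj c; have [h ->] := cls_surj d.
rewrite down_cls//; split=> [/(_ g)|/cls_eq gh].
  by move=> /(_ (lcoset_refl (sH m) g)) /cls_mem.
move=> x /= /lcosetE mx; apply/lcosetE => //.
have [H1 HM HV] := sH n.
have := HM _ _ (HV _ gh) (chain_le nm (mx (sH m))).
by rewrite invgM invgK mulgA mulgK.
Qed.

Lemma card_down n m (S : {set level n}) : (n <= m)%N ->
  #|(@down n m) @^-1: S| = (#|S| * #|(@down n m) @^-1: [set cls n 1%g]%SET|)%N.
Proof.
move=> nm; rewrite -sum1_card (partition_big (@down n m) (mem S))/=; last first.
  by move=> c; rewrite inE.
rewrite -sum_nat_const; apply: eq_bigr => d dS.
have [g dE] := cls_surj d.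
rewrite (_ : #|_| = #|(@level_act m g) @: ((@down n m) @^-1: [set cls n 1%g]%SET)|).
  rewrite -sum1_card; apply: eq_bigl => c.
  apply/andP/imsetP => [[cS /eqP cd]|[e]].
    have [h ch] := cls_surj c; exists (cls m (g^-1 * h)%g).
      have e : cls n (g^-1 * h)%g = cls n 1%g.
        apply: (@cls_eqMl n g _ _).1.
        by rewrite mulVKg mulg1 -dE -cd ch down_cls.
      by rewrite finset.in_set finset.in_set1 down_cls// e.
    by rewrite level_act_cls mulVKg.
  have [h ->] := cls_surj e.
  rewrite finset.in_set finset.in_set1 down_cls// level_act_cls => /eqP h1 ->.
  have e' : cls n (g * h)%g = d.
    by rewrite dE -[in RHS](mulg1 g); apply/(@cls_eqMl n g h 1%g).
  by rewrite finset.in_set down_cls// e' dS eqxx.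
apply/esym/card_imset => c c'.
have [a ->] := cls_surj c; have [b ->] := cls_surj c'.
by rewrite !level_act_cls => /cls_eqMl.
Qed.

Lemma counting_down (R : realType) n m (S : {set level n}) : (n <= m)%N ->
  ncounting R ((@down n m) @^-1: S) = ncounting R S.
Proof.
move=> nm; have cT := card_down [set: level n]%SET nm.
rewrite preimsetT !cardsT in cT.
rewrite /ncounting card_down// cT.
have : (0 < #|level m|)%N := level_gt0 m.
rewrite cT muln_gt0 => /andP[n0 k0].
by rewrite !natrM -mulf_div divff ?mulr1// pnatr_eq0 -lt0n.
Qed.

(* Inclusion of cosets expresses compatibility with G/H_n.+1 -> G/H_n. *)
Definition invlim : Type :=
  [set x : forall n, level n | forall n, val (x n.+1) `<=` val (x n)].

HB.instance Definition _ := Choice.on invlim.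

Definition coord n (x : invlim) : level n := val x n.

Lemma invlim_subproof g : (fun n => cls n g) \in
  [set x : forall n, level n | forall n, val (x n.+1) `<=` val (x n)].
Proof.
apply/mem_set => n; apply/(@down_sub n n.+1) => //; exact: down_cls.
Qed.

Definition invlim_cls g : invlim := exist _ (fun n => cls n g) (invlim_subproof g).

HB.instance Definition _ := isPointed.Build invlim (invlim_cls 1%g).

Lemma coord_down n m (x : invlim) : (n <= m)%N -> coord n x = down n (coord m x).
Proof.
move=> nm; apply/esym/down_sub => //.
rewrite /coord; move: (set_mem (valP x)) => /=; set y := val x => yP.
move: nm => /subnK <-; elim: (m - n)%N => [//|k IH].
by rewrite addSn; apply: subset_trans IH; exact: yP.
Qed.

Lemma coord_cls n (x : invlim) :
  exists g, forall k, (k <= n)%N -> coord k x = cls k g.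
Proof.
have [g gx] := cls_surj (coord n x); exists g => k kn.
by rewrite (coord_down _ kn) gx down_cls.
Qed.

Definition cylinder : set (set invlim) :=
  [set A | exists n (S : {set level n}), A = [set x | coord n x \in S]].

Lemma cylinderS n (S : {set level n}) m : (n <= m)%N ->
  [set x | coord n x \in S] = [set x | coord m x \in (@down n m) @^-1: S].
Proof. by move=> nm; apply/seteqP; split=> x /=; rewrite inE (coord_down _ nm). Qed.

Lemma cylinder0 : cylinder set0.
Proof. by exists 0%N, finset.set0; apply/seteqP; split=> x //=; rewrite inE. Qed.

Lemma cylinder2 A B : cylinder A -> cylinder B -> exists n (S T : {set level n}),
  A = [set x | coord n x \in S] /\ B = [set x | coord n x \in T].
Proof.
move=> [n [S ->]] [m [T ->]]; exists (maxn n m).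
exists ((@down n _) @^-1: S), ((@down m _) @^-1: T).
by split; apply: cylinderS; rewrite ?leq_maxl ?leq_maxr.
Qed.

Lemma cylinderU : setU_closed cylinder.
Proof.
move=> A B cA cB; have [n [S [T [-> ->]]]] := cylinder2 cA cB.
exists n, (S :|: T)%SET; apply/seteqP; split=> x /=; rewrite inE.
  by move=> /orP.
by move/orP.
Qed.

Lemma cylinderC : setC_closed cylinder.
Proof.
move=> _ [n [S ->]]; exists n, (~: S)%SET; apply/seteqP; split=> x /=; rewrite inE.
  by move/negP.
by move/negP.
Qed.

End Levels.

Definition cylinder_display : measure_display. Proof. exact. Qed.

HB.instance Definition _ (G : groupType) (H : chain G) :=
  isAlgebraOfSets.Build cylinder_display (invlim H) (@cylinder0 G H)
    (@cylinderU G H) (@cylinderC G H).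

Section Counting.
Variables (R : realType) (T : finType).
Implicit Types A B : {set T}.

Lemma counting_ge0 A : 0 <= ncounting R A.
Proof. by rewrite /ncounting divr_ge0. Qed.

Lemma countingU A B : (A :&: B = finset.set0)%SET ->
  ncounting R (A :|: B)%SET = ncounting R A + ncounting R B.
Proof.
move=> AB; rewrite /ncounting -mulrDl -natrD cardsU; congr (_%:R / _).
by rewrite AB cards0 subn0.
Qed.

Lemma counting0 : ncounting R (finset.set0 : {set T}) = 0.
Proof. by rewrite /ncounting cards0 mul0r. Qed.

Lemma countingT : (0 < #|T|)%N -> ncounting R [set: T]%SET = 1.
Proof. by move=> T0; rewrite /ncounting cardsT divff// pnatr_eq0 -lt0n. Qed.
End Counting.

Section InverseLimitMeasure.
Variables (R : realType) (G : groupType) (H : chain G).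

Definition cylinder_level (A : set (invlim H)) : nat :=
  xget 0%N [set n | exists S : {set level H n}, A = [set x | coord n x \in S]].

(* [cylinder_level A] is some level n over which the cylinder A is defined; the
   value does not depend on it, see [cylinder_contentE]. *)
Definition cylinder_content (A : set (invlim H)) : \bar R :=
  let n := cylinder_level A in
  (ncounting R [set c : level H n | `[< (@coord _ H n @` A) c >]]%SET)%:E.

Lemma coord_surj n (c : level H n) : exists x : invlim H, coord n x = c.
Proof. by have [g ->] := cls_surj c; exists (invlim_cls H g). Qed.

Lemma coord_cylinder n (S : {set level H n}) :
  [set c : level H n | `[< (@coord _ H n @` [set x | coord n x \in S]) c >]]%SET = S.
Proof.
apply/setP => c; rewrite finset.in_set; apply/asboolP/idP => [[x /= xS <-]//|cS].
by have [x xc] := coord_surj c; exists x => //=; rewrite xc.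
Qed.

Lemma cylinder_contentE n (S : {set level H n}) :
  cylinder_content [set x | coord n x \in S] = (ncounting R S)%:E.
Proof.
rewrite /cylinder_content/cylinder_level; move AE : [set x | coord n x \in S] => A.
case: xgetP => [m _ /= [T AT]|/(_ n)]; last by case; exists S; rewrite AE.
rewrite AT coord_cylinder; congr EFin.
pose k := maxn n m.
have nk : (n <= k)%N by rewrite leq_maxl.
have mk : (m <= k)%N by rewrite leq_maxr.
rewrite -(counting_down R S nk) -(counting_down R T mk).
rewrite -[in RHS](coord_cylinder (_ @^-1: S)) -[in LHS](coord_cylinder (_ @^-1: T)).
by rewrite -!cylinderS// AE -AT.
Qed.

Lemma cylinder_content_ge0 A : (0 <= cylinder_content A)%E.
Proof. by rewrite lee_fin counting_ge0. Qed.

Lemma cylinder_content0 : cylinder_content set0 = 0%E.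
Proof.
have -> : set0 = [set x : invlim H | coord 0 x \in (finset.set0 : {set level H 0})].
  by apply/seteqP; split=> x //=; rewrite finset.in_set0.
by rewrite cylinder_contentE counting0.
Qed.

Lemma cylinder_contentU (A B : set (invlim H)) : measurable A -> measurable B ->
  A `&` B = set0 ->
  cylinder_content (A `|` B) = (cylinder_content A + cylinder_content B)%E.
Proof.
move=> mA mB; have [n [S [T [-> ->]]]] := cylinder2 mA mB => ST.
have -> : [set x | coord n x \in S] `|` [set x | coord n x \in T] =
    [set x | coord n x \in (S :|: T)%SET].
  by apply/seteqP; split=> x /=; rewrite finset.in_setU => /orP.
rewrite !cylinder_contentE countingU//.
apply/setP => c; rewrite finset.in_setI finset.in_set0.
apply/negP => /andP[cS cT]; have [x xc] := coord_surj c.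
by suff: set0 x by []; rewrite -ST /= xc.
Qed.

Lemma cylinder_content_semi_additive : measure_function.semi_additive cylinder_content.
Proof.
apply: (additive2P cylinder_content0).2 => A B mA mB AB.
exact: cylinder_contentU.
Qed.

HB.instance Definition _ := isContent.Build cylinder_display (invlim H) R
  cylinder_content cylinder_content_ge0 cylinder_content_semi_additive.

Lemma cylinder_compact (A : nat -> set (invlim H)) :
  (forall n, measurable (A n)) -> \bigcup_n A n = setT ->
  exists N, \bigcup_(n in `I_N) A n = setT.
Proof.
move=> mA AT; apply: contrapT => nA.
have {}nA N : exists x : invlim H, forall n, (n < N)%N -> ~ A n x.
  apply: contrapT => /forallNP xA; apply: nA; exists N; apply/seteqP; split => // x _.
  have /existsNP[n /not_implyP[nN /contrapT Anx]] := xA x.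
  by exists n.
have /choice[x xA] := nA.
have [U [UU subU]] : exists U : set_system nat, UltraFilter U /\ \oo `<=` U.
  exact: ultraFilterLemma.
have Uc n : exists c : level H n, U [set k | coord n (x k) = c].
  apply: contrapT => /forallNP nU.
  have : \forall k \near U, forall c : level H n, ~ coord n (x k) = c.
    apply: filter_forall => c.
    by have [/nU//|] := in_ultra_setVsetC [set k | coord n (x k) = c] UU.
  by move=> /filter_ex[k /(_ (coord n (x k)))]; apply.
pose c n : level H n := xget (cls H n 1%g) [set c | U [set k | coord n (x k) = c]].
have cP n : U [set k | coord n (x k) = c n].
  by rewrite /c; case: xgetP => [_ _ //|nc]; have [d /(nc d)] := Uc n.
have cy : c \in [set x : forall n, level H n | forall n, val (x n.+1) `<=` val (x n)].
  apply/mem_set => n; apply/(@down_sub _ H n n.+1) => //.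
  have [k [/= <- <-]] := filter_ex (filterI (cP n) (cP n.+1)).
  by apply/esym/coord_down.
pose y : invlim H := exist _ c cy.
have [m _ Amy] : (\bigcup_n A n) y by rewrite AT.
have [n [S AS]] := mA m.
have mU : U [set k | (m < k)%N] by apply: subU; exact: nbhs_infty_gt.
have [k [/= ck mk]] := filter_ex (filterI (cP n) mU).
apply: (xA k m mk); rewrite AS /= ck.
by move: Amy; rewrite AS.
Qed.

Lemma cylinder_content_subadditive :
  measurable_subset_sigma_subadditive cylinder_content.
Proof.
move=> A F mF mA AF.
pose B n := if n is n'.+1 then F n' else ~` A.
have [||N BN] := @cylinder_compact B.
- by move=> [|n] /=; [exact: measurableC|exact: mF].
- apply/seteqP; split => // x _; have [/AF[n _ Fnx]|nAx] := pselect (A x).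
    by exists n.+1.
  by exists 0%N.
apply: (@le_trans _ _ (\sum_(0 <= k < N) cylinder_content (F k))%E); last first.
  by apply: nneseries_lim_ge => *; exact: cylinder_content_ge0.
rewrite big_mkord; apply: content_subadditive => // x Ax.
have [[|n] /= nN] : (\bigcup_(n in `I_N) B n) x by rewrite BN.
  by [].
by move=> Fnx; rewrite -bigcup_mkord; exists n => //=; exact: ltnW.
Qed.

HB.instance Definition _ := Content_SigmaSubAdditive_isMeasure.Build
  cylinder_display R (invlim H) cylinder_content cylinder_content_subadditive.

End InverseLimitMeasure.

Definition invlim_space (G : groupType) (H : chain G) :=
  g_sigma_algebraType (@measurable _ (invlim H)).

(* The unique measure on the sigma-algebra generated by the cylinders which
   projects onto the normalized counting measure of each G/H_n, see
   [invlim_measureE]. *)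
Definition invlim_measure (R : realType) (G : groupType) (H : chain G) :
    set (invlim_space H) -> \bar R :=
  measure_extension (@cylinder_content R G H).

Section InverseLimitProbability.
Variables (R : realType) (G : groupType) (H : chain G).
HB.instance Definition _ := Measurable.on (invlim_space H).
Let mu := invlim_measure R (H := H).
HB.instance Definition _ := Measure.on mu.

Lemma invlim_measureE n (S : {set level H n}) :
  invlim_measure R [set x : invlim_space H | coord n x \in S] = (ncounting R S)%:E.
Proof.
rewrite /invlim_measure /measure_extension measurable_mu_extE; last by exists n, S.
exact: cylinder_contentE.
Qed.

Lemma invlim_measureT : mu setT = 1%E.
Proof.
have -> : setT = [set x : invlim_space H | coord 0 x \in [set: level H 0]%SET].
  by apply/seteqP; split=> x //=; rewrite finset.in_setT.
by rewrite /mu invlim_measureE countingT// level_gt0.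
Qed.

HB.instance Definition _ :=
  Measure_isProbability.Build _ _ R mu invlim_measureT.
End InverseLimitProbability.

(* The measurable space is not required to be standard: the definitions below
   make sense without it, and inverse limits of finite sets are standard. *)
Record pmp_action (R : realType) (G : groupType) := PmpAction {
  pmp_display : measure_display;
  pmp_space :> measurableType pmp_display;
  pmp_mu : probability pmp_space R;
  pmp_act : G -> pmp_space -> pmp_space;
  pmp_act1 : forall x, pmp_act 1%g x = x;
  pmp_actM : forall g h x, pmp_act (g * h)%g x = pmp_act g (pmp_act h x);
  pmp_measurable : forall g, measurable_fun setT (pmp_act g);
  pmp_preserving : forall g A, measurable A ->
    pmp_mu (pmp_act g @^-1` A) = pmp_mu A }.

Definition free_action (R : realType) (G : groupType) (a : pmp_action R G) :
    Prop :=
  forall g, g <> 1%g -> pmp_mu a [set x | pmp_act g x = x] = 0%E.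

Section Profinite.
Variables (R : realType) (G : groupType) (H : chain G).

Lemma invlim_act_subproof g (x : invlim H) :
  (fun n => level_act g (coord n x)) \in
  [set x : forall n, level H n | forall n, val (x n.+1) `<=` val (x n)].
Proof.
apply/mem_set => n _ [y xy <-] /=; exists y => //.
by apply: (set_mem (valP x)).
Qed.

Definition invlim_act g (x : invlim_space H) : invlim_space H :=
  exist _ (fun n => level_act g (coord n x)) (invlim_act_subproof g x).

Lemma invlim_eq (x y : invlim H) : (forall n, coord n x = coord n y) -> x = y.
Proof. by move=> xy; apply: val_inj; apply: functional_extensionality_dep. Qed.

Lemma coord_act n g (x : invlim H) :
  coord n (invlim_act g x) = level_act g (coord n x).
Proof. by []. Qed.

Lemma invlim_act1 x : invlim_act 1%g x = x.
Proof. by apply: invlim_eq => n; rewrite coord_act level_act1. Qed.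

Lemma invlim_actM g h x : invlim_act (g * h)%g x = invlim_act g (invlim_act h x).
Proof. by apply: invlim_eq => n; rewrite !coord_act level_actM. Qed.

Lemma invlim_act_cylinder g n (S : {set level H n}) :
  invlim_act g @^-1` [set x | coord n x \in S] =
  [set x | coord n x \in (@level_act G H n g) @^-1: S].
Proof. by apply/seteqP; split=> x /=; rewrite finset.in_set. Qed.

Lemma invlim_act_measurable g : measurable_fun setT (invlim_act g).
Proof.
apply: (measurability (@measurable _ (invlim H) : set (set (invlim_space H)))) => //.
move=> _ [_ [n [S ->]] <-]; rewrite setTI invlim_act_cylinder.
apply: sub_sigma_algebra; by exists n, ((@level_act G H n g) @^-1: S).
Qed.

Lemma level_act_inj n g : injective (@level_act G H n g).
Proof.
by move=> c d /(congr1 (level_act g^-1%g)); rewrite -!level_actM mulVg !level_act1.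
Qed.

Lemma counting_level_act n g (S : {set level H n}) :
  ncounting R ((@level_act G H n g) @^-1: S) = ncounting R S.
Proof.
rewrite /ncounting; congr (_%:R / _); rewrite on_card_preimset//.
exists (level_act g^-1%g) => c _; rewrite -level_actM ?mulVg ?mulgV level_act1//.
Qed.

Lemma invlim_act_preserving_cylinder g n (S : {set level H n}) :
  invlim_measure R (invlim_act g @^-1` [set x | coord n x \in S]) =
  invlim_measure R [set x : invlim_space H | coord n x \in S].
Proof.
by rewrite invlim_act_cylinder !invlim_measureE counting_level_act.
Qed.

Lemma invlim_act_preserving g A : measurable A ->
  invlim_measure R (invlim_act g @^-1` A) = invlim_measure R (H := H) A.
Proof.
move=> mA.
pose f : {mfun invlim_space H >-> invlim_space H} :=
  HB.pack (invlim_act g)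
    (isMeasurableFun.Build _ _ _ _ _ (@invlim_act_measurable g)).
have -> : invlim_measure R (invlim_act g @^-1` A) =
  pushforward (invlim_measure R (H := H)) f A by [].
apply: (@measure_unique _ R (invlim_space H) (@cylinder G H) (fun=> setT)) => //.
- exact: (@measurableI _ (invlim H)).
- by move=> _; rewrite -setC0; apply: cylinderC; exact: cylinder0.
- by rewrite bigcup_const.
- by move=> _ [n [S ->]]; exact: invlim_act_preserving_cylinder.
- move=> _; rewrite [ltLHS](_ : _ = 1%E) ?ltry//; exact: probability_setT.
Qed.

Definition profinite_action : pmp_action R G :=
  @PmpAction R G _ (invlim_space H) (invlim_measure R (H := H)) invlim_act
    invlim_act1 invlim_actM invlim_act_measurable invlim_act_preserving.

Lemma invlim_fix_measurable n g :
  [set x : invlim_space H | coord n (invlim_act g x) = coord n x] =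
  [set x | coord n x \in [set c | level_act g c == c]%SET].
Proof.
by apply/seteqP; split=> x /=; rewrite finset.in_set coord_act => /eqP.
Qed.

End Profinite.

Record fin_action (F : groupType) := FinAction {
  fin_space :> finType;
  fin_space_gt0 : (0 < #|fin_space|)%N;
  fin_act : F -> fin_space -> fin_space;
  fin_act1 : forall x, fin_act 1%g x = x;
  fin_actM : forall g h x, fin_act (g * h)%g x = fin_act g (fin_act h x) }.

Record sofic_approximation (R : realType) (F G : groupType)
    (pi : {multiplicative F -> G}) := SoficApproximation {
  sofic_seq :> nat -> fin_action F;
  sofic_ker : forall g, pi g = 1%g ->
    ncounting R [set x : sofic_seq n | fin_act g x == x]%SET @[n --> \oo] --> (1 : R);
  sofic_free : forall g, pi g <> 1%g ->
    ncounting R [set x : sofic_seq n | fin_act g x == x]%SET @[n --> \oo] --> (0 : R) }.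

Section Sigma.
Variables (R : realType) (F G : groupType) (pi : {multiplicative F -> G}).
Variable H : chain G.

Lemma pi1 : pi 1%g = 1%g.
Proof. by apply: (mulgI (pi 1%g)); rewrite -gmulfM !mulg1. Qed.

Lemma level_pi_act1 n (c : level H n) : level_act (pi 1%g) c = c.
Proof. by rewrite pi1 level_act1. Qed.

Lemma level_pi_actM n g h (c : level H n) :
  level_act (pi (g * h)%g) c = level_act (pi g) (level_act (pi h) c).
Proof. by rewrite gmulfM level_actM. Qed.

Definition level_action n : fin_action F :=
  @FinAction F (level H n) (level_gt0 H n) (fun g => level_act (pi g))
    (@level_pi_act1 n) (@level_pi_actM n).

Lemma level_action_ker g : pi g = 1%g ->
  ncounting R [set x : level_action n | fin_act g x == x]%SET @[n --> \oo] --> (1 : R).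
Proof.
move=> g1; rewrite (_ : (fun _ => _) = cst 1); first exact: cvg_cst.
apply/funext => n; rewrite -(countingT R (level_gt0 H n)); congr ncounting.
by apply/setP => c; rewrite !finset.in_set /= g1 level_act1 eqxx.
Qed.

Lemma level_action_free g : free_action (profinite_action R H) -> pi g <> 1%g ->
  ncounting R [set x : level_action n | fin_act g x == x]%SET @[n --> \oo] --> (0 : R).
Proof.
move=> aF g1.
pose A n : set (invlim_space H) :=
  [set x | coord n (invlim_act (pi g) x) = coord n x].
have AE n : A n = [set x | coord n x \in [set c | level_act (pi g) c == c]%SET].
  exact: invlim_fix_measurable.
have mA n : measurable (A n).
  by rewrite AE; apply: sub_sigma_algebra; exists n; eexists.
have A0 : \bigcap_n A n = [set x | invlim_act (pi g) x = x].
  apply/seteqP; split=> x /=; last by move=> xE n _; rewrite /A/= xE.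
  by move=> Ax; apply: invlim_eq => n; exact: Ax.
have muA : (invlim_measure R (H := H) \o A) =
    (fun n => (ncounting R [set x : level_action n | fin_act g x == x]%SET)%:E).
  by apply/funext => n; rewrite /= AE invlim_measureE.
have cA : (invlim_measure R (H := H) \o A) n @[n --> \oo] --> 0%E.
  rewrite -(aF _ g1) -A0; apply: nonincreasing_cvg_mu => //.
  - by apply: (le_lt_trans (probability_le1 _ (mA 0%N))); rewrite ltry.
  - exact: bigcap_measurable.
  - by move=> n m nm; apply/subsetPset => x; rewrite /A/= !(coord_down _ nm) => ->.
by move: cA; rewrite muA => /fine_cvgP[_].
Qed.

Definition Sigma_chain (aF : free_action (profinite_action R H)) :
    sofic_approximation R pi :=
  @SoficApproximation R F G pi level_action level_action_ker
    (fun g => level_action_free aF).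
End Sigma.

Section SoficEntropy.
Variables (R : realType) (F G : groupType) (rho : G -> F) (a : pmp_action R G).
Implicit Types (alpha xi P : set (set a)) (E : set G) (delta : R).

Definition finite_partition alpha : Prop :=
  [/\ finite_set alpha, (forall A, alpha A -> measurable A) &
      partition alpha id [set: a]].

Definition refines alpha xi : Prop :=
  forall A, alpha A -> exists2 B, xi B & A `<=` B.

Definition translate (g : G) (A : set a) : set a := pmp_act g @` A.

(* The partition written alpha_E: its blocks are the nonempty intersections of
   one block of each translate f alpha, f in E. *)
Definition join_translates alpha E : set (set a) :=
  [set B | B !=set0 /\ exists c : G -> set a,
     (forall f, E f -> alpha (c f)) /\ B = \bigcap_(f in E) translate f (c f)].

(* The algebra generated by a finite partition P. *)
Definition generated_algebra P : set (set a) :=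
  [set A | exists2 Q, Q `<=` P & A = \bigcup_(B in Q) B].

(* Homomorphisms of Boolean algebras from the measure algebra generated by P,
   i.e. modulo null sets, to the subsets of T.  They are represented by maps on
   all of [set a], whose values outside [generated_algebra P] are irrelevant.
   Preservation of the unit follows from the first two conditions, and the last
   one says that phi factors through the quotient by null sets. *)
Definition measure_algebra_hom P (T : finType) (phi : set a -> {set T}) : Prop :=
  [/\ forall A B, generated_algebra P A -> generated_algebra P B ->
        phi (A `|` B) = (phi A :|: phi B)%SET,
      forall A, generated_algebra P A -> phi (~` A) = (~: phi A)%SET &
      forall A, generated_algebra P A -> pmp_mu a A = 0%E ->
        phi A = finset.set0].

Definition symdiff (T : finType) (A B : {set T}) : {set T} :=
  ((A :\: B) :|: (B :\: A))%SET.

Definition sofic_hom alpha E delta (b : fin_action F) (phi : set a -> {set b}) :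
    Prop :=
  [/\ measure_algebra_hom (join_translates alpha E) phi,
      forall A f, alpha A -> E f ->
        ncounting R (symdiff (fin_act (rho f) @: phi A)%SET
                            (phi (translate f A))) < delta &
      \sum_(A \in join_translates alpha E)
        `|ncounting R (phi A) - fine (pmp_mu a A)| < delta].

(* The number of distinct restrictions to the finite partition xi of elements
   of Hom(a, alpha, E, delta, b). *)
Definition sofic_hom_count xi alpha E delta (b : fin_action F) : nat :=
  #|[set s : {ffun fset_set xi -> {set b}} |
      `[< exists2 phi, sofic_hom alpha E delta phi &
            forall C, s C = phi (val C) >]]%SET|.

Variables (U : set_system nat) (Sigma : nat -> fin_action F).

Definition sofic_entropy_at xi alpha E delta : \bar R :=
  lim ((#|Sigma n|%:R^-1)%:E *
       lne (sofic_hom_count xi alpha E delta (Sigma n))%:R%:E @[n --> U])%E.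

Definition sofic_entropy : \bar R :=
  ereal_sup [set
    ereal_inf [set
      ereal_inf [set
        ereal_inf [set
          sofic_entropy_at xi alpha E delta
        | delta in [set delta : R | 0 < delta]]
      | E in [set E : set G | finite_set E /\ E 1%g]]
    | alpha in [set alpha | finite_partition alpha /\ refines alpha xi]]
  | xi in [set xi | finite_partition xi]].

End SoficEntropy.

Definition nonprincipal_ultrafilter (U : set_system nat) : Prop :=
  UltraFilter U /\ forall n, ~ U [set n].

(* Main.v *)
(** All chains are built from one sequence of normal subgroups J_i of finite index, such
    that each g <> 1 lies in only finitely many J_i: H^r_n is the intersection of the J_i
    with i < n and i in S_r, where the S_r (r real) are infinite and pairwise incomparable
    sets of integers. A section of the projection onto G/H_n avoiding a small exceptional
    set turns approximations by cylinders into homomorphisms, so that the entropy of an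
    action with respect to its own sofic approximation is nonnegative. If j is in S_s but
    not in S_r, a homomorphism at a fine scale would give an almost equivariant map from
    G/H^r_n to a quotient on which J_j is the stabilizer, and it suffices that there is no
    such map, with bounds depending on j but not on n.

    For PSL_2(Z) and free groups, two elements are mapped to units of a quaternion order in
    SL_2(F_q), q = q_i dividing r^2 + 2. Products of these groups for different q_i have a
    uniform spectral gap provided that the q_i grow fast (Sarnak-Xue): a nontrivial
    eigenvalue has multiplicity at least (q - 1) / 2, while words which are scalar mod q are
    rare, because they correspond to lattice points on ellipses. For PSL_k(Z), k >= 3, J_i
    is the congruence subgroup mod q_i and almost equivariant maps are excluded by the
    relative property (T) of Z^2 x| <E_12(p), E_21(p)>. *)
Require Import Defs.
From HB Require Import structures.
From mathcomp Require Import all_boot all_order all_fingroup all_algebra cyclic separable cyclotomic.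
From mathcomp Require Import sesquilinear spectral complex.
From mathcomp Require Import zify ring lra.

Set Implicit Arguments.
Unset Strict Implicit.
Unset Printing Implicit Defensive.

Import Order.TTheory GRing.Theory Num.Theory.
Local Open Scope ring_scope.

(** The obstacle is uniformity: E and delta must be fixed before n, so the test elements have to
    expand at one rate on products of arbitrarily many finite groups. When a factor SL_2(F_q) is
    added to a product Z, only functions with zero sums along the new factor need a new estimate.
    With q about 2^(32 g), radius 68 g and #|Z| <= 2^g, an eigenvalue above 3 - 1/300 forces a trace
    of at least 2^(135 g) q / 4, whereas closed paths account for at most 2^g q^3 2^(68 g) up to a
    factor linear in g. Since q^2 is about 2^(64 g), 135 beats 1 + 68 + 64. Hence q_i is taken
    exponential in the orders of all earlier factors. For k >= 3 the test elements divisible by p =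
    q_j lie in J_j, so they almost preserve the J_j-orbit of the image point. The primes on the
    source side differ from q_j; there the multiples of p reach E_13(1), which is not in J_j. *)

Local Notation "x %:C" := (real_complex _ x) (format "x %:C") : ring_scope.


(** * Sphere operators of 3-regular graphs *)

Section Rayleigh.
Local Open Scope sesquilinear_scope.
Variables (R : rcfType) (V : finType).

Definition nrm2 (z : R[i]) : R := complex.Re z ^+ 2 + complex.Im z ^+ 2.

Lemma nrm2_ge0 z : 0 <= nrm2 z.
Proof. by rewrite addr_ge0 ?sqr_ge0. Qed.

Lemma nrm2E z : (nrm2 z)%:C = z * z^*.
Proof. by rewrite /nrm2 add_Re2_Im2 sqr_normc. Qed.

Lemma nrm2_eq0 z : (nrm2 z == 0) = (z == 0).
Proof. by rewrite -(inj_eq (@complexI R)) nrm2E mulf_eq0 conjc_eq0 orbb. Qed.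

(** In the coordinates of a unitary eigenbasis both sides are sums of squares weighted by
    eigenvalues. The eigenfunctions are complex because additive characters of F_q will be applied
    to them. *)
Lemma rayleigh (k : V -> V -> R) (l0 : R) : (forall u v, k u v = k v u) ->
  (forall (l : R) (h : V -> R[i]), (exists v, h v != 0) ->
     (forall v, \sum_u (k v u)%:C * h u = l%:C * h v) -> l <= l0) ->
  forall f : V -> R, \sum_v \sum_u k v u * f u * f v <= l0 * \sum_v f v ^+ 2.
Proof.
move=> ksym keig f.
pose n := #|V|.
pose A : 'M[R[i]]_n := \matrix_(i, j) (k (enum_val i) (enum_val j))%:C.
have cC (x : R) : ((x%:C : R[i])^*)%R = x%:C.
  by rewrite conj_Creal //; apply/complex_realP; exists x.
have Aherm : A \is hermsymmx.
  apply/is_hermitianmxP; rewrite expr0 scale1r; apply/matrixP => i j.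
  by rewrite !mxE ksym [RHS]cC.
have := hermitian_spectral_diag_real Aherm.
have /hermitian_normalmx /orthomx_spectralP := Aherm.
set P := spectralmx A; set D := spectral_diag A => AE Dreal.
have Pu : P \is unitarymx by apply: spectral_unitarymx.
have Pi : P \in unitmx by apply: unitarymx_unit.
have Dle i : exists2 d : R, D 0 i = d%:C & d <= l0.
  have /mxOverP /(_ 0 i) /complex_realP [d Dd] := Dreal; exists d => //.
  have PA : P *m A = diag_mx D *m P by rewrite {1}AE !mulmxA mulmxV ?mul1mx.
  apply: (keig d (fun v => P i (enum_rank v))).
    case: (pickP (fun v => P i (enum_rank v) != 0)) => [v Pv|P0]; first by exists v.
    have : row i P = 0.
      apply/rowP => j; rewrite !mxE; have := P0 (enum_val j).
      by rewrite enum_valK => /negbFE/eqP.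
    move=> /(congr1 (mulmx^~ (invmx P))); rewrite mul0mx -row_mul mulmxV //.
    by move=> /rowP/(_ i)/eqP; rewrite !mxE eqxx oner_eq0.
  move=> v; have /matrixP/(_ i (enum_rank v)) := PA.
  rewrite mul_diag_mx [RHS]mxE Dd mxE => <-.
  rewrite (reindex (@enum_rank V)) /=; last by exists enum_val => x _; rewrite ?enum_valK ?enum_rankK.
  by apply: eq_bigr => u _; rewrite !mxE !enum_rankK mulrC ksym.
pose x : 'rV[R[i]]_n := \row_i (f (enum_val i))%:C.
have xx : x ^t* = x^T by apply/matrixP => i j; rewrite !mxE cC.
pose w := x *m invmx P.
have wx : w *m P = x by rewrite /w mulmxKV.
have iP : invmx P = P ^t* by rewrite invmx_unitary.
have e1 : (\sum_v \sum_u k v u * f u * f v)%:C = (x *m A *m x ^t*) 0 0.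
  rewrite xx mxE (reindex (@enum_rank V)) /=; last by exists enum_val => y _; rewrite ?enum_valK ?enum_rankK.
  rewrite rmorph_sum; apply: eq_bigr => v _.
  rewrite !mxE enum_rankK rmorph_sum mulr_suml [RHS](reindex (@enum_rank V)) /=; last by exists enum_val => y _; rewrite ?enum_valK ?enum_rankK.
  apply: eq_bigr => u _; rewrite !mxE !enum_rankK !rmorphM ksym /=; ring.
have e2 : (\sum_v f v ^+ 2)%:C = (x *m x ^t*) 0 0.
  rewrite xx mxE (reindex (@enum_rank V)) /=; last by exists enum_val => y _; rewrite ?enum_valK ?enum_rankK.
  by rewrite rmorph_sum; apply: eq_bigr => v _; rewrite !mxE enum_rankK rmorphXn.
have xw : x ^t* = invmx P *m w ^t*.
  by rewrite -wx trmx_mul map_mxM -iP.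
rewrite -lecR rmorphM /= e1 e2 AE xw !mulmxA (_ : x *m invmx P = w) //.
rewrite -[w *m _ *m P *m _]mulmxA mulmxV // mulmx1.
rewrite [X in _ <= _ * X]mxE mxE mulr_sumr; apply: ler_sum => i _.
have [d Dd dl] := Dle i.
rewrite mul_mx_diag !mxE Dd [_ * d%:C]mulrC -mulrA -normCK ler_wpM2r ?exprn_ge0 //.
by rewrite lecR.
Qed.
End Rayleigh.

Section Bessel.
Variables (R : rcfType) (V : finType).
Implicit Types h k : V -> R[i].

Lemma conjCR (x : R) : (x%:C : R[i])^* = x%:C.
Proof. by rewrite conj_Creal //; apply/complex_realP; exists x. Qed.

Definition dot h k : R[i] := \sum_v h v * (k v)^*.
Definition norm2 h : R := \sum_v nrm2 (h v).

Lemma norm2_ge0 h : 0 <= norm2 h.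
Proof. by apply: sumr_ge0 => v _; apply: nrm2_ge0. Qed.

Lemma norm2E h : (norm2 h)%:C = dot h h.
Proof. by rewrite rmorph_sum; apply: eq_bigr => v _; rewrite /= nrm2E. Qed.

Lemma norm2_gt0 h v : h v != 0 -> 0 < norm2 h.
Proof.
move=> hv; rewrite /norm2 (bigD1 v) //= ltr_wpDr //.
  by apply: sumr_ge0 => u _; apply: nrm2_ge0.
by rewrite lt_neqAle eq_sym nrm2_eq0 hv nrm2_ge0.
Qed.

Lemma dotC h k : dot h k = (dot k h)^*.
Proof.
by rewrite rmorph_sum; apply: eq_bigr => v _ /=; rewrite rmorphM /= conjCK mulrC.
Qed.

Lemma bessel (I : finType) (h : I -> V -> R[i]) k :
  (forall i, 0 < norm2 (h i)) -> (forall i j, i != j -> dot (h i) (h j) = 0) ->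
  \sum_i nrm2 (dot k (h i)) / norm2 (h i) <= norm2 k.
Proof.
move=> hpos hort.
pose a i : R[i] := dot k (h i) / (norm2 (h i))%:C.
pose g v : R[i] := \sum_i a i * h i v.
have nz i : (norm2 (h i))%:C != 0 :> R[i].
  by rewrite (inj_eq (@complexI R)) gt_eqF.
set s := \sum_i _.
have dgh i : dot g (h i) = dot k (h i).
  transitivity (\sum_j a j * dot (h j) (h i)).
    under [RHS]eq_bigr do rewrite mulr_sumr.
    rewrite exchange_big /=; apply: eq_bigr => v _.
    by rewrite mulr_suml; apply: eq_bigr => j _; rewrite mulrA.
  rewrite (bigD1 i) //= big1 ?addr0 => [|j ji]; last by rewrite hort ?mulr0.
  by rewrite -norm2E /a divfK.
have dg x : dot x g = \sum_i (a i)^* * dot x (h i).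
  under [RHS]eq_bigr do rewrite mulr_sumr.
  rewrite exchange_big /=; apply: eq_bigr => v _.
  rewrite rmorph_sum mulr_sumr; apply: eq_bigr => i _.
  by rewrite /= rmorphM /=; ring.
have kg : dot k g = s%:C.
  rewrite dg rmorph_sum; apply: eq_bigr => i _ /=.
  rewrite [RHS](rmorphM (real_complex R)) /= fmorphV /= nrm2E /a.
  by rewrite rmorphM /= fmorphV /= conjCR; ring.
have gg : dot g g = s%:C.
  by rewrite dg -kg dg; apply: eq_bigr => i _; rewrite dgh.
have gk : dot g k = s%:C by rewrite dotC kg conjCR.
have : 0 <= norm2 (fun v => k v - g v) by apply: norm2_ge0.
suff -> : norm2 (fun v => k v - g v) = norm2 k - s by rewrite subr_ge0.
apply: complexI; rewrite rmorphB /= !norm2E.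
transitivity (dot k k - dot k g - dot g k + dot g g).
  rewrite /dot -!sumrB -big_split /=; apply: eq_bigr => v _.
  rewrite rmorphB /=; ring.
by rewrite kg gg gk; ring.
Qed.
End Bessel.

Section ReducedWords.
Implicit Types (i j : 'I_3) (w : seq 'I_3).

(** Words without equal neighbouring letters are the reduced words of Z/2 * Z/2 * Z/2, that is, the
    non-backtracking paths from a vertex of a 3-regular graph. *)
Definition okl i w := if w is j :: _ then j != i else true.

Fixpoint reduced w := if w is i :: w' then okl i w' && reduced w' else true.

Fixpoint rwords n : seq (seq 'I_3) :=
  if n is n'.+1 then [seq i :: w | i <- enum 'I_3, w <- [seq w <- rwords n' | okl i w]]
  else [:: [::]].

Lemma mem_rwords n w : (w \in rwords n) = (size w == n) && reduced w.
Proof.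
elim: n w => [|n IHn] [|i w] //=.
- by apply/allpairsPdep => -[i [w [_ _]]].
- apply/allpairsPdep/idP => [[j [w' [_]]]|/and3P[sw ow rw]].
    by rewrite mem_filter IHn => /and3P[ow sw rw] [-> ->]; rewrite eqSS sw ow.
  exists i, w; split; rewrite ?mem_enum // mem_filter ow IHn rw andbT.
  by rewrite -eqSS.
Qed.

Lemma rwords_uniq n : uniq (rwords n).
Proof.
elim: n => //= n IHn; apply: allpairs_uniq_dep => [|i _|].
- exact: enum_uniq.
- exact: filter_uniq.
- by move=> [i w] [j w'] _ _ [-> ->].
Qed.

Lemma size_rwords n : (size (rwords n) <= 3 * 2 ^ n)%N.
Proof.
have okn m i : (0 < m)%N -> (size [seq w <- rwords m | okl i w] <= 2 ^ m)%N.
  elim: m i => // m IHm i _ /=.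
  rewrite size_filter count_flatten -map_comp sumnE big_map big_enum /=.
  rewrite (bigD1 i) //= count_map (@eq_count _ _ pred0) ?count_pred0 ?add0n; last first.
    by move=> w; rewrite /= eqxx.
  apply: (@leq_trans (\sum_(j < 3 | j != i) 2 ^ m)).
    apply: leq_sum => j _; rewrite count_map.
    apply: leq_trans (count_size _ _) _.
    by case: m IHm => [_|m IHm]; [rewrite size_filter count_size|apply: IHm].
  by rewrite sum_nat_const cardC1 card_ord expnS.
case: n => // n /=.
rewrite size_allpairs_dep sumnE big_map big_enum /=.
apply: (@leq_trans (\sum_(i < 3) 2 ^ n)); last first.
  by rewrite sum_nat_const card_ord leq_mul // leq_exp2l.
apply: leq_sum => i _; case: n => [|n]; last exact: okn.
by rewrite size_filter count_size.
Qed.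
End ReducedWords.

Section Spheres.
Variables (R : rcfType) (V : finType) (s : 'I_3 -> V -> V).
Hypothesis sK : forall i, involutive (s i).

Definition run (v : V) (w : seq 'I_3) : V := foldl (fun u i => s i u) v w.

Definition sphere n (h : V -> R[i]) v := \sum_(w <- rwords n) h (run v w).

(** Paths that do not start along the edge i: exactly these can be prolonged backwards by i, which
    yields the recursion for [sphere]. *)
Let away n i (h : V -> R[i]) v := \sum_(w <- rwords n | okl i w) h (run v w).

Lemma sphereS n h v : sphere n.+1 h v = \sum_i away n i h (s i v).
Proof.
rewrite /sphere /= big_allpairs_dep big_enum /=; apply: eq_bigr => i _.
by rewrite big_filter.
Qed.

Lemma awayS n i h v : away n.+1 i h v = sphere n.+1 h v - away n i h (s i v).
Proof.
rewrite sphereS (bigD1 i) //= addrAC subrr add0r.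
rewrite /away big_mkcond /= big_allpairs_dep big_enum /= [RHS]big_mkcond /=.
apply: eq_bigr => j _; rewrite big_filter.
by case: (j != i) => //; rewrite big1.
Qed.

Lemma sphere0 h v : sphere 0 h v = h v.
Proof. by rewrite /sphere big_seq1. Qed.

Let away0 i h v : away 0 i h v = h v.
Proof. by rewrite /away big_mkcond big_seq1. Qed.

Lemma sphere1 h v : sphere 1 h v = \sum_i h (s i v).
Proof. by rewrite sphereS; apply: eq_bigr => i _; rewrite away0. Qed.

Lemma sphere2 h v : sphere 2 h v = \sum_i sphere 1 h (s i v) - 3%:R * h v.
Proof.
rewrite sphereS; under eq_bigr do rewrite awayS sK.
rewrite sumrB; congr (_ - _); under eq_bigr do rewrite away0.
by rewrite sumr_const card_ord mulr_natl.
Qed.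

(** A step i followed by a reduced path either is reduced or returns to v. A path of positive length
    arises from a return in 2 ways, since i must differ from its first letter; the empty path arises
    in 3 ways, hence the constant in [sphere2]. *)
Lemma sphere_rec n h v : sphere n.+3 h v =
  \sum_i sphere n.+2 h (s i v) - 2%:R * sphere n.+1 h v.
Proof.
rewrite sphereS; under eq_bigr do rewrite awayS sK.
rewrite sumrB; congr (_ - _).
under eq_bigr do rewrite awayS.
rewrite sumrB sumr_const card_ord -sphereS; ring.
Qed.

(** The orthogonal polynomials of the 3-regular tree; the coefficient 3 in degree 2 reflects that
    the root has three children, every other vertex two. *)
Fixpoint sphere_val (l : R) n : R :=
  match n with
  | 0 => 1
  | 1 => l
  | n'.+1 => l * sphere_val l n' - (if n' is n''.+1 then (if n'' is 0 then 3%:R else 2%:R) * sphere_val l n'' else 0)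
  end.

Lemma sphere_valS l n :
  sphere_val l n.+3 = l * sphere_val l n.+2 - 2%:R * sphere_val l n.+1.
Proof. by []. Qed.

Lemma sphere_eigen (l : R) h : (forall v, \sum_i h (s i v) = l%:C * h v) ->
  forall n v, sphere n h v = (sphere_val l n)%:C * h v.
Proof.
move=> hl n; suff H : (forall v, sphere n h v = (sphere_val l n)%:C * h v) /\
   (forall v, sphere n.+1 h v = (sphere_val l n.+1)%:C * h v) by case: H.
elim: n => [|[|n] [IH0 IH1]].
- by split=> v; rewrite ?sphere0 ?sphere1 ?mul1r.
- split=> // v; rewrite sphere2; under eq_bigr do rewrite IH1.
  rewrite -mulr_sumr hl /= !rmorphB !rmorphM /= !rmorph_nat; ring.
- split=> // v; rewrite sphere_rec; under eq_bigr do rewrite IH1.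
  rewrite -mulr_sumr hl IH0 sphere_valS.
  rewrite !rmorphB !rmorphM /= !rmorph_nat; ring.
Qed.

(** Inductively each value is at least t times the previous one, because l - 2 / t >= t. The last
    hypothesis absorbs the exceptional coefficient 3 in degree 2. *)
Lemma sphere_val_ge (l t : R) : 1 < t -> t <= 2%:R -> t + 2%:R / t <= l ->
  3%:R <= 2%:R * l / t -> forall n, t ^+ n <= sphere_val l n.
Proof.
move=> t1 t2 tl l3 n.
have t0 : 0 < t by lra.
have lt0 : t <= l by apply: le_trans tl; rewrite lerDl divr_ge0 ?ler0n ?ltW.
suff H : t ^+ n <= sphere_val l n /\ t * sphere_val l n <= sphere_val l n.+1 by case: H.
elim: n => [|[|n] [IH0 IH1]]; first by rewrite expr0 mulr1 /=; split.
  split; first by rewrite expr1.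
  rewrite /=; have : (2%:R / t) * l <= (l - t) * l.
    by apply: ler_wpM2r; lra.
  by rewrite mulrAC in l3; nra.
have p0 : 0 <= sphere_val l n.+1 by apply: le_trans IH0; rewrite exprn_ge0 ?ltW.
split.
  by rewrite exprS; apply: le_trans IH1; rewrite ler_pM2l.
rewrite sphere_valS.
set p := sphere_val l n.+2 in IH1 *; set p' := sphere_val l n.+1 in p0 IH0 IH1 *.
have : p' * 2%:R <= p * (2%:R / t).
  by rewrite mulrA ler_pdivlMr //; lra.
have : (t + 2%:R / t) * p <= l * p by apply: ler_wpM2r => //; nra.
lra.
Qed.

(* Bessel's inequality bounds the Hilbert-Schmidt norm of the sphere operator
   from below by [sphere_val l n ^+ 2] times the multiplicity of [l]. *)
Lemma sphere_multiplicity (I : finType) (h : I -> V -> R[i]) (l : R) n :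
  (forall i v, \sum_j h i (s j v) = l%:C * h i v) ->
  (forall i, 0 < norm2 (h i)) -> (forall i j, i != j -> dot (h i) (h j) = 0) ->
  sphere_val l n ^+ 2 * #|I|%:R <=
  \sum_v \sum_(w <- rwords n) \sum_(w' <- rwords n) (run v w == run v w')%:R.
Proof.
move=> hl hpos hort.
(* The kernel of the sphere operator; Bessel's inequality is applied to each of its rows. *)
pose k v u : R := \sum_(w <- rwords n) (run v w == u)%:R.
have kh i v : sphere n (h i) v = (dot (fun u => (k v u)%:C) (h i))^*.
  rewrite -dotC /sphere /dot.
  transitivity (\sum_(w <- rwords n) \sum_u h i u * (run v w == u)%:R).
    apply: eq_bigr => w _; rewrite (bigD1 (run v w)) //= eqxx mulr1 big1 ?addr0 // => u.
    by rewrite eq_sym => /negbTE->; rewrite mulr0.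
  rewrite exchange_big /=; apply: eq_bigr => u _.
  rewrite conjCR rmorph_sum mulr_sumr; apply: eq_bigr => w _ /=.
  by rewrite rmorph_nat.
have nc (z : R[i]) : nrm2 z^* = nrm2 z.
  by apply: complexI; rewrite !nrm2E conjCK mulrC.
have nM (x : R) (z : R[i]) : nrm2 (x%:C * z) = x ^+ 2 * nrm2 z.
  apply: complexI; rewrite [RHS](rmorphM (real_complex R)) /= !nrm2E rmorphM /=.
  by rewrite conjCR rmorphXn /=; ring.
have -> : sphere_val l n ^+ 2 * #|I|%:R =
    \sum_v \sum_i nrm2 (dot (fun u => (k v u)%:C) (h i)) / norm2 (h i).
  rewrite exchange_big /= mulr_natr -sumr_const; apply: eq_bigr => i _.
  rewrite -mulr_suml; under eq_bigr do rewrite -nc -kh (sphere_eigen (hl i)) nM.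
  by rewrite -mulr_sumr mulfK ?gt_eqF ?hpos //; apply: hpos.
apply: ler_sum => v _; apply: le_trans (bessel _ hpos hort) _.
rewrite le_eqVlt; apply/orP; left; apply/eqP.
transitivity (\sum_u k v u * k v u).
  by apply: eq_bigr => u _; rewrite /nrm2 /= expr0n addr0 expr2.
rewrite /k; under eq_bigr do rewrite mulr_suml.
rewrite exchange_big /=; apply: eq_bigr => w _.
under eq_bigr do rewrite mulr_sumr.
rewrite exchange_big /=; apply: eq_bigr => w' _.
rewrite (bigD1 (run v w')) //= eqxx mulr1 big1 ?addr0 // => u.
by rewrite eq_sym => /negbTE->; rewrite mulr0.
Qed.

End Spheres.

Lemma reducedE w : reduced w = sorted (fun i j : 'I_3 => j != i) w.
Proof. by elim: w => // i [|j w] //= ->; case: w. Qed.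

Lemma reduced_catl p w : reduced (p ++ w) -> reduced p.
Proof. by rewrite !reducedE => /cat_sorted2[]. Qed.

Lemma reduced_catr p w : reduced (p ++ w) -> reduced w.
Proof. by rewrite !reducedE => /cat_sorted2[]. Qed.

Lemma reduced_rev w : reduced (rev w) = reduced w.
Proof. by rewrite !reducedE rev_sorted; apply: eq_sorted => i j; rewrite eq_sym. Qed.

Lemma reduced_join i j x y : reduced (i :: x) -> reduced (j :: y) -> i != j ->
  reduced (rev (i :: x) ++ j :: y).
Proof.
rewrite -reduced_rev !reducedE rev_cons cat_rcons => rx ry ij.
by rewrite sorted_cat_cons rx /= eq_sym ij.
Qed.

Lemma common_prefix (T : eqType) (w w' : seq T) : size w = size w' ->
  exists p x x', [/\ w = p ++ x, w' = p ++ x' &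
    (x = [::] /\ x' = [::]) \/
    exists i j y y', [/\ x = i :: y, x' = j :: y' & i != j]].
Proof.
elim: w w' => [|i w IHw] [|j w'] //=.
  by move=> _; exists [::], [::], [::]; split=> //; left.
move=> [/IHw[p [x [x' [-> -> H]]]]]; have [->|ij] := eqVneq i j.
  by exists (j :: p), x, x'.
exists [::], (i :: p ++ x), (j :: p ++ x'); split=> //; right.
by exists i, j, (p ++ x), (p ++ x').
Qed.

Section Collisions.
Variables (V : finType) (s : 'I_3 -> V -> V).
Hypothesis sK : forall i, involutive (s i).

Lemma run_cat v p w : run s v (p ++ w) = run s (run s v p) w.
Proof. exact: foldl_cat. Qed.

Lemma run_rev v w : run s (run s v w) (rev w) = v.
Proof.
elim/last_ind: w => // w i IHw.
by rewrite rev_rcons -cats1 run_cat /= sK IHw.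
Qed.

(* A collision [run v w = run v w'] of reduced words yields, after removing the
   common prefix, a reduced word of even length fixing a point. *)
Lemma collisions (fixw : pred (seq 'I_3)) n v :
  (forall u z, reduced z -> run s u z = u -> fixw z) ->
  (\sum_(w <- rwords n) \sum_(w' <- rwords n) (run s v w == run s v w') <=
   \sum_(t < n.+1) 3 * 2 ^ (n - t) * count fixw (rwords (t + t)))%N.
Proof.
move=> fixP.
pose L := [seq x <- [seq (w, w') | w <- rwords n, w' <- rwords n] |
             run s v x.1 == run s v x.2].
have -> : (\sum_(w <- rwords n) \sum_(w' <- rwords n) (run s v w == run s v w'))%N
    = size L.
  by rewrite size_filter -sum1_count [RHS]big_mkcond big_allpairs_dep /=.
(* Recovers the pair (p ++ x, p ++ x') from p and the word rev x ++ x', which is reduced because x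
   and x' are empty or start with different letters. *)
pose re (t : nat) (x : seq 'I_3 * seq 'I_3) := (x.1 ++ rev (take t x.2), x.1 ++ drop t x.2).
pose M (t : nat) := [seq (p, z) | p <- rwords (n - t), z <- [seq z <- rwords (t + t) | fixw z]].
pose T := flatten [seq [seq re t x | x <- M t] | t : 'I_n.+1].
apply: (@leq_trans (size T)).
  apply: uniq_leq_size.
    apply: filter_uniq; apply: allpairs_uniq; rewrite ?rwords_uniq //.
    by move=> [? ?] [? ?] _ _ [-> ->].
  move=> [w w']; rewrite mem_filter => /andP[/= /eqP ww' /allpairsP[[a b] [/= wn wn' [wa wb]]]].
  subst a b.
  move: wn wn'; rewrite !mem_rwords => /andP[/eqP sw rw] /andP[/eqP sw' rw'].
  have [] := @common_prefix _ w w'; first by rewrite sw sw'.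
  move=> p [x [x' [wE wE' H]]].
  have sx : size x = size x'.
    by have := sw'; rewrite -sw wE wE' !size_cat => /addnI ->.
  have px : (size x < n.+1)%N by rewrite ltnS -sw wE size_cat leq_addl.
  apply/flatten_mapP; exists (Ordinal px); first by rewrite mem_enum.
  apply/mapP; exists (p, rev x ++ x'); last first.
    rewrite /re /= take_size_cat ?size_rev // drop_size_cat ?size_rev // revK.
    by rewrite -wE -wE'.
  apply/allpairsP; exists (p, rev x ++ x'); split=> //=.
    rewrite mem_rwords (reduced_catl (w := x)) -?wE // andbT -sw wE size_cat.
    by rewrite addnK.
  have rz : reduced (rev x ++ x').
    case: H => [[-> ->]//|[i [j [y [y' [xE xE' ij]]]]]].
    rewrite xE xE'; apply: reduced_join => //.
      by rewrite -xE; apply: reduced_catr (p) _ _; rewrite -wE.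
    by rewrite -xE'; apply: reduced_catr (p) _ _; rewrite -wE'.
  rewrite mem_filter mem_rwords rz size_cat size_rev sx eqxx !andbT.
  apply: (fixP (run s v w)) => //; rewrite run_cat {1}wE run_cat run_rev.
  by rewrite -run_cat -wE' -ww'.
rewrite size_flatten /shape -map_comp sumnE big_map big_enum /=.
apply: leq_sum => t _; rewrite size_map size_allpairs size_filter.
by rewrite leq_mul // size_rwords.
Qed.
End Collisions.

(** * Lattice points and quaternions *)

(** The first points of the blocks are counted by [bs]; every other point is determined by its
    difference [d] to the first point of its block. *)
Lemma size_le_blocks (T E F : eqType) (s : seq T) (b : T -> E) (bs : seq E)
    (d : T -> T -> F) (ds : seq F) : uniq s ->
  (forall p, p \in s -> b p \in bs) ->
  (forall p o, p \in s -> o \in s -> b p = b o -> p != o -> d p o \in ds) ->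
  (forall p o p' o', p \in s -> o \in s -> p' \in s -> o' \in s ->
     b p = b o -> b p' = b o' -> p != o -> p' != o' -> d p o = d p' o' -> p = p') ->
  (size s <= size bs + size ds)%N.
Proof.
move=> us sb sd sinj.
pose o p := nth p s (find (fun x => b x == b p) s).
have oP p : p \in s -> o p \in s /\ b (o p) = b p.
  move=> ps; have h : has (fun x => b x == b p) s by apply/hasP; exists p.
  by split; [rewrite mem_nth -?has_find|apply/eqP; exact: (nth_find p h)].
have oE p p' : p \in s -> p' \in s -> b p = b p' -> o p = o p'.
  move=> ps ps' bb; rewrite /o bb; apply: set_nth_default.
  by rewrite -has_find; apply/hasP; exists p'.
rewrite -(count_predC (fun p => o p == p)) leq_add //.
  rewrite -size_filter -(size_map b); apply: uniq_leq_size.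
    rewrite map_inj_in_uniq ?filter_uniq // => p p'.
    rewrite !mem_filter => /andP[/eqP op ps] /andP[/eqP op' ps'] bb.
    by rewrite -op -op'; apply: oE.
  by move=> x /mapP[p]; rewrite mem_filter => /andP[_ ps] ->; apply: sb.
rewrite -size_filter -(size_map (fun p => d p (o p))); apply: uniq_leq_size.
  rewrite map_inj_in_uniq ?filter_uniq // => p p'.
  rewrite !mem_filter /= => /andP[op ps] /andP[op' ps'].
  have [os ob] := oP p ps; have [os' ob'] := oP p' ps'.
  by apply: sinj; rewrite // eq_sym.
move=> x /mapP[p]; rewrite mem_filter /= => /andP[op ps] ->.
by have [os ob] := oP p ps; apply: sd; rewrite // eq_sym.
Qed.

Definition zrange (n : nat) : seq int := [seq (i%:Z - n%:Z) | i <- iota 0 (n + n).+1].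

Lemma mem_zrange n (z : int) : (z \in zrange n) = (`|z| <= n%:Z).
Proof.
apply/mapP/idP => [[k]|zn]; first by rewrite mem_iota => ? ->; lia.
by exists (absz (z + n%:Z)); rewrite ?mem_iota; lia.
Qed.

Lemma size_zrange n : size (zrange n) = (n + n).+1.
Proof. by rewrite size_map size_iota. Qed.

(** Meant for d the difference and (x, y) the sum of two points of a conic: chord and midpoint are
    conjugate, so a midpoint near one axis bounds the slope of the chord. *)
Lemma chord_le (b c d1 d2 x y : int) : b * (d1 * x) + c * (d2 * y) = 0 ->
  0 <= b -> 0 <= c -> c * `|y| <= b * `|x| -> 0 < b * `|x| -> `|d1| <= `|d2|.
Proof.
move=> e b0 c0 yx x0; rewrite -(ler_pM2r x0).
have -> : `|d1| * (b * `|x|) = `|d2| * (c * `|y|).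
  have : `|b * (d1 * x)| = `|c * (d2 * y)| by rewrite -[RHS]normrN; congr Num.norm; lia.
  by rewrite !normrM (ger0_norm b0) (ger0_norm c0); lia.
by apply: ler_wpM2l.
Qed.

(** The midpoint of a chord of direction d lies on the conjugate diameter, a line through the
    origin. A given norm leaves only a sign open, which the last two hypotheses settle. *)
Lemma chord_center (d1 d2 x y x' y' : int) : (d1 != 0) || (d2 != 0) ->
  d1 * x + 15 * (d2 * y) = 0 -> d1 * x' + 15 * (d2 * y') = 0 ->
  x ^+ 2 + 15 * y ^+ 2 = x' ^+ 2 + 15 * y' ^+ 2 ->
  (0 <= x * x') -> (0 <= y * y') -> x = x' /\ y = y'.
Proof.
move=> d0 e e' N sx sy.
have xy : x * y' = x' * y.
  have [d10|d1n] := eqVneq d1 0.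
    move: d0 e e'; rewrite d10 eqxx /= !mul0r !add0r => d0 e e'.
    have -> : y = 0 by apply/eqP; move: e => /eqP; rewrite !mulf_eq0 (negPf d0).
    have -> : y' = 0 by apply/eqP; move: e' => /eqP; rewrite !mulf_eq0 (negPf d0).
    by rewrite !mulr0.
  apply: (mulfI d1n).
  have e1 : d1 * x = - (15 * (d2 * y)) by apply/eqP; rewrite -addr_eq0 e.
  have e2 : d1 * x' = - (15 * (d2 * y')) by apply/eqP; rewrite -addr_eq0 e'.
  by rewrite !mulrA e1 e2; ring.
have sq (z z' : int) : z ^+ 2 = z' ^+ 2 -> 0 <= z * z' -> z = z'.
  by move=> /eqP; rewrite eqf_sqr => /orP[/eqP//|/eqP->]; nia.
have xx : (x ^+ 2 + 15 * y ^+ 2) * x ^+ 2 = (x ^+ 2 + 15 * y ^+ 2) * x' ^+ 2.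
  transitivity (x' ^+ 2 * x ^+ 2 + 15 * (x * y') ^+ 2); first by rewrite N; ring.
  by rewrite xy; ring.
have x2 : x ^+ 2 = x' ^+ 2.
  have [N0|Nn] := eqVneq (x ^+ 2 + 15 * y ^+ 2) 0; last exact: mulfI Nn _ _ xx.
  move: N N0 (sqr_ge0 x) (sqr_ge0 y) (sqr_ge0 x') (sqr_ge0 y'); clear.
  by move: (x ^+ 2) (y ^+ 2) (x' ^+ 2) (y' ^+ 2) => *; lia.
split; apply: sq => //; move: N; rewrite x2 => /addrI.
by apply: mulfI.
Qed.

Local Lemma same_sign_le (u u' v v' : int) : (0 <= u) = (0 <= u') -> (0 <= v) = (0 <= v') ->
  15 * `|v| <= `|u| -> 15 * `|v'| <= `|u'| -> 15 * `|v + v'| <= 1 * `|u + u'|.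
Proof. by case: (lerP 0 u); case: (lerP 0 u'); case: (lerP 0 v); case: (lerP 0 v') => //; lia. Qed.

Local Lemma same_sign_gt (u u' v v' : int) : (0 <= u) = (0 <= u') -> (0 <= v) = (0 <= v') ->
  ~~ (15 * `|v| <= `|u|) -> ~~ (15 * `|v'| <= `|u'|) ->
  1 * `|u + u'| <= 15 * `|v + v'| /\ 0 < 15 * `|v + v'|.
Proof. by case: (lerP 0 u); case: (lerP 0 u'); case: (lerP 0 v); case: (lerP 0 v') => //; lia. Qed.

Local Lemma same_sign_mul (u v u' v' : int) : (0 <= u) = (0 <= v) -> (0 <= u') = (0 <= v') ->
  (0 <= u) = (0 <= u') -> 0 <= (u + v) * (u' + v').
Proof.
case: (lerP 0 u) => hu; case: (lerP 0 v) => hv //; case: (lerP 0 u') => hu' //;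
  case: (lerP 0 v') => hv' // _ _ _; first by rewrite mulr_ge0 // addr_ge0.
by rewrite -mulrNN mulr_ge0 // oppr_ge0; lia.
Qed.

Local Lemma half (u v u' v' : int) : u - v = u' - v' -> u + v = u' + v' -> u = u'.
Proof. by lia. Qed.

(* Lattice points on an ellipse: two points in one block of side [h] have a
   difference in a box of side about [h], and a chord is determined by its
   direction vector within a quadrant. *)
Lemma ellipse_points (K : int) (a : nat) (s : seq (int * int)) : (0 < a)%N -> uniq s ->
  (forall p, p \in s -> p.1 ^+ 2 + 15 * p.2 ^+ 2 = K /\
     `|p.1| <= 7 * (a ^ 9)%:Z /\ `|p.2| <= 7 * (a ^ 9)%:Z) ->
  (size s <= 136 * a ^ 6)%N.
Proof.
move=> a0 us sP.
(* Eight classes: the two signs, and which coordinate parametrizes the arc. Where 15 |y| <= |x|, the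
   change of x is bounded by that of y, so blocks cut the y-axis; elsewhere they cut the x-axis. *)
pose cl (p : int * int) := (0 <= p.1, 0 <= p.2, 15 * `|p.2| <= `|p.1|).
(* The side a^3 balances the 7 h^2 + 1 blocks of a class against the (2 h + 1)^2 differences; 136 is
   8 * (8 + 9). *)
pose h := (a ^ 3)%N.
have h0 : (0 < h)%N by rewrite expn_gt0 a0.
have ah : (a ^ 9 = h * h * h)%N by rewrite /h -!expnD.
have ah6 : (a ^ 6 = h * h)%N by rewrite /h -!expnD.
pose sel (b : bool) (p : int * int) := if b then p.2 else p.1.
pose bl (p : int * int) := (cl p, (absz (sel (cl p).2 p) %/ h)%N).
pose cls := [seq (x, z) | x <- [seq (x, y) | x <- [:: true; false], y <- [:: true; false]], z <- [:: true; false]].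
have clsP x : x \in cls by case: x => [[[] []] []].
pose bs := [seq (c, n) | c <- cls, n <- iota 0 (7 * (h * h)).+1].
pose d (p o : int * int) := (cl p, (p.1 - o.1, p.2 - o.2)).
pose ds := [seq (c, e) | c <- cls, e <- [seq (x, y) | x <- zrange h, y <- zrange h]].
have := @size_le_blocks _ _ _ s bl bs d ds us.
have -> : size bs = (8 * (7 * (h * h)).+1)%N by rewrite size_allpairs size_iota.
have -> : size ds = (8 * ((h + h).+1 * (h + h).+1))%N by rewrite size_allpairs size_allpairs !size_zrange.
move=> H; apply: (leq_trans (H _ _ _)); last 1 first.
- by rewrite ah6; nia.
- move=> p ps; apply/allpairsP; exists (bl p); split; [exact: clsP| |by []].
  have [_ [p1 p2]] := sP p ps; rewrite mem_iota /= add0n.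
  rewrite ltn_divLR //.
  pose k := (h * h * h)%N.
  have -> : ((7 * (h * h)).+1 * h = 7 * k + h)%N by rewrite /k; ring.
  rewrite ah -/k in p1 p2; move: h0 p1 p2; rewrite /sel /=; case: ifP => _; move: (k) (h) p.1 p.2; clear => k' h' u v; lia.
- move=> p o ps os; move=> E _.
  have clE : cl p = cl o := congr1 fst E.
  have bE : (absz (sel (cl p).2 p) %/ h = absz (sel (cl o).2 o) %/ h)%N := congr1 snd E.
  have [s1 s2 s3] := clE; rewrite -clE in bE.
  rewrite /d /ds; apply: (allpairs_f (fun c e => (c, e))); first exact: clsP.
  have [pK _] := sP p ps; have [oK _] := sP o os.
  have eK : (p.1 - o.1) * (p.1 + o.1) + 15 * ((p.2 - o.2) * (p.2 + o.2)) = 0.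
    transitivity (p.1 ^+ 2 + 15 * p.2 ^+ 2 - (o.1 ^+ 2 + 15 * o.2 ^+ 2)); first by ring.
    by rewrite pK oK subrr.
  have dB (u v : int) : (absz u %/ h = absz v %/ h)%N -> (0 <= u) = (0 <= v) ->
      `|u - v| <= h%:Z.
    move=> uv sg; move: (divn_eq (absz u) h) (divn_eq (absz v) h) (ltn_pmod (absz u) h0) (ltn_pmod (absz v) h0).
    rewrite uv; move: (absz u %% h)%N (absz v %% h)%N (absz v %/ h * h)%N (h) sg => b c e k; clear; lia.
  apply/allpairsP; exists (p.1 - o.1, p.2 - o.2); split=> //=; rewrite mem_zrange.
    case c': (cl p).2 bE => bE; last exact: dB.
    have c : 15 * `|o.2| <= `|o.1| by rewrite -s3.
    rewrite /= in c'.
    have [z|nz] := eqVneq (p.1 + o.1) 0; first by move: z s1; move: (p.1) (o.1) (h); clear => u v k; lia.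
    have : `|p.1 - o.1| <= `|p.2 - o.2|.
      apply: (chord_le (b := 1) (c := 15) (x := p.1 + o.1) (y := p.2 + o.2)) => //.
      - by rewrite mul1r.
      - exact: same_sign_le.
      - by rewrite mul1r normr_gt0.
    by move=> l1; apply: le_trans l1 (dB _ _ bE s2).
  case c': (cl p).2 bE => bE; first exact: dB.
  have c : ~~ (15 * `|o.2| <= `|o.1|) by rewrite -s3; apply/negbT.
  move/negbT: c' => c'; rewrite /= in c'.
  have : `|p.2 - o.2| <= `|p.1 - o.1|.
    have [l1 l2] := same_sign_gt s1 s2 c' c.
    apply: (chord_le (b := 15) (c := 1) (x := p.2 + o.2) (y := p.1 + o.1)) => //.
    by rewrite mul1r addrC.
  by move=> l1; apply: le_trans l1 (dB _ _ bE s1).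
- move=> p o p' o' ps os ps' os'; rewrite /bl /cl => -[s1 s2 _ _] [s1' s2' _ _] po po'.
  rewrite /d /cl => -[t1 t2 _ d1 d2].
  have [pK _] := sP p ps; have [oK _] := sP o os.
  have [pK' _] := sP p' ps'; have [oK' _] := sP o' os'.
  have {}po : (p.1 != o.1) || (p.2 != o.2).
    by move: po; rewrite [p]surjective_pairing [o]surjective_pairing xpair_eqE negb_and.
  suff [e1 e2] : p.1 + o.1 = p'.1 + o'.1 /\ p.2 + o.2 = p'.2 + o'.2.
    by rewrite [p]surjective_pairing [p']surjective_pairing (half d1 e1) (half d2 e2).
  have chord (u v u' v' : int) : u ^+ 2 + 15 * v ^+ 2 = K -> u' ^+ 2 + 15 * v' ^+ 2 = K ->
      (u - u') * (u + u') + 15 * ((v - v') * (v + v')) = 0.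
    move=> e e'; transitivity (u ^+ 2 + 15 * v ^+ 2 - (u' ^+ 2 + 15 * v' ^+ 2)); first by ring.
    by rewrite e e' subrr.
  have par (u v u' v' : int) : u ^+ 2 + 15 * v ^+ 2 = K -> u' ^+ 2 + 15 * v' ^+ 2 = K ->
      (u + u') ^+ 2 + 15 * (v + v') ^+ 2 = 4 * K - ((u - u') ^+ 2 + 15 * (v - v') ^+ 2).
    move=> e e'; transitivity (2 * ((u ^+ 2 + 15 * v ^+ 2) + (u' ^+ 2 + 15 * v' ^+ 2)) -
      ((u - u') ^+ 2 + 15 * (v - v') ^+ 2)); first by ring.
    by rewrite e e'; ring.
  apply: (@chord_center (p.1 - o.1) (p.2 - o.2)).
  - by rewrite !subr_eq0.
  - exact: chord.
  - by rewrite d1 d2; apply: chord.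
  - by rewrite (par _ _ _ _ pK oK) (par _ _ _ _ pK' oK') d1 d2.
  - exact: same_sign_mul.
  - exact: same_sign_mul.
Qed.

(* Elements of the maximal order Z e + Z X_0 + Z X_1 + Z X_2 with
   e = (1 + X_0 + X_1 + X_2) / 2 of the rational quaternion algebra of discriminant 5,
   where X_i ^ 2 = - 2 and X_0 X_1 = (1 + X_0 + X_1 + 3 X_2) / 2, cyclically; a quadruple
   lists the coordinates on e, X_0, X_1, X_2, and [lmul i] is left multiplication by X_i. *)
Definition quat := (int * int * int * int)%type.

Definition lmul (i : 'I_3) (v : quat) : quat :=
  let: (c, x, y, z) := v in
  match val i with
  | 0 => (- c - 4 * x + y + z, c + 2 * x - z, 2 * x - 2 * z, c + 2 * x + y - z)
  | 1 => (- c - 4 * y + z + x, c + 2 * y + z - x, c + 2 * y - x, 2 * y - 2 * x)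
  | _ => (- c - 4 * z + x + y, 2 * z - 2 * y, c + 2 * z + x - y, c + 2 * z - y)
  end.

Definition qnorm (v : quat) : int :=
  let: (c, x, y, z) := v in
  c * c + c * (x + y + z) + 2 * (x * x + y * y + z * z) - x * y - x * z - y * z.

Definition qeven (v : quat) : bool :=
  let: (c, x, y, z) := v in
  [&& (2 %| c)%Z, (2 %| x)%Z, (2 %| y)%Z & (2 %| z)%Z].

(** 1 = 2 e - X_0 - X_1 - X_2. *)
Definition qone : quat := (2, -1, -1, -1).

Lemma ord3P (P : 'I_3 -> Prop) : P ord0 -> P (Ordinal (isT : 1 < 3)%N) ->
  P (Ordinal (isT : 2 < 3)%N) -> forall i, P i.
Proof.
move=> P0 P1 P2 [[|[|[|//]]] Hi].
- by rewrite (_ : Ordinal Hi = ord0) //; apply: val_inj.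
- by rewrite (_ : Ordinal Hi = Ordinal (isT : 1 < 3)%N) //; apply: val_inj.
- by rewrite (_ : Ordinal Hi = Ordinal (isT : 2 < 3)%N) //; apply: val_inj.
Qed.

Lemma qnorm_lmul i v : qnorm (lmul i v) = 2 * qnorm v.
Proof.
by move: i v; apply: ord3P => -[[[c x] y] z]; rewrite /qnorm /=; ring.
Qed.

Lemma lmul_inj i : injective (lmul i).
Proof.
by move: i; apply: ord3P => -[[[c x] y] z] [[[c' x'] y'] z'] /= [];
  move=> e1 e2 e3 e4; congr (_, _, _, _); lia.
Qed.

(** At the prime 2 the order is a matrix algebra, and X_0, X_1, X_2 are the three edges at a vertex
    of its 3-regular tree; divisibility by 2 means backtracking. The proof only compares parities of
    coordinates. *)
Lemma lmul_even i j v : i != j -> qeven (lmul i (lmul j v)) -> qeven (lmul j v).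
Proof.
move: i j v; apply: ord3P; apply: ord3P => -[[[c x] y] z] //= _ /and4P[];
  by move=> e1 e2 e3 e4; apply/and4P; split; lia.
Qed.

Lemma lmul_neq i j v v' : i != j -> lmul i v = lmul j v' -> qeven (lmul j v').
Proof.
move=> ij e; apply: (lmul_even ij); rewrite -e.
by move: i v {ij e}; apply: ord3P => -[[[c x] y] z] /=; apply/and4P; split; lia.
Qed.

Definition qcoord (e : quat) (w : seq 'I_3) : quat := foldl (fun v i => lmul i v) e w.

Lemma qcoord_rcons e w i : qcoord e (rcons w i) = lmul i (qcoord e w).
Proof. by rewrite /qcoord foldl_rcons. Qed.

Lemma qnorm_qcoord e w : qnorm (qcoord e w) = 2 ^+ size w * qnorm e.
Proof.
elim/last_ind: w => [|w i IHw]; first by rewrite mul1r.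
by rewrite qcoord_rcons qnorm_lmul IHw size_rcons exprS mulrA.
Qed.

Lemma reduced_rcons w i j : reduced (rcons (rcons w i) j) -> reduced (rcons w i) && (i != j).
Proof.
rewrite -reduced_rev !rev_rcons => /andP[ij r].
apply/andP; split; last exact: ij.
by rewrite -reduced_rev rev_rcons; exact: r.
Qed.

(** The odd norm of [e] starts the induction: if X_i e were even, 4 would divide its norm 2
    [qnorm e]. Then [lmul_even] applies along the word. *)
Lemma qcoord_primitive e w : ~~ (2 %| qnorm e)%Z -> reduced w -> w != [::] ->
  ~~ qeven (qcoord e w).
Proof.
move=> e1; elim/last_ind: w => // w i; case/lastP: w => [_|w j IHw] rw _.
  rewrite /= ; apply: contra e1 => ev.
  have : (4 %| qnorm (lmul i e))%Z.
    move: ev; case: (lmul i e) => -[[c x] y] z /= /and4P[].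
    move=> /dvdzP[a ->] /dvdzP[b ->] /dvdzP[d ->] /dvdzP[f ->].
    apply/dvdzP; exists (qnorm (a, b, d, f)); rewrite /=; ring.
  by rewrite qnorm_lmul; lia.
have /andP[rwj ji] := reduced_rcons rw; move: IHw => /(_ rwj).
rewrite !qcoord_rcons -size_eq0 size_rcons => /(_ isT); apply: contra.
by apply: lmul_even; rewrite eq_sym.
Qed.

Lemma qcoord_inj e w w' : ~~ (2 %| qnorm e)%Z -> reduced w -> reduced w' ->
  size w = size w' -> qcoord e w = qcoord e w' -> w = w'.
Proof.
move=> e1; elim/last_ind: w w' => [|w i IHw] w' rw; first by case: w'.
case/lastP: w' => [|w' j] rw'; first by rewrite size_rcons.
rewrite !size_rcons !qcoord_rcons => -[sw] E.
have [ij|ij] := eqVneq i j; last first.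
  have := qcoord_primitive e1 rw'; rewrite -size_eq0 size_rcons => /(_ isT).
  by rewrite qcoord_rcons (lmul_neq ij E).
move: E; rewrite ij => /lmul_inj E; congr (rcons _ _); apply: IHw => //.
  by move: rw; rewrite -cats1 => /reduced_catl.
by move: rw'; rewrite -cats1 => /reduced_catl.
Qed.

(** The coefficient of X_0 is c / 2 + x, and similarly for X_1 and X_2; so for odd m this expresses
    congruence to a scalar mod m. *)
Definition qscalar (m : int) (v : quat) : bool :=
  let: (c, x, y, z) := v in
  [&& (m %| c + 2 * x)%Z, (m %| c + 2 * y)%Z & (m %| c + 2 * z)%Z].

Lemma size_le_fibers (T E : eqType) (s : seq T) (f : T -> E) (es : seq E) B :
  uniq s -> (forall p, p \in s -> f p \in es) ->
  (forall e, (size [seq p <- s | f p == e] <= B)%N) -> (size s <= size es * B)%N.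
Proof.
move=> us sf sB; elim: es s us sf sB => [|e es IH] s us sf sB.
  by case: s us sf sB => // p s _ /(_ p (mem_head _ _)).
rewrite -(count_predC (fun p => f p == e)) -!size_filter mulSn leq_add ?sB //.
apply: IH.
- exact: filter_uniq.
- move=> p; rewrite mem_filter /= => /andP[pe /sf].
  by rewrite inE (negPf pe).
- move=> e'; rewrite -filter_predI; apply: leq_trans (sB e').
  by rewrite !size_filter; apply: sub_count => p /= /andP[].
Qed.


(** [qre] is the reduced trace; [qu], [qv], [qn] diagonalize the norm form on the trace zero part,
    see [qnorm_diag]. This is the origin of the ellipses with coefficient 15. *)
Definition qre (v : quat) : int := let: (c, x, y, z) := v in c.
Definition qu (v : quat) : int :=
  let: (c, x, y, z) := v in 3 * ((c + 2 * x) + (c + 2 * y)) - 2 * (c + 2 * z).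
Definition qv (v : quat) : int := let: (c, x, y, z) := v in (c + 2 * x) - (c + 2 * y).
Definition qn (v : quat) : int := let: (c, x, y, z) := v in c + 2 * z.

Lemma qnorm_diag v :
  12 * qre v ^+ 2 + qu v ^+ 2 + 15 * qv v ^+ 2 + 20 * qn v ^+ 2 = 48 * qnorm v.
Proof. by move: v => [[[c x] y] z] /=; ring. Qed.

Lemma quat_coords v v' : qre v = qre v' -> qu v = qu v' -> qv v = qv v' ->
  qn v = qn v' -> v = v'.
Proof.
move: v v' => [[[c x] y] z] [[[c' x'] y'] z'] /= -> e1 e2 e3.
by congr (_, _, _, _); lia.
Qed.

(** 4 [qnorm v] - c^2 is an integral quadratic form in c + 2 x, c + 2 y, c + 2 z, hence divisible by
    the square of m. *)
Lemma qscalarP m v : qscalar m v ->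
  [/\ (m %| qu v)%Z, (m %| qv v)%Z, (m %| qn v)%Z &
      (m ^+ 2 %| qre v ^+ 2 - 4 * qnorm v)%Z].
Proof.
move: v => [[[c x] y] z] /= /and3P[/dvdzP[x' xE] /dvdzP[y' yE] /dvdzP[z' zE]].
rewrite xE yE zE; split.
- by apply/dvdzP; exists (3 * (x' + y') - 2 * z'); ring.
- by apply/dvdzP; exists (x' - y'); ring.
- by apply/dvdzP; exists z'.
apply/dvdzP; exists (- (2 * (x' ^+ 2 + y' ^+ 2 + z' ^+ 2) - x' * y' - x' * z' - y' * z')).
transitivity (- (2 * ((x' * m) ^+ 2 + (y' * m) ^+ 2 + (z' * m) ^+ 2) -
   (x' * m) * (y' * m) - (x' * m) * (z' * m) - (y' * m) * (z' * m))); last by ring.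
by rewrite -xE -yE -zE; ring.
Qed.

(** Words of even length have a norm M^2 that is a square, so that the expression factors; an odd
    prime cannot divide both factors, whose difference 4 M is a power of 2. *)
Lemma dvdz_sqr_diff (q t : nat) (x : int) : prime q -> odd q ->
  let M := (2 ^ t)%N%:Z in (q%:Z ^+ 2 %| x ^+ 2 - 4 * (M * M))%Z ->
  (q%:Z ^+ 2 %| x - 2 * M)%Z \/ (q%:Z ^+ 2 %| x + 2 * M)%Z.
Proof.
move=> qp qo M.
have -> : x ^+ 2 - 4 * (M * M) = (x - 2 * M) * (x + 2 * M) by ring.
have cop (y : int) : ~~ (q%:Z %| y)%Z -> coprimez (q%:Z ^+ 2) y.
  by move=> qy; rewrite coprimezE abszX coprimeXl //= prime_coprime.
have [qx|nqx] := boolP (q%:Z %| x - 2 * M)%Z; last first.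
  by rewrite Gauss_dvdzr ?cop //; right.
have [qx'|nqx'] := boolP (q%:Z %| x + 2 * M)%Z; last first.
  by rewrite Gauss_dvdzl ?cop //; left.
exfalso; have : (q%:Z %| (x + 2 * M) - (x - 2 * M))%Z by rewrite rpredB.
have -> : (x + 2 * M) - (x - 2 * M) = (2 ^ t.+2)%N%:Z by rewrite /M !expnS; lia.
rewrite dvdzE /= Euclid_dvdX // dvdn_prime2 // => /andP[/eqP q2 _].
by rewrite q2 in qo.
Qed.

Local Lemma sumsq_ge0 (x y z : int) : 0 <= x ^+ 2 + 15 * y ^+ 2 + 20 * z ^+ 2.
Proof.
by move: (sqr_ge0 x) (sqr_ge0 y) (sqr_ge0 z); move: (x ^+ 2) (y ^+ 2) (z ^+ 2); lia.
Qed.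

Section CountScalar.
Variables (q a t : nat).
Hypotheses (q_prime : prime q) (q_odd : odd q) (a0 : (0 < a)%N).
Let M : int := (2 ^ t)%N%:Z.

Let words := [seq w <- rwords (t + t) | qscalar q%:Z (qcoord qone w)].

Let wordsP w : w \in words ->
  [/\ reduced w, size w = (t + t)%N, qnorm (qcoord qone w) = M * M & qscalar q%:Z (qcoord qone w)].
Proof.
rewrite mem_filter mem_rwords => /and3P[sc /eqP sw rw]; split=> //.
have -> : M = 2 ^+ t by rewrite /M -natz natrX.
by rewrite qnorm_qcoord sw (_ : qnorm qone = 1) // mulr1 exprD.
Qed.

(** The trace is congruent to 2 M or - 2 M mod q^2 and at most 2 M in size, so it equals one of them
    when 4 M < q^2. The norm then leaves no trace zero part, and the element is M or - M, which is
    even for t > 0, against [qcoord_primitive]. *)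
Lemma count_scalar_eq0 : (0 < t)%N -> (4 * 2 ^ t < q ^ 2)%N -> words = [::].
Proof.
move=> t0 tq; case: (words) wordsP => // w s /(_ w (mem_head _ _))[rw sw nw sc].
exfalso; have [_ _ _] := qscalarP sc.
have := qnorm_diag (qcoord qone w).
have : ~~ qeven (qcoord qone w).
  apply: qcoord_primitive => //; apply/eqP => wn.
  by move: sw t0; rewrite wn /=; clear; lia.
rewrite nw; set v := qcoord qone w => ev dg H0.
have {H0} H : (q%:Z ^+ 2 %| qre v - 2 * M)%Z \/ (q%:Z ^+ 2 %| qre v + 2 * M)%Z.
  exact: dvdz_sqr_diff.
have c2 : qre v ^+ 2 <= 4 * (M * M).
  move: dg (sqr_ge0 (qu v)) (sqr_ge0 (qv v)) (sqr_ge0 (qn v)).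
  by move: (qre v ^+ 2) (qu v ^+ 2) (qv v ^+ 2) (qn v ^+ 2) (M * M); clear; lia.
have M0 : 0 <= M by [].
have cM : `|qre v| <= 2 * M.
  rewrite -(@ler_pXn2r _ 2) ?nnegrE ?mulr_ge0 // real_normK ?num_real //.
  by rewrite (_ : (2 * M) ^+ 2 = 4 * (M * M)) //; ring.
have tq' : 4 * M < q%:Z ^+ 2.
  have : (4 * 2 ^ t)%N%:Z < (q ^ 2)%N%:Z by rewrite ltz_nat.
  by rewrite PoszM /M -[(q ^ 2)%N%:Z]natz natrX natz.
have small (y : int) : (q%:Z ^+ 2 %| y)%Z -> `|y| <= 4 * M -> y = 0.
  move=> /dvdzP[k ->] hk; have [->|k0] := eqVneq k 0; first by rewrite mul0r.
  exfalso; move: hk; rewrite normrM (ger0_norm (sqr_ge0 _)) => hk.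
  have : 1 * q%:Z ^+ 2 <= `|k| * q%:Z ^+ 2.
    by rewrite ler_wpM2r ?sqr_ge0 //; move: k0; clear; lia.
  by rewrite mul1r => /le_trans/(_ hk); rewrite leNgt tq'.
have c4 : qre v ^+ 2 = 4 * (M * M).
  case: H => /small H.
    have -> : qre v = 2 * M; last by ring.
    by apply/eqP; rewrite -subr_eq0; apply/eqP/H; move: cM M0; move: (qre v) (M); clear; lia.
  have -> : qre v = - (2 * M); last by ring.
  by apply/eqP; rewrite -addr_eq0; apply/eqP/H; move: cM M0; move: (qre v) (M); clear; lia.
have z0 : qu v = 0 /\ qv v = 0 /\ qn v = 0.
  move: dg; rewrite c4 (_ : 12 * (4 * (M * M)) = 48 * (M * M)); last by ring.
  move: (sqr_ge0 (qu v)) (sqr_ge0 (qv v)) (sqr_ge0 (qn v)) => h1 h2 h3 dg.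
  have : [/\ qu v ^+ 2 = 0, qv v ^+ 2 = 0 & qn v ^+ 2 = 0].
    move: h1 h2 h3 dg; move: (qu v ^+ 2) (qv v ^+ 2) (qn v ^+ 2) (M * M); clear.
    by move=> a b c d *; split; lia.
  by case=> /eqP + /eqP + /eqP; rewrite !sqrf_eq0 => /eqP-> /eqP-> /eqP->.
have Mev : exists M', M = 2 * M'.
  by exists (2 ^ t.-1)%N%:Z; rewrite /M -(prednK t0) expnS.
have cE : qre v = 2 * M \/ qre v = - (2 * M).
  have /eqP : qre v ^+ 2 = (2 * M) ^+ 2 by rewrite c4; ring.
  by rewrite eqf_sqr => /orP[]/eqP; [left|right].
move: ev z0 Mev cE; clear; move: (v) (M) => [[[c x] y] z] N /= ev [e1 [e2 e3]] [M' ->] cE.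
by case/negP: ev; apply/and4P; split; case: cE => cE; lia.
Qed.

(** The trace lies in two residue classes mod q^2 and [qn] is a multiple of q, which leaves at most
    90 a^10 choices for both. The remaining two coordinates, divided by q, lie on an ellipse with at
    most 136 a^6 points. *)
Lemma count_scalar_le : (2 ^ t <= a ^ 17)%N -> (a ^ 8 <= q)%N ->
  (size words <= 90 * 136 * a ^ 16)%N.
Proof.
move=> Ma aq.
have q0 : (0 < q)%N by apply: prime_gt0.
have Ma' : M <= (a ^ 17)%N%:Z by rewrite lez_nat.
have aq' : (a ^ 16)%N%:Z <= q%:Z ^+ 2.
  rewrite (_ : q%:Z ^+ 2 = (q ^ 2)%N%:Z) ?lez_nat; last by rewrite -[(q ^ 2)%N%:Z]natz natrX natz.
  by rewrite (_ : 16 = 8 * 2)%N // expnM leq_exp2r.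
have M0 : 0 <= M by [].
pose par v := ((q%:Z ^+ 2 %| qre v - 2 * M)%Z).
pose kk v := if par v then ((qre v - 2 * M) %/ q%:Z ^+ 2)%Z else ((qre v + 2 * M) %/ q%:Z ^+ 2)%Z.
pose f w := let v := qcoord qone w in (par v, kk v, (qn v %/ q%:Z)%Z).
(* The quotient of the trace is at most 4 a^17 / a^16 = 4 a, and 20 n^2 <= 48 a^18 gives n <= 2 a^9;
   the size 2 (8 a + 1) (4 a^9 + 1) is at most 90 a^10. *)
pose es := [seq (x, n) | x <- [seq (s, k) | s <- [:: true; false], k <- zrange (4 * a)],
              n <- zrange (2 * a ^ 9)].
have uw : uniq words by rewrite filter_uniq ?rwords_uniq.
have ses : (size es <= 90 * a ^ 10)%N.
  rewrite !size_allpairs !size_zrange /= (_ : 10 = 1 + 9)%N // expnD expn1.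
  move: (expn_gt0 a 9); rewrite a0 /=; move: (a ^ 9)%N a0 => b; clear; nia.
have kkP w : w \in words -> let v := qcoord qone w in
    qre v = (if par v then 2 * M else - (2 * M)) + kk v * q%:Z ^+ 2.
  move=> /wordsP[_ _ nw sc] v; have [_ _ _] := qscalarP sc.
  rewrite nw -/v => /(dvdz_sqr_diff q_prime q_odd); rewrite -/M /kk /par.
  case: ifP => [d _|_ [//|d]]; first by rewrite divzK //; ring.
  by rewrite divzK //; ring.
pose P v := (qu v %/ q%:Z)%Z; pose m v := (qv v %/ q%:Z)%Z; pose n v := (qn v %/ q%:Z)%Z.
have qE w : w \in words -> let v := qcoord qone w in
    [/\ qu v = P v * q%:Z, qv v = m v * q%:Z & qn v = n v * q%:Z].
  by move=> /wordsP[_ _ _ /qscalarP[h1 h2 h3 _]] v; rewrite !divzK.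
have dg w : w \in words -> let v := qcoord qone w in
    q%:Z ^+ 2 * (P v ^+ 2 + 15 * m v ^+ 2 + 20 * n v ^+ 2) = 48 * (M * M) - 12 * qre v ^+ 2.
  move=> ww v; have [e1 e2 e3] := qE w ww; have [_ _ nw _] := wordsP ww.
  rewrite -nw -qnorm_diag -/v e1 e2 e3; ring.
have a16 : 0 < (a ^ 16)%N%:Z by rewrite ltz_nat expn_gt0 a0.
have MM : M * M <= (a ^ 16)%N%:Z * (a ^ 18)%N%:Z.
  apply: (le_trans (ler_pM _ _ Ma' Ma')) => //.
  by rewrite -!PoszM -!expnD.
have bd w : w \in words -> let v := qcoord qone w in
    P v ^+ 2 + 15 * m v ^+ 2 + 20 * n v ^+ 2 <= 48 * (a ^ 18)%N%:Z.
  move=> ww /=; have := dg w ww; set v := qcoord qone w; rewrite /=; set S := (X in _ * X = _) => e.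
  have S0 : 0 <= S by apply: sumsq_ge0.
  rewrite -(ler_pM2l a16); apply: (le_trans (ler_wpM2r S0 aq')); rewrite e.
  rewrite [X in _ <= X]mulrCA; move: MM (sqr_ge0 (qre v)).
  by move: ((a ^ 16)%N%:Z * (a ^ 18)%N%:Z) (M * M) (qre v ^+ 2); clear; lia.
have sq_le (x b : int) (k : nat) : x ^+ 2 <= b -> b <= (k%:Z * (a ^ 9)%N%:Z) ^+ 2 -> `|x| <= (k * a ^ 9)%N%:Z.
  move=> xb bk; rewrite -(@ler_pXn2r _ 2) ?nnegrE // real_normK ?num_real //.
  by rewrite PoszM; apply: le_trans xb bk.
have a18 : (a ^ 18)%N%:Z = (a ^ 9)%N%:Z ^+ 2 by rewrite expr2 -PoszM -expnD.
have bd' w : w \in words -> let v := qcoord qone w in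
    [/\ `|P v| <= (7 * a ^ 9)%N%:Z, `|m v| <= (7 * a ^ 9)%N%:Z & `|n v| <= (2 * a ^ 9)%N%:Z].
  move=> ww v; have := bd w ww; rewrite /= -/v a18 => h.
  split; apply: sq_le (lexx _) _; rewrite exprMn;
  move: h (sqr_ge0 (P v)) (sqr_ge0 (m v)) (sqr_ge0 (n v)) (sqr_ge0 (a ^ 9)%N%:Z);
  move: (P v ^+ 2) (m v ^+ 2) (n v ^+ 2) ((a ^ 9)%N%:Z ^+ 2); clear => x y z t; lia.
apply: (@leq_trans (size es * (136 * a ^ 6))); last first.
  apply: leq_trans (leq_mul ses (leqnn _)) _.
  by rewrite (_ : 16 = 10 + 6)%N // expnD mulnACA.
apply: (size_le_fibers (f := f)) => //.
  move=> w ww; have [_ _ nb] := bd' w ww; have := kkP w ww; have := dg w ww.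
  rewrite /f; set v := qcoord qone w => dgv kkv.
  apply: (allpairs_f (fun x n => (x, n))); last by rewrite mem_zrange.
  apply: (allpairs_f (fun x n => (x, n))); first by case: (par v).
  rewrite mem_zrange -(ler_pM2l a16).
  apply: (@le_trans _ _ (q%:Z ^+ 2 * `|kk v|)); first by rewrite ler_wpM2r.
  have cM : `|qre v| <= 2 * M.
    rewrite -(@ler_pXn2r _ 2) ?nnegrE ?mulr_ge0 // real_normK ?num_real //.
    have : 0 <= q%:Z ^+ 2 * (P v ^+ 2 + 15 * m v ^+ 2 + 20 * n v ^+ 2).
      apply: mulr_ge0; first exact: sqr_ge0.
      exact: sumsq_ge0.
    rewrite dgv (_ : (2 * M) ^+ 2 = 4 * (M * M)); last by ring.
    by move: (qre v ^+ 2) (M * M); clear; lia.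
  have e : `|kk v * q%:Z ^+ 2| <= 4 * M.
    have -> : kk v * q%:Z ^+ 2 = qre v - (if par v then 2 * M else - (2 * M)).
      by rewrite kkv addrC addKr.
    by move: cM M0; move: (qre v) (M); clear => x y; case: ifP => _; lia.
  rewrite -[X in X * `|_|]ger0_norm ?sqr_ge0 // -normrM mulrC; apply: (le_trans e).
  rewrite (_ : (a ^ 16)%N%:Z * (4 * a)%N%:Z = 4 * (a ^ 17)%N%:Z).
    by rewrite ler_pM2l.
  by rewrite -PoszM mulnCA -expnSr PoszM.
move=> e; set s' := [seq p <- words | f p == e].
pose g w := (P (qcoord qone w), m (qcoord qone w)).
rewrite -(size_map g).
case s'E : s' => [|w0 s0] //; rewrite -s'E.
have w0s : w0 \in s' by rewrite s'E mem_head.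
have s'P w : w \in s' -> w \in words /\ f w = f w0.
  by move: w0s; rewrite !mem_filter => /andP[/eqP-> _] /andP[/eqP-> ->].
have fib w : w \in s' -> qre (qcoord qone w) = qre (qcoord qone w0) /\ n (qcoord qone w) = n (qcoord qone w0).
  move=> ws; have [ww [e1 e2 e3]] := s'P w ws; have [ww0 _] := s'P w0 w0s.
  by split=> //; rewrite (kkP w ww) (kkP w0 ww0) e1 e2.
apply: (ellipse_points (K := P (qcoord qone w0) ^+ 2 + 15 * m (qcoord qone w0) ^+ 2)) => //.
  rewrite map_inj_in_uniq; first by rewrite filter_uniq.
  move=> w w' ws ws' [eP em].
  have [ww _] := s'P w ws; have [ww' _] := s'P w' ws'.
  have [rw sw _ _] := wordsP ww; have [rw' sw' _ _] := wordsP ww'.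
  apply: (@qcoord_inj qone) => //; first by rewrite sw sw'.
  have [f1 f2] := fib w ws; have [f1' f2'] := fib w' ws'.
  have [q1 q2 q3] := qE w ww; have [q1' q2' q3'] := qE w' ww'.
  apply: quat_coords; first by rewrite f1 f1'.
  - by rewrite q1 q1' eP.
  - by rewrite q2 q2' em.
  - by rewrite q3 q3' f2 f2'.
move=> p /mapP[w ws ->] /=; have [ww _] := s'P w ws; have [ww0 _] := s'P w0 w0s.
have [b1 b2 _] := bd' w ww; split=> //.
have [f1 f2] := fib w ws; have h1 := dg w ww; have h0 := dg w0 ww0.
rewrite /= in h1 h0; rewrite f1 f2 -h0 in h1.
apply: (addIr (20 * n (qcoord qone w0) ^+ 2)); apply: mulfI h1.
by rewrite expf_neq0 // -lt0n.
Qed.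

End CountScalar.

(** * Matrix model of the quaternion algebra *)

Section Mat2.
Variable F : comNzRingType.
Implicit Types a b c d : F.

Definition mat2 a b c d : 'M[F]_2 :=
  \matrix_(i, j) if i == 0 then (if j == 0 then a else b) else (if j == 0 then c else d).

Lemma mat2E (A : 'M[F]_2) : A = mat2 (A 0 0) (A 0 1) (A 1 0) (A 1 1).
Proof.
apply/matrixP => i j; rewrite mxE.
by case: i => [[|[|//]] Hi]; case: j => [[|[|//]] Hj] /=; congr (A _ _); apply: val_inj.
Qed.

Lemma mat2P (A B : 'M[F]_2) : A 0 0 = B 0 0 -> A 0 1 = B 0 1 -> A 1 0 = B 1 0 ->
  A 1 1 = B 1 1 -> A = B.
Proof. by move=> h1 h2 h3 h4; rewrite [A]mat2E [B]mat2E h1 h2 h3 h4. Qed.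

Lemma mat2M a b c d a' b' c' d' : mat2 a b c d *m mat2 a' b' c' d' =
  mat2 (a * a' + b * c') (a * b' + b * d') (c * a' + d * c') (c * b' + d * d').
Proof. by apply: mat2P; rewrite !mxE !big_ord_recl big_ord0 !mxE /= addr0. Qed.

Lemma mat2D a b c d a' b' c' d' : mat2 a b c d + mat2 a' b' c' d' =
  mat2 (a + a') (b + b') (c + c') (d + d').
Proof. by apply: mat2P; rewrite !mxE. Qed.

Lemma mat2Z k a b c d : k *: mat2 a b c d = mat2 (k * a) (k * b) (k * c) (k * d).
Proof. by apply: mat2P; rewrite !mxE. Qed.

Lemma mat2_scalar k : k%:M = mat2 k 0 0 k.
Proof. by apply: mat2P; rewrite !mxE. Qed.

Lemma det_mat2 a b c d : \det (mat2 a b c d) = a * d - b * c.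
Proof.
rewrite (expand_det_row _ 0) !big_ord_recl big_ord0 /cofactor !det_mx11 !mxE /=.
by rewrite !expr0 !mul1r expr1 !mulN1r mulrN addr0.
Qed.

End Mat2.

Section QuaternionMatrices.
Variables (F : fieldType) (r : F).
Hypotheses (r2 : r ^+ 2 = - 2%:R) (n2 : 2%:R != 0 :> F) (n3 : 3%:R != 0 :> F)
  (n5 : 5%:R != 0 :> F).

Let n4 : 4%:R != 0 :> F. Proof. by rewrite (natrM F 2 2) mulf_neq0. Qed.
Let n8 : 8%:R != 0 :> F. Proof. by rewrite (natrM F 2 4) mulf_neq0. Qed.

(* The splitting of the quaternion algebra given by a square root r of -2. *)
Definition xmat (i : 'I_3) : 'M[F]_2 :=
  match val i with
  | 0 => mat2 r 0 0 (- r)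
  | 1 => mat2 (- r / 4%:R) 1 (- 15%:R / 8%:R) (r / 4%:R)
  | _ => mat2 (- r / 4%:R) ((2%:R * r - 1) / 3%:R) (5%:R * (1 + 2%:R * r) / 8%:R) (r / 4%:R)
  end.

Definition qmat (v : quat) : 'M[F]_2 :=
  let: (c, x, y, z) := v in
  (c%:~R / 2%:R) *: (1%:M + xmat 0 + xmat 1 + xmat 2%:R) +
  x%:~R *: xmat 0 + y%:~R *: xmat 1 + z%:~R *: xmat 2%:R.

Lemma qmat_lmul i v : qmat (lmul i v) = xmat i *m qmat v.
Proof.
move: i v; apply: ord3P => -[[[c x] y] z];
  rewrite /qmat /xmat /= !mat2_scalar !mat2D !mat2Z !mat2D !mat2M; congr mat2;
  rewrite !(rmorphD, rmorphN, rmorphM, rmorphB) /=;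
  by field: r2; rewrite ?n2 ?n3 ?n4 ?n8.
Qed.

Lemma xmatM i : xmat i *m xmat i = (- 2%:R)%:M.
Proof.
move: i; apply: ord3P; rewrite mat2_scalar /xmat /= mat2M; congr mat2;
  by field: r2; rewrite ?n2 ?n3 ?n4 ?n8.
Qed.

Lemma det_xmat i : \det (xmat i) = 2%:R.
Proof.
move: i; apply: ord3P; rewrite /xmat /= det_mat2;
  by field: r2; rewrite ?n2 ?n3 ?n4 ?n8.
Qed.


Lemma qmat_one : qmat qone = 1%:M.
Proof.
rewrite /qmat /xmat /= !mat2_scalar !mat2D !mat2Z !mat2D; congr mat2;
  by field: r2; rewrite ?n2 ?n3 ?n4 ?n8.
Qed.

Lemma qmat_qcoord e w : qmat (qcoord e w) = foldl (fun A i => xmat i *m A) (qmat e) w.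
Proof. by elim: w e => //= i w IHw e; rewrite IHw qmat_lmul. Qed.

(** The off-diagonal entries give two equations in V and W, with determinant 4 r after
    normalization; the diagonal then gives U. The prime 5 is excluded because the algebra ramifies
    there. *)
Lemma qmat_scalar (k : F) c x y z : qmat (c, x, y, z) = k%:M ->
  [/\ (c + 2 * x)%:~R = 0 :> F, (c + 2 * y)%:~R = 0 :> F & (c + 2 * z)%:~R = 0 :> F].
Proof.
have r0 : r != 0.
  by apply/eqP => r0; move: r2 n2 => /eqP; rewrite r0 expr0n /= eq_sym oppr_eq0 => ->.
rewrite /qmat /xmat /= !mat2_scalar !mat2D !mat2Z !mat2D.
set A := mat2 _ _ _ _ => AE.
have e00 : A 0 0 = k by rewrite AE mxE.
have e01 : A 0 1 = 0 by rewrite AE mxE.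
have e10 : A 1 0 = 0 by rewrite AE mxE.
have e11 : A 1 1 = k by rewrite AE mxE.
move: e00 e01 e10 e11; rewrite !mxE /= !(rmorphD, rmorphN, rmorphM, rmorphB) /=.
set C := c%:~R; set X := x%:~R; set Y := y%:~R; set Z := z%:~R => e00 e01 e10 e11.
pose U := C + 2%:R * X; pose V := C + 2%:R * Y; pose W := C + 2%:R * Z.
have f1 : V + (2%:R * r - 1) / 3%:R * W = 0.
  apply: (mulIf (x := 2%:R^-1)); first by rewrite invr_eq0.
  by rewrite mul0r -[RHS]e01 /V /W; field; rewrite ?n2 ?n3.
have f2 : - 3%:R * V + (1 + 2%:R * r) * W = 0.
  apply: (mulIf (x := 5%:R / 16%:R)).
    by rewrite mulf_neq0 // invr_eq0 (natrM F 2 8) mulf_neq0.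
  rewrite mul0r -[RHS]e10 /V /W; field; rewrite ?n2 ?n3 ?n8 //.
  by rewrite (natrM F 2 8) mulf_neq0.
have W0 : W = 0.
  apply: (mulfI (x := 4%:R * r)); first by rewrite mulf_neq0.
  rewrite mulr0 -[RHS]f2 -[RHS](addr0) -(mulr0 3%:R) -f1; field; rewrite ?n3 //.
have V0 : V = 0 by move: f1; rewrite W0 mulr0 addr0.
have U0 : U = 0.
  apply: (mulfI (x := r)) => //; rewrite mulr0.
  have : (A 0 0 - A 1 1) = 0 by rewrite AE !mxE subrr.
  have -> : r * U = (r * U - r / 4%:R * (V + W)) by rewrite V0 W0 addr0 mulr0 subr0.
  move=> _; rewrite -(subrr k) -{1}e00 -{1}e11 /U /V /W; field.
  by rewrite ?n2 ?n3 ?n4 ?n8.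
by split.
Qed.

End QuaternionMatrices.

(** * The spectral gap *)

Lemma exists_prim_root (C : numClosedFieldType) n : (0 < n)%N ->
  exists z : C, n.-primitive_root z.
Proof.
move=> n0; have [rs E] := closed_field_poly_normal ('X^n - 1 : {poly C}).
rewrite (monicP _) ?monicXnsubC // scale1r in E.
have srs : (n < (size rs).+1)%N by rewrite -(size_prod_XsubC rs id) -E size_XnsubC.
have urs : uniq rs.
  by rewrite -separable_prod_XsubC -E separable_Xn_sub_1 // pnatr_eq0 -lt0n.
have unr : all n.-unity_root rs by apply/allP => z; rewrite -root_prod_XsubC -E.
by have /hasP[z _ zP] := has_prim_root n0 unr urs srs; exists z.
Qed.

Definition sl2 (F : finFieldType) : predArgType := {g : 'M[F]_2 | \det g == 1}.

Section SL2.
Variable F : finFieldType.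
Local Notation sl2 := (sl2 F).

HB.instance Definition _ := SubType.on sl2.
HB.instance Definition _ := [Finite of sl2 by <:].

Lemma slm_subproof (g h : sl2) : \det (val g *m val h) == 1.
Proof. by rewrite det_mulmx (eqP (valP g)) (eqP (valP h)) mulr1. Qed.

Definition slm (g h : sl2) : sl2 := exist _ (val g *m val h) (slm_subproof g h).

Lemma sl1_subproof : \det (1%:M : 'M[F]_2) == 1.
Proof. by rewrite det1. Qed.

Definition sl1 : sl2 := exist _ 1%:M sl1_subproof.

Lemma slmA : associative slm.
Proof. by move=> a b c; apply: val_inj; rewrite /= mulmxA. Qed.
Lemma sl1m : left_id sl1 slm.
Proof. by move=> a; apply: val_inj; rewrite /= mul1mx. Qed.
Lemma slm1 : right_id sl1 slm.
Proof. by move=> a; apply: val_inj; rewrite /= mulmx1. Qed.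

Lemma slV_subproof (g : sl2) : \det (invmx (val g)) == 1.
Proof. by rewrite det_inv (eqP (valP g)) invr1. Qed.

Definition slV (g : sl2) : sl2 := exist _ (invmx (val g)) (slV_subproof g).

Lemma sl_unit (g : sl2) : val g \in unitmx.
Proof. by rewrite unitmxE (eqP (valP g)) unitr1. Qed.

Lemma slVm g : slm (slV g) g = sl1.
Proof. by apply: val_inj; rewrite /= mulVmx ?sl_unit. Qed.
Lemma slmV g : slm g (slV g) = sl1.
Proof. by apply: val_inj; rewrite /= mulmxV ?sl_unit. Qed.

Lemma slm_injr g : injective (slm^~ g).
Proof. by move=> a b /(congr1 (slm^~ (slV g))); rewrite -!slmA slmV !slm1. Qed.

Lemma card_sl2 : (#|sl2| <= #|F| ^ 3)%N.
Proof.
(* Three entries determine the fourth: the last diagonal entry if the first one is nonzero, and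
   otherwise the lower left one, as the upper right one is then nonzero. *)
pose f (g : sl2) : F * F * F := let A := val g in
  (A 0 0, A 0 1, if A 0 0 == 0 then A 1 1 else A 1 0).
have finj : injective f.
  move=> g h [e00 e01 e].
  have dg := eqP (valP g); have dh := eqP (valP h).
  rewrite [val g]mat2E det_mat2 in dg; rewrite [val h]mat2E det_mat2 in dh.
  apply: val_inj; apply: mat2P => //.
    move: e; rewrite e00; case: ifP => [/eqP z e|_ //].
    move: dg dh; rewrite e00 e01 z !mul0r !sub0r => dg dh.
    have n0 : val h 0 1 != 0.
      by apply: contra_eqN dh => /eqP->; rewrite mul0r oppr0 eq_sym oner_eq0.
    by apply: (mulfI n0); apply: oppr_inj; rewrite dg dh.
  move: e; rewrite e00; case: ifPn => [//|n0 e].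
  have : val g 0 0 * val g 1 1 - val g 0 1 * val g 1 0 =
         val h 0 0 * val h 1 1 - val h 0 1 * val h 1 0 by rewrite dg dh.
  by rewrite e00 e01 e => /addIr/(mulfI n0).
have := leq_card f finj; rewrite !card_prod => H; apply: leq_trans H _.
by rewrite !expnS expn0 muln1 mulnA.
Qed.

End SL2.

Section UnipotentCharacters.
Variables (R : rcfType) (q : nat) (V : finType).
Local Notation F := 'F_q.
Hypotheses (q_prime : prime q) (q_odd : odd q).
Variables (ra : V -> sl2 F -> V) (U D : F -> sl2 F).
Hypothesis raM : forall v g h, ra (ra v g) h = ra v (slm g h).
Hypothesis ra1 : forall v, ra v (sl1 F) = v.
Hypothesis UD : forall s t, U (s + t) = slm (U s) (U t).
Hypothesis U0 : U 0 = sl1 F.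
Hypothesis DU : forall c s, c != 0 -> slm (U s) (D c) = slm (D c) (U (c ^+ 2 * s)).

Let ra_inj g : injective (ra^~ g).
Proof. by move=> v w /(congr1 (ra^~ (slV g))); rewrite /= !raM slmV !ra1. Qed.

Variables (z : R[i]) (zP : q.-primitive_root z).

Let chi (t : F) : R[i] := z ^+ (val t).

Let chiD s t : chi (s + t) = chi s * chi t.
Proof.
have -> : chi (s + t) = z ^+ ((val s + val t) %% q).
  by congr (z ^+ _); rewrite /=; congr (_ %% _)%N; exact: Fp_cast.
by rewrite (expr_mod _ (prim_expr_order zP)) exprD.
Qed.

Let chi0 : chi 0 = 1. Proof. by rewrite /chi expr0. Qed.

Let chi_inj s t : chi s = chi t -> s = t.
Proof.
move=> /eqP; rewrite /chi (eq_prim_root_expr zP) => /eqP e.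
apply: val_inj; move: e; rewrite !modn_small //.
  by apply: leq_trans (ltn_ord t) _; rewrite Fp_cast.
by apply: leq_trans (ltn_ord s) _; rewrite Fp_cast.
Qed.

Let chi_conj s : chi s * (chi s)^* = 1.
Proof.
rewrite -normCK; have : `|chi s| ^+ q = 1.
  by rewrite -normrX /chi exprAC (prim_expr_order zP) expr1n normr1.
move=> /eqP; rewrite pexpr_eq1 ?prime_gt0 // => /eqP->.
by rewrite expr1n.
Qed.

Let chi_sum t : t != 0 -> \sum_k chi (k * t) = 0.
Proof.
move=> t0; set S := \sum_k _.
have : chi t * S = S.
  rewrite /S mulr_sumr [RHS](reindex_inj (addrI 1)) /=.
  by apply: eq_bigr => k _; rewrite -chiD mulrDl mul1r.
move=> /eqP; rewrite -subr_eq0 -{2}[S]mul1r -mulrBl mulf_eq0 subr_eq0 => /orP[/eqP|/eqP//].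
by rewrite -chi0 => /chi_inj e; rewrite e eqxx in t0.
Qed.

Let m := q./2.
Let cc (i : 'I_m) : F := (i.+1)%:R.

Let cc_bound (i : 'I_m) : (i.+1 < q)%N.
Proof. by have := ltn_ord i; rewrite /m; have := prime_gt1 q_prime; lia. Qed.

Let cc0 i : cc i != 0.
Proof. by rewrite /cc -(dvdn_pcharf (pchar_Fp q_prime)) gtnNdvd. Qed.

Let cc_sqr i j : cc i ^+ 2 = cc j ^+ 2 -> i = j.
Proof.
move=> /eqP; rewrite eqf_sqr => /orP[|]; rewrite /cc; last first.
  rewrite -addr_eq0 -natrD -(dvdn_pcharf (pchar_Fp q_prime)) gtnNdvd //.
  have := ltn_ord i; have := ltn_ord j; rewrite /m; have := odd_double_half q.
  by rewrite q_odd; lia.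
wlog ij : i j / (i <= j)%N.
  by move=> H e; case: (leqP i j) => [/H|/ltnW/H H']; [exact|rewrite H' // eq_sym].
rewrite eq_sym -subr_eq0 -natrB ?ltnS // subSS -(dvdn_pcharf (pchar_Fp q_prime)) => d.
apply: val_inj => /=; apply/eqP; rewrite eqn_leq ij -subn_eq0 /=.
by move: d; case: (j - i)%N (cc_bound j) (leq_subr i j) => // k jq kj; rewrite gtnNdvd //; lia.
Qed.

(** An explicit form of the bound (q - 1) / 2 of Frobenius for nontrivial representations of
    SL_2(F_q): a nontrivial character of U occurring in an eigenspace is moved by the torus to (q -
    1) / 2 distinct characters. *)
Lemma unipotent_family (sum_op : (V -> R[i]) -> V -> R[i]) (l : R) h :
  (forall h g v, sum_op (fun v => h (ra v g)) v = sum_op h (ra v g)) ->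
  (forall (I : finType) (a : I -> R[i]) (hs : I -> V -> R[i]) v,
     sum_op (fun v => \sum_i a i * hs i v) v = \sum_i a i * sum_op (hs i) v) ->
  (forall v, sum_op h v = l%:C * h v) ->
  ~ (forall t v, h (ra v (U t)) = h v) ->
  exists hs : 'I_m -> V -> R[i],
    [/\ forall i v, sum_op (hs i) v = l%:C * hs i v,
        forall i, 0 < norm2 (hs i) &
        forall i j, i != j -> dot (hs i) (hs j) = 0].
Proof.
move=> opra opsum hl hU.
(* Components of h along the characters of U; if only k = 0 occurred, h would be invariant under
   U. *)
pose f k v := \sum_t chi (k * t) * h (ra v (U t)).
have fU k s v : chi (k * s) * f k (ra v (U s)) = f k v.
  rewrite /f [RHS](reindex_inj (addrI s)) mulr_sumr /=; apply: eq_bigr => t _.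
  by rewrite raM -UD mulrA -chiD -mulrDr.
have hf v : \sum_k f k v = q%:R * h v.
  rewrite exchange_big (bigD1 0) //= [X in _ + X]big1 ?addr0 => [|t t0].
    under eq_bigr do rewrite mulr0 chi0 mul1r U0 ra1.
    by rewrite sumr_const card_Fp // mulr_natl.
  by rewrite -mulr_suml chi_sum ?mul0r.
have [k k0 [v0 fk]] : exists2 k, k != 0 & exists v, f k v != 0.
  case: (pickP (fun x : F * V => (x.1 != 0) && (f x.1 x.2 != 0))) => [[k v] /= /andP[]|F0].
    by exists k => //; exists v.
  case: hU => t v.
  have hv u : q%:R * h u = f 0 u.
    rewrite -hf (bigD1 0) //= big1 ?addr0 // => k k0.
    by have := F0 (k, u); rewrite /= k0 => /negbFE/eqP.
  have qn : q%:R != 0 :> R[i] by rewrite pnatr_eq0 -lt0n prime_gt0.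
  apply: (mulfI qn); rewrite !hv -[RHS](fU 0 t) mul0r chi0 mul1r //.
have fl v : sum_op (f k) v = l%:C * f k v.
  rewrite opsum mulr_sumr; apply: eq_bigr => t _.
  by rewrite opra hl mulrCA.
(* The torus element multiplies the parameter k by [cc i ^+ 2]; these squares are distinct, so
   different characters occur and the functions are orthogonal. *)
pose hs i v := f k (ra v (D (cc i))).
exists hs; split=> [i v|i|i j ij].
- by rewrite /hs opra fl.
- apply: (norm2_gt0 (v := ra v0 (slV (D (cc i))))).
  by rewrite /hs raM slVm ra1.
have hsU a s v : chi (k * (cc a ^+ 2 * s)) * hs a (ra v (U s)) = hs a v.
  by rewrite /hs raM DU // -raM fU.
set d := dot _ _.
have e : d = chi (k * cc i ^+ 2) * (chi (k * cc j ^+ 2))^* * d.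
  transitivity (\sum_v chi (k * cc i ^+ 2) * (chi (k * cc j ^+ 2))^* *
      (hs i (ra v (U 1)) * (hs j (ra v (U 1)))^*)).
    apply: eq_bigr => v _; rewrite -[in LHS](hsU i 1 v) -[in LHS](hsU j 1 v) !mulr1.
    by rewrite rmorphM /=; ring.
  by rewrite -mulr_sumr /d /dot [in RHS](reindex_inj (@ra_inj (U 1))).
have [//|d0] := eqVneq d 0.
move: e => /eqP; rewrite -{1}[d]mul1r (inj_eq (mulIf d0)) => /eqP e.
case/eqP: ij; apply: cc_sqr; apply: (mulfI k0); apply: chi_inj.
by rewrite -[LHS]mulr1 -(chi_conj (k * cc j ^+ 2)) mulrCA -e mulr1.
Qed.

End UnipotentCharacters.

Section Elementary.
Variable F : finFieldType.

Definition mksl (A : 'M[F]_2) : sl2 F := insubd (sl1 F) A.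

Lemma val_mksl A : \det A = 1 -> val (mksl A) = A.
Proof. by move=> dA; rewrite val_insubd dA eqxx. Qed.

Definition upper t := mksl (mat2 1 t 0 1).
Definition lower t := mksl (mat2 1 0 t 1).
Definition torus (c : F) := mksl (mat2 c^-1 0 0 c).
Definition torusV (c : F) := mksl (mat2 c 0 0 c^-1).

Lemma val_upper t : val (upper t) = mat2 1 t 0 1.
Proof. by rewrite val_mksl // det_mat2 mulr0 subr0 mulr1. Qed.
Lemma val_lower t : val (lower t) = mat2 1 0 t 1.
Proof. by rewrite val_mksl // det_mat2 mul0r subr0 mulr1. Qed.
Lemma val_torus c : c != 0 -> val (torus c) = mat2 c^-1 0 0 c.
Proof. by move=> c0; rewrite val_mksl // det_mat2 mul0r subr0 mulVf. Qed.
Lemma val_torusV c : c != 0 -> val (torusV c) = mat2 c 0 0 c^-1.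
Proof. by move=> c0; rewrite val_mksl // det_mat2 mul0r subr0 mulfV. Qed.

Lemma upperD s t : upper (s + t) = slm (upper s) (upper t).
Proof.
by apply: val_inj; rewrite /= !val_upper mat2M; congr mat2; ring.
Qed.
Lemma lowerD s t : lower (s + t) = slm (lower s) (lower t).
Proof.
by apply: val_inj; rewrite /= !val_lower mat2M; congr mat2; ring.
Qed.
Lemma upper0 : upper 0 = sl1 F.
Proof. by apply: val_inj; rewrite /= val_upper mat2_scalar. Qed.
Lemma lower0 : lower 0 = sl1 F.
Proof. by apply: val_inj; rewrite /= val_lower mat2_scalar. Qed.
Lemma upper_torus c s : c != 0 -> slm (upper s) (torus c) = slm (torus c) (upper (c ^+ 2 * s)).
Proof.
move=> c0; apply: val_inj; rewrite /= !val_upper val_torus // !mat2M.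
by congr mat2; field.
Qed.
Lemma lower_torus c s : c != 0 -> slm (lower s) (torusV c) = slm (torusV c) (lower (c ^+ 2 * s)).
Proof.
move=> c0; apply: val_inj; rewrite /= !val_lower val_torusV // !mat2M.
by congr mat2; field.
Qed.

(** A matrix with nonzero lower left entry is a product upper, lower, upper; otherwise a factor
    [lower 1] makes this entry nonzero. *)
Lemma sl2_gen (P : sl2 F -> Prop) : P (sl1 F) ->
  (forall g t, P g -> P (slm g (upper t))) -> (forall g t, P g -> P (slm g (lower t))) ->
  forall g, P g.
Proof.
move=> P1 PU PL.
have main (g : sl2 F) : val g 1 0 != 0 -> P g.
  move=> c0; have dg := eqP (valP g); move: c0 dg.
  pose a := val g 0 0; pose b := val g 0 1; pose c := val g 1 0; pose d := val g 1 1.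
  rewrite [X in \det X = _ -> _]mat2E det_mat2 -/a -/b -/c -/d => c0 dg.
  have -> : g = slm (slm (slm (sl1 F) (upper ((a - 1) / c))) (lower c)) (upper ((d - 1) / c)).
    apply: val_inj; rewrite /= mul1mx val_lower !val_upper !mat2M [LHS]mat2E -/a -/b -/c -/d.
    have -> : b = (a * d - 1) / c by rewrite -dg opprB addrC subrK mulfK.
    by congr mat2; field.
  by apply: (PU); apply: (PL); apply: (PU).
move=> g; have [c0|/main //] := eqVneq (val g 1 0) 0.
have -> : g = slm (slm g (lower 1)) (lower (- 1)).
  by rewrite -slmA -lowerD subrr lower0 slm1.
apply: PL; apply: main; have dg := eqP (valP g); move: dg.
rewrite [X in \det X = _ -> _]mat2E det_mat2 c0 mulr0 subr0 => dg.
rewrite /= val_lower [val g]mat2E mat2M mxE /= c0 mul0r add0r mulr1.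
by apply: contra_eqN dg => /eqP->; rewrite mulr0 eq_sym oner_eq0.
Qed.
End Elementary.

Section WalkLift.
Variables (F : finFieldType) (r : F) (Z : finType) (act act' : 'I_3 -> Z -> Z).
Hypotheses (r2 : r ^+ 2 = - 2%:R) (n2 : 2%:R != 0 :> F) (n3 : 3%:R != 0 :> F)
  (n5 : 5%:R != 0 :> F).
Hypotheses (actK : forall i, cancel (act i) (act' i)) (act'K : forall i, cancel (act' i) (act i)).

Local Notation X := (xmat r).

(* The units X_0 ^-1 X_i and their inverses. *)
Definition gam (i : 'I_3) : sl2 F := mksl (- 2%:R^-1 *: (X 0 *m X i)).
Definition gamV (i : 'I_3) : sl2 F := mksl (- 2%:R^-1 *: (X i *m X 0)).

Let detX i j : \det (- 2%:R^-1 *: (X i *m X j)) = 1.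
Proof. by rewrite detZ det_mulmx !det_xmat //; field. Qed.

Lemma val_gam i : val (gam i) = - 2%:R^-1 *: (X 0 *m X i).
Proof. by rewrite val_mksl. Qed.
Lemma val_gamV i : val (gamV i) = - 2%:R^-1 *: (X i *m X 0).
Proof. by rewrite val_mksl. Qed.

Lemma gamK i : slm (gamV i) (gam i) = sl1 F.
Proof.
apply: val_inj; rewrite /= val_gam val_gamV -scalemxAl -scalemxAr scalerA.
rewrite mulmxA -[X i *m X 0 *m X 0]mulmxA xmatM // mul_mx_scalar -scalemxAl xmatM //.
by rewrite !scale_scalar_mx; congr _%:M; field.
Qed.

Lemma gam_gamV i : slm (gam i) (gamV i) = sl1 F.
Proof.
apply: val_inj; rewrite /= val_gam val_gamV -scalemxAl -scalemxAr scalerA.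
rewrite mulmxA -[X 0 *m X i *m X i]mulmxA xmatM // mul_mx_scalar -scalemxAl xmatM //.
by rewrite !scale_scalar_mx; congr _%:M; field.
Qed.

Lemma gam0 : gam 0 = sl1 F.
Proof.
by apply: val_inj; rewrite /= val_gam xmatM // scale_scalar_mx; congr _%:M; field.
Qed.

Definition cover : finType := (Z * sl2 F * bool)%type.

(* The map z, k -> (act i) z, (gam i) k as an edge of a bipartite 3-regular graph. *)
Definition cstep (i : 'I_3) (v : cover) : cover :=
  let: (z, k, e) := v in
  if e then (act' i z, slm (gamV i) k, false) else (act i z, slm (gam i) k, true).

Lemma cstepK i : involutive (cstep i).
Proof.
move=> [[z k] []] /=.
  by rewrite act'K slmA gam_gamV sl1m.
by rewrite actK slmA gamK sl1m.
Qed.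

(* On the bipartite cover a walk multiplies [lift] by the corresponding product
   of quaternion matrices, up to scalars. *)
Let lift (v : cover) : 'M[F]_2 :=
  let: (z, k, e) := v in if e then X 0 *m val k else val k.

Let lift_s i v : exists2 c, c != 0 & lift (cstep i v) = c *: (X i *m lift v).
Proof.
move: v => [[z k] []] /=.
  exists (- 2%:R^-1); first by rewrite oppr_eq0 invr_eq0.
  by rewrite val_gamV -scalemxAl mulmxA.
exists 1; rewrite ?oner_eq0 // val_gam -scalemxAl -scalemxAr !mulmxA xmatM //.
by rewrite mul_scalar_mx -scalemxAl scalerA; congr (_ *: _); field.
Qed.

Let lift_run w v : exists2 c, c != 0 &
  lift (run cstep v w) = c *: (foldl (fun A i => X i *m A) 1%:M w *m lift v).
Proof.
elim/last_ind: w => [|w i [c c0 IHw]].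
  by exists 1; rewrite ?oner_eq0 // mul1mx scale1r.
have [d d0 e] := lift_s i (run cstep v w).
exists (d * c); first exact: mulf_neq0.
by rewrite /run foldl_rcons -/(run cstep v w) e IHw foldl_rcons -scalemxAr scalerA mulmxA.
Qed.

Let lift_unit v : lift v \in unitmx.
Proof.
move: v => [[z k] []] /=; last exact: sl_unit.
by rewrite unitmxE det_mulmx det_xmat // (eqP (valP k)) mulr1 unitfE.
Qed.

Lemma run_fixed_scalar u w : run cstep u w = u -> exists k, qmat r (qcoord qone w) = k%:M.
Proof.
move=> fixw; have [c c0] := lift_run w u; rewrite fixw => e; exists c^-1.
rewrite qmat_qcoord // qmat_one //.
rewrite -[LHS](mulmxK (lift_unit u)).
set L := foldl _ _ _ in e *; have -> : L *m lift u = c^-1 *: lift u.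
  by rewrite [in RHS]e scalerA mulVf // scale1r.
by rewrite -scalemxAl mulmxV ?lift_unit // scale_scalar_mx mulr1.
Qed.
End WalkLift.

Section NumericBounds.
Variable R : rcfType.

(** Bernoulli's inequality: (1 - 1/272)^136 >= 1 - 136/272 = 1/2. *)
Lemma half_pow_ge (g : nat) : (2%:R^-1) ^+ g <= (1 - 272%:R^-1) ^+ (136 * g) :> R.
Proof.
rewrite exprM; apply: lerXn2r; rewrite ?nnegrE ?exprn_ge0 //; [lra|lra|].
have bern n : (n%:R <= 272%:R :> R) -> 1 - n%:R / 272%:R <= (1 - 272%:R^-1) ^+ n :> R.
  elim: n => [|n IHn]; first by rewrite mul0r subr0 expr0.
  rewrite -natr1 => hn; rewrite exprSr.
  have h1 : n%:R <= 272%:R :> R by lra.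
  have h2 := IHn h1; have n0 : 0 <= n%:R :> R by [].
  have : (1 - n%:R / 272%:R) * (1 - 272%:R^-1) <= (1 - 272%:R^-1) ^+ n * (1 - 272%:R^-1) :> R.
    by apply: ler_wpM2r => //; lra.
  apply: le_trans; nra.
by apply: le_trans (bern 136 _); [lra|lra].
Qed.

(** The number 2 (1 - 1/272), chosen so that th + 2 / th <= 3 - 1/300; by [half_pow_ge], th^(136 g)
    loses only a factor 2^g against 2^(136 g). *)
Let th : R := 271%:R / 136%:R.
Let l0 : R := 3%:R - 300%:R^-1.

Lemma sphere_val_large (l : R) (g : nat) : l0 < l ->
  (2 ^ (135 * g))%:R <= sphere_val l (68 * g) ^+ 2.
Proof.
move=> ll.
have ti : 2%:R / th = 272%:R / 271%:R by rewrite /th; lra.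
have tb : th + 272%:R / 271%:R <= l by move: ll; rewrite /th /l0; lra.
have t3 : 3%:R <= 272%:R / 271%:R * l by move: ll; rewrite /l0; lra.
have h n : th ^+ n <= sphere_val l n.
  apply: sphere_val_ge; rewrite ?ti //; [rewrite /th; lra|rewrite /th; lra|].
  by rewrite mulrAC ti.
apply: (@le_trans _ _ ((th ^+ (68 * g)) ^+ 2)); last first.
  by apply: lerXn2r (h _); rewrite nnegrE; last apply: le_trans (h _);
    rewrite exprn_ge0 // /th; lra.
rewrite -exprM mulnAC (_ : 68 * 2 = 136)%N //.
have -> : th = 2%:R * (1 - 272%:R^-1) by rewrite /th; lra.
set x := 1 - _.
have -> : (2%:R * x) ^+ (136 * g) = 2%:R ^+ (135 * g) * (2%:R ^+ g * x ^+ (136 * g)).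
  have e : (136 * g = 135 * g + g)%N by rewrite -[X in (_ + X)%N]mul1n -mulnDl.
  by rewrite exprMn {1}e exprD mulrA.
rewrite natrX ler_peMr ?exprn_ge0 //.
have e : 2%:R ^+ g * 2%:R^-1 ^+ g = 1 :> R.
  by rewrite -exprMn mulfV ?expr1n // pnatr_eq0.
rewrite -[X in X <= _]e; apply: ler_wpM2l; last exact: half_pow_ge.
by apply: exprn_ge0; lra.
Qed.

End NumericBounds.

(* Collects the contributions [N t] of the fixed words of length [2 t]: none for
   short [t] by [count_scalar_eq0], and at most [2 ^ (64 g)] up to a constant. *)
Lemma collision_sum_le (g q : nat) (N : nat -> nat) : (2 ^ (32 * g) <= q)%N ->
  (N 0 <= 1)%N ->
  (forall t, (0 < t)%N -> (4 * 2 ^ t < q ^ 2)%N -> N t = 0) ->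
  (forall t, (t <= 68 * g)%N -> (N t <= 90 * 136 * 2 ^ (64 * g))%N) ->
  (\sum_(t < (68 * g).+1) 3 * 2 ^ (68 * g - t) * N t <= 2 ^ (68 * g) * ((68 * (12 * (90 * 136)) + 3) * g.+1))%N.
Proof.
move=> qg N0 Nsmall Nbig; set n := (68 * g)%N.
have each (t : 'I_n) : (3 * 2 ^ (n - t.+1) * N t.+1 <= 2 ^ n * (12 * (90 * 136)))%N.
  case: (ltnP (4 * 2 ^ t.+1) (q ^ 2)) => [/(Nsmall _ (ltn0Sn _))->|qt]; first by rewrite muln0.
  have tn : (t.+1 <= n)%N := ltn_ord t.
  apply: (leq_trans (leq_mul (leqnn _) (Nbig _ tn))).
  (* A length that contributes is so large that fewer prefixes compensate for the fixed words: 2^(64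
     g) <= q^2 <= 4 * 2^(t + 1). *)
  have h : (2 ^ (64 * g) <= 4 * 2 ^ t.+1)%N.
    apply: leq_trans qt; rewrite (_ : 64 * g = 32 * g * 2)%N; last by clear; lia.
    by rewrite expnM leq_exp2r.
  have e : (2 ^ n = 2 ^ (n - t.+1) * 2 ^ t.+1)%N by rewrite -expnD subnK.
  rewrite e; move: h; move: (2 ^ (64 * g))%N (2 ^ t.+1)%N (2 ^ (n - t.+1))%N; clear => a b c h.
  have -> : (c * b * (12 * (90 * 136)) = 3 * c * (90 * 136 * (4 * b)))%N by ring.
  by rewrite !leq_mul.
rewrite big_ord_recl /= subn0.
apply: (@leq_trans (3 * 2 ^ n + \sum_(t < n) 2 ^ n * (12 * (90 * 136)))).
  apply: leq_add; last by apply: leq_sum => t _; apply: each.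
  by rewrite -[X in (_ <= X)%N]muln1 leq_mul.
rewrite sum_nat_const card_ord /n; move: (2 ^ (68 * g))%N => A.
have -> : (3 * A + 68 * g * (A * (12 * (90 * 136))) = A * (3 + 68 * (12 * (90 * 136)) * g))%N by ring.
by apply: leq_mul => //; move: (68 * (12 * (90 * 136)))%N => K; clear; nia.
Qed.

(** In units of g the exponents on the right are 1 + 68 + 64 + 1, where 64 comes from q^2 and the
    last 1 from g + 1 <= 2^g; the left has 135. The hypothesis e + 68 <= g absorbs the constants. *)
Lemma multiplicity_contradiction (g q h K e : nat) : (e + 68 <= g)%N -> (K <= 2 ^ e)%N ->
  (0 < q)%N -> (q < 2 ^ (32 * g + 32))%N -> (q <= 4 * h)%N ->
  ~ (2 ^ (135 * g) * h <= 2 ^ g * q ^ 3 * 2 * (2 ^ (68 * g) * (K * g.+1)))%N.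
Proof.
move=> eg Ke q0 qg qh H.
have g1 : (g.+1 <= 2 ^ g)%N by apply: ltn_expl.
have q2 : (q ^ 2 <= 2 ^ (64 * g + 64))%N.
  rewrite (_ : 64 * g + 64 = (32 * g + 32) * 2)%N; last by clear; lia.
  by rewrite expnM leq_exp2r // ltnW.
have : (2 ^ (135 * g) * q <= 2 ^ (134 * g + 67 + e) * q)%N.
  apply: (@leq_trans (4 * (2 ^ (135 * g) * h))); first by rewrite mulnCA leq_mul.
  apply: (leq_trans (leq_mul (leqnn 4) H)).
  have -> : (4 * (2 ^ g * q ^ 3 * 2 * (2 ^ (68 * g) * (K * g.+1))) =
     2 ^ g * 2 ^ (68 * g) * 2 ^ 3 * (q ^ 2) * (K * g.+1) * q)%N by rewrite !expnS !expn0; ring.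
  rewrite leq_mul2r; apply/orP; right.
  apply: (leq_trans (leq_mul (leq_mul (leqnn _) q2) (leq_mul Ke g1))).
  rewrite -!expnD leq_exp2l //; clear; lia.
rewrite leq_mul2r; move: q0; rewrite lt0n => /negPf-> /=; rewrite leq_exp2l //.
by move: eg; clear; lia.
Qed.

Section Gap.
Variables (R : rcfType) (q g : nat) (r : 'F_q) (Z : finType).
Variables (act act' : 'I_3 -> Z -> Z).
Hypotheses (q_prime : prime q) (q_lo : (2 ^ (32 * g) <= q)%N)
  (q_hi : (q < 2 ^ (32 * g + 32))%N) (g_large : (100 <= g)%N)
  (r2 : r ^+ 2 = - 2%:R) (Z_small : (#|Z| <= 2 ^ g)%N).
Hypotheses (actK : forall i, cancel (act i) (act' i)) (act'K : forall i, cancel (act' i) (act i)).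

Let q_big : (2 ^ 5 <= q)%N.
Proof. by apply: leq_trans q_lo; rewrite leq_exp2l //; move: g_large; clear; lia. Qed.

Let nz k : (0 < k < 32)%N -> k%:R != 0 :> 'F_q.
Proof.
move=> /andP[k0 k32]; rewrite -(dvdn_pcharf (pchar_Fp q_prime)) gtnNdvd //.
exact: leq_trans q_big.
Qed.

Let n2 : 2%:R != 0 :> 'F_q. Proof. exact: nz. Qed.
Let n3 : 3%:R != 0 :> 'F_q. Proof. exact: nz. Qed.
Let n5 : 5%:R != 0 :> 'F_q. Proof. exact: nz. Qed.

Let q_odd : odd q.
Proof. by case: (even_prime q_prime) q_big => [->|//]. Qed.

Local Notation V := (cover 'F_q Z).
Local Notation step := (cstep r act act').

Let stepK : forall i, involutive (step i).
Proof. exact: cstepK. Qed.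

Let fixed_scalar u w : run step u w = u -> qscalar q%:Z (qcoord qone w).
Proof.
move=> /(run_fixed_scalar r2 n2 n3)[k].
case: (qcoord qone w) => -[[a x] y] z /(qmat_scalar r2 n2 n3 n5) [e1 e2 e3].
have zq (c : int) : c%:~R = 0 :> 'F_q -> (q%:Z %| c)%Z.
  move=> c0; rewrite dvdzE /= (dvdn_pcharf (pchar_Fp q_prime)).
  move: c0; case: c => n /=; first by rewrite -pmulrn => ->.
  by rewrite NegzE mulrNz -pmulrn => /eqP; rewrite oppr_eq0.
by rewrite /= !zq.
Qed.

Let ra (v : V) (k : sl2 'F_q) : V := let: (z, a, e) := v in (z, slm a k, e).

Let raM v a b : ra (ra v a) b = ra v (slm a b).
Proof. by case: v => [[z k] e]; rewrite /= slmA. Qed.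

Let ra1 v : ra v (sl1 'F_q) = v.
Proof. by case: v => [[z k] e]; rewrite /= slm1. Qed.

Let step_ra i v k : step i (ra v k) = ra (step i v) k.
Proof. by case: v => [[z a] []]; rewrite /= slmA. Qed.

Let op (h : V -> R[i]) v := \sum_i h (step i v).

(* An eigenfunction with zero sums on the fibres is not invariant under one of the two
   unipotent subgroups, which yields an eigenspace of dimension at least (q - 1) / 2;
   this is incompatible with the count of closed paths of length 136 g. *)
Lemma eigenvalue_le (h : V -> R[i]) (l : R) :
  (forall v, \sum_i h (step i v) = l%:C * h v) ->
  (forall z e, \sum_k h (z, k, e) = 0) -> (exists v, h v != 0) ->
  l <= 3%:R - 300%:R^-1.
Proof.
move=> hl h0 [v0 hv0]; rewrite leNgt; apply/negP => ll.
have [z zP] := exists_prim_root R[i] (prime_gt0 q_prime).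
have opra h' k v : op (fun v => h' (ra v k)) v = op h' (ra v k).
  by apply: eq_bigr => i _; rewrite step_ra.
have opsum (I : finType) (a : I -> R[i]) (hs : I -> V -> R[i]) v :
    op (fun v => \sum_i a i * hs i v) v = \sum_i a i * op (hs i) v.
  rewrite /op exchange_big; apply: eq_bigr => i _ /=.
  by rewrite mulr_sumr.
have [hs [hs1 hs2 hs3]] : exists hs : 'I_(q./2) -> V -> R[i],
    [/\ forall i v, op (hs i) v = l%:C * hs i v,
        forall i, 0 < norm2 (hs i) &
        forall i j, i != j -> dot (hs i) (hs j) = 0].
  have [x neq|hU] := pickP (fun x : 'F_q * V => h (ra x.2 (upper x.1)) != h x.2).
     apply: (unipotent_family q_prime q_odd raM ra1 (@upperD _) (upper0 _)
      (@upper_torus _) zP opra opsum hl) => inv.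
    by move: neq; rewrite inv eqxx.
  have [x neq|hL] := pickP (fun x : 'F_q * V => h (ra x.2 (lower x.1)) != h x.2).
     apply: (unipotent_family q_prime q_odd raM ra1 (@lowerD _) (lower0 _)
      (@lower_torus _) zP opra opsum hl) => inv.
    by move: neq; rewrite inv eqxx.
  (* Upper and lower unipotents generate SL_2, so h would be constant on the fibres, hence 0 as its
     sums there vanish. *)
  exfalso; have inv k v : h (ra v k) = h v.
    elim/sl2_gen: k v => [v|k t IH v|k t IH v]; first by rewrite ra1.
      by rewrite -raM; have := hU (t, ra v k) => /negbFE/eqP/= ->.
    by rewrite -raM; have := hL (t, ra v k) => /negbFE/eqP/= ->.
  move: v0 hv0 => [[z0 k0] e0] /eqP[]; apply/eqP.
  have := h0 z0 e0; under eq_bigr => k _.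
    rewrite (_ : (z0, k, e0) = ra (z0, k0, e0) (slm (slV k0) k)) ?inv; first over.
    by rewrite /= slmA slmV sl1m.
  move=> /eqP; rewrite sumr_const mulrn_eq0 => /orP[|//].
  by rewrite -leqn0 leqNgt => /negP[]; apply/card_gt0P; exists k0.
have := sphere_multiplicity stepK (68 * g) hs1 hs2 hs3.
rewrite card_ord => mult.
pose N t := count (fun w => qscalar q%:Z (qcoord qone w)) (rwords (t + t)).
have coll v := @collisions _ _ stepK (fun w => qscalar q%:Z (qcoord qone w)) (68 * g) v (fun u w _ => @fixed_scalar u w).
have NE t : N t = size [seq w <- rwords (t + t) | qscalar q%:Z (qcoord qone w)].
  by rewrite size_filter.
have Nsum : (\sum_(t < (68 * g).+1) 3 * 2 ^ (68 * g - t) * N t <=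
   2 ^ (68 * g) * ((68 * (12 * (90 * 136)) + 3) * g.+1))%N.
  apply: (collision_sum_le q_lo).
  - by rewrite /N; apply: count_size.
  - by move=> t t0 tq; rewrite NE (count_scalar_eq0 q_prime q_odd t0 tq).
  move=> t tg; rewrite NE.
  (* Here a = 2^(4 g), so that a^8 = 2^(32 g) <= q and a^17 = 2^(68 g). *)
  have -> : (2 ^ (64 * g) = (2 ^ (4 * g)) ^ 16)%N by rewrite -expnM mulnAC.
  apply: (count_scalar_le q_prime q_odd); first by rewrite expn_gt0.
    by rewrite -expnM mulnAC leq_exp2l.
  by rewrite -expnM mulnAC.
have cV : (#|{: V}| <= 2 ^ g * q ^ 3 * 2)%N.
  rewrite !card_prod card_bool; apply: leq_mul => //; apply: leq_mul => //.
  by apply: leq_trans (card_sl2 _) _; rewrite card_Fp.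
have K27 : (68 * (12 * (90 * 136)) + 3 <= 2 ^ 27)%N.
  have K0 X : (0 < X)%N -> (68 * X + 3 <= 2 ^ 7 * X)%N by clear; lia.
  apply: leq_trans (K0 _ _) _; first by rewrite !muln_gt0.
  apply: (@leq_trans (2 ^ 7 * (2 ^ 4 * (2 ^ 7 * 2 ^ 8)))); last by rewrite -!expnD leq_exp2l.
  by rewrite leq_mul2l leq_mul // leq_mul.
move: (68 * (12 * (90 * 136)) + 3)%N Nsum K27 => K Nsum K27.
apply: (@multiplicity_contradiction g q q./2 K 27) => //.
- by apply: leq_trans g_large.
- exact: prime_gt0.
- by rewrite -[X in (X <= _)%N](odd_double_half q) q_odd -muln2; move: (half_gt0 q); have := prime_gt1 q_prime; move: (q./2); clear; lia.
rewrite -(ler_nat R).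
have := le_trans (ler_wpM2r (ler0n R q./2) (sphere_val_large g ll)) mult.
rewrite -natrM => H; apply: le_trans H _; under eq_bigr do under eq_bigr do rewrite -natr_sum.
under eq_bigr do rewrite -natr_sum.
rewrite -natr_sum ler_nat.
apply: (@leq_trans (\sum_(v : V) 2 ^ (68 * g) * (K * g.+1))).
  by apply: leq_sum => v _; apply: leq_trans (coll v) Nsum.
by rewrite sum_nat_const leq_mul2r cV orbT.
Qed.

End Gap.

Section FiberRayleigh.
Variables (R : rcfType) (Z K : finType) (act act' : 'I_3 -> Z -> Z) (m m' : 'I_3 -> K -> K).
Hypotheses (actK : forall i, cancel (act i) (act' i)) (act'K : forall i, cancel (act' i) (act i)).
Hypotheses (mK : forall i, cancel (m i) (m' i)) (m'K : forall i, cancel (m' i) (m i)).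
Hypothesis K_gt0 : (0 < #|K|)%N.

Let V : finType := (Z * K * bool)%type.
Let st i (v : V) : V := let: (z, k, e) := v in
  if e then (act' i z, m' i k, false) else (act i z, m i k, true).
Let pst i (p : Z * bool) := let: (z, e) := p in
  if e then (act' i z, false) else (act i z, true).
Let pr (v : V) := (v.1.1, v.2).

Let stK i : involutive (st i).
Proof. by move=> [[z k] []] /=; rewrite ?act'K ?m'K ?actK ?mK. Qed.
Let pstK i : involutive (pst i).
Proof. by move=> [z []] /=; rewrite ?act'K ?actK. Qed.
(** The eigenvalue bound covers only functions with zero sums on the fibres, while [rayleigh] asks
    for all eigenfunctions. Subtracting the fibre average from the kernel forces zero sums on every
    eigenfunction of nonzero eigenvalue; eigenvalues <= 0 are below l0 anyway. *)
Lemma fiber_rayleigh (l0 : R) : 0 <= l0 ->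
  (forall (l : R) (h : V -> R[i]),
    (forall v, \sum_i h (st i v) = l%:C * h v) ->
    (forall z e, \sum_k h (z, k, e) = 0) -> (exists v, h v != 0) -> l <= l0) ->
  forall f : Z * K -> R, (forall z, \sum_k f (z, k) = 0) ->
  \sum_z \sum_k \sum_i f (act i z, m i k) * f (z, k) <= l0 * \sum_z \sum_k f (z, k) ^+ 2.
Proof.
move=> l00 eig f f0.
pose n : R := #|K|%:R; have n0 : n != 0 by rewrite pnatr_eq0 -lt0n.
pose ker (v u : V) : R := \sum_i ((st i v == u)%:R - n^-1 * (pst i (pr v) == pr u)%:R).
have kerC u v : ker u v = ker v u.
  apply: eq_bigr => i _; congr (_%:R - _ * _%:R).
    by rewrite -(inj_eq (inv_inj (stK i))) stK eq_sym.
  by rewrite -(inj_eq (inv_inj (pstK i))) pstK eq_sym.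
have fib (S : pzRingType) (h : V -> S) (p : Z * bool) :
    \sum_u (p == pr u)%:R * h u = \sum_k h (p.1, k, p.2).
  rewrite (eq_bigr (fun u => if p == pr u then h u else 0)); last first.
    by move=> u _; case: eqP; rewrite ?mul1r ?mul0r.
  rewrite -big_mkcond /= (reindex_onto (fun k => (p.1, k, p.2)) (fun u : V => u.1.2)) /=.
    by apply: eq_bigl => k; rewrite /pr /= -surjective_pairing !eqxx.
  by move=> [[z k] e] /= /eqP ->.
have pnt (S : pzRingType) (h : V -> S) (v : V) : \sum_u (v == u)%:R * h u = h v.
  rewrite (bigD1 v) //= eqxx mul1r big1 ?addr0 // => u /negPf; rewrite eq_sym => ->.
  by rewrite mul0r.
have kerE (h : V -> R[i]) v : \sum_u (ker v u)%:C * h u =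
    \sum_i (h (st i v) - (n^-1)%:C * \sum_k h ((pst i (pr v)).1, k, (pst i (pr v)).2)).
  rewrite /ker; under eq_bigr do rewrite rmorph_sum /= mulr_suml.
  rewrite exchange_big; apply: eq_bigr => i _ /=.
  under eq_bigr do rewrite rmorphB rmorphM /= !rmorph_nat mulrBl -mulrA.
  by rewrite big_split /= sumrN -mulr_sumr fib pnt.
have kerE' (h : V -> R) v : \sum_u ker v u * h u =
    \sum_i (h (st i v) - n^-1 * \sum_k h ((pst i (pr v)).1, k, (pst i (pr v)).2)).
  rewrite /ker; under eq_bigr do rewrite mulr_suml.
  rewrite exchange_big; apply: eq_bigr => i _ /=.
  under eq_bigr do rewrite mulrBl -mulrA.
  by rewrite big_split /= sumrN -mulr_sumr fib pnt.
have ray := rayleigh (k := ker) (l0 := l0) kerC _.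
have {}ray : forall F : V -> R, \sum_v \sum_u ker v u * F u * F v <= l0 * \sum_v F v ^+ 2.
  apply: ray => l h hn0 hl.
  have [ln|lp] := leP l 0; first exact: le_trans ln l00.
  have ln0 : l%:C != 0 by rewrite fmorph_eq0 gt_eqF.
  have H0 z e : \sum_k h (z, k, e) = 0.
    apply: (mulfI ln0); rewrite mulr0 mulr_sumr.
    under eq_bigr do rewrite -hl kerE.
    rewrite exchange_big big1 // => i _; rewrite big_split /= sumrN sumr_const -mulr_natl mulrA.
    have -> : #|K|%:R * (n^-1)%:C = 1 :> R[i].
      by rewrite -(rmorph_nat (real_complex R)) -rmorphM mulfV.
    rewrite mul1r /pr /=; case: e => /=.
      by rewrite [X in _ - X](reindex_inj (can_inj (m'K i))) /= subrr.
    by rewrite [X in _ - X](reindex_inj (can_inj (mK i))) /= subrr.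
  apply: (eig l h) => // v; rewrite -hl kerE; apply: eq_bigr => i _.
  by rewrite H0 mulr0 subr0.
have sV (h : V -> R) : \sum_v h v = \sum_z \sum_k \sum_(e : bool) h (z, k, e).
  by rewrite pair_bigA /= pair_bigA /=; apply: eq_bigr => -[[z k] e].
(* f is put on both sheets of the bipartite cover; the edges leaving either sheet give the same sum,
   whence a factor 2 on both sides. *)
have := ray (fun v => f v.1).
have -> : \sum_(v : V) f v.1 ^+ 2 = 2%:R * \sum_z \sum_k f (z, k) ^+ 2.
  rewrite (sV (fun v => f v.1 ^+ 2)) mulr_sumr; apply: eq_bigr => z _; rewrite mulr_sumr; apply: eq_bigr => k _.
  by rewrite big_bool mulr_natl mulr2n.
have -> : \sum_(v : V) \sum_u ker v u * f u.1 * f v.1 =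
  2%:R * (\sum_z \sum_k \sum_i f (act i z, m i k) * f (z, k)).
  under eq_bigr do rewrite -mulr_suml (kerE' (fun u => f u.1)).
  have sE (v : V) : (\sum_i (f (st i v).1 - n^-1 * \sum_k f ((pst i (pr v)).1, k))) * f v.1 =
     \sum_i f (st i v).1 * f v.1.
    by rewrite mulr_suml; apply: eq_bigr => i _; rewrite f0 mulr0 subr0.
  under eq_bigr do rewrite sE.
  rewrite (sV (fun v => \sum_i f (st i v).1 * f v.1)) mulr_natl mulr2n.
  transitivity (\sum_z \sum_k (\sum_i f (act' i z, m' i k) * f (z, k)) +
     \sum_z \sum_k (\sum_i f (act i z, m i k) * f (z, k))).
    rewrite -big_split; apply: eq_bigr => z _ /=; rewrite -big_split; apply: eq_bigr => k _ /=.
    by rewrite big_bool.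
  congr (_ + _).
  transitivity (\sum_i \sum_z \sum_k f (act' i z, m' i k) * f (z, k)).
    rewrite [RHS]exchange_big /=; apply: eq_bigr => z _; exact: exchange_big.
  transitivity (\sum_i \sum_z \sum_k f (act i z, m i k) * f (z, k)); last first.
    rewrite exchange_big /=; apply: eq_bigr => z _; exact: exchange_big.
  apply: eq_bigr => i _; rewrite (reindex_inj (can_inj (actK i))) /=.
  apply: eq_bigr => z _; rewrite (reindex_inj (can_inj (mK i))) /=.
  by apply: eq_bigr => k _; rewrite actK mK mulrC.
by rewrite mulrCA ler_pM2l ?ltr0n.
Qed.
End FiberRayleigh.

Section Gap.
Variables (R : rcfType) (q g : nat) (r : 'F_q) (Z : finType).
Variables (act act' : 'I_3 -> Z -> Z).
Hypotheses (q_prime : prime q) (q_lo : (2 ^ (32 * g) <= q)%N)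
  (q_hi : (q < 2 ^ (32 * g + 32))%N) (g_large : (100 <= g)%N)
  (r2 : r ^+ 2 = - 2%:R) (Z_small : (#|Z| <= 2 ^ g)%N).
Hypotheses (actK : forall i, cancel (act i) (act' i)) (act'K : forall i, cancel (act' i) (act i)).
Hypotheses (n2 : 2%:R != 0 :> 'F_q) (n3 : 3%:R != 0 :> 'F_q).

Lemma fiber_gap (f : Z * sl2 'F_q -> R) : (forall z, \sum_k f (z, k) = 0) ->
  \sum_z \sum_k \sum_i f (act i z, slm (gam r i) k) * f (z, k)
    <= (3%:R - 300%:R^-1) * \sum_z \sum_k f (z, k) ^+ 2.
Proof.
apply: (@fiber_rayleigh R Z (sl2 'F_q) act act' (fun i => slm (gam r i)) (fun i => slm (gamV r i))) => //.
- by move=> i k; rewrite slmA (gamK r2 n2 n3) sl1m.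
- by move=> i k; rewrite slmA (gam_gamV r2 n2 n3) sl1m.
- by apply/card_gt0P; exists (sl1 _).
- by lra.
move=> l h hl h0 hn; apply: (eigenvalue_le q_prime q_lo q_hi g_large r2 Z_small actK act'K _ h0 hn).
by move=> v; rewrite -hl; apply: eq_bigr => i _; case: v => [[z k] []].
Qed.
End Gap.

(** * Uniform spectral gaps for products *)

Section Energy.
Variables (R : rcfType) (Y : finType) (act : 'I_3 -> Y -> Y).

Definition energy (f : Y -> R) : R := \sum_i \sum_y (f (act i y) - f y) ^+ 2.

Definition spectral_gap (kappa : R) : Prop :=
  forall f : Y -> R, \sum_y f y = 0 -> kappa * \sum_y f y ^+ 2 <= energy f.

End Energy.

Section Extension.
Variables (R : rcfType) (Z K : finType) (act : 'I_3 -> Z -> Z) (m : 'I_3 -> K -> K).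
Hypothesis m_inj : forall i, injective (m i).
Hypothesis act_inj : forall i, injective (act i).

Let st i (v : Z * K) : Z * K := (act i v.1, m i v.2).

Lemma fiber_energy (l : R) (f : Z * K -> R) :
  \sum_z \sum_k \sum_i f (st i (z, k)) * f (z, k) <= (3%:R - l) * \sum_z \sum_k f (z, k) ^+ 2 ->
  2%:R * l * \sum_z \sum_k f (z, k) ^+ 2 <= energy st f.
Proof.
move=> H; rewrite /energy.
have sq (i : 'I_3) : \sum_y f (st i y) ^+ 2 = \sum_z \sum_k f (z, k) ^+ 2.
  rewrite pair_bigA /= [RHS](reindex_inj (h := st i)) /=; last first.
    by move=> [z k] [z' k'] [/act_inj-> /m_inj->].
  by apply: eq_bigr => v _.
have e : \sum_i \sum_y (f (st i y) - f y) ^+ 2 =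
   \sum_(i : 'I_3) (2%:R * (\sum_z \sum_k f (z, k) ^+ 2) - 2%:R * \sum_y f (st i y) * f y).
  apply: eq_bigr => i _; rewrite mulr_natl mulr2n -{1}(sq i) pair_bigA /= mulr_sumr -big_split -sumrB /=.
  by apply: eq_bigr => -[z k] _ /=; ring.
rewrite e sumrB sumr_const card_ord -mulr_sumr.
have -> : \sum_(i : 'I_3) \sum_y f (st i y) * f y = \sum_z \sum_k \sum_i f (st i (z, k)) * f (z, k).
  rewrite exchange_big /=; apply/esym; rewrite (pair_bigA _ (fun z k => \sum_i f (st i (z, k)) * f (z, k))) /=.
  by apply: eq_bigr => -[z k] _.
move: H; rewrite -mulr_natr.
by move: (\sum_z \sum_k f (z, k) ^+ 2) (\sum_z _) => A B; lra.
Qed.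

(** Write f = b + d with b the mean over the fibres and d of zero sum on each fibre. Norm and energy
    split without cross terms, because fibres are mapped bijectively to fibres; so kappa does not
    deteriorate from one factor to the next. *)
Lemma spectral_gap_extension (kappa : R) : (0 < #|K|)%N ->
  spectral_gap act kappa ->
  (forall f : Z * K -> R, (forall z, \sum_k f (z, k) = 0) ->
     kappa * (\sum_z \sum_k f (z, k) ^+ 2) <= energy st f) ->
  spectral_gap st kappa.
Proof.
move=> K0 gapZ gapK f f0; pose n : R := #|K|%:R.
have n0 : 0 < n by rewrite ltr0n.
pose b z := n^-1 * \sum_k f (z, k); pose d v := f v - b v.1.
have sd z : \sum_k d (z, k) = 0.
  rewrite /d /= sumrB sumr_const -[_ *+ #|_|]mulr_natl /b mulrA mulfV ?mul1r ?subrr //.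
  by rewrite gt_eqF.
have b0 : \sum_z b z = 0.
  by rewrite -mulr_sumr pair_bigA /= (eq_bigr f) ?f0 ?mulr0 // => -[].
have fd v : f v = b v.1 + d v by rewrite /d addrC subrK.
have split2 : \sum_v f v ^+ 2 = n * \sum_z b z ^+ 2 + \sum_z \sum_k d (z, k) ^+ 2.
  rewrite (eq_bigr (fun v => f (v.1, v.2) ^+ 2)) => [|[] //].
  rewrite -(pair_bigA _ (fun z k => f (z, k) ^+ 2)) /= mulr_sumr -big_split; apply: eq_bigr => z _ /=.
  rewrite (eq_bigr (fun k => b z ^+ 2 + 2%:R * b z * d (z, k) + d (z, k) ^+ 2)); last first.
    by move=> k _; rewrite fd /=; ring.
  by rewrite !big_split /= -[X in _ + X + _]mulr_sumr sd mulr0 addr0 sumr_const -mulr_natl.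
have splitE : energy st f = n * energy act b + energy st d.
  rewrite /energy mulr_sumr -big_split; apply: eq_bigr => i _ /=.
  rewrite (eq_bigr (fun v => (f (st i (v.1, v.2)) - f (v.1, v.2)) ^+ 2)) => [|[] //].
  rewrite -(pair_bigA _ (fun z k => (f (st i (z, k)) - f (z, k)) ^+ 2)) /=.
  rewrite [X in _ = _ + X](eq_bigr (fun v => (d (st i (v.1, v.2)) - d (v.1, v.2)) ^+ 2)) => [|[] //].
  rewrite -(pair_bigA _ (fun z k => (d (st i (z, k)) - d (z, k)) ^+ 2)) /=.
  rewrite mulr_sumr -big_split; apply: eq_bigr => z _ /=.
  rewrite (eq_bigr (fun k => (b (act i z) - b z) ^+ 2 +
     2%:R * (b (act i z) - b z) * (d (st i (z, k)) - d (z, k)) + (d (st i (z, k)) - d (z, k)) ^+ 2)); last first.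
    by move=> k _; rewrite !fd /=; ring.
  rewrite !big_split /= -[X in _ + X + _]mulr_sumr sumrB sd.
  have -> : \sum_k d (st i (z, k)) = 0.
    by rewrite -[RHS](sd (act i z)) [RHS](reindex_inj (m_inj (i := i))).
  by rewrite subrr mulr0 addr0 sumr_const -mulr_natl.
rewrite split2 splitE mulrDr lerD //; last exact: gapK.
by rewrite mulrCA ler_wpM2l ?gapZ // ltW.
Qed.
End Extension.

(** By finiteness the closed set is invariant, so its indicator minus the mean has energy 0 and
    vanishes. *)
Lemma spectral_gap_connected (R : rcfType) (Y : finType) (act : 'I_3 -> Y -> Y) (kappa : R)
    (B : {pred Y}) : 0 < kappa -> (forall i, injective (act i)) -> spectral_gap act kappa ->
  (forall i y, y \in B -> act i y \in B) -> (exists y, y \in B) -> forall y, y \in B.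
Proof.
move=> k0 inj gap closed [y0 By0].
have inv i y : (act i y \in B) = (y \in B).
  apply/idP/idP => [|/closed //].
  have : [set act i x | x in B] = [set x in B].
    apply/eqP; rewrite eqEcard; apply/andP; split.
      by apply/subsetP => _ /imsetP[x Bx ->]; rewrite inE closed.
    by rewrite card_imset // cardsE.
  move=> /setP/(_ (act i y)); rewrite inE => <- /imsetP[x Bx /inj->] //.
have Y0 : #|Y|%:R != 0 :> R by rewrite pnatr_eq0 -lt0n; apply/card_gt0P; exists y0.
pose mean : R := #|Y|%:R^-1 * \sum_y (y \in B)%:R.
pose f y : R := (y \in B)%:R - mean.
have f0 : \sum_y f y = 0.
  by rewrite sumrB sumr_const -[_ *+ #|_|]mulr_natl mulrA mulfV // mul1r subrr.
have e0 : energy act f = 0.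
  by rewrite /energy big1 // => i _; rewrite big1 // => y _; rewrite /f inv subrr expr0n.
have := gap f f0; rewrite e0 pmulr_rle0 // => s0 y.
have fz x : f x = 0.
  have /eqP : \sum_y f y ^+ 2 = 0.
    by apply/eqP; rewrite eq_le s0 sumr_ge0 // => x' _; exact: sqr_ge0.
  rewrite psumr_eq0 => [/allP/(_ x)|x' _]; last exact: sqr_ge0.
  by rewrite mem_index_enum => /(_ isT); rewrite sqrf_eq0 => /eqP.
have := fz y0; rewrite -(fz y) /f By0 => /addIr/eqP.
by case: (y \in B) => //; rewrite oner_eq0.
Qed.

(* A prime factor of r ^ 2 + 2, with r the product of the odd numbers below 2 B. *)
Lemma exists_pool_prime (B : nat) : exists q, [/\ prime q, (B < q)%N & exists r : 'F_q, r ^+ 2 = - 2%:R].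
Proof.
pose p := (\prod_(i < B) i.*2.+1)%N; pose q := pdiv (p ^ 2 + 2).
have op : odd p.
  by rewrite /p; elim/big_ind: _ => [//|x y|i _]; rewrite ?oddM /= ?odd_double // => -> ->.
have pq : prime q by apply: pdiv_prime; rewrite addn2.
have dq : (q %| p ^ 2 + 2)%N by apply: pdiv_dvd.
have oq : odd q.
  by apply: dvdn_odd dq _; rewrite oddD oddX op.
exists q; split=> //; last first.
  exists p%:R; apply/eqP; rewrite -subr_eq0 opprK -natrX -natrD.
  by rewrite -(dvdn_pcharf (pchar_Fp pq)).
rewrite ltnNge; apply/negP => qB.
have qp : (q %| p)%N.
  have h : (q./2 < B)%N by have := odd_double_half q; have := prime_gt1 pq; rewrite oq; clear -qB; lia.
  by rewrite /p (bigD1 (Ordinal h)) //= -[in X in (X %| _)%N](odd_double_half q) oq add1n dvdn_mulr.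
have : (q %| 2)%N by rewrite -(dvdn_addr 2 (@dvdn_exp 2 _ _ isT qp)).
rewrite dvdn_prime2 // => /eqP e2; by rewrite e2 in oq.
Qed.

(** The product of cubes bounds the order of the product of the earlier groups. With g about log_2
    (q i) / 32 that product has at most 2^g elements and g >= 100, as [fiber_gap] requires. *)
Definition sparse_pool (q : nat -> nat) :=
  (forall i, prime (q i)) /\ (forall i, 2 ^ (32 * (\prod_(k < i) q k ^ 3 + 100)) <= q i)%N.

Lemma exists_sparse_pool : exists (q : nat -> nat) (r : forall i, 'F_(q i)),
  sparse_pool q /\ forall i, r i ^+ 2 = - 2%:R.
Proof.
have ex B : exists q, prime q && (B < q)%N && [exists r : 'F_q, r ^+ 2 == - 2%:R].
  have [q [pq Bq [r r2]]] := exists_pool_prime B; exists q; rewrite pq Bq /=.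
  by apply/existsP; exists r; rewrite r2.
pose next P := xchoose (ex (2 ^ (32 * (P + 100)))%N).
(* The choice of the next prime depends on the earlier ones only through the running product of
   cubes, which therefore carries the recursion. *)
pose P := fix P i := if i is j.+1 then (P j * next (P j) ^ 3)%N else 1%N.
have PE i : (\prod_(k < i) next (P k) ^ 3)%N = P i.
  by elim: i => [|i IH]; rewrite ?big_ord0 // big_ord_recr IH.
have nextP i : prime (next (P i)) && (2 ^ (32 * (P i + 100)) < next (P i))%N &&
   [exists r : 'F_(next (P i)), r ^+ 2 == - 2%:R] by exact: (xchooseP (ex (2 ^ (32 * (P i + 100)))%N)).
have exr i : exists r : 'F_(next (P i)), r ^+ 2 == - 2%:R.
  by have /andP[_ /existsP] := nextP i.
exists (fun i => next (P i)), (fun i => xchoose (exr i)); split; last first.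
  by move=> i; apply/eqP; exact: (xchooseP (exr i)).
by split=> i; have /andP[/andP[p /ltnW l] _] := nextP i; rewrite ?PE.
Qed.

Section Tower.
Variables (R : rcfType) (q : nat -> nat) (r : forall i, 'F_(q i)).
Hypotheses (pool : sparse_pool q) (r2 : forall i, r i ^+ 2 = - 2%:R).

Lemma pool_prime i : prime (q i). Proof. by case: pool. Qed.

Lemma pool_ge i : (2 ^ 32 <= q i)%N.
Proof.
by have [_ /(_ i)] := pool; apply: leq_trans; rewrite leq_exp2l // mulnDr; lia.
Qed.

Lemma pool_nz i k : (0 < k < 32)%N -> k%:R != 0 :> 'F_(q i).
Proof.
move=> /andP[k0 k32]; rewrite -(dvdn_pcharf (pchar_Fp (pool_prime i))) gtnNdvd //.
by apply: leq_trans (pool_ge i); apply: (@leq_trans (2 ^ 5)) => //; rewrite leq_exp2l.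
Qed.

Local Notation sl i := (sl2 'F_(q i)).
Local Notation gm i := (gam (r i)).

(* The diagonal action of the three letters on the product of the groups
   SL_2(F_(q i)), i in I, with coordinates [tower_coord] indexed by all of nat. *)
Record tower (I : seq nat) := Tower {
  tower_space :> finType;
  tower_act : 'I_3 -> tower_space -> tower_space;
  tower_actV : 'I_3 -> tower_space -> tower_space;
  tower_actK : forall l, cancel (tower_act l) (tower_actV l);
  tower_actVK : forall l, cancel (tower_actV l) (tower_act l);
  tower_base : tower_space;
  tower_coord : forall i, tower_space -> sl i;
  tower_coord_base : forall i, i \in I -> tower_coord i tower_base = sl1 _;
  tower_coord_act : forall i l y, i \in I ->
    tower_coord i (tower_act l y) = slm (gm i l) (tower_coord i y);
  tower_coord_inj : forall y y',
    (forall i, i \in I -> tower_coord i y = tower_coord i y') -> y = y';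
  tower_coord_surj : forall (k : forall i, sl i), exists y,
    forall i, i \in I -> tower_coord i y = k i;
  tower_card : (#|tower_space| <= \prod_(i <- I) q i ^ 3)%N;
  tower_gap : spectral_gap (R := R) tower_act 150%:R^-1 }.

(** The indices decrease, so the head is the largest and its prime dominates the product over the
    tail, to which it is added as a new fibre. *)
Lemma tower_exists (I : seq nat) : sorted gtn I -> inhabited (tower I).
Proof.
elim: I => [_|j I IH sI].
  constructor; apply: (@Tower [::] unit (fun _ => id) (fun _ => id) _ _ tt (fun i _ => sl1 _)) => //.
  - by case=> [] [].
  - by rewrite big_nil card_unit.
  move=> f; have uE (g : unit -> R) : \sum_x g x = g tt.
    by rewrite (bigD1 tt) //= big1 ?addr0 // => -[].
  by rewrite uE => f0; rewrite uE f0 expr0n mulr0 /energy sumr_ge0 // => i _; rewrite uE sqr_ge0.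
have [Z] := IH (path_sorted sI : sorted gtn I).
have jI i : i \in I -> (i < j)%N.
  by move: sI => /= /(order_path_min (rev_trans ltn_trans))/allP H /H.
have nj : j \notin I by apply/negP => /jI; rewrite ltnn.
(* The type of a coordinate depends on its index, so the new coordinate is transported along j =
   i. *)
pose cast i (e : j = i) (k : sl j) : sl i := eq_rect j (fun i => sl i) k i e.
pose co i (v : Z * sl j) : sl i :=
  if @eqP _ j i is ReflectT e then cast i e v.2 else tower_coord i v.1.
have coj v : co j v = v.2.
  by rewrite /co; case: eqP => // e; rewrite /cast (eq_irrelevance e erefl).
have coI i v : i \in I -> co i v = tower_coord i v.1.
  by rewrite /co; case: eqP => [e iI|//]; exfalso; apply: (negP nj); rewrite e.
have nz2 : 2%:R != 0 :> 'F_(q j) by apply: pool_nz.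
have nz3 : 3%:R != 0 :> 'F_(q j) by apply: pool_nz.
have gK l : cancel (slm (gm j l)) (slm (gamV (r j) l)).
  by move=> k; rewrite slmA (gamK (r2 j) nz2 nz3) sl1m.
have gVK l : cancel (slm (gamV (r j) l)) (slm (gm j l)).
  by move=> k; rewrite slmA (gam_gamV (r2 j) nz2 nz3) sl1m.
constructor.
apply: (@Tower (j :: I) (Z * sl j)%type (fun l v => (tower_act l v.1, slm (gm j l) v.2))
  (fun l v => (tower_actV l v.1, slm (gamV (r j) l) v.2)) _ _ (tower_base Z, sl1 _) co).
- by move=> l [z k] /=; rewrite tower_actK gK.
- by move=> l [z k] /=; rewrite tower_actVK gVK.
- move=> i; rewrite in_cons => /orP[/eqP->|iI]; first by rewrite coj.
  by rewrite coI // tower_coord_base.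
- move=> i l v; rewrite in_cons => /orP[/eqP->|iI]; first by rewrite !coj.
  by rewrite !coI // tower_coord_act.
- move=> [z k] [z' k'] H; have := H j (mem_head _ _); rewrite !coj /= => ->.
  congr pair; apply: tower_coord_inj => i iI.
  by have := H i; rewrite !coI // in_cons iI orbT => ->.
- move=> k; have [z zk] := @tower_coord_surj I Z k; exists (z, k j) => i.
  by rewrite in_cons => /orP[/eqP->|iI]; rewrite ?coj // coI // zk.
- rewrite card_prod big_cons mulnC; apply: leq_mul; last exact: tower_card.
  by apply: leq_trans (card_sl2 _) _; rewrite card_Fp ?pool_prime.
apply: (@spectral_gap_extension R Z (sl j) (@tower_act I Z) (fun l => slm (gm j l))).
- by move=> l; exact: (can_inj (gK l)).
- by apply/card_gt0P; exists (sl1 _).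
- exact: tower_gap.
move=> f f0.
have -> : 150%:R^-1 = 2%:R * 300%:R^-1 :> R by lra.
apply: (@fiber_energy R Z (sl j) (@tower_act I Z) (fun l => slm (gm j l))).
- by move=> l; exact: (can_inj (gK l)).
- by move=> l; exact: (can_inj (tower_actK l)).
pose g := (trunc_log 2 (q j) %/ 32)%N.
have [_ /(_ j) qj] := pool.
have qj0 : (0 < q j)%N by rewrite prime_gt0 ?pool_prime.
have gP : (\prod_(k < j) q k ^ 3 + 100 <= g)%N.
  by rewrite /g leq_divRL // mulnC trunc_log_max.
apply: (@fiber_gap R (q j) g (r j) Z (@tower_act I Z) (@tower_actV I Z)) => //.
- exact: pool_prime.
- by apply: leq_trans (trunc_logP (ltnSn 1) qj0); rewrite leq_exp2l // mulnC leq_trunc_div.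
- apply: leq_trans (trunc_log_ltn (q j) (ltnSn 1)) _; rewrite leq_exp2l //.
  by have := ltn_ceil (trunc_log 2 (q j)) (isT : 0 < 32)%N; rewrite -/g; clear; lia.
- by apply: leq_trans gP; rewrite leq_addl.
- have IP : (\prod_(i <- I) q i ^ 3 <= \prod_(k < j) q k ^ 3)%N.
    have uI : uniq I.
      by apply: (sorted_uniq (rev_trans ltn_trans) (fun x => ltnn x)); exact: path_sorted sI.
    rewrite -(big_mkord xpredT (fun k => q k ^ 3)%N) [leqRHS](bigID (mem I)) /= -[leqLHS]muln1; apply: leq_mul.
      rewrite -[leqRHS]big_filter [leqRHS](perm_big I) //.
      apply: uniq_perm => //; first by rewrite filter_uniq ?iota_uniq.
      by move=> i; rewrite mem_filter mem_index_iota /=; case: (boolP (i \in I)) => // /jI ->.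
    by rewrite prodn_gt0 // => i; rewrite expn_gt0 prime_gt0 ?pool_prime.
  apply: leq_trans (tower_card Z) _; apply: leq_trans IP _.
  apply: leq_trans (ltnW (ltn_expl g (ltnSn 1))).
  by apply: leq_trans gP; rewrite leq_addr.
exact: tower_actK.
exact: tower_actVK.
Qed.

End Tower.

(** * Relative property (T) *)

Definition absC (R : rcfType) (z : R[i]) : R := complex.Re `|z|.

Section AbsC.
Variable R : rcfType.
Implicit Types z w : R[i].

Lemma absCE z : (absC z)%:C = `|z|.
Proof. by rewrite /absC RRe_real // normr_real. Qed.
Lemma absC_ge0 z : 0 <= absC z.
Proof. by rewrite -lecR absCE; exact: normr_ge0. Qed.
Lemma absC_le z w : absC (z + w) <= absC z + absC w.
Proof. by rewrite -lecR rmorphD /= !absCE ler_normD. Qed.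
Lemma absCM z w : absC (z * w) = absC z * absC w.
Proof. by apply: (@complexI R); rewrite rmorphM /= !absCE normrM. Qed.
Lemma absCN z : absC (- z) = absC z.
Proof. by rewrite /absC normrN. Qed.
Lemma absC_nrm2 z : nrm2 z = absC z ^+ 2.
Proof. by apply: (@complexI R); rewrite nrm2E rmorphXn /= absCE normCK. Qed.
End AbsC.

Section UnitCircle.
Variables (R : rcfType) (z : R[i]).
Hypothesis z1 : absC z = 1.

Let absCX n : absC (z ^+ n) = 1.
Proof.
elim: n => [|n IH]; last by rewrite exprS absCM z1 IH mulr1.
by apply: (@complexI R); rewrite absCE normr1.
Qed.

Lemma chord_le_mul n : absC (z ^+ n - 1) <= n%:R * absC (z - 1).
Proof.
elim: n => [|n IH].
  by rewrite expr0 subrr mul0r /absC normr0.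
have -> : z ^+ n.+1 - 1 = z ^+ n * (z - 1) + (z ^+ n - 1) by rewrite exprSr; ring.
apply: le_trans (absC_le _ _) _; rewrite absCM absCX mul1r mulrSr mulrDl mul1r addrC.
by rewrite lerD2r.
Qed.

(* z^n - 1 = (z - 1) sum_(k < n) z^k, and each z^k is close to 1. *)
Lemma chord_ge_mul n : n%:R * absC (z - 1) <= 1 ->
  n%:R * absC (z - 1) <= 2%:R * absC (z ^+ n - 1).
Proof.
move=> small; set d := absC (z - 1).
have d0 : 0 <= d := absC_ge0 _.
have H m : m%:R * d - (m%:R * d) * (m%:R * d) / 2%:R <= absC (z ^+ m - 1).
  have : absC (z ^+ m - 1 - m%:R * (z - 1)) <= (m%:R * d) * (m%:R * d) / 2%:R.
    elim: m => [|m IH].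
      by rewrite expr0 subrr !mul0r subr0 /absC normr0.
    have -> : z ^+ m.+1 - 1 - m.+1%:R * (z - 1) =
       (z - 1) * (z ^+ m - 1) + (z ^+ m - 1 - m%:R * (z - 1)) by rewrite exprSr -natr1; ring.
    apply: le_trans (absC_le _ _) _; rewrite absCM -/d.
    have := ler_wpM2l d0 (chord_le_mul m); rewrite -/d -natr1.
    move: IH (sqr_ge0 d); move: (absC _) (absC _) (m%:R : R) => A B x h1 h2 h3; nra.
  move=> H1; have := absC_le (z ^+ m - 1) (- (z ^+ m - 1 - m%:R * (z - 1))).
  rewrite absCN (_ : _ + - _ = m%:R * (z - 1)); last by ring.
  rewrite absCM -/d.
  have -> : absC (m%:R : R[i]) = m%:R by apply: (@complexI R); rewrite absCE normr_nat rmorph_nat.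
  move: H1; move: (absC _) (absC _) => A B; lra.
have := H n; move: small; rewrite -/d; have : 0 <= n%:R * d by rewrite mulr_ge0.
move: (n%:R * d) (absC _) => x A; nra.
Qed.
End UnitCircle.

Section RelativeT.
Variables (R : rcfType) (N : nat).
Local Notation I := 'I_N.+1.
Variables (z : R[i]) (zP : (N.+1).-primitive_root z).

Let e (x y : I) : R[i] := z ^+ (x * y).
Let e_mod (n : nat) : z ^+ (n %% N.+1) = z ^+ n.
Proof. exact: (expr_mod _ (prim_expr_order zP)). Qed.

Let eD x y y' : e x (y + y') = e x y * e x y'.
Proof. by rewrite /e -exprD -mulnDr -e_mod /= modnMmr e_mod. Qed.
Let eC x y : e x y = e y x. Proof. by rewrite /e mulnC. Qed.
Let eDl x x' y : e (x + x') y = e x y * e x' y. Proof. by rewrite eC eD !(eC y). Qed.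
Let e0 x : e x 0 = 1. Proof. by rewrite /e muln0. Qed.
Let e0l x : e 0 x = 1. Proof. by rewrite eC e0. Qed.
Let abs1 : absC z = 1.
Proof.
have : absC z ^+ N.+1 = 1.
  have X n : absC (z ^+ n) = absC z ^+ n.
    elim: n => [|n IH]; last by rewrite !exprS absCM IH.
    by apply: (@complexI R); rewrite absCE normr1.
  by rewrite -X (prim_expr_order zP); apply: (@complexI R); rewrite absCE normr1.
by move=> /eqP; rewrite pexpr_eq1 ?absC_ge0 // => /eqP.
Qed.
Let abs_e x y : absC (e x y) = 1.
Proof.
rewrite /e; elim: (_ * _)%N => [|n IH]; last by rewrite exprS absCM abs1 IH mulr1.
by apply: (@complexI R); rewrite absCE normr1.
Qed.
Let eV x y : e x y * (e x y)^* = 1.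
Proof. by rewrite -normCK -absCE abs_e expr1n. Qed.

Let e_inj x : (forall y, e y x = 1) -> x = 0.
Proof.
(* For N = 0 the group is trivial, and [inord 1] is then 0. *)
case: (posnP N) => [N0|N0]; first by move=> _; move: x; rewrite N0 => -[[|//] ?]; exact: val_inj.
move=> /(_ (inord 1)); rewrite /e inordK // mul1n => e1.
have : z ^+ x == z ^+ 0 by rewrite e1.
rewrite (eq_prim_root_expr zP) /eqn mod0n modn_small // => /eqP x0.
exact: val_inj.
Qed.

Let e_sum x : x != 0 -> \sum_y e y x = 0.
Proof.
move=> x0; set s := \sum_y _.
have H y : e y x * s = s.
  rewrite /s mulr_sumr [RHS](reindex_inj (addrI y)) /=.
  by apply: eq_bigr => k _; rewrite eDl.
apply/eqP; apply: contraNT x0 => s0; apply/eqP/e_inj => y.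
by apply: (mulIf s0); rewrite mul1r H.
Qed.

Local Notation V := (I * I)%type.
Let chi (c v : V) : R[i] := e c.1 v.1 * e c.2 v.2.
Let chiD c v w : chi c (v + w) = chi c v * chi c w.
Proof. by rewrite /chi /= !eD; ring. Qed.
Let chiV c v : chi c v * (chi c v)^* = 1.
Proof. by rewrite /chi rmorphM mulrACA !eV mulr1. Qed.
Let abs_chi c v : absC (chi c v) = 1. Proof. by rewrite absCM !abs_e mulr1. Qed.
Let chiN c v : chi c (- v) = (chi c v)^*.
Proof.
have : chi c v * chi c (- v) = chi c v * (chi c v)^*.
  by rewrite chiV -chiD subrr /chi !e0 mulr1.
move=> /mulfI; apply; apply/eqP => c0.
by have := chiV c v; rewrite c0 mul0r => /eqP; rewrite eq_sym oner_eq0.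
Qed.
Let chi_sum v : \sum_c chi c v = if v == 0 then (N.+1 ^ 2)%:R else 0.
Proof.
rewrite -(pair_bigA _ (fun x y => chi (x, y) v)) /=.
have -> : \sum_x \sum_y chi (x, y) v = (\sum_x e x v.1) * (\sum_y e y v.2).
  by rewrite mulr_suml; apply: eq_bigr => x _; rewrite mulr_sumr.
have s0 : \sum_(y : I) e y 0 = N.+1%:R.
  by rewrite (eq_bigr (fun _ => 1)) => [|y _]; rewrite ?e0 // sumr_const card_ord.
case: v => v1 v2 /=; case: eqP => [[-> ->]|ne]; first by rewrite !s0 -natrM mulnn.
have [e1|n1] := eqVneq v1 0; last by rewrite e_sum ?mul0r.
have [e2|n2] := eqVneq v2 0; last by rewrite (e_sum n2) mulr0.
by case: ne; rewrite e1 e2.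
Qed.

Variables (T C : finType) (al : V -> T -> T).
Hypotheses (al0 : forall t, al 0 t = t) (alD : forall v w t, al (v + w) t = al v (al w t)).

Let al_inj v : injective (al v).
Proof. by move=> s t /(congr1 (al (- v))); rewrite -!alD addNr !al0. Qed.

(** (N + 1)^2 times the component of f on which V acts through the inverse of the character c; hence
    the normalization by (N + 1)^4. *)
Let hat (f : T -> R) c t : R[i] := \sum_v chi c v * (f (al v t))%:C.
Let n4 : R := (N.+1 ^ 4)%:R.
Let n4_gt0 : 0 < n4. Proof. by rewrite ltr0n expn_gt0. Qed.

Let parseval f : \sum_c \sum_t nrm2 (hat f c t) = n4 * \sum_t f t ^+ 2.
Proof.
apply: (@complexI R); rewrite rmorph_sum rmorphM rmorph_sum /=.
under eq_bigr do rewrite rmorph_sum /=.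
rewrite exchange_big /=.
have key t : \sum_c (nrm2 (hat f c t))%:C = (N.+1 ^ 2)%:R * \sum_v ((f (al v t)) ^+ 2)%:C.
  transitivity (\sum_c \sum_(v : V) \sum_(w : V) chi c (v - w : V) * ((f (al v t)) * f (al w t))%:C).
    apply: eq_bigr => c _; rewrite nrm2E /hat rmorph_sum /= mulr_suml.
    apply: eq_bigr => v _; rewrite mulr_sumr; apply: eq_bigr => w _.
    rewrite rmorphM /= chiD chiN rmorphM /= conjCR; ring.
  rewrite exchange_big mulr_sumr /=; apply: eq_bigr => v _; rewrite exchange_big /=.
  under eq_bigr do rewrite -mulr_suml chi_sum.
  rewrite (bigD1 v) //= subrr eqxx big1 ?addr0 ?expr2 // => w wv.
  by rewrite subr_eq0 eq_sym (negPf wv) mul0r.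
under eq_bigr do rewrite key.
rewrite -mulr_sumr exchange_big /=.
have -> : \sum_(v : V) \sum_t (f (al v t) ^+ 2)%:C = (N.+1 ^ 2)%:R * \sum_t (f t ^+ 2)%:C.
  transitivity (\sum_(v : V) \sum_t (f t ^+ 2)%:C).
    by apply: eq_bigr => v _; rewrite [RHS](reindex_inj (@al_inj v)).
  by rewrite sumr_const card_prod card_ord mulnn mulr_natl.
by rewrite mulrA -natrM -expnD /n4 rmorph_nat.
Qed.

Let hatB f g c t : hat (fun s => f s - g s) c t = hat f c t - hat g c t.
Proof. by rewrite /hat -sumrB; apply: eq_bigr => v _; rewrite rmorphB mulrBr. Qed.

Let hat_al f w c t : chi c w * hat (fun s => f (al w s)) c t = hat f c t.
Proof.
rewrite /hat mulr_sumr [RHS](reindex_inj (addrI w)) /=; apply: eq_bigr => v _.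
by rewrite mulrA -chiD -alD.
Qed.

Variable Phi : T -> C.
Let ind c (t : T) : R := (Phi t == c)%:R.
(** The spectral measure, on the dual group of V, of the indicator functions of the fibres of [Phi];
    its total mass is the cardinal of T. *)
Let mass x : R := \sum_c \sum_t nrm2 (hat (ind c) x t) / n4.
Let T1 : R := #|T|%:R.
Let moved (g : T -> T) : R := #|[set t | Phi (g t) != Phi t]|%:R.

Let mass_ge0 x : 0 <= mass x.
Proof.
by apply: sumr_ge0 => c _; apply: sumr_ge0 => t _; rewrite divr_ge0 ?nrm2_ge0 // ltW.
Qed.

Let indicator_sum (a b : C) : \sum_c ((a == c)%:R - (b == c)%:R) ^+ 2 = ((a != b)%:R *+ 2 : R).
Proof.
have [->|ab] := eqVneq a b.
  by rewrite mul0rn big1 // => c _; rewrite subrr expr0n.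
have s1 x : \sum_c (x == c)%:R = 1 :> R.
  by rewrite (bigD1 x) //= eqxx big1 ?addr0 // => c /negPf; rewrite eq_sym => ->.
rewrite (eq_bigr (fun c => (a == c)%:R + (b == c)%:R)) => [|c _].
  by rewrite big_split /= !s1 mulr2n.
case: (a =P c) => [ac|_]; case: (b =P c) => [bc|_];
  rewrite ?subr0 ?sub0r ?sqrrN ?expr1n ?expr0n ?addr0 ?add0r //.
by rewrite ac bc eqxx in ab.
Qed.

Let moved_sum (g : T -> T) : \sum_c \sum_t (ind c (g t) - ind c t) ^+ 2 = 2%:R * moved g.
Proof.
rewrite exchange_big /moved /= -sum1_card natr_sum mulr_sumr [RHS]big_mkcond /=.
apply: eq_bigr => t _; rewrite indicator_sum inE; case: (_ != _) => /=; rewrite ?mul0rn //.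
by rewrite mulr1 mulr1n.
Qed.

Let total_mass : \sum_x mass x = T1.
Proof.
rewrite exchange_big /=.
under eq_bigr => c _ do (under eq_bigr do rewrite -mulr_suml; rewrite -mulr_suml parseval mulrC mulKf ?gt_eqF //).
rewrite exchange_big /= /T1 -sum1_card natr_sum; apply: eq_bigr => t _.
rewrite (bigD1 (Phi t)) //= /ind eqxx expr1n big1 ?addr0 // => c /negPf.
by rewrite eq_sym => ->; rewrite expr0n.
Qed.

(** Parseval for the differences of indicator functions; a moved point changes exactly two of
    them. *)
Let mass_moved w : \sum_x absC (chi x w - 1) ^+ 2 * mass x = 2%:R * moved (al w).
Proof.
rewrite -moved_sum; under eq_bigr do rewrite /mass mulr_sumr.
rewrite exchange_big /=; apply: eq_bigr => c _.
have := parseval (fun t => ind c (al w t) - ind c t).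
move=> /(congr1 (fun y => n4^-1 * y)); rewrite mulKf ?gt_eqF // => <-.
rewrite mulr_sumr; apply: eq_bigr => x _; rewrite !mulr_sumr; apply: eq_bigr => t _.
set u := hat (fun s => ind c (al w s)) x t.
have E : chi x w * u = hat (ind c) x t := hat_al (ind c) w x t.
have nu : nrm2 (hat (ind c) x t) = nrm2 u by rewrite -E !absC_nrm2 absCM abs_chi mul1r.
have d : hat (fun t => ind c (al w t) - ind c t) x t = (1 - chi x w) * u.
  by rewrite (hatB (fun t => ind c (al w t))) -E mulrBl mul1r.
by rewrite d nu !absC_nrm2 absCM -[1 - _]opprB absCN; ring.
Qed.

Section Shear.
Variables (g : T -> T) (sh sh' : V -> V).
Hypotheses (g_inj : injective g) (gal : forall v t, g (al v t) = al (sh v) (g t)).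
Hypotheses (shK : cancel sh sh') (sh'K : cancel sh' sh).
Variable dual : V -> V.
Hypothesis dualP : forall x v, chi x (sh' v) = chi (dual x) v.

Let hat_g f x t : hat (fun s => f (g s)) x t = hat f (dual x) (g t).
Proof.
rewrite /hat [RHS](reindex_inj (can_inj shK)) /=; apply: eq_bigr => v _.
by rewrite -dualP shK gal.
Qed.

(** g carries the component at [dual x] to the one at x, so both masses differ by what g changes in
    the indicators. The pointwise estimate with weights 50 and 1/100 replaces the Cauchy-Schwarz
    inequality, at the price of the fixed error #|T| / 50. *)
Lemma mass_shear : \sum_x `|mass (dual x) - mass x| <= 100%:R * moved g + 50%:R^-1 * T1.
Proof.
have md x : mass (dual x) = \sum_c \sum_t nrm2 (hat (fun s => ind c (g s)) x t) / n4.
  apply: eq_bigr => c _; rewrite [LHS](reindex_inj g_inj) /=.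
  by apply: eq_bigr => t _; rewrite hat_g.
pose P := \sum_x \sum_c \sum_t nrm2 (hat (fun s => ind c (g s)) x t - hat (ind c) x t) / n4.
have PE : P = 2%:R * moved g.
  rewrite -moved_sum /P exchange_big /=; apply: eq_bigr => c _.
  have := parseval (fun t => ind c (g t) - ind c t).
  move=> /(congr1 (fun y => n4^-1 * y)); rewrite mulKf ?gt_eqF // => <-.
  rewrite mulr_sumr; apply: eq_bigr => x _; rewrite !mulr_sumr; apply: eq_bigr => t _.
  by rewrite (hatB (fun t => ind c (g t))) mulrC.
have total_dual : \sum_x mass (dual x) = T1.
  under eq_bigr do rewrite md.
  rewrite exchange_big /=.
  under eq_bigr => c _ do (under eq_bigr do rewrite -mulr_suml; rewrite -mulr_suml parseval mulrC mulKf ?gt_eqF //).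
  rewrite exchange_big /= /T1 -sum1_card natr_sum; apply: eq_bigr => t _.
  rewrite [LHS](_ : _ = \sum_c ind c (g t) ^+ 2) //.
  rewrite (bigD1 (Phi (g t))) //= /ind eqxx expr1n big1 ?addr0 // => c /negPf.
  by rewrite eq_sym => ->; rewrite expr0n.
have point (u v : R[i]) : `|nrm2 u - nrm2 v| <= 50%:R * nrm2 (u - v) + 100%:R^-1 * (nrm2 u + nrm2 v).
  rewrite !absC_nrm2; have h1 := absC_le (u - v) v; have h2 := absC_le (v - u) u.
  rewrite subrK in h1; rewrite subrK -opprB absCN in h2.
  have a0 := absC_ge0 u; have b0 := absC_ge0 v; have c0 := absC_ge0 (u - v).
  move: (absC u) (absC v) (absC (u - v)) h1 h2 a0 b0 c0 => A B D h1 h2 a0 b0 c0.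
  have AM : D * (A + B) <= 50%:R * D ^+ 2 + 100%:R^-1 * (A ^+ 2 + B ^+ 2).
    have := sqr_ge0 (10%:R * D - 10%:R^-1 * (A + B)); have := sqr_ge0 (A - B); nra.
  by rewrite ler_norml; apply/andP; split; nra.
have A : \sum_x `|mass (dual x) - mass x| <=
    50%:R * P + 100%:R^-1 * (\sum_x mass (dual x) + \sum_x mass x).
  rewrite /P mulr_sumr -big_split mulr_sumr -big_split; apply: ler_sum => x _ /=.
  rewrite md /mass -sumrB -big_split !mulr_sumr -big_split.
  apply: le_trans (ler_norm_sum _ _ _) _; apply: ler_sum => c _ /=.
  rewrite -sumrB -big_split !mulr_sumr -big_split.
  apply: le_trans (ler_norm_sum _ _ _) _; apply: ler_sum => s _ /=.
  rewrite -mulrBl -mulrDl !mulrA -mulrDl normrM [X in _ * X]ger0_norm; last by rewrite invr_ge0 ltW.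
  by rewrite ler_wpM2r ?point // invr_ge0 ltW.
by move: A; rewrite PE total_dual total_mass => A; apply: le_trans A _; lra.
Qed.
End Shear.

Section PingPong.
Variables (p : nat) (p_large : (5 <= p)%N) (p_coprime : coprime p N.+1).
(** Distance from 1 of the character x at p rather than at the generator: almost invariance is only
    known for multiples of p. As p is prime to N + 1, it still vanishes only for x = 0. *)
Let d (x : I) : R := absC (e x (inord 1 *+ p) - 1).

Let e1p (x : I) (k : nat) : e x (inord 1 *+ k) = e x (inord 1) ^+ k.
Proof. by elim: k => [|k IH]; rewrite ?mulr0n ?e0 ?expr0 // mulrS eD IH exprS. Qed.
Let eMn (x y : I) k : e (x *+ k) y = e x y ^+ k.
Proof. by elim: k => [|k IH]; rewrite ?mulr0n ?e0l ?expr0 // mulrS eDl IH exprS. Qed.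
Let eMnr (x y : I) k : e x (y *+ k) = e x y ^+ k.
Proof. by rewrite eC eMn eC. Qed.

Let z_e x : e x (inord 1) = z ^+ x.
Proof.
case: (posnP N) => [N0|N0]; last by rewrite /e inordK // muln1.
have -> : x = 0 by apply: val_inj; move: (x); rewrite N0 => -[[|//]].
by rewrite e0l expr0.
Qed.

Let d_eq0 x : d x = 0 -> x = 0.
Proof.
move=> d0; have : e x (inord 1 *+ p) = 1.
  apply/eqP; rewrite -subr_eq0 -normr_eq0 -absCE.
  by rewrite -/(d x) d0.
rewrite e1p z_e -exprM => /eqP; rewrite -(expr0 z) (eq_prim_root_expr zP) mod0n -/(dvdn _ _).
rewrite Gauss_dvdl; last by rewrite coprime_sym.
move=> dv; apply: val_inj => /=.
by apply/eqP; move: dv; rewrite /dvdn modn_small.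
Qed.

Let dN x : d (- x) = d x.
Proof.
rewrite /d; set w := e x _.
have ww : e (- x) (inord 1 *+ p) * w = 1 by rewrite /w -eDl addNr e0l.
rewrite -[RHS]mul1r -(abs_e (- x) (inord 1 *+ p)) -absCM mulrBr mulr1 ww -opprB absCN //.
Qed.

Let dD x y : d (x + y) <= d x + d y.
Proof.
rewrite /d eDl; set u := e x _; set v := e y _.
have -> : u * v - 1 = (u - 1) + u * (v - 1) by ring.
by apply: le_trans (absC_le _ _) _; rewrite absCM abs_e mul1r.
Qed.

Let dB x y : d x <= d (x + y) + d y.
Proof. by have := dD (x + y) (- y); rewrite addrK dN. Qed.

Let d_mul x k : k%:R * d x <= 1 -> k%:R * d x <= 2%:R * d (x *+ k).
Proof.
by rewrite /d eMn => H; apply: chord_ge_mul => //; exact: abs_e.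
Qed.

Variables (g h : T -> T).
Hypotheses (g_inj : injective g) (h_inj : injective h).
Hypothesis gal : forall v t, g (al v t) = al (v.1 + v.2 *+ p, v.2) (g t).
Hypothesis hal : forall v t, h (al v t) = al (v.1, v.2 + v.1 *+ p) (h t).
(** The factor p^2 pays for Chebyshev's inequality at the threshold d > 1 / (2 p) in [small_mass]: 4
    p^2 * 2 / (10000 p^2) = 1/1250. *)
Let D : R := 10000%:R * p%:R ^+ 2.
Hypotheses (mg : D * moved g <= T1) (mh : D * moved h <= T1)
  (m1 : D * moved (al (inord 1 *+ p, 0)) <= T1) (m2 : D * moved (al (0, inord 1 *+ p)) <= T1).

Let eN x y : e x (- y) = e (- x) y.
Proof.
apply: (@mulIf _ (e x y)); last by rewrite -eD -eDl !addNr e0 e0l.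
by apply/eqP => c0; have := eV x y; rewrite c0 mul0r => /eqP; rewrite eq_sym oner_eq0.
Qed.

Let dualg (x : V) : V := (x.1, x.2 - x.1 *+ p).
Let dualgV (x : V) : V := (x.1, x.2 + x.1 *+ p).
Let dualh (x : V) : V := (x.1 - x.2 *+ p, x.2).
Let dualhV (x : V) : V := (x.1 + x.2 *+ p, x.2).

Let shear_g : \sum_x `|mass (dualg x) - mass x| <= 100%:R * moved g + 50%:R^-1 * T1.
Proof.
apply: (@mass_shear g dualhV dualh) => //.
  by move=> [v1 v2]; rewrite /dualh /dualhV /= addrK.
move=> [x1 x2] [v1 v2]; rewrite /chi /dualg /dualh /= eD eDl -mulrA; congr (_ * _).
by rewrite mulrC; congr (_ * _); rewrite eN -mulNrn !eMn eMnr.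
Qed.

Let shear_h : \sum_x `|mass (dualh x) - mass x| <= 100%:R * moved h + 50%:R^-1 * T1.
Proof.
apply: (@mass_shear h dualgV dualg) => //.
  by move=> [v1 v2]; rewrite /dualg /dualgV /= addrK.
move=> [x1 x2] [v1 v2]; rewrite /chi /dualg /dualh /= eD eDl -!mulrA; congr (_ * _).
by rewrite mulrC; congr (_ * _); rewrite eN -mulNrn !eMn eMnr.
Qed.

(** The measure [mass] is almost invariant under f, so both preimages of P, which are disjoint and
    contained in Q, have almost the mass of P. *)
Let double_bound (f f' : V -> V) (P Q : {pred V}) (eta : R) :
  cancel f f' -> cancel f' f -> \sum_x `|mass (f x) - mass x| <= eta ->
  (forall y, (f y \in P) + (f' y \in P) <= (y \in Q))%N ->
  2%:R * \sum_(x in P) mass x <= \sum_(x in Q) mass x + 2%:R * eta.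
Proof.
move=> fK f'K He PQ.
have b1 : \sum_(x in P) mass x <= \sum_(y | f' y \in P) mass y + eta.
  rewrite [X in _ <= X + _](reindex_inj (can_inj fK)) /=.
  rewrite [X in _ <= X + _](eq_bigl (fun x => x \in P)); last by move=> x; rewrite fK.
  rewrite -lerBlDl -sumrB; apply: le_trans He.
  apply: (@le_trans _ _ (\sum_(x in P) `|mass (f x) - mass x|)).
    by apply: ler_sum => x _; rewrite distrC ler_norm.
  by rewrite [leRHS](bigID (fun x => x \in P)) /= lerDl sumr_ge0.
have b2 : \sum_(x in P) mass x <= \sum_(y | f y \in P) mass y + eta.
  rewrite [leLHS](reindex_inj (can_inj fK)) /=.
  rewrite -lerBlDl -sumrB; apply: le_trans He.
  apply: (@le_trans _ _ (\sum_(x | f x \in P) `|mass (f x) - mass x|)).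
    by apply: ler_sum => x _; rewrite ler_norm.
  by rewrite [leRHS](bigID (fun x => f x \in P)) /= lerDl sumr_ge0.
have b3 : \sum_(y | f' y \in P) mass y + \sum_(y | f y \in P) mass y <= \sum_(x in Q) mass x.
  rewrite !(big_mkcond (fun y => _ \in P)) (big_mkcond (fun y => y \in Q)) -big_split /=.
  apply: ler_sum => y _; have := PQ y; have := mass_ge0 y.
  by case: (f y \in P); case: (f' y \in P); case: (y \in Q); rewrite ?addr0 ?add0r.
by move: b1 b2 b3; move: (\sum_(y | _) _) (\sum_(y | _) _) (\sum_(x in Q) _) (\sum_(x in P) _)
  => A B C' E; lra.
Qed.

Let small (x : I) : bool := 2%:R * p%:R * d x <= 1.
Let B : {pred V} := [pred x : V | small x.1 && small x.2].
Let R1 : {pred V} := [pred x : V | [&& x \in B, x != 0 & d x.2 <= d x.1]].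
Let R2 : {pred V} := [pred x : V | [&& x \in B, x != 0 & d x.1 < d x.2]].

Let p5 : (5%:R : R) <= p%:R. Proof. by rewrite ler_nat. Qed.
Let d_ge0 x : 0 <= d x. Proof. exact: absC_ge0. Qed.

(** Near 0 one has d (a *+ p) >= (p / 2) d a with p >= 5, while d b <= d a; so a shear makes the
    smaller coordinate the larger one. *)
Let expand (a b : I) : small a -> d b <= d a -> 0 < d a ->
  d a < d (b + a *+ p) /\ d a < d (b - a *+ p).
Proof.
rewrite /small => sa ba a0.
have H : p%:R * d a <= 2%:R * d (a *+ p).
  by apply: d_mul; move: sa; have := p5; move: (d a) a0 (p%:R : R) => D' a0 P; nra.
have h1 := dB (a *+ p) b; rewrite (addrC (a *+ p)) in h1.
have h2 := dB (- (a *+ p)) b; rewrite (addrC (- _)) dN in h2.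
have K : 5%:R * d a <= p%:R * d a by rewrite ler_wpM2r.
by split; lra.
Qed.

Let not_both (a b : I) : small a -> d (b - a *+ p) <= d a -> d (b + a *+ p) <= d a -> 0 < d a -> False.
Proof.
rewrite /small => sa h1 h2 a0.
have H : (2 * p)%:R * d a <= 2%:R * d (a *+ (2 * p)) by apply: d_mul; rewrite natrM.
have E : a *+ (2 * p) = (b + a *+ p) - (b - a *+ p).
  by rewrite mul2n -addnn mulrnDr opprB [b + _]addrC -addrA [b + (_ - b)]addrC subrK.
have h3 := dD (b + a *+ p) (- (b - a *+ p)); rewrite dN -E in h3.
have K : 5%:R * d a <= p%:R * d a by rewrite ler_wpM2r.
move: H; rewrite natrM -mulrA => H; lra.
Qed.

Let pos_max (x1 x2 : I) : (x1, x2) != 0 :> V -> d x2 <= d x1 -> 0 < d x1.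
Proof.
move=> n0 le; rewrite lt_neqAle d_ge0 andbT eq_sym; apply: contraNneq n0 => d1.
have d2 : d x2 = 0 by apply/eqP; rewrite eq_le d_ge0 -{1}d1 le.
by rewrite (d_eq0 d1) (d_eq0 d2).
Qed.

Let eta : R := 400%:R^-1 * T1 + 50%:R^-1 * T1.
Let beta : R := 1250%:R^-1 * T1.

Let T1_ge0 : 0 <= T1. Proof. exact: ler0n. Qed.
Let moved_small f : D * moved f <= T1 -> 100%:R * moved f <= 400%:R^-1 * T1.
Proof.
rewrite /D => H; have m0 : 0 <= moved f := ler0n _ _.
have : 250000%:R * moved f <= 10000%:R * p%:R ^+ 2 * moved f.
  rewrite (_ : 250000%:R = 10000%:R * 5%:R ^+ 2); last by lra.
  apply: (ler_wpM2r m0); apply: ler_wpM2l; first exact: ler0n.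
  by rewrite lerXn2r // nnegrE.
by move: (moved f) m0 H => m m0 H; lra.
Qed.

Let small_mass (k : V -> I) w : (forall x, absC (chi x w - 1) = d (k x)) ->
  D * moved (al w) <= T1 -> \sum_(x | ~~ small (k x)) mass x <= beta.
Proof.
move=> kw mw.
have : \sum_(x | ~~ small (k x)) mass x <= 4%:R * p%:R ^+ 2 * (2%:R * moved (al w)).
  rewrite -mass_moved mulr_sumr big_mkcond; apply: ler_sum => x _; rewrite kw.
  have m0 := mass_ge0 x; have d0 := d_ge0 (k x); have pp := p5.
  case: ifPn => [|_]; last by rewrite !mulr_ge0 // ?sqr_ge0.
  rewrite /small -ltNge => H; rewrite mulrA -[leLHS]mul1r ler_wpM2r //.
  have -> : 4%:R * p%:R ^+ 2 * d (k x) ^+ 2 = (2%:R * p%:R * d (k x)) ^+ 2 by ring.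
  by rewrite exprn_ege1 // ltW.
have -> : 4%:R * p%:R ^+ 2 * (2%:R * moved (al w)) = 8%:R * (p%:R ^+ 2 * moved (al w)) by ring.
by move: mw; rewrite /D /beta -mulrA; move: (p%:R ^+ 2 * moved _) => *; lra.
Qed.

(* Ping-pong on characters: the mass outside the trivial character is small, since near
   0 multiplication by p expands the distance [d]. *)
Lemma relative_T : 2%:R * moved (al (inord 1, 0)) <= T1.
Proof.
have s1 : \sum_(x : V | ~~ small x.1) mass x <= beta.
  by apply: small_mass m1 => x; rewrite /chi /= e0 mulr1.
have s2 : \sum_(x : V | ~~ small x.2) mass x <= beta.
  by apply: small_mass m2 => x; rewrite /chi /= e0 mul1r.
have sB : \sum_(x | x \notin B) mass x <= 2%:R * beta.
  apply: (@le_trans _ _ (\sum_(x : V | ~~ small x.1) mass x + \sum_(x : V | ~~ small x.2) mass x)); last by lra.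
  rewrite !(big_mkcond (fun x : V => ~~ _)) -big_split /=; apply: ler_sum => x _.
  rewrite inE /= negb_and; have := mass_ge0 x.
  by case: (small x.1); case: (small x.2) => /= m0; rewrite ?addr0 ?add0r // lerDl.
have e1 : 2%:R * \sum_(x in R1) mass x <= \sum_(x in [pred x : V | d x.1 < d x.2]) mass x + 2%:R * eta.
  apply: (@double_bound dualg dualgV).
  - by move=> [x1 x2]; rewrite /dualg /dualgV /= subrK.
  - by move=> [x1 x2]; rewrite /dualg /dualgV /= addrK.
  - by apply: le_trans shear_g _; rewrite lerD2r moved_small.
  move=> [y1 y2]; rewrite !inE /dualg /dualgV /=.
  case: (boolP [&& _, _ & _]) => [/and3P[/andP[sa _] n0 le1]|_];
    case: (boolP [&& _, _ & _]) => [/and3P[/andP[sa' _] n0' le1']|_] //=.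
  - by case: (not_both sa le1 le1' (pos_max n0 le1)).
  - by have [h1 _] := expand sa le1 (pos_max n0 le1); rewrite subrK in h1; rewrite h1.
  - by have [_ h1] := expand sa' le1' (pos_max n0' le1'); rewrite addrK in h1; rewrite h1.
have e2 : 2%:R * \sum_(x in R2) mass x <= \sum_(x in [pred x : V | d x.2 < d x.1]) mass x + 2%:R * eta.
  have swap (x1 x2 : I) : (x1, x2) != 0 :> V -> (x2, x1) != 0 :> V.
    by apply: contraNneq => -[-> ->].
  apply: (@double_bound dualh dualhV).
  - by move=> [x1 x2]; rewrite /dualh /dualhV /= subrK.
  - by move=> [x1 x2]; rewrite /dualh /dualhV /= addrK.
  - by apply: le_trans shear_h _; rewrite lerD2r moved_small.
  move=> [y1 y2]; rewrite !inE /dualh /dualhV /=.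
  case: (boolP [&& _, _ & _]) => [/and3P[/andP[_ sa] /swap n0 /ltW le1]|_];
    case: (boolP [&& _, _ & _]) => [/and3P[/andP[_ sa'] /swap n0' /ltW le1']|_] //=.
  - by case: (not_both sa le1 le1' (pos_max n0 le1)).
  - by have [h1 _] := expand sa le1 (pos_max n0 le1); rewrite subrK in h1; rewrite h1.
  - by have [_ h1] := expand sa' le1' (pos_max n0' le1'); rewrite addrK in h1; rewrite h1.
have f1 : \sum_(x in [pred x : V | d x.1 < d x.2]) mass x <=
    \sum_(x in R2) mass x + \sum_(x | x \notin B) mass x.
  rewrite !(big_mkcond (fun x : V => _ \in _)) (big_mkcond (fun x => x \notin B)) -big_split /=.
  apply: ler_sum => x _; have m0 := mass_ge0 x.
  have -> : (x \in R2) = [&& x \in B, x != 0 & d x.1 < d x.2] by [].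
  have -> : (x \in [pred x : V | d x.1 < d x.2]) = (d x.1 < d x.2) by [].
  case: ifPn => [dx|_]; last by repeat (case: ifP => _); rewrite ?addr0 ?add0r ?addr_ge0.
  have -> : (x != 0) by apply: contraTneq dx => ->; rewrite ltxx.
  by rewrite ?dx; case: (x \in B); rewrite /= ?addr0 ?add0r.
have f2 : \sum_(x in [pred x : V | d x.2 < d x.1]) mass x <=
    \sum_(x in R1) mass x + \sum_(x | x \notin B) mass x.
  rewrite !(big_mkcond (fun x : V => _ \in _)) (big_mkcond (fun x => x \notin B)) -big_split /=.
  apply: ler_sum => x _; have m0 := mass_ge0 x.
  have -> : (x \in R1) = [&& x \in B, x != 0 & d x.2 <= d x.1] by [].
  have -> : (x \in [pred x : V | d x.2 < d x.1]) = (d x.2 < d x.1) by [].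
  case: ifPn => [dx|_]; last by repeat (case: ifP => _); rewrite ?addr0 ?add0r ?addr_ge0.
  have -> : (x != 0) by apply: contraTneq dx => ->; rewrite ltxx.
  by rewrite ?(ltW dx); case: (x \in B); rewrite /= ?addr0 ?add0r.
have f3 : \sum_(x : V | x != 0) mass x <=
    \sum_(x in R1) mass x + \sum_(x in R2) mass x + \sum_(x | x \notin B) mass x.
  rewrite !(big_mkcond (fun x : V => _ \in _)) !(big_mkcond (fun x : V => ~~ _)) -!big_split /=.
  apply: ler_sum => x _; have m0 := mass_ge0 x.
  have -> : (x \in R1) = [&& x \in B, x != 0 & d x.2 <= d x.1] by [].
  have -> : (x \in R2) = [&& x \in B, x != 0 & d x.1 < d x.2] by [].
  case: ifPn => [nx|_]; last by repeat (case: ifP => _); rewrite ?addr0 ?add0r ?addr_ge0.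
  by case: (x \in B); rewrite /= ?add0r ?addr0 //; case: leP => _; rewrite ?addr0 ?add0r.
have f4 : 2%:R * moved (al (inord 1, 0)) <= 4%:R * \sum_(x : V | x != 0) mass x.
  rewrite -mass_moved mulr_sumr [leRHS]big_mkcond; apply: ler_sum => x _.
  have m0 := mass_ge0 x; case: ifPn => [_|/negPn/eqP->].
    rewrite ler_wpM2r //; have := absC_le (chi x (inord 1, 0)) (- 1); rewrite absCN abs_chi.
    have -> : absC (1 : R[i]) = 1 by rewrite /absC normr1.
    by have := absC_ge0 (chi x (inord 1, 0) - 1); move: (absC _) => A; nra.
  by rewrite /chi /= !e0l mulr1 subrr /absC normr0 expr0n mul0r.
(* Adding e1 and e2 bounds the mass off the trivial character by 4 eta + 6 beta, which is less than
   #|T| / 10; in f4 it is multiplied by 4. *)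
rewrite /eta in e1 e2; rewrite /beta in sB.
have T0 := T1_ge0.
lra.
Qed.
End PingPong.
End RelativeT.

(** * Almost equivariant maps *)

From mathcomp Require Import boolp.

Section Separation.
Variables (G : groupType) (J : nat -> G -> Prop).

Definition gaction (T : Type) (act : G -> T -> T) : Prop :=
  (forall t, act 1%g t = t) /\ (forall g h t, act (g * h)%g t = act g (act h t)).

Definition stabilizers (T : Type) (act : G -> T -> T) (I : seq nat) : Prop :=
  forall t g, act g t = t <-> forall i, i \in I -> J i g.

(** E and d depend on I' and j only, while I, T, T' and phi are arbitrary: in the application I
    grows with the level n of the approximation. *)
Definition separated_family : Prop :=
  forall (I' : seq nat) j, j \in I' -> exists (E : seq G) (d : nat),
    forall (I : seq nat) (T T' : finType) (act : G -> T -> T) (act' : G -> T' -> T'),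
      gaction act -> gaction act' -> stabilizers act I -> stabilizers act' I' ->
      j \notin I -> (0 < #|T|)%N -> forall phi : T -> T',
      ~ (forall g, g \in E -> (d * #|[set t | phi (act g t) != act' g (phi t)]| <= #|T|)%N).

Lemma gaction_inj T (act : G -> T -> T) g : gaction act -> injective (act g).
Proof.
by case=> a1 aM x y /(congr1 (act g^-1%g)); rewrite -!aM mulVg !a1.
Qed.

Lemma gaction_eq T (act : G -> T -> T) g h t : gaction act ->
  act g t = act h t <-> act (g^-1 * h)%g t = t.
Proof.
move=> [a1 aM]; rewrite aM; split=> [<-|]; first by rewrite -aM mulVg a1.
by move=> /(congr1 (act g)); rewrite -aM mulgV a1.
Qed.

End Separation.

(** * Separation from the spectral gap of towers *)

Section TwoGenerators.
Variables (R : rcfType) (q : nat -> nat) (r : forall i, 'F_(q i)).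
Hypotheses (pool : sparse_pool q) (r2 : forall i, r i ^+ 2 = - 2%:R).
Variables (G : groupType) (J : nat -> G -> Prop) (a : 'I_3 -> G).

Definition gword (w : seq 'I_3) : G := foldr (fun l g => a l * g)%g 1%g w.
Definition slword i (w : seq 'I_3) : sl2 'F_(q i) :=
  foldr (fun l k => slm (gam (r i) l) k) (sl1 _) w.

Hypothesis Jword : forall i u v,
  J i ((gword u)^-1 * gword v)%g <-> slword i u = slword i v.

Lemma gword_cat u v : gword (u ++ v) = (gword u * gword v)%g.
Proof. by elim: u => [|l u IH] /=; rewrite ?mul1g // IH mulgA. Qed.

Lemma slword_cat i u v : slword i (u ++ v) = slm (slword i u) (slword i v).
Proof. by elim: u => [|l u IH] /=; rewrite ?sl1m // IH slmA. Qed.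

Section Fixed.
Variables (I I' : seq nat) (j : nat) (T T' : finType) (act : G -> T -> T) (act' : G -> T' -> T').
Hypotheses (jI' : j \in I') (aT : gaction act) (aT' : gaction act')
  (sT : stabilizers J act I) (sT' : stabilizers J act' I') (jI : j \notin I) (T0 : (0 < #|T|)%N).
Variables (K : seq nat) (Y : tower R r K).
Hypothesis KE : forall i, (i \in K) = (i \in I) || (i \in I').

Let yword (w : seq 'I_3) : Y := foldr (fun l y => tower_act l y) (tower_base Y) w.

Let coord_yword i w : i \in K -> tower_coord i (yword w) = slword i w.
Proof.
move=> iK; elim: w => [|l w IH] /=; first exact: tower_coord_base.
by rewrite tower_coord_act // IH.
Qed.

(** By the spectral gap the orbit of the base point is everything; positive words suffice since the
    tower is finite. *)
Let yword_surj y : exists w, yword w == y.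
Proof.
pose B := [pred y : Y | `[< exists w, yword w == y >]].
have : y \in B.
  apply: (spectral_gap_connected (kappa := 150%:R^-1) _ _ (@tower_gap _ _ _ _ Y)).
  - by rewrite invr_gt0.
  - by move=> l; exact: (can_inj (tower_actK l)).
  - move=> l x /asboolP[w /eqP <-]; apply/asboolP; exists (l :: w) => //.
  - by exists (tower_base Y); apply/asboolP; exists [::].
by move=> /asboolP.
Qed.

Let wd y := xchoose (yword_surj y).
Let ywd y : yword (wd y) = y. Proof. exact/eqP/(xchooseP (yword_surj y)). Qed.

Let coord_wd i y : i \in K -> slword i (wd y) = tower_coord i y.
Proof. by move=> iK; rewrite -coord_yword // ywd. Qed.

(** Both actions factor through the tower, because K contains I and I' and the subgroups J_i are
    detected by the coordinates. *)
Let same_word w y : (forall i, i \in K -> slword i w = tower_coord i y) ->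
  (forall t, act (gword w) t = act (gword (wd y)) t) /\
  (forall t, act' (gword w) t = act' (gword (wd y)) t).
Proof.
move=> H; have Ji i : i \in K -> J i ((gword w)^-1 * gword (wd y))%g.
  by move=> iK; apply/Jword; rewrite H // coord_wd.
split=> t; apply/gaction_eq => //.
  by apply/sT => i iI; apply: Ji; rewrite KE iI.
by apply/sT' => i iI; apply: Ji; rewrite KE iI orbT.
Qed.

Let act_wd l y :
  (forall t, act (gword (wd (tower_act l y))) t = act (a l) (act (gword (wd y)) t)) /\
  (forall t, act' (gword (wd (tower_act l y))) t = act' (a l) (act' (gword (wd y)) t)).
Proof.
have [|e e'] := @same_word (l :: wd y) (tower_act l y).
  by move=> i iK /=; rewrite tower_coord_act // coord_wd.
by split=> t; rewrite -(e, e') /= (aT.2, aT'.2).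
Qed.

Variable phi : T -> T'.
Let err l t : bool := phi (act (a l) t) != act' (a l) (phi t).
(** If phi were equivariant on the orbit of t, then [F t (phi t)] would be 1 everywhere; in general
    a low energy says that phi is almost equivariant there. *)
Let F t tau y : R := (phi (act (gword (wd y)) t) == act' (gword (wd y)) tau)%:R.

Let F01 t tau y : F t tau y ^+ 2 = F t tau y.
Proof. by rewrite /F; case: eqP; rewrite ?expr1n ?expr0n. Qed.

Let sum_F t : \sum_tau \sum_y F t tau y = #|Y|%:R.
Proof.
rewrite exchange_big -sum1_card natr_sum; apply: eq_bigr => y _.
set g := gword (wd y).
have inj := gaction_inj (g := g) aT'; have /bij_inj := injF_bij inj.
rewrite (bigD1 (act' g^-1%g (phi (act g t)))) //= /F -/g -aT'.2 mulgV aT'.1 eqxx.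
rewrite big1 ?addr0 // => tau; apply: contraNeq; rewrite pnatr_eq0 eqb0 negbK => /eqP ->.
by rewrite -aT'.2 mulVg aT'.1.
Qed.

(** An edge contributes only where phi fails to be equivariant, and then for at most two values of
    tau. *)
Let sum_energy t : \sum_tau energy (@tower_act _ _ _ _ Y) (F t tau) <=
  2%:R * (\sum_l \sum_y err l (act (gword (wd y)) t))%:R.
Proof.
rewrite /energy exchange_big natr_sum mulr_sumr; apply: ler_sum => l _ /=.
rewrite exchange_big natr_sum mulr_sumr; apply: ler_sum => y _ /=.
have [e e'] := act_wd l y; rewrite /F.
under eq_bigr do rewrite e e'.
set g := gword (wd y); set x := act g t.
rewrite (reindex_inj (gaction_inj (g := g^-1%g) aT')) /=.
have gg s : act' g (act' g^-1%g s) = s by rewrite -aT'.2 mulgV aT'.1.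
under eq_bigr do rewrite !gg -/x.
have point (b : T') (h : T' -> T') : injective h -> \sum_s (b == h s)%:R <= 1 :> R.
  move=> hi; case: (pickP (fun s => b == h s)) => [s0 /eqP bs|none].
    rewrite (bigD1 s0) //= bs eqxx big1 ?addr0 // => s /negPf ns.
    by rewrite (inj_eq hi) eq_sym ns.
  by rewrite big1 // => s _; rewrite none.
rewrite /err; case: eqP => [ex|_] /=.
  rewrite mulr0 big1 // => s _; rewrite ex (inj_eq (gaction_inj aT')) subrr expr0n //.
rewrite mulr1; apply: (@le_trans _ _ (\sum_s ((phi (act (a l) x) == act' (a l) s)%:R + (phi x == s)%:R))).
  apply: ler_sum => s _; do 2 case: (_ == _); rewrite /= ?subrr ?subr0 ?sub0r ?sqrrN ?expr1n ?expr0n /= ?addr0 ?add0r //.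
  by rewrite addr_ge0.
rewrite big_split /= (_ : 2%:R = 1 + 1) // lerD //; last exact: (point _ id).
exact/point/gaction_inj.
Qed.

(* The values at y and at a translate fixing t but moving tau cannot both be 1. *)
Let half_F t tau : 2%:R * \sum_y F t tau y <= #|Y|%:R.
Proof.
have [y1 y1P] := tower_coord_surj Y (fun i => if i == j then upper 1 else sl1 'F_(q i)).
pose w1 := wd y1.
have w1j : slword j w1 = upper 1 by rewrite coord_wd ?y1P ?eqxx // KE jI' orbT.
have w1i i : i \in K -> i != j -> slword i w1 = sl1 _.
  by move=> iK /negPf ij; rewrite coord_wd ?y1P ?ij.
have w1T s : act (gword w1) s = s.
  apply/sT => i iI; have := (Jword i [::] w1).2; rewrite /= invg1 mul1g; apply.
  rewrite w1i // ?KE ?iI //; by apply: contraNneq jI => <-.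
have w1T' s : act' (gword w1) s <> s.
  move=> /sT'/(_ j jI') Jj; have := (Jword j [::] w1).1; rewrite /= invg1 mul1g => /(_ Jj).
  rewrite w1j => /(congr1 (fun k : sl2 'F_(q j) => val k 0 1)); rewrite /= val_upper !mxE /= => /eqP.
  by rewrite eq_sym oner_eq0.
pose rho y := yword (wd y ++ w1).
have crho i y : i \in K -> tower_coord i (rho y) = slm (tower_coord i y) (slword i w1).
  by move=> iK; rewrite coord_yword // slword_cat coord_wd.
have rho_inj : injective rho.
  move=> y y' e; apply: tower_coord_inj => i iK; apply: (@slm_injr _ (slword i w1)).
  by rewrite -!crho // e.
have disj y : F t tau y + F t tau (rho y) <= 1.
  have [e e'] := @same_word (wd y ++ w1) (rho y) (fun i iK => esym (coord_yword _ iK)).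
  rewrite /F -e -e' gword_cat aT.2 w1T aT'.2.
  case: eqP => [->|_]; last by rewrite add0r lern1 leq_b1.
  case: eqP => [/(gaction_inj aT') e1|_]; last by rewrite addr0.
  by case: (w1T' tau).
rewrite mulr_natl mulr2n {2}(reindex_inj rho_inj) -big_split /=.
apply: le_trans (ler_sum _ (fun y _ => disj y)) _.
by rewrite sumr_const.
Qed.

Let Y0 : (0 < #|Y|)%N. Proof. by apply/card_gt0P; exists (tower_base Y). Qed.

(** The variance of an indicator of mean at most 1/2 is at least half of its sum, and the gap is
    1/150. *)
Let energy_F t tau : 300%:R^-1 * \sum_y F t tau y <= energy (@tower_act _ _ _ _ Y) (F t tau).
Proof.
set m := \sum_y F t tau y; pose n : R := #|Y|%:R.
have n0 : 0 < n by rewrite ltr0n.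
have m0 : 0 <= m by apply: sumr_ge0 => y _; rewrite -F01 sqr_ge0.
pose f y := F t tau y - m / n.
have f0 : \sum_y f y = 0.
  by rewrite /f sumrB sumr_const -[_ *+ #|_|]mulr_natl mulrC mulfVK ?subrr // gt_eqF.
have fE : energy (@tower_act _ _ _ _ Y) f = energy (@tower_act _ _ _ _ Y) (F t tau).
  by apply: eq_bigr => l _; apply: eq_bigr => y _; rewrite /f; congr (_ ^+ 2); ring.
have f2 : \sum_y f y ^+ 2 = m - m * (m / n).
  rewrite (eq_bigr (fun y => F t tau y - 2%:R * (m / n) * F t tau y + (m / n) ^+ 2)); last first.
    by move=> y _; move: (F01 t tau y); rewrite /f; move: (F t tau y) (m / n) => x c xx; ring: xx.
  rewrite big_split sumrB /= -mulr_sumr -/m sumr_const -[_ *+ #|_|]mulr_natl -/n.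
  by field; rewrite gt_eqF.
have := tower_gap f0; rewrite fE f2; apply: le_trans.
have h : m / n <= 2%:R^-1.
  by rewrite ler_pdivrMr //; have := half_F t tau; rewrite -/m -/n; lra.
have : m * (m / n) <= m * 2%:R^-1 by rewrite ler_wpM2l.
by move: (m / n) => x; lra.
Qed.

(** Averaging over t gives a point whose orbit carries at most 3 #|Y| / 2000 errors. Comparing
    [energy_F] with [sum_energy] there yields 1/300 <= 6/2000, which is false. *)
Lemma separation_aux :
  ~ (forall l, (2000 * #|[set t | phi (act (a l) t) != act' (a l) (phi t)]| <= #|T|)%N).
Proof.
move=> small.
pose X t := (\sum_l \sum_y err l (act (gword (wd y)) t))%N.
have sumX : (2000 * \sum_t X t <= 3 * #|Y| * #|T|)%N.
  rewrite /X exchange_big big_distrr /=.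
  apply: (@leq_trans (\sum_(l < 3) #|Y| * #|T|)).
    apply: leq_sum => l _; rewrite exchange_big big_distrr /=.
    apply: (@leq_trans (\sum_(y : Y) #|T|)); last by rewrite sum_nat_const.
    apply: leq_sum => y _; apply: leq_trans (small l).
    rewrite leq_mul2l; apply/orP; right.
    have <- : (\sum_t err l t = \sum_t err l (act (gword (wd y)) t))%N.
      by rewrite [LHS](reindex_inj (gaction_inj (g := gword (wd y)) aT)).
    by rewrite -sum1_card [leqRHS]big_mkcond /=; apply: leq_sum => t _; rewrite inE -/(err l t); case: (err l t).
  by rewrite sum_nat_const card_ord mulnA.
have [t Xt] : exists t, (2000 * X t <= 3 * #|Y|)%N.
  case: (pickP (fun t => 2000 * X t <= 3 * #|Y|)%N) => [t Xt|none]; first by exists t.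
  exfalso; move: sumX; rewrite leqNgt => /negP; apply.
  rewrite big_distrr /= mulnC -sum_nat_const ltn_neqAle; apply/andP; split; last first.
    by apply: leq_sum => t _; rewrite ltnW // ltnNge none.
  have [t0 _] := card_gt0P T0.
  rewrite (bigD1 t0) //= [X in _ != X](bigD1 t0) //= neq_ltn; apply/orP; left.
  rewrite -addSn leq_add //; first by rewrite ltnNge none.
  by apply: leq_sum => t _; rewrite ltnW // ltnNge none.
have := sum_energy t; have : 300%:R^-1 * #|Y|%:R <= \sum_tau energy (@tower_act _ _ _ _ Y) (F t tau).
  by rewrite -(sum_F t) mulr_sumr; apply: ler_sum => tau _; exact: energy_F.
rewrite -/(X t) => H1 H2; have := le_trans H1 H2.
move: Xt; rewrite -(ler_nat R) !natrM; have : 0 < #|Y|%:R :> R by rewrite ltr0n.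
by move: (#|Y|%:R) ((X t)%:R) => n x; lra.
Qed.
End Fixed.

Theorem word_separated : separated_family J.
Proof.
move=> I' j jI'; exists (codom a), 2000%N => I T T' act act' aT aT' sT sT' jI T0 phi small.
pose K := rev (sort leq (undup (I ++ I'))).
have sK : sorted gtn K.
  rewrite /K rev_sorted ltn_sorted_uniq_leq sort_uniq undup_uniq.
  exact: (sort_sorted leq_total).
have [Y] := @tower_exists R q r pool r2 K sK.
have KE i : (i \in K) = (i \in I) || (i \in I') by rewrite mem_rev mem_sort mem_undup mem_cat.
apply: (@separation_aux I I' j T T' act act' jI' aT aT' sT sT' jI T0 K Y KE phi) => l.
by apply: small; exact: codom_f.
Qed.

End TwoGenerators.

From mathcomp Require Import boolp classical_sets cardinality.
Require Import Defs.

Definition good_family (G : groupType) (J : nat -> set G) : Prop :=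
  [/\ forall i, subgroup (J i), forall i, normal (J i),
      forall i, finite_set (lcosets (J i)),
      forall g, g <> 1%g -> exists i0, forall i, (i0 <= i)%N -> ~ J i g &
      separated_family J].

Lemma finite_index (G : groupType) (J : set G) (T : finType) (f : G -> T) :
  subgroup J -> (forall g h, f g = f h -> J (g^-1 * h)%g) -> finite_set (lcosets J).
Proof.
move=> sJ fJ.
have [rep repP] : exists rep : T -> G, forall g, f (rep (f g)) = f g.
  have ex t : exists g, (exists h, f h = t) -> f g = t.
    by have [[h ht]|no] := pselect (exists h, f h = t); [exists h|exists 1%g => /no].
  have [rep H] := choice ex.
  by exists rep => g; apply: H; exists g.
apply: (@sub_finite_set _ _ ((fun t => lcoset J (rep t)) @` [set: T])%classic).
  move=> _ [g _ <-]; exists (f g) => //; apply: lcoset_eq => //.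
  by apply/lcosetE => //; apply: fJ; rewrite repP.
exact/finite_image/finite_finset.
Qed.

Lemma pool_gt (q : nat -> nat) i : sparse_pool q -> (i < q i)%N.
Proof.
move=> [pq /(_ i)]; apply: leq_trans.
apply: (@leq_trans (2 ^ (32 * (2 ^ i + 100)))); last first.
  rewrite leq_exp2l // leq_mul2l leq_add2r /= -[in X in (2 ^ X <= _)%N](card_ord i) -prod_nat_const.
  apply: leq_prod => k _; apply: leq_trans (prime_gt1 (pq k)) _.
  by rewrite -[X in (X <= _)%N]expn1 leq_pexp2l // prime_gt0.
apply: leq_trans (ltn_expl i (ltnSn 1)) _; rewrite leq_exp2l //.
have := ltn_expl i (ltnSn 1); move: (2 ^ i)%N => P; clear; lia.
Qed.

Lemma pool_inj (q : nat -> nat) : sparse_pool q -> injective q.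
Proof.
move=> [pq qq].
have lt i j : (i < j)%N -> (q i < q j)%N.
  move=> ij; apply: leq_trans (qq j).
  have P : (q i <= \prod_(k < j) q k ^ 3)%N.
    rewrite (bigD1 (Ordinal ij)) //= -[X in (X <= _)%N]muln1; apply: leq_mul.
      by rewrite -[X in (X <= _)%N]expn1 leq_pexp2l // prime_gt0.
    by rewrite prodn_gt0 // => k; rewrite expn_gt0 prime_gt0.
  apply: leq_ltn_trans P _; apply: leq_trans (ltn_expl _ (ltnSn 1)) _.
  rewrite leq_exp2l //; move: (\prod_(k < j) _)%N => P; clear; lia.
move=> i j e; case: (ltngtP i j) => // /lt; by rewrite e ltnn.
Qed.

(** c + 2 x, c + 2 y, c + 2 z are fixed integers, which vanish mod a larger prime only if they are
    0. Then the quaternion is an integer m with m^2 = 2^n [qnorm e], so m is even, against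
    [qcoord_primitive]. *)
Lemma qcoord_not_scalar (q : nat -> nat) (r : forall i, 'F_(q i)) e w :
  sparse_pool q -> (forall i, r i ^+ 2 = - 2%:R) ->
  ~~ (2 %| qnorm e)%Z -> reduced w -> w != [::] ->
  exists i0, forall i, (i0 <= i)%N -> forall k, qmat (r i) (qcoord e w) <> k%:M.
Proof.
move=> pool r2 e1 rw w0.
have qi i := pool_gt i pool.
have := qcoord_primitive e1 rw w0; have := qnorm_qcoord e w.
have sw : (0 < size w)%N by rewrite lt0n size_eq0.
case E : (qcoord e w) => [[[c x] y] z] nrm prim.
pose N := (`|(c + 2 * x)%R| + `|(c + 2 * y)%R| + `|(c + 2 * z)%R|)%N.
exists N => i iN k /(qmat_scalar (r2 i) (@pool_nz _ pool i 2 isT) (@pool_nz _ pool i 3 isT) (@pool_nz _ pool i 5 isT)).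
have zq (d : int) : (`|d| <= N)%N -> d%:~R = 0 :> 'F_(q i) -> d = 0.
  move=> dN d0; apply/eqP; rewrite -absz_eq0; apply: contraLR isT => nd.
  have : (q i %| `|d|)%N.
    rewrite (dvdn_pcharf (pchar_Fp (pool_prime pool i))).
    move: d0; case: (d) => n /=; first by rewrite -pmulrn => ->.
    by rewrite NegzE mulrNz -pmulrn => /eqP; rewrite oppr_eq0.
  rewrite -lt0n in nd; move=> /(dvdn_leq nd) qd.
  by have := leq_trans (qi i) (leq_trans qd (leq_trans dN iN)); rewrite ltnn.
move=> [/zq e1' /zq e2' /zq e3'].
have [{}e1' {}e2' {}e3'] : [/\ c + 2 * x = 0, c + 2 * y = 0 & c + 2 * z = 0].
  by split; [apply: e1'|apply: e2'|apply: e3']; rewrite /N; lia.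
have [m [cm xm ym zm]] : exists m : int, [/\ c = 2 * m, x = - m, y = - m & z = - m].
  by exists (- x); split; lia.
move: nrm prim; rewrite cm xm ym zm /= => nrm prim.
have n2 : m * m = 2 ^+ size w * qnorm e by rewrite -nrm; ring.
have : (2 %| m * m)%Z by rewrite n2 -(prednK sw) exprS -mulrA dvdz_mulr.
move: prim; move: (m); clear => m /negP prim.
rewrite dvdzE abszM Euclid_dvdM // orbb => d; apply: prim.
have dm : (2 %| m)%Z by rewrite dvdzE.
by rewrite !rpredN dm dvdz_mulr.
Qed.

(** * The modular group *)

Section Rotation.
Variables (F : fieldType) (r : F).
Hypotheses (r2 : r ^+ 2 = - 2%:R) (n2 : 2%:R != 0 :> F) (n3 : 3%:R != 0 :> F)
  (n5 : 5%:R != 0 :> F).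

Let n4 : 4%:R != 0 :> F. Proof. by rewrite (natrM F 2 2) mulf_neq0. Qed.
Let n8 : 8%:R != 0 :> F. Proof. by rewrite (natrM F 2 4) mulf_neq0. Qed.

(* The unit - (1 + X_0 + X_1 + X_2) / 2 of order 3, which permutes the X_i cyclically. *)
Definition urot : quat := (-1, 0, 0, 0).
Definition urot2 : quat := (-1, 1, 1, 1).
Definition rotmat : 'M[F]_2 := qmat r urot.

Lemma rotmat_sqr : rotmat *m rotmat = qmat r urot2.
Proof.
rewrite /rotmat /qmat /xmat /= !mat2_scalar !mat2D !mat2Z !mat2D !mat2M; congr mat2;
  by field: r2; rewrite ?n2 ?n3 ?n4 ?n8.
Qed.

Lemma rotmat_cube : rotmat *m (rotmat *m rotmat) = 1%:M.
Proof.
rewrite rotmat_sqr /rotmat /qmat /xmat /= !mat2_scalar !mat2D !mat2Z !mat2D !mat2M; congr mat2;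
  by field: r2; rewrite ?n2 ?n3 ?n4 ?n8.
Qed.

Lemma rotmat_xmat i : rotmat *m xmat r i = xmat r (i + 1) *m rotmat.
Proof.
move: i; apply: ord3P; rewrite /rotmat /qmat /xmat /= !mat2_scalar !mat2D !mat2Z !mat2D !mat2M;
  congr mat2; by field: r2; rewrite ?n2 ?n3 ?n4 ?n8.
Qed.
End Rotation.

Section FreeProduct.
Variables (G : groupType) (s u : G).
Hypotheses (ss : (s * s = 1)%g) (uuu : (u * (u * u) = 1)%g).
Hypothesis gen : forall P : G -> Prop, P 1%g ->
  (forall g, P g -> P (s * g)%g) -> (forall g, P g -> P (u * g)%g) -> forall g, P g.

(** These three involutions correspond to X_0, X_1, X_2; in Z/2 * Z/3 they generate the kernel of
    the projection to Z/3, a free product of three groups of order 2. *)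
Definition uconj (i : 'I_3) : G := (u ^+ val i * s * (u ^+ val i)^-1)%g.
Definition xword (w : seq 'I_3) : G := foldr (fun i g => uconj i * g)%g 1%g w.

Hypothesis xword_free : forall w n, reduced w -> w != [::] -> (xword w * u ^+ n)%g <> 1%g.
Hypothesis u_order : forall n, (u ^+ n = 1)%g -> (3 %| n)%N.

Variables (q : nat -> nat) (r : forall i, 'F_(q i)).
Hypotheses (pool : sparse_pool q) (r2 : forall i, r i ^+ 2 = - 2%:R).

Let n2 i : 2%:R != 0 :> 'F_(q i). Proof. exact: (@pool_nz _ pool i 2 isT). Qed.
Let n3 i : 3%:R != 0 :> 'F_(q i). Proof. exact: (@pool_nz _ pool i 3 isT). Qed.
Let n5 i : 5%:R != 0 :> 'F_(q i). Proof. exact: (@pool_nz _ pool i 5 isT). Qed.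

Let r0 i : r i != 0.
Proof. by apply: contraNneq (n2 i) => e; rewrite -oppr_eq0 -r2 e expr0n. Qed.

Let cube i : rotmat (r i) *m (rotmat (r i) *m rotmat (r i)) = 1%:M.
Proof. by apply: rotmat_cube; [exact: r2|exact: n2|exact: n3]. Qed.
Let square i : rotmat (r i) *m rotmat (r i) = qmat (r i) urot2.
Proof. by apply: rotmat_sqr; [exact: r2|exact: n2|exact: n3]. Qed.
Let conjX i l : rotmat (r i) *m xmat (r i) l = xmat (r i) (l + 1) *m rotmat (r i).
Proof. by apply: rotmat_xmat; [exact: r2|exact: n2|exact: n3]. Qed.
Let lmulX i l v : qmat (r i) (lmul l v) = xmat (r i) l *m qmat (r i) v.
Proof. by apply: qmat_lmul; [exact: r2|exact: n2|exact: n3]. Qed.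

Local Notation M i := 'M['F_(q i)]_2.

(* The graph of the homomorphism to GL_2(F_(q i)) mapping s to X_0 / r and u to
   [rotmat]. *)
Inductive modgraph i : G -> M i -> Prop :=
| Modgraph1 : modgraph 1%g 1%:M
| ModgraphS g m : modgraph g m -> modgraph (s * g)%g ((r i)^-1 *: xmat (r i) 0 *m m)
| ModgraphU g m : modgraph g m -> modgraph (u * g)%g (rotmat (r i) *m m).

Let SS i : ((r i)^-1 *: xmat (r i) 0) *m ((r i)^-1 *: xmat (r i) 0) = 1%:M.
Proof.
rewrite -scalemxAl -scalemxAr (xmatM (r2 i) (n2 i) (n3 i)).
rewrite !scale_scalar_mx; congr _%:M.
by rewrite -(r2 i) expr2 (mulKf (r0 i)) (mulVf (r0 i)).
Qed.

Lemma modgraphM i g m h n : @modgraph i g m -> modgraph h n -> modgraph (g * h)%g (m *m n).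
Proof.
elim=> [|{}g {}m _ IH|{}g {}m _ IH] hn; first by rewrite mul1g mul1mx.
- by rewrite -mulgA -mulmxA; apply/ModgraphS/IH.
- by rewrite -mulgA -mulmxA; apply/ModgraphU/IH.
Qed.

Lemma modgraphV i g m : @modgraph i g m -> exists m',
  [/\ modgraph g^-1%g m', m' *m m = 1%:M & m *m m' = 1%:M].
Proof.
elim=> [|{}g {}m _ [m' [gm' e e']]|{}g {}m _ [m' [gm' e e']]].
- by exists 1%:M; rewrite invg1 mulmx1; split=> //; constructor.
- exists (m' *m ((r i)^-1 *: xmat (r i) 0 *m 1%:M)); split.
  + rewrite invgM; apply: modgraphM => //.
    have -> : (s^-1 = s * 1)%g by apply: (mulgI s); rewrite mulgV mulg1 ss.
    exact/ModgraphS/Modgraph1.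
  + by rewrite mulmx1 mulmxA -[_ *m _ *m (_ *: _)]mulmxA SS mulmx1.
  + by rewrite mulmx1 mulmxA -[_ *m m *m m']mulmxA e' mulmx1 SS.
- exists (m' *m (rotmat (r i) *m (rotmat (r i) *m 1%:M))); split.
  + rewrite invgM; apply: modgraphM => //.
    have -> : (u^-1 = u * (u * 1))%g by apply: (mulgI u); rewrite mulgV mulg1 uuu.
    exact/ModgraphU/ModgraphU/Modgraph1.
  + rewrite mulmx1 -mulmxA [X in _ *m X]mulmxA -[X in _ *m (X *m _)]mulmxA.
    by rewrite cube mul1mx.
  + rewrite mulmx1 mulmxA -[_ *m m *m m']mulmxA e' mulmx1.
    by rewrite cube.
Qed.

Lemma modgraph_total i g : exists m, @modgraph i g m.
Proof.
elim/gen: g => [|g [m gm]|g [m gm]]; first by exists 1%:M; constructor.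
- by eexists; apply: ModgraphS gm.
- by eexists; apply: ModgraphU gm.
Qed.

Let uconjS i : uconj (i + 1) = (u * uconj i * u^-1)%g.
Proof.
have -> : (u * uconj i * u^-1 = u ^+ (val i).+1 * s * (u ^+ (val i).+1)^-1)%g.
  by rewrite /uconj expgS invgM !mulgA.
have u3 : (u ^+ 3 = 1)%g by rewrite !expgS expg0 mulg1.
by move: i; apply: ord3P; rewrite /uconj //= u3 expg0.
Qed.

Let uconjK i : (uconj i * uconj i = 1)%g.
Proof.
by rewrite /uconj -!mulgA mulKg [(s * (s * _))%g]mulgA ss mul1g mulgV.
Qed.

Let uconjKl i g : (uconj i * (uconj i * g) = g)%g.
Proof. by rewrite (mulgA (uconj i) (uconj i)) uconjK mul1g. Qed.

Local Notation rS w := (map (fun i : 'I_3 => i + 1) w).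

Let reduced_rS w : reduced w -> reduced (rS w).
Proof.
elim: w => //= i [//|j w] IH /andP[ij rw].
by apply/andP; split; [rewrite /= (inj_eq (addIr 1)); exact: ij|exact: IH].
Qed.

Let xwordS w : (u * xword w = xword (rS w) * u)%g.
Proof.
elim: w => [|i w IH] /=; first by rewrite mul1g mulg1.
by rewrite uconjS -!mulgA -IH mulKg.
Qed.

Let xprod i (w : seq 'I_3) : M i := foldr (fun l m => (r i)^-1 *: xmat (r i) l *m m) 1%:M w.

Let xprodS i w : rotmat (r i) *m xprod i w = xprod i (rS w) *m rotmat (r i).
Proof.
elim: w => [|l w IH] /=; first by rewrite mul1mx mulmx1.
rewrite mulmxA -scalemxAr conjX scalemxAl -mulmxA IH.
by rewrite !mulmxA.
Qed.

Definition rotpow i n : M i := iter n (mulmx (rotmat (r i))) 1%:M.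

(** The normal form of the free product, computed in G and in the matrices at once; it reduces the
    uniqueness of the matrix to [xword_free] and [u_order]. *)
Lemma modgraph_normal i g m : @modgraph i g m -> exists w n,
  [/\ reduced w, g = (xword w * u ^+ n)%g & m = xprod i w *m rotpow i n].
Proof.
elim=> [|{}g {}m _ [w [n [rw -> ->]]]|{}g {}m _ [w [n [rw -> ->]]]].
- by exists [::], 0%N; rewrite /= mulmx1 mulg1.
- have s0 : s = uconj 0 by rewrite /uconj /= expg0 mul1g invg1 mulg1.
  case: w rw => [_|l w rw]; first by exists [:: 0], n; rewrite /= -s0 mulg1 mul1g mulmx1 mul1mx.
  have [l0|l0] := eqVneq 0 l.
    exists w, n; split; first by move: rw; rewrite -cat1s => /reduced_catr.
      by rewrite {1}s0 /= -l0 -(mulgA (uconj 0) (xword w)) uconjKl.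
    by rewrite /= -l0 !mulmxA SS mul1mx.
  exists [:: 0, l & w], n; split.
    + by apply/andP; split; [rewrite /= eq_sym|exact: rw].
    + by rewrite {1}s0 /= -!(mulgA (uconj 0)).
    + by rewrite /= !mulmxA.
- exists (rS w), n.+1; split; first exact: reduced_rS.
    by rewrite mulgA xwordS -mulgA expgS.
  by rewrite mulmxA xprodS -mulmxA.
Qed.

Let rotpow3 i n : (3 %| n)%N -> rotpow i n = 1%:M.
Proof.
move=> /dvdnP[k ->]; elim: k => [//|k IH]; rewrite mulSn /rotpow iterD -/(rotpow i (k * 3)) IH /=.
by rewrite mulmx1 cube.
Qed.

Let rotpow_mod i n : rotpow i n = rotpow i (n %% 3).
Proof.
rewrite [in LHS](divn_eq n 3) addnC /rotpow iterD -/(rotpow i (n %/ 3 * 3)) rotpow3 //.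
exact: dvdn_mull.
Qed.

Lemma modgraph1 i m : @modgraph i 1%g m -> m = 1%:M.
Proof.
case/modgraph_normal=> w [n [rw g1 ->]].
have [w0|w0] := eqVneq w [::]; last by case: (@xword_free w n).
by rewrite w0 rotpow3 ?mulmx1 //; apply: u_order; rewrite g1 w0 mul1g.
Qed.

Lemma modgraph_fun i g m m' : @modgraph i g m -> modgraph g m' -> m = m'.
Proof.
move=> gm gm'; have [n [gn e e']] := modgraphV gm'.
have := modgraphM gm gn; rewrite mulgV => /modgraph1 mn.
by rewrite -[LHS]mulmx1 -e mulmxA mn mul1mx.
Qed.

Definition modker i : set G := fun g => modgraph g (1%:M : M i).

Let kerV i g m h n : @modgraph i g m -> modgraph h n -> (modker i (g^-1 * h)%g <-> m = n).
Proof.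
move=> gm hn; have [m' [gm' e e']] := modgraphV gm; split=> [H|mn].
  have := modgraphM gm H; rewrite mulmx1 mulgA mulgV mul1g => hm.
  exact: modgraph_fun hm hn.
by have := modgraphM gm' hn; rewrite -mn e.
Qed.

Lemma modker_subgroup i : subgroup (modker i).
Proof.
split; first exact: Modgraph1.
  by move=> g h gm hm; have := modgraphM gm hm; rewrite mul1mx.
by move=> g /modgraphV[m' [gm' e _]]; rewrite mulmx1 in e; rewrite /modker -e.
Qed.

Lemma modker_normal i : normal (modker i).
Proof.
move=> g x xm; have [m gm] := modgraph_total i g; have [m' [gm' _ e]] := modgraphV gm.
by have := modgraphM (modgraphM gm xm) gm'; rewrite mulmx1 e.
Qed.

Let xprod_coord i w e : xprod i w *m qmat (r i) e =
  (r i)^-1 ^+ size w *: qmat (r i) (qcoord e (rev w)).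
Proof.
elim: w => [|l w IH] /=; first by rewrite mul1mx expr0 scale1r.
rewrite -mulmxA IH -scalemxAl -scalemxAr scalerA rev_cons qcoord_rcons lmulX.
by rewrite exprS.
Qed.

(** Powers of the rotation come from units of the order; their odd norm admits them as the initial
    [e] of [qcoord_not_scalar], so a trailing power of u does no harm. *)
Let rotpowE n : exists2 e, ~~ (2 %| qnorm e)%Z & forall i, rotpow i n = qmat (r i) e.
Proof.
have H i := rotpow_mod i n.
have : (n %% 3 < 3)%N by rewrite ltn_mod.
case: (n %% 3)%N H => [|[|[|//]]] H _.
- by exists qone => // i; rewrite H (qmat_one (r2 i) (n2 i) (n3 i)).
- by exists urot => // i; rewrite H /= mulmx1.
- by exists urot2 => // i; rewrite H /= mulmx1 square.
Qed.

Lemma modgraph_uconj i l : modgraph (uconj l) ((r i)^-1 *: xmat (r i) l).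
Proof.
have rotl : forall k, modgraph (uconj k) ((r i)^-1 *: xmat (r i) k) ->
    modgraph (uconj (k + 1)) ((r i)^-1 *: xmat (r i) (k + 1)).
  move=> k gk; have U : modgraph u (rotmat (r i)).
    by have := ModgraphU (Modgraph1 i); rewrite mulg1 mulmx1.
  have [V [gV _ UV]] := modgraphV U.
  have := modgraphM (modgraphM U gk) gV; rewrite -uconjS -scalemxAr conjX.
  by rewrite scalemxAl -mulmxA UV mulmx1.
have b0 : modgraph (uconj 0) ((r i)^-1 *: xmat (r i) 0).
  rewrite /uconj /= expg0 mul1g invg1.
  by have := ModgraphS (Modgraph1 i); rewrite mulmx1.
have b1 := rotl _ b0; have b2 := rotl _ b1.
move: l; apply: ord3P; [exact: b0| |].
+ set o := Ordinal _; have -> : o = 0 + 1 by apply: val_inj.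
  exact: b1.
+ set o := Ordinal _; have -> : o = 0 + 1 + 1 by apply: val_inj.
  exact: b2.
Qed.

Lemma modker_residual g : g <> 1%g -> exists i0, forall i, (i0 <= i)%N -> ~ modker i g.
Proof.
move=> g1; have [m0 gm0] := modgraph_total 0 g.
have [w [n [rw gE _]]] := modgraph_normal gm0.
have [e ne eP] := rotpowE n.
have gm i : modgraph g (xprod i w *m rotpow i n).
  have [m gm] := modgraph_total i g.
  suff H : modgraph (xword w * u ^+ n)%g (xprod i w *m rotpow i n) by rewrite gE.
  apply: modgraphM; last first.
    by elim: n {gE eP gm} => [|k IH]; [constructor|rewrite expgS; apply: ModgraphU].
  elim: w {rw gE} => [|l w IH] /=; first exact: Modgraph1.
  exact: (modgraphM (modgraph_uconj i l) IH).
have [w0|w0] := eqVneq w [::]; last first.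
  have rw' : reduced (rev w) by rewrite reduced_rev.
  have w0' : rev w != [::] by rewrite -size_eq0 size_rev size_eq0.
  have [i0 i0P] := qcoord_not_scalar pool r2 ne rw' w0'.
  exists i0 => i ii0 gk; have := modgraph_fun (gm i) gk; rewrite eP xprod_coord => E.
  apply: (i0P i ii0 (r i ^+ size w)).
  rewrite -[RHS]scalemx1 -E scalerA -exprMn mulfV ?r0 // expr1n scale1r //.
exists 0%N => i _ gk.
have := modgraph_fun (gm i) gk; rewrite w0 /= mul1mx.
have : ~~ (3 %| n)%N.
  apply/negP => /dvdnP[k nk]; apply: g1; rewrite gE w0 mul1g nk.
  by rewrite mulnC expgnA !expgS expg0 mulg1 uuu expg1n.
rewrite rotpow_mod /dvdn.
have : (n %% 3 < 3)%N by rewrite ltn_mod.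
case: (n %% 3)%N => [|[|[|//]]] //= _ _; rewrite mulmx1 ?square;
  move=> /(qmat_scalar (r2 i) (n2 i) (n3 i) (n5 i))[+ _ _] => /eqP.
- by rewrite /= mulr0 addr0 mulrNz oppr_eq0 oner_eq0.
- by rewrite /= oner_eq0.
Qed.

Lemma modker_finite i : finite_set (lcosets (modker i)).
Proof.
have [f fP] := choice (modgraph_total i).
apply: (@finite_index G (modker i) 'M['F_(q i)]_2 f); first exact: modker_subgroup.
by move=> g h e; apply/(kerV (fP g) (fP h)).
Qed.

(** Its image is r^-2 X_0 X_l = - X_0 X_l / 2, which is [gam l]. *)
Let pairword (l : 'I_3) := (uconj 0 * uconj l)%g.

Let modgraph_gword i w : modgraph (gword pairword w) (val (slword r i w)).
Proof.
elim: w => [|l w IH] /=; first exact: Modgraph1.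
apply: modgraphM => //; rewrite (val_gam (r2 i) (n2 i) (n3 i)).
have := modgraphM (modgraph_uconj i 0) (modgraph_uconj i l).
rewrite -scalemxAl -scalemxAr scalerA -expr2 exprVn r2 invrN; exact.
Qed.

Lemma free_product_good_family (R : rcfType) : good_family modker.
Proof.
split.
- exact: modker_subgroup.
- exact: modker_normal.
- exact: modker_finite.
- exact: modker_residual.
apply: (@word_separated R q r pool r2 G modker pairword) => i v w.
split=> [/(kerV (modgraph_gword i v) (modgraph_gword i w))|e].
  exact: val_inj.
by apply/(kerV (modgraph_gword i v) (modgraph_gword i w)); rewrite e.
Qed.
End FreeProduct.

(** * Integral matrices modulo the center *)

Section ProjectiveClass.
Variable k : nat.
Local Notation pc := (@quotient_class (SLZ k) _ : SLZ k -> PSLZ k).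

Lemma pclassM (A B : SLZ k) : pc (A * B)%g = (pc A * pc B)%g.
Proof. by rewrite -quotient_classM. Qed.

Lemma pclassV (A : SLZ k) : pc A^-1%g = (pc A)^-1%g.
Proof. by apply: (mulgI (pc A)); rewrite -pclassM !mulgV. Qed.

Lemma pclassX (A : SLZ k) n : pc (A ^+ n)%g = (pc A ^+ n)%g.
Proof. by elim: n => [|n IH]; rewrite ?expg0 // !expgS pclassM IH. Qed.

Lemma pclass_surj (g : PSLZ k) : exists A, g = pc A.
Proof. exact: quotient_surj. Qed.

Lemma pclass_eq1 (A : SLZ k) : pc A = 1%g <-> center A.
Proof.
split=> [/(congr1 val)/= e|cA].
  have /(lcosetE (@center_subgroup (SLZ k))) : lcoset (@center (SLZ k)) 1%g A.
    by rewrite -e; apply: lcoset_refl; exact: center_subgroup.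
  by rewrite invg1 mul1g.
apply: val_inj => /=; apply: lcoset_eq; first exact: center_subgroup.
by apply/lcosetE; [exact: center_subgroup|rewrite invg1 mul1g].
Qed.

Lemma elem_det (i j : 'I_k) (t : int) : i != j -> \det (1%:M + t *: delta_mx i j) == 1.
Proof.
wlog ij : i j / (i < j)%N.
  move=> H ij; have [ltij|] := ltnP i j; first exact: H.
  rewrite leq_eqVlt => /orP[/eqP/val_inj e|ltji]; first by rewrite e eqxx in ij.
  rewrite -det_tr linearD linearZ /= trmx1 trmx_delta; apply: H => //.
  by rewrite eq_sym.
move=> _; rewrite -det_tr det_trig; last first.
  apply/is_trig_mxP => a b ab; rewrite !mxE.
  have -> : (b == a) = false by apply/eqP => e; rewrite e ltnn in ab.
  case: eqP => [e|]; case: eqP => [e'|] //=; rewrite ?mulr0 ?addr0 //.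
  by move: ab ij; rewrite e e' => ab ba; have := ltn_trans ab ba; rewrite ltnn.
rewrite big1 // => a _; rewrite !mxE eqxx.
case: eqP => [->|]; case: eqP => [e|] //=; rewrite ?mulr0 ?addr0 //.
by move: ij; rewrite e ltnn.
Qed.

Definition elem (i j : 'I_k) (t : int) : SLZ k := insubd (1%g : SLZ k) (1%:M + t *: delta_mx i j).

Lemma val_elem i j t : i != j -> val (elem i j t) = 1%:M + t *: delta_mx i j.
Proof. by move=> ij; rewrite val_insubd elem_det. Qed.

Lemma elemD i j s t : i != j -> elem i j (s + t) = (elem i j s * elem i j t)%g.
Proof.
move=> ij; apply: val_inj; rewrite /= !val_elem // mulmxDl mul1mx mulmxDr mulmx1.
rewrite -scalemxAl -scalemxAr mul_delta_mx_0 ?scaler0 ?addr0; last by rewrite eq_sym.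
by rewrite scalerDl addrA addrAC.
Qed.

Lemma center_scalar (A : SLZ k) : center A -> is_scalar_mx (val A).
Proof.
move=> cA.
have comm i j : i != j -> val A *m delta_mx i j = delta_mx i j *m val A.
  move=> ij; have /(congr1 val) := cA (elem i j 1).
  rewrite /= val_elem // mulmxDl mulmxDr mulmx1 mul1mx scale1r.
  by move=> /addrI.
have rowcol i j x y : i != j -> val A x i *+ (y == j) = (val A j y) *+ (x == i).
  move=> /comm /matrixP/(_ x y); rewrite !mxE.
  rewrite (bigD1 i) //= big1 => [|l /negPf li]; last by rewrite mxE li mulr0.
  rewrite mxE eqxx /= mulr_natr addr0 => ->.
  rewrite (bigD1 j) //= big1 => [|l /negPf li]; last by rewrite mxE li andbF mul0r.
  by rewrite mxE eqxx andbT mulr_natl addr0.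
case: k A cA comm rowcol => [|k'] A cA comm rowcol.
  apply/is_scalar_mxP; exists 1; apply/matrixP => -[] //.
apply/is_scalar_mxP; exists (val A 0 0); apply/matrixP => x y; rewrite !mxE.
have [->|xy] := eqVneq x y; last by have := rowcol y x x x; rewrite eqxx (negPf xy) eq_sym xy mulr1n; apply.
have [->//|y0] := eqVneq y 0.
by have := rowcol y 0 y 0 y0; rewrite !eqxx.
Qed.

Lemma scalar_center (A : SLZ k) : is_scalar_mx (val A) -> center A.
Proof.
by move=> /is_scalar_mxP[a aE] B; apply: val_inj; rewrite /= aE scalar_mxC.
Qed.

End ProjectiveClass.

Section ModularGroup.
Local Notation pc := (@quotient_class (SLZ 2) _ : SLZ 2 -> PSLZ 2).

Definition slz (a b c d : int) : SLZ 2 := insubd (1%g : SLZ 2) (mat2 a b c d).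

Lemma val_slz a b c d : a * d - b * c = 1 -> val (slz a b c d) = mat2 a b c d.
Proof. by move=> e; rewrite val_insubd det_mat2 e eqxx. Qed.

Definition slzS := slz 0 (-1) 1 0.
Definition slzU := slz 0 1 (-1) (-1).
Definition slzT n := slz 1 n 0 1.
Let vS : val slzS = mat2 0 (-1) 1 0. Proof. exact: val_slz. Qed.
Let vU : val slzU = mat2 0 1 (-1) (-1). Proof. exact: val_slz. Qed.
Let vT n : val (slzT n) = mat2 1 n 0 1. Proof. by rewrite val_slz // mulr0 subr0. Qed.

Let SS : pc (slzS * slzS)%g = 1%g.
Proof.
apply/pclass_eq1/scalar_center; apply/is_scalar_mxP; exists (-1).
by rewrite /= vS mat2M mat2_scalar; congr mat2; ring.
Qed.

Let UUU : (slzU * (slzU * slzU) = 1)%g.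
Proof. by apply: val_inj; rewrite /= vU !mat2M mat2_scalar; congr mat2; ring. Qed.

Let TSU : slzT 1 = (slzS * slzU)%g.
Proof. by apply: val_inj; rewrite /= vT vS vU mat2M; congr mat2; ring. Qed.

Let TD m n : slzT (m + n) = (slzT m * slzT n)%g.
Proof. by apply: val_inj; rewrite /= !vT mat2M; congr mat2; ring. Qed.

Let det4 (A : SLZ 2) : val A 0 0 * val A 1 1 - val A 0 1 * val A 1 0 = 1.
Proof. by rewrite -det_mat2 -mat2E; exact/eqP/(valP A). Qed.

(** Euclid's algorithm on the first column: S T^(-m) replaces the lower left entry by the remainder
    of the division of the upper left entry by it. *)
Lemma modular_gen (P : PSLZ 2 -> Prop) : P 1%g ->
  (forall g, P g -> P (pc slzS * g)%g) -> (forall g, P g -> P (pc slzU * g)%g) -> forall g, P g.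
Proof.
move=> P1 PS PU.
pose Q (A : SLZ 2) := forall g, P g -> P (pc A * g)%g.
have QM A B : Q A -> Q B -> Q (A * B)%g.
  by move=> qA qB g pg; rewrite pclassM -mulgA; apply/qA/qB.
have QS : Q slzS by []. have QU : Q slzU by [].
have Q1 : Q 1%g by move=> g; rewrite mul1g.
have QSV : Q slzS^-1%g.
  move=> g /QS; rewrite (_ : pc slzS = pc slzS^-1%g) //.
  by rewrite pclassV; apply: (mulgI (pc slzS)); rewrite -pclassM SS mulgV.
have QUV : Q slzU^-1%g.
  rewrite (_ : slzU^-1%g = slzU * slzU)%g; first exact: QM.
  by apply: (mulgI slzU); rewrite mulgV UUU.
have QT (n : nat) : Q (slzT n%:Z) /\ Q (slzT (- n%:Z)).
  have T0 : slzT 0 = 1%g by apply: val_inj; rewrite /= vT mat2_scalar.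
  have T1V : slzT (- 1) = (slzU^-1 * slzS^-1)%g.
    by rewrite -invgM -TSU; apply: (mulgI (slzT 1)); rewrite mulgV -TD subrr T0.
  elim: n => [|n [IH IH']]; first by rewrite oppr0 T0.
  rewrite -addn1 PoszD opprD !TD; split; apply: (QM) => //; first by rewrite TSU; exact: QM.
  by rewrite T1V; exact: QM.
have {}QT (n : int) : Q (slzT n).
  by case: n => n; [have [] := QT n|rewrite NegzE; have [] := QT n.+1].
have main n : forall A : SLZ 2, (`|(val A 1 0)%R| <= n)%N -> Q A.
  elim: n => [|n IH] A.
    rewrite leqn0 absz_eq0 => /eqP c0; have := det4 A; rewrite c0 mulr0 subr0 => ad.
    have [[a1 d1]|[a1 d1]] : (val A 0 0 = 1 /\ val A 1 1 = 1) \/ (val A 0 0 = -1 /\ val A 1 1 = -1).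
      move: (val A 0 0) (val A 1 1) ad => a d ad.
      have /eqP : (`|a| * `|d| = 1)%N by rewrite -abszM ad.
      rewrite muln_eq1 => /andP[/eqP a1 /eqP d1]; move: ad.
      have [->|->] : a = 1 \/ a = -1 by clear -a1; lia.
        by rewrite mul1r => ->; left.
      by rewrite mulN1r => e; right; split => //; rewrite -e opprK.
    - rewrite (_ : A = slzT (val A 0 1)) //; apply: val_inj.
      by rewrite vT [LHS]mat2E a1 d1 c0.
    - pose t' := val A 0 1; pose t := - t'; rewrite (_ : A = slzS * slzS * slzT t)%g; first by apply: (QM) => //; exact: QM.
      by apply: val_inj; rewrite /= vS vT [LHS]mat2E a1 d1 c0 !mat2M /t /t'; congr mat2; ring.
  move=> cn; have [c0|c0] := eqVneq (val A 1 0) 0; first by apply: IH; rewrite c0.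
  pose m := divz (val A 0 0) (val A 1 0).
  pose B := (slzS * slzT (- m) * A)%g.
  have -> : A = (slzT m * slzS^-1 * B)%g.
    rewrite /B !mulgA -[(_ * slzS^-1 * slzS)%g]mulgA mulVg mulg1 -TD subrr.
    by rewrite (_ : slzT 0 = 1%g) ?mul1g //; apply: val_inj; rewrite /= vT mat2_scalar.
  apply: (QM); first exact: QM.
  apply: IH.
  have -> : val B 1 0 = modz (val A 0 0) (val A 1 0).
    have E := divz_eq (val A 0 0) (val A 1 0); rewrite -/m in E.
    have -> : modz (val A 0 0) (val A 1 0) = val A 0 0 - m * val A 1 0.
      by rewrite [in RHS]E addrAC subrr add0r.
    rewrite /B /= vS vT mat2M.
    move: (val A) => a; rewrite !mxE !big_ord_recl big_ord0 !mxE /=.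
    by rewrite (_ : lift ord0 ord0 = 1 :> 'I_2); [ring|exact: val_inj].
  have := modz_ge0 (val A 0 0) c0; have := ltz_mod (val A 0 0) c0.
  move: modz (val A 0 0) (val A 1 0) (val A 1 0) cn => x y; clear; lia.
move=> g; have [A ->] := pclass_surj g; rewrite -[pc A]mulg1.
exact: (main _ A (leqnn _)).
Qed.

Let app (A : SLZ 2) (v : int * int) : int * int :=
  (val A 0 0 * v.1 + val A 0 1 * v.2, val A 1 0 * v.1 + val A 1 1 * v.2).

Let appM A B v : app (A * B)%g v = app A (app B v).
Proof.
rewrite /app /=; move: (val A) (val B) => a b; rewrite !mxE !big_ord_recl !big_ord0 /= !addr0.
rewrite (_ : lift ord0 ord0 = 1 :> 'I_2); last exact: val_inj.
by congr pair; ring.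
Qed.

(* The three cones, permuted cyclically by U; U^i S U^-i maps the two others into
   the i-th one. *)
Let cone (i : 'I_3) (v : int * int) : bool :=
  let: (x, y) := v in let z := - x - y in
  match val i with 0 => 0 < x * y | 1 => 0 < z * x | _ => 0 < y * z end.

Let app1 v : app 1%g v = v.
Proof. by case: v => x y; rewrite /app /= !mxE /= mul1r mul0r addr0 mul0r add0r mul1r. Qed.

Let cone_U i v : cone (i + 1) (app slzU v) = cone i v.
Proof.
case: v => x y; rewrite /app vU !mxE /=; move: i; apply: ord3P => /=; congr (0 < _); ring.
Qed.

Let cone_UX n i v : cone (i *+ 1 + n%:R) (app (slzU ^+ n)%g v) = cone i v.
Proof.
elim: n => [|n IH]; first by rewrite expg0 app1 addr0.
by rewrite expgS appM -IH -(cone_U (i *+ 1 + n%:R)) -addrA -mulrSr.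
Qed.

Let cone_S j v : j != 0 -> cone j v -> cone 0 (app slzS v).
Proof.
case: v => x y; rewrite /app vS !mxE /=; move: j; apply: ord3P => //= _; nia.
Qed.

Let cone_uconj i j v : i != j -> cone j v -> cone i (app (uconj slzS slzU i) v).
Proof.
move=> ij cj; rewrite /uconj !appM.
have -> : cone i (app (slzU ^+ val i)%g (app slzS (app (slzU ^+ val i)^-1%g v))) =
  cone 0 (app slzS (app (slzU ^+ val i)^-1%g v)).
  by rewrite -(cone_UX (val i) 0) mul0rn add0r natr_Zp.
apply: (@cone_S (j - i)); first by rewrite subr_eq0 eq_sym.
rewrite -(cone_UX (val i) (j - i)) -appM mulgV app1 mulr1n natr_Zp subrK //.
Qed.

Let cone_xword w i j v : reduced (rcons w i) -> i != j -> cone j v ->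
  cone (head i w) (app (xword slzS slzU (rcons w i)) v).
Proof.
elim: w => [|l w IH].
  move=> _ ij cj; rewrite (_ : xword _ _ _ = uconj slzS slzU i); first exact: cone_uconj ij cj.
  by rewrite /xword /= mulg1.
move=> /andP[lw rw] ij cj.
rewrite (_ : xword _ _ (rcons (l :: w) i) = (uconj slzS slzU l * xword slzS slzU (rcons w i))%g) // appM.
apply: (@cone_uconj l (head i w)); last exact: IH.
by move: lw; rewrite eq_sym; case: (w).
Qed.

Let cone_disj i j v : cone i v -> cone j v -> i = j.
Proof.
case: v => x y; move: i j; apply: ord3P; apply: ord3P => //=; nia.
Qed.

Let cone_inhab i : exists v, cone i v.
Proof.
by move: i; apply: ord3P; [exists (1, 1)|exists (1, -2)|exists (-2, 1)].
Qed.

Let xword_class w : xword (pc slzS) (pc slzU) w = pc (xword slzS slzU w).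
Proof.
elim: w => //= i w ->; rewrite pclassM; congr (_ * _)%g.
by rewrite /uconj !pclassM pclassV pclassX.
Qed.

Lemma modular_free w n : reduced w -> w != [::] ->
  (xword (pc slzS) (pc slzU) w * pc slzU ^+ n)%g <> 1%g.
Proof.
case/lastP: w => // w i rw _.
rewrite xword_class -pclassX -pclassM => /pclass_eq1/center_scalar/is_scalar_mxP[a aE].
set A := (xword _ _ _ * _)%g in aE.
(* Ping-pong: U^n maps the cone j - n to the cone j, and the word maps this to the cone of its first
   letter. So j must differ from the last letter and j - n from the first one. *)
have [j ij jn] : exists2 j : 'I_3, i != j & j - n%:R != head i w.
  have : exists j : 'I_3, (i != j) && (j != head i w + n%:R).
    by move: (head _ _ + _); move: i {rw A aE}; apply: ord3P; apply: ord3P;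
      [exists 1|exists 2%:R|exists 1|exists 2%:R|exists 2%:R|exists 0|exists 1|exists 0|exists 0].
  by move=> [j /andP[ij jn]]; exists j => //; rewrite subr_eq.
have [v cv] := cone_inhab (j - n%:R).
have cA : cone (head i w) (app A v).
  rewrite appM; apply: (cone_xword rw ij).
  by have := cone_UX n (j - n%:R) v; rewrite mulr1n subrK cv.
move/negP: jn; apply; apply/eqP; apply: (cone_disj cv).
(* A scalar of square 1 preserves the cones, whose definition is quadratic. *)
have a2 : a * a = 1 by have := det4 A; rewrite aE !mxE /= mulr0 subr0.
move: cA; rewrite /app aE !mxE /= !mul0r addr0 add0r.
by move: (head i w) v {cv}; apply: ord3P => -[x y] /=; clear -a2; nia.
Qed.

Lemma modular_order n : (pc slzU ^+ n)%g = 1%g -> (3 %| n)%N.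
Proof.
have U3 : (pc slzU ^+ 3 = 1)%g by rewrite -pclassX !expgS expg0 mulg1 UUU.
rewrite {1}(divn_eq n 3) addnC expgnDr mulnC expgnA U3 expg1n mulg1 -pclassX.
move=> /pclass_eq1/center_scalar/is_scalar_mxP[a]; rewrite /dvdn.
have : (n %% 3 < 3)%N by rewrite ltn_mod.
case: (n %% 3)%N => [|[|[|//]]] // _; rewrite !expgS expg0 mulg1 ?(appM) /= vU ?mat2M.
- by move=> /matrixP/(_ 0 1); rewrite !mxE.
- by move=> /matrixP/(_ 0 1); rewrite !mxE.
Qed.

Theorem PSL2_good_family (R : rcfType) : exists J : nat -> set (PSLZ 2), good_family J.
Proof.
have [q [r [pool r2]]] := exists_sparse_pool.
exists (modker (pc slzS) (pc slzU) r).
apply: (@free_product_good_family _ (pc slzS) (pc slzU) _ _ modular_gen modular_free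
  modular_order q r pool r2 R).
- by rewrite -pclassM SS.
- by rewrite -!pclassM UUU.
Qed.
End ModularGroup.

(** * Free groups *)

Section SL2Group.
Variable F : finFieldType.
HB.instance Definition _ := isGroup.Build (sl2 F) (@slmA F) (@sl1m F) (@slm1 F) (@slVm F) (@slmV F).
End SL2Group.

(* Composing with a transposition adds one prescribed value. *)
Lemma perm_extension (X : finType) (ps : seq (X * X)) :
  uniq (map fst ps) -> uniq (map snd ps) ->
  exists s : {perm X}, forall p, p \in ps -> s p.1 = p.2.
Proof.
elim: ps => [|[x y] ps IH] /=; first by exists 1%g.
move=> /andP[nx ux] /andP[ny uy]; have [s sP] := IH ux uy.
exists (s * tperm (s x) y)%g => -[x' y']; rewrite inE permM => /orP[/eqP[-> ->]|ps'] /=.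
  by rewrite tpermL.
rewrite (sP _ ps') /=; apply: tpermD.
  apply: contraNneq nx => e; apply/mapP; exists (x', y') => //=.
  by apply: (@perm_inj _ s); rewrite e (sP _ ps').
by apply: contraNneq ny => ->; apply/mapP; exists (x', y').
Qed.

Section Generation.
Variables (G : groupType) (S : set G).

Inductive generated : G -> Prop :=
| Generated1 : generated 1%g
| GeneratedM s g : S s -> generated g -> generated (s * g)%g
| GeneratedV s g : S s -> generated g -> generated (s^-1 * g)%g.

Lemma generated_mul g h : generated g -> generated h -> generated (g * h)%g.
Proof.
elim=> [|s {}g Ss _ IH|s {}g Ss _ IH] Hh; first by rewrite mul1g.
  by rewrite -mulgA; apply: GeneratedM => //; exact: IH.
by rewrite -mulgA; apply: GeneratedV => //; exact: IH.
Qed.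

Lemma generated_gen s : S s -> generated s.
Proof. by move=> Ss; rewrite -[s]mulg1; apply: GeneratedM => //; constructor. Qed.

Lemma generated_genV s : S s -> generated s^-1%g.
Proof. by move=> Ss; rewrite -[s^-1%g]mulg1; apply: GeneratedV => //; constructor. Qed.

Lemma generated_inv g : generated g -> generated g^-1%g.
Proof.
elim=> [|s {}g Ss _ IH|s {}g Ss _ IH]; first by rewrite invg1; constructor.
  by rewrite invgM; apply: generated_mul => //; exact: generated_genV.
by rewrite invgM invgK; apply: generated_mul => //; exact: generated_gen.
Qed.

Definition generated_type : Type := {g : G | `[< generated g >]}.
HB.instance Definition _ :=
  [isSub of generated_type for (@sval G (fun g => `[< generated g >]))].
HB.instance Definition _ := [Choice of generated_type by <:].

Let gmul (x y : generated_type) : generated_type :=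
  exist _ (val x * val y)%g (asboolT (generated_mul (asboolW (valP x)) (asboolW (valP y)))).
Let ginv (x : generated_type) : generated_type :=
  exist _ (val x)^-1%g (asboolT (generated_inv (asboolW (valP x)))).
Let gone : generated_type := exist _ 1%g (asboolT Generated1).
Let gmulA : associative gmul. Proof. by move=> x y z; apply: val_inj; rewrite /= mulgA. Qed.
Let gmul1 : left_id gone gmul. Proof. by move=> x; apply: val_inj; rewrite /= mul1g. Qed.
Let g1mul : right_id gone gmul. Proof. by move=> x; apply: val_inj; rewrite /= mulg1. Qed.
Let gmulV : left_inverse gone ginv gmul. Proof. by move=> x; apply: val_inj; rewrite /= mulVg. Qed.
Let gVmul : right_inverse gone ginv gmul. Proof. by move=> x; apply: val_inj; rewrite /= mulgV. Qed.
HB.instance Definition _ := isGroup.Build generated_type gmulA gmul1 g1mul gmulV gVmul.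

Let incl (x : generated_type) : G := val x.
(** The universal property maps G to the subgroup generated by S; followed by the inclusion this is
    the identity, by uniqueness. *)
Lemma free_basis_generated : free_basis S -> forall g, generated g.
Proof.
move=> fS g.
pose f (x : G) : generated_type := insubd (1%g : generated_type) x.
have [h [hs _]] := fS generated_type f.
have [h0 [_ h0u]] := fS G id.
have ihM : {morph (incl \o h) : x y / (x * y)%g >-> (x * y)%g}.
  by move=> x y; rewrite /= gmulfM.
pose ih : {multiplicative G -> G} := HB.pack (incl \o h)
  (isMultiplicative.Build G G (incl \o h) ihM).
pose ii : {multiplicative G -> G} := HB.pack (@id G)
  (isMultiplicative.Build G G id (fun x y => erefl)).
have e1 : ih =1 h0.
  apply: h0u => s Ss /=; rewrite hs // /f /incl val_insubd ifT //.
  exact/asboolT/generated_gen.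
have e2 : ii =1 h0 by apply: h0u.
have -> : g = val (h g) by rewrite -[LHS]/(ii g) e2 -e1.
by have /asboolP := valP (h g).
Qed.
End Generation.

Lemma multiplicative1 (G K : groupType) (h : {multiplicative G -> K}) : h 1%g = 1%g.
Proof. by apply: (mulgI (h 1%g)); rewrite -gmulfM !mulg1. Qed.

Lemma multiplicativeV (G K : groupType) (h : {multiplicative G -> K}) g : h g^-1%g = (h g)^-1%g.
Proof. by apply: (mulgI (h g)); rewrite -gmulfM !mulgV multiplicative1. Qed.

Lemma free_basis_two (G : groupType) (S : set G) : free_basis S ->
  (exists x y : G, (x * y)%g <> (y * x)%g) -> exists a b, [/\ S a, S b & a <> b].
Proof.
move=> fS [x [y xy]]; apply: contrapT => no; apply: xy.
have one a b : S a -> S b -> a = b.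
  by move=> Sa Sb; apply: contrapT => ab; apply: no; exists a, b.
have commV (u v : G) : (u * v = v * u)%g -> (u^-1 * v = v * u^-1)%g.
  by move=> e; apply: (mulgI u); rewrite mulVKg mulgA e mulgK.
have comm1 s g : S s -> generated S g -> (s * g = g * s)%g.
  move=> Ss; elim=> [|t {}g St _ IH|t {}g St _ IH]; first by rewrite mul1g mulg1.
    by rewrite (one _ _ St Ss) -mulgA -IH.
  by rewrite (one _ _ St Ss) mulVKg -mulgA -IH mulKg.
have gx := free_basis_generated fS x; have gy := free_basis_generated fS y.
elim: gx => [|t g St _ IH|t g St _ IH]; first by rewrite mul1g mulg1.
  by rewrite -mulgA IH !mulgA (comm1 _ _ St gy).
by rewrite -mulgA IH !mulgA (commV _ _ (comm1 _ _ St gy)).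
Qed.

Lemma val_gam_pair (F : finFieldType) (r : F) : r ^+ 2 = - 2%:R -> 2%:R != 0 :> F ->
  3%:R != 0 :> F -> forall x y (k : sl2 F), val (gamV r x * gam r y * k)%g =
  - 2%:R^-1 *: (xmat r x *m (xmat r y *m val k)).
Proof.
move=> r2 n2 n3 x y k.
have vM (k1 k2 : sl2 F) : val (k1 * k2)%g = val k1 *m val k2 by [].
rewrite !vM val_gam // val_gamV // -scalemxAl -scalemxAr scalerA -scalemxAl.
have -> : xmat r x *m xmat r 0 *m (xmat r 0 *m xmat r y) = - 2%:R *: (xmat r x *m xmat r y).
  rewrite mulmxA -[xmat r x *m _ *m xmat r 0]mulmxA xmatM // mul_mx_scalar -scalemxAl //.
rewrite -scalemxAl scalerA mulmxA; congr (_ *: _).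
by rewrite -mulrA mulrNN mulVf // mulr1.
Qed.

Section FreeGroup.
Variables (R : rcfType) (q : nat -> nat) (r : forall i, 'F_(q i)).
Hypotheses (pool : sparse_pool q) (r2 : forall i, r i ^+ 2 = - 2%:R).
Variables (G : groupType) (S : set G) (a b : G).
Hypotheses (fS : free_basis S) (Sa : S a) (Sb : S b) (ab : a <> b).

Let n2 i : 2%:R != 0 :> 'F_(q i). Proof. exact: (@pool_nz _ pool i 2 isT). Qed.
Let n3 i : 3%:R != 0 :> 'F_(q i). Proof. exact: (@pool_nz _ pool i 3 isT). Qed.

Local Notation K i := (sl2 'F_(q i)).
Local Notation gm i := (gam (r i)).

Let o1 : 'I_3 := Ordinal (isT : 1 < 3)%N.
Let o2 : 'I_3 := Ordinal (isT : 2 < 3)%N.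

Definition pair_letter (l : 'I_3) : G :=
  match val l with 0 => 1%g | 1 => a | _ => b end.

Let theta_ex i : exists h : {multiplicative G -> K i}, h a = gm i o1 /\ h b = gm i o2.
Proof.
have [h [hS _]] := fS (fun s => if s == a then gm i o1 else gm i o2 : K i).
exists h; rewrite !hS // eqxx; split => //.
by case: eqP => [e|_]; [case: ab|].
Qed.

Definition theta i : {multiplicative G -> K i} := projT1 (cid (theta_ex i)).

Lemma theta_letter i l : theta i (pair_letter l) = gm i l.
Proof.
have [ta tb] := projT2 (cid (theta_ex i)); move: l; apply: ord3P; [|exact: ta|exact: tb].
by rewrite /pair_letter /= multiplicative1 (gam0 (r2 i) (n2 i) (n3 i)).
Qed.

Let Lgen : set G := fun s => s = a \/ s = b.
Local Notation L := (generated Lgen).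

Let letterL l : L (pair_letter l).
Proof.
move: l; apply: ord3P; rewrite /pair_letter /=; first exact: Generated1.
  by apply: generated_gen; left.
by apply: generated_gen; right.
Qed.

(** A pair x^-1 y becomes X_x X_y up to a scalar under theta, as the two factors X_0 cancel. Thus
    elements of L are treated as words of even length in the X_i. *)
Let evp (ps : seq ('I_3 * 'I_3)) : G :=
  foldr (fun p g => (pair_letter p.1)^-1 * pair_letter p.2 * g)%g 1%g ps.
Let flat (ps : seq ('I_3 * 'I_3)) : seq 'I_3 := foldr (fun p w => [:: p.1, p.2 & w]) [::] ps.

Let evp_surj g : L g -> exists ps, evp ps = g.
Proof.
elim=> [|s {}g Ls _ [ps <-]|s {}g Ls _ [ps <-]]; first by exists [::].
  have [l sl] : exists l, s = pair_letter l by case: Ls => ->; [exists o1|exists o2].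
  by exists ((ord0, l) :: ps); rewrite /= {1}/pair_letter /= invg1 mul1g sl.
have [l sl] : exists l, s = pair_letter l by case: Ls => ->; [exists o1|exists o2].
by exists ((l, ord0) :: ps); rewrite /= {2}/pair_letter /= mulg1 sl.
Qed.

Let evp_reduce ps : reduced (flat ps) \/ exists ps', evp ps' = evp ps /\ (size ps' < size ps)%N.
Proof.
elim: ps => [|[x y] ps IH]; first by left.
have [<-|xy] := eqVneq x y.
  by right; exists ps; rewrite /= mulVg mul1g.
case: IH => [red|[ps' [e lt]]]; last by right; exists ((x, y) :: ps'); rewrite /= e ltnS.
case: ps red => [_|[x' y'] ps red]; first by left; rewrite /= eq_sym xy.
have [<-|yx] := eqVneq y x'.
  right; exists ((x, y') :: ps); split; last by [].
  by rewrite /= !mulgA mulgK.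
by left; rewrite /= eq_sym xy /= eq_sym yx.
Qed.

Let evp_minimal g : L g -> exists ps, evp ps = g /\ reduced (flat ps).
Proof.
move=> Lg; pose P n := `[< exists ps, evp ps = g /\ size ps = n >].
have exP : exists n, P n.
  by have [ps e] := evp_surj Lg; exists (size ps); apply/asboolP; exists ps.
have [n /asboolP[ps [e sz]] nmin] := ex_minnP exP.
exists ps; split=> //; case: (evp_reduce ps) => // -[ps' [e' lt]].
suff /nmin : P (size ps') by rewrite leqNgt -sz lt.
by apply/asboolP; exists ps'; rewrite e'.
Qed.

Let theta_evp i ps : exists2 c, c != 0 &
  val (theta i (evp ps)) = c *: foldr (fun l A => xmat (r i) l *m A) 1%:M (flat ps).
Proof.
elim: ps => [|[x y] ps [c c0 IH]] /=.
  by exists 1; rewrite ?oner_eq0 // multiplicative1 scale1r.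
exists (- 2%:R^-1 * c); first by rewrite mulf_neq0 // oppr_eq0 invr_eq0 n2.
have -> : theta i ((pair_letter x)^-1 * pair_letter y * evp ps)%g =
    (gamV (r i) x * gm i y * theta i (evp ps))%g.
  rewrite 2!gmulfM multiplicativeV 2!theta_letter; congr (_ * _ * _)%g.
  apply: (mulgI (gm i x)); rewrite mulgV.
  exact/esym/(gam_gamV (r2 i) (n2 i) (n3 i)).
rewrite (val_gam_pair (r2 i) (n2 i) (n3 i)) IH.
by rewrite -!scalemxAr scalerA.
Qed.

Lemma theta_residual g : L g -> g <> 1%g -> exists i0, forall i, (i0 <= i)%N -> theta i g <> 1%g.
Proof.
move=> /evp_minimal[ps [<- red]] g1.
have f0 : rev (flat ps) != [::].
  by case: ps {red} g1 => [[]//|[x y] ps] _; rewrite -size_eq0 size_rev.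
have rr : reduced (rev (flat ps)) by rewrite reduced_rev.
have [i0 i0P] := qcoord_not_scalar pool r2 (isT : ~~ (2 %| qnorm qone)%Z) rr f0.
exists i0 => i ii e; have [c c0 E] := theta_evp i ps.
apply: (i0P i ii c^-1).
rewrite (qmat_qcoord (r2 i) (n2 i) (n3 i)) (qmat_one (r2 i) (n2 i) (n3 i)) foldl_rev.
move: E; rewrite e => /(congr1 (fun A => c^-1 *: A)); rewrite scalerA mulVf // scale1r => <-.
by rewrite (_ : val (1%g : K i) = 1%:M) ?scalemx1.
Qed.

(** A syllable (v, c, e) stands for v c or v c^-1, with v in L and c a basis element other than a
    and b. *)
Let syl := (G * G * bool)%type.
Let cl (x : syl) : G := if x.2 then x.1.2 else x.1.2^-1%g.
Let evs (l : seq syl) (v : G) : G := foldr (fun x g => x.1.1 * cl x * g)%g v l.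
Let okx (x : syl) : Prop := [/\ L x.1.1, S x.1.2, x.1.2 <> a & x.1.2 <> b].
Let valid (l : seq syl) := forall x, x \in l -> okx x.
Let lmulv v (l : seq syl) vm : seq syl * G :=
  if l is (v', c, e) :: l' then ((v * v', c, e)%g :: l', vm) else ([::], v * vm)%g.

Let lmulvP v l vm : L v -> valid l -> L vm ->
  [/\ evs (lmulv v l vm).1 (lmulv v l vm).2 = (v * evs l vm)%g, valid (lmulv v l vm).1,
      L (lmulv v l vm).2 & size (lmulv v l vm).1 = size l].
Proof.
move=> Lv; case: l => [|[[v' c] e] l] va Lm /=.
  by split=> //; exact: generated_mul.
split=> //; first by rewrite /cl /= !mulgA.
move=> x; rewrite inE => /orP[/eqP->|xl]; last by apply: va; rewrite inE xl orbT.
have [Lv' Sc ca cb] := va _ (mem_head _ _).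
by split=> //=; exact: generated_mul.
Qed.

Let evs_surj g : exists l vm, [/\ valid l, L vm & evs l vm = g].
Proof.
have [: step] @H : forall s e h, S s -> (exists l vm, [/\ valid l, L vm & evs l vm = h]) ->
    exists l vm, [/\ valid l, L vm & evs l vm = ((if e then s else s^-1) * h)%g].
  abstract: step.
  move=> s e h Ss [l [vm [va Lm <-]]].
  have [Ls|nLs] := pselect (Lgen s).
    have Le : L (if e then s else s^-1)%g.
      by case: e; [apply: generated_gen|apply: generated_genV].
    have [e1 e2 e3 _] := lmulvP Le va Lm.
    by exists (lmulv (if e then s else s^-1)%g l vm).1, (lmulv (if e then s else s^-1)%g l vm).2.
  exists ((1%g, s, e) :: l), vm; split=> //=; last by rewrite /cl /= mul1g.
  move=> x; rewrite inE => /orP[/eqP->|xl]; last exact: va.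
  split=> //=; first exact: Generated1.
    by move=> sa; apply: nLs; left.
  by move=> sb; apply: nLs; right.
elim: (free_basis_generated fS g) => [|s {}g Ss _ IH|s {}g Ss _ IH].
- by exists [::], 1%g; split=> //; exact: Generated1.
- exact: (H s true).
- exact: (H s false).
Qed.

Let syllable_minimal g : exists l vm, [/\ valid l, L vm, evs l vm = g &
  forall l1 v c e l2, l <> l1 ++ [:: (v, c, e), (1%g, c, ~~ e) & l2]].
Proof.
pose P n := `[< exists l vm, [/\ valid l, L vm, evs l vm = g & size l = n] >].
have exP : exists n, P n.
  have [l [vm [va Lm e]]] := evs_surj g.
  by exists (size l); apply/asboolP; exists l, vm.
have [n /asboolP[l [vm [va Lm e sz]]] nmin] := ex_minnP exP.
exists l, vm; split=> // l1 v c ep l2 lE.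
have va2 : valid l2 by move=> x xl; apply: va; rewrite lE mem_cat !inE xl !orbT.
have va1 : valid l1 by move=> x xl; apply: va; rewrite lE mem_cat xl.
have [Lv Sc ca cb] : okx (v, c, ep) by apply: va; rewrite lE mem_cat mem_head orbT.
have [e1 e2 e3 e4] := lmulvP Lv va2 Lm.
have cat_evs k1 k2 w : evs (k1 ++ k2) w = evs k1 (evs k2 w) by rewrite /evs foldr_cat.
suff /nmin : P (size (l1 ++ (lmulv v l2 vm).1)).
  by rewrite -sz lE !size_cat e4 leq_add2l /= ltnNge leqnSn.
apply/asboolP; exists (l1 ++ (lmulv v l2 vm).1), (lmulv v l2 vm).2; split=> //.
  by move=> x; rewrite mem_cat => /orP[/va1|/e2].
rewrite -e lE !cat_evs; congr evs; rewrite e1 /= /cl /= mul1g -mulgA; congr (_ * _)%g.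
by clear -Lv; move: ep {Lv} => [] /=; rewrite mulgA ?mulgV ?mulVg mul1g.
Qed.

(* A shortest expression of g in terms of L and the other generators describes a path in
   K x {0, ..., m}, along which the other generators are extended to permutations. *)
Lemma outside_separated g : ~ L g -> exists i0, forall i, (i0 <= i)%N ->
  exists (X : finType) (h : {multiplicative G -> {perm X}}),
    (forall v, L v -> theta i v = 1%g -> h v = 1%g) /\ h g <> 1%g.
Proof.
move=> nL; have [l [vm [va Lm gE nred]]] := syllable_minimal g.
have [i0 i0P] : exists i0, forall i, (i0 <= i)%N -> forall x, x \in l -> x.1.1 <> 1%g -> theta i x.1.1 <> 1%g.
  elim: l va {gE nred} => [|x l IH] va; first by exists 0%N.
  have [|i1 i1P] := IH; first by move=> y yl; apply: va; rewrite inE yl orbT.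
  have [Lx _ _ _] := va _ (mem_head _ _).
  have [x1|x1] := pselect (x.1.1 = 1%g).
    exists i1 => i ii y; rewrite inE => /orP[/eqP->|yl]; first by rewrite x1.
    exact: i1P.
  have [i2 i2P] := theta_residual Lx x1.
  exists (maxn i1 i2) => i; rewrite geq_max => /andP[ii1 ii2] y.
  by rewrite inE => /orP[/eqP-> _|yl]; [exact: i2P|exact: i1P].
exists i0 => i ii; pose m := size l; pose X : finType := (K i * 'I_m.+1)%type.
pose x0 : syl := (1%g, 1%g, true).
(* The path enters layer t at (1, t); the factor in L moves it to [src t], and the letter of the
   syllable must move it on to [dst t] in layer t + 1. *)
pose src (t : nat) : X := (theta i (nth x0 l t).1.1, inord t).
pose dst (t : nat) : X := (1%g, inord t.+1).
pose ep t := (nth x0 l t).2.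
pose fs t := if ep t then src t else dst t.
pose sn t := if ep t then dst t else src t.
pose idx c := [seq t <- iota 0 m | (nth x0 l t).1.2 == c].
have idxP c t : t \in idx c -> (t < m)%N /\ (nth x0 l t).1.2 = c.
  by rewrite mem_filter mem_iota => /andP[/eqP-> /andP[_]].
have ord_eq s t : (s <= m)%N -> (t <= m)%N -> (inord s : 'I_m.+1) = inord t -> s = t.
  by move=> sm tm /(congr1 val); rewrite /= !inordK.
(* The values prescribed for c can conflict only where src s = dst t. Then s = t + 1 and theta kills
   the factor in between, which is 1 by the choice of i; opposite exponents would cancel in the
   shortest expression. *)
have clash c s t : s \in idx c -> t \in idx c -> src s = dst t -> ep s = ep t.
  move=> /idxP[sm sc] /idxP[tm tc] [th /ord_eq st].
  have {}st : s = t.+1 by apply: st => //; exact: ltnW.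
  apply: contrapT => /eqP; rewrite eq_sym => /negPf ne.
  have v1 : (nth x0 l s).1.1 = 1%g.
    apply: contrapT => v1; apply: (i0P i ii (nth x0 l s)) => //; exact: mem_nth.
  apply: (nred (take t l) (nth x0 l t).1.1 c (ep t) (drop t.+2 l)).
  rewrite -[LHS](cat_take_drop t); congr (_ ++ _).
  rewrite (drop_nth x0 tm) -st (drop_nth x0 sm) st; congr [:: _, _ & _].
    by rewrite /ep -tc -!surjective_pairing.
  rewrite -st -v1 -sc; have -> : ~~ ep t = ep s by case: (ep s) (ep t) ne => -[].
  by rewrite /ep -!surjective_pairing.
have ufs c : uniq (map fst [seq (fs t, sn t) | t <- idx c]).
  rewrite -map_comp map_inj_in_uniq ?filter_uniq ?iota_uniq // => s t sc tc /=.
  have [sm _] := idxP _ _ sc; have [tm _] := idxP _ _ tc.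
  rewrite /fs; case: ifP => es; case: ifP => et.
  + by move=> [_ /ord_eq]; apply; exact: ltnW.
  + by move=> /(clash c s t sc tc); rewrite es et.
  + by move=> /esym/(clash c t s tc sc); rewrite es et.
  + by move=> [/ord_eq H]; have [] : s.+1 = t.+1 by exact: H.
have usn c : uniq (map snd [seq (fs t, sn t) | t <- idx c]).
  rewrite -map_comp map_inj_in_uniq ?filter_uniq ?iota_uniq // => s t sc tc /=.
  have [sm _] := idxP _ _ sc; have [tm _] := idxP _ _ tc.
  rewrite /sn; case: ifP => es; case: ifP => et.
  + by move=> [/ord_eq H]; have [] : s.+1 = t.+1 by exact: H.
  + by move=> /esym/(clash c t s tc sc); rewrite es et.
  + by move=> /(clash c s t sc tc); rewrite es et.
  + by move=> [_ /ord_eq]; apply; exact: ltnW.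
have [sg sgP] := choice (fun c => perm_extension (ufs c) (usn c)).
have rinj k : injective (fun x : X => (x.1 * k, x.2)%g : X).
  by move=> [x t] [y u] e; have /= -> := congr1 snd e; have /= /mulIg -> := congr1 fst e.
have [h [hS _]] := fS (fun s => if s == a then perm (rinj (gm i o1)) else
   if s == b then perm (rinj (gm i o2)) else sg s : {perm X}).
have [ta tb] : theta i a = gm i o1 /\ theta i b = gm i o2.
  exact: (projT2 (cid (theta_ex i))).
have hL v x : L v -> h v x = ((x.1 * theta i v)%g, x.2).
  move=> Lv; elim: Lv x => [|s w Ls _ IH|s w Ls _ IH] x.
  - by rewrite !multiplicative1 perm1 mulg1; case: x.
  - rewrite !gmulfM permM IH mulgA; congr (_ * _, _)%g; case: Ls => ->; rewrite hS // ?eqxx ?ta ?tb ?permE //.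
    + by case: eqP => [e|_]; [case: ab|rewrite permE].
    + by case: eqP => [e|_]; [case: ab|rewrite permE].
  - rewrite !gmulfM permM IH mulgA.
    have hs y : h s^-1%g y = ((y.1 * (theta i s)^-1)%g, y.2).
      rewrite multiplicativeV; apply: (@perm_inj _ (h s)); rewrite permKV.
      case: Ls => ->; rewrite hS // ?eqxx ?ta ?tb.
        by rewrite permE /= mulgVK; case: y.
      by case: eqP => [e|_]; [case: ab|rewrite permE /= mulgVK; case: y].
    by rewrite hs multiplicativeV.
exists X, h; split=> [v Lv v1|hg].
  by apply/permP => x; rewrite hL // v1 mulg1 perm1; case: x.
have hc t : (t < m)%N -> h (cl (nth x0 l t)) (src t) = dst t.
  move=> tm; have [_ Sc ca cb] := va _ (mem_nth x0 tm).
  have hcc : h (nth x0 l t).1.2 = sg (nth x0 l t).1.2.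
    by rewrite hS //; case: eqP => // _; case: eqP.
  have tin : t \in idx (nth x0 l t).1.2 by rewrite mem_filter eqxx mem_iota.
  have := sgP (nth x0 l t).1.2 (fs t, sn t) (map_f _ tin); rewrite -hcc /= /fs /sn /cl -/(ep t).
  case: (ep t) => // e; rewrite multiplicativeV; apply: (@perm_inj _ (h (nth x0 l t).1.2)).
  by rewrite permKV.
have path k : (k <= m)%N -> h (evs (drop (m - k) l) vm) (1%g, inord (m - k)) = (theta i vm, inord m).
  elim: k => [_|k IH km]; first by rewrite subn0 drop_oversize // hL // mul1g.
  have tm : (m - k.+1 < m)%N by rewrite ltn_subrL //; exact: leq_trans km.
  rewrite (drop_nth x0 tm) /= !gmulfM !permM (hL (nth x0 l (m - k.+1)).1.1); last first.
    by have [] := va _ (mem_nth x0 tm).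
  rewrite mul1g -/(src (m - k.+1)%N) hc // /dst.
  rewrite (_ : (m - k.+1).+1 = m - k)%N; last by move: km; clear; lia.
  exact: IH (ltnW km).
have := path m (leqnn m); rewrite subnn drop0 gE hg perm1 => -[_ /ord_eq e].
have m0 : m = 0%N by apply/esym/e.
by apply: nL; rewrite -gE; move: m0; rewrite /m; case: (l).
Qed.

Definition finite_index_map (N : set G) : Prop :=
  exists (T : finType) (f : G -> T), forall g h, f g = f h -> N (g^-1 * h)%g.

(** The kernels of theta need not separate elements outside L. J i is therefore cut down by finitely
    many N (i, j), one for each code j < i, all containing the kernel of [theta i] in L; so J i
    meets L in that kernel, as [word_separated] requires. *)
Lemma free_group_good_family : countable [set: G]%classic -> exists J : nat -> set G, good_family J.
Proof.
move=> /countable_injP[code codeI].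
have code_inj x y : code x = code y -> x = y by move=> e; apply: codeI; rewrite ?inE.
pose okN i (N : set G) := [/\ subgroup N, normal N, finite_index_map N &
  forall v, L v -> theta i v = 1%g -> N v].
(* N (i, j) avoids the element of code j as soon as some admissible subgroup does, and is the whole
   group otherwise. *)
have exN (ij : nat * nat) : exists N : set G, okN ij.1 N /\
    forall g, code g = ij.2 -> (exists N0, okN ij.1 N0 /\ ~ N0 g) -> ~ N g.
  case: ij => i j /=.
  have [[g [cg [N0 [ok0 n0]]]]|no] := pselect (exists g, code g = j /\ exists N0, okN i N0 /\ ~ N0 g).
    by exists N0; split=> // g' cg' _; rewrite (code_inj g' g) // cg.
  exists setT; split; first by split=> //; exists unit, (fun _ => tt).
  by move=> g cg N0; case: no; exists g.
have [N NP] := choice exN.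
pose J i : set G := fun x => theta i x = 1%g /\ forall j, (j < i)%N -> N (i, j) x.
exists J; split.
- move=> i; split.
  + by split=> [|j _]; [exact: multiplicative1|have [[[]]] := NP (i, j)].
  + move=> x y [x1 xN] [y1 yN]; split=> [|j ji]; first by rewrite gmulfM x1 y1 mulg1.
    by have [[[_ M _] _ _ _] _] := NP (i, j); apply: M; [exact: xN|exact: yN].
  + move=> x [x1 xN]; split=> [|j ji]; first by rewrite multiplicativeV x1 invg1.
    by have [[[_ _ V] _ _ _] _] := NP (i, j); apply: V; exact: xN.
- move=> i g x [x1 xN]; split=> [|j ji].
    by rewrite !gmulfM x1 mulg1 multiplicativeV mulgV.
  by have [[_ nN _ _] _] := NP (i, j); apply: nN; exact: xN.
- move=> i.
  have fi n : finite_index_map (fun x => forall j, (j < n)%N -> N (i, j) x).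
    elim: n => [|n [T [f fP]]]; first by exists unit, (fun _ => tt).
    have [[_ _ [T' [f' fP']] _] _] := NP (i, n).
    exists (T * T')%type, (fun x => (f x, f' x)) => g h [e e'] j.
    by rewrite ltnS leq_eqVlt => /orP[/eqP->|]; [exact: fP'|exact: fP].
  have [T [f fP]] := fi i.
  apply: (@finite_index _ _ (K i * T)%type (fun x => (theta i x, f x))).
    split.
    + by split=> [|j _]; [exact: multiplicative1|have [[[]]] := NP (i, j)].
    + move=> x y [x1 xN] [y1 yN]; split=> [|j ji]; first by rewrite gmulfM x1 y1 mulg1.
      by have [[[_ M _] _ _ _] _] := NP (i, j); apply: M; [exact: xN|exact: yN].
    + move=> x [x1 xN]; split=> [|j ji]; first by rewrite multiplicativeV x1 invg1.
      by have [[[_ _ V] _ _ _] _] := NP (i, j); apply: V; exact: xN.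
  move=> g h [e e']; split; last exact: fP.
  by rewrite gmulfM multiplicativeV e mulVg.
- move=> g g1; have [Lg|nLg] := pselect (L g).
    have [i0 i0P] := theta_residual Lg g1; exists i0 => i ii [t1 _].
    exact: (i0P i ii).
  have [i0 i0P] := outside_separated nLg.
  exists (maxn i0 (code g).+1) => i; rewrite geq_max => /andP[ii ci] [_ /(_ _ ci)].
  have [_ H] := NP (i, code g); apply: H => //=.
  have [X [h [hL hg]]] := i0P i ii.
  exists (fun x => h x = 1%g); split=> //; split=> //.
  + split; first exact: multiplicative1.
      by move=> x y x1 y1; rewrite gmulfM x1 y1 mulg1.
    by move=> x x1; rewrite multiplicativeV x1 invg1.
  + by move=> x y y1; rewrite !gmulfM y1 mulg1 multiplicativeV mulgV.
  + by exists {perm X}, h => x y e; rewrite gmulfM multiplicativeV e mulVg.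
apply: (@word_separated R q r pool r2 G J pair_letter) => i u v.
have tw w : theta i (gword pair_letter w) = slword r i w.
  by elim: w => [|l w IH] /=; rewrite ?multiplicative1 // gmulfM theta_letter IH.
have Lw w : L (gword pair_letter w).
  by elim: w => [|l w IH] /=; [exact: Generated1|exact: generated_mul].
split=> [[+ _]|e].
  rewrite gmulfM multiplicativeV !tw => /(congr1 (fun x => slword r i u * x)%g).
  by rewrite mulVKg mulg1.
have t1 : theta i ((gword pair_letter u)^-1 * gword pair_letter v)%g = 1%g.
  by rewrite gmulfM multiplicativeV !tw e mulVg.
split=> // j _; have [[_ _ _ H] _] := NP (i, j); apply: H => //.
by apply: generated_mul => //; exact: generated_inv.
Qed.
End FreeGroup.

(** * Congruence subgroups *)

Section Elementary.
Variable k : nat.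
Implicit Types i j l : 'I_k.

Let delta0 i j i' l : j != i' -> delta_mx i j *m delta_mx i' l = 0 :> 'M[int]_k.
Proof. by move=> h; rewrite mul_delta_mx_0. Qed.

Lemma elem_comm i j i' j' s t : i != j -> i' != j' -> j != i' -> j' != i ->
  (elem i j s * elem i' j' t = elem i' j' t * elem i j s)%g.
Proof.
move=> ij ij' h h'; apply: val_inj; rewrite /= !val_elem // !mulmxDl !mulmxDr !mul1mx !mulmx1.
rewrite -!scalemxAl -!scalemxAr !delta0 // !scaler0 !addr0.
by rewrite -!addrA; congr (_ + _); rewrite addrC.
Qed.

Lemma elem_commutator i j l s t : i != j -> j != l -> i != l ->
  (elem i j s * elem j l t = elem i l (s * t) * (elem j l t * elem i j s))%g.
Proof.
move=> ij jl il; apply: val_inj; rewrite /= !val_elem //.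
have a1 : delta_mx i j *m delta_mx j l = delta_mx i l :> 'M[int]_k by rewrite mul_delta_mx.
have a2 : delta_mx j l *m delta_mx i j = 0 :> 'M[int]_k by rewrite delta0 // eq_sym.
have a3 : delta_mx i l *m delta_mx j l = 0 :> 'M[int]_k by rewrite delta0 // eq_sym.
have a4 : delta_mx i l *m delta_mx i j = 0 :> 'M[int]_k by rewrite delta0 // eq_sym.
rewrite [in RHS](_ : (1%:M + t *: delta_mx j l) *m (1%:M + s *: delta_mx i j) =
  1%:M + s *: delta_mx i j + t *: delta_mx j l); last first.
  by rewrite mulmxDl mul1mx mulmxDr mulmx1 -scalemxAl -scalemxAr a2 !scaler0 addr0.
have -> : (1%:M + (s * t) *: delta_mx i l) *m (1%:M + s *: delta_mx i j + t *: delta_mx j l) =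
    1%:M + s *: delta_mx i j + t *: delta_mx j l + (s * t) *: delta_mx i l.
  by rewrite mulmxDl mul1mx !mulmxDr mulmx1 -!scalemxAl -!scalemxAr a3 a4 !scaler0 !addr0.
rewrite mulmxDl mul1mx mulmxDr mulmx1 -scalemxAl -scalemxAr a1 scalerA addrA; congr (_ + _).
by rewrite addrAC.
Qed.
End Elementary.

Section Congruence.
Variables (R : rcfType) (q : nat -> nat) (pool : sparse_pool q) (n : nat).
Local Notation k := n.+3.
Local Notation pc := (@quotient_class (SLZ k) _ : SLZ k -> PSLZ k).
Local Notation M i := 'M['F_(q i)]_k.

Let qp i : prime (q i) := pool_prime pool i.

Definition reduction i (A : SLZ k) : M i := map_mx intr (val A).

Let redM i A B : reduction i (A * B)%g = reduction i A *m reduction i B.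
Proof. by rewrite /reduction map_mxM. Qed.
Let red1 i : reduction i 1%g = 1%:M.
Proof. by rewrite /reduction map_mx1. Qed.

Let redV i A : reduction i A^-1%g *m reduction i A = 1%:M.
Proof. by rewrite -redM mulVg red1. Qed.
Let redV' i A : reduction i A *m reduction i A^-1%g = 1%:M.
Proof. by rewrite -redM mulgV red1. Qed.

Definition scalar_mod i (A : SLZ k) : Prop := exists a, reduction i A = a%:M.

Let scM i A B : scalar_mod i A -> scalar_mod i B -> scalar_mod i (A * B)%g.
Proof. by move=> [a aE] [b bE]; exists (a * b); rewrite redM aE bE -scalar_mxM. Qed.

Let scV i A : scalar_mod i A -> scalar_mod i A^-1%g.
Proof.
move=> [a aE]; have e := redV' i A; rewrite aE mul_scalar_mx in e.
have a0 : a != 0.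
  apply/eqP => a0; move: e; rewrite a0 scale0r => /matrixP/(_ 0 0); rewrite !mxE /= => /eqP.
  by rewrite eq_sym oner_eq0.
exists a^-1; rewrite -[LHS]scale1r -(mulVf a0) -scalerA e scalemx1 //.
Qed.

Let sc_center i A : center A -> scalar_mod i A.
Proof.
move=> /center_scalar/is_scalar_mxP[a aE]; exists (a%:~R).
by rewrite /reduction aE map_scalar_mx.
Qed.

(** Scalar rather than 1 mod q_i, so that the condition does not depend on the representative modulo
    the center. *)
Definition congruence i : set (PSLZ k) := fun g => exists A, g = pc A /\ scalar_mod i A.

Let congE i A : congruence i (pc A) <-> scalar_mod i A.
Proof.
split=> [[B [AB sB]]|sA]; last by exists A.
have : pc (A * B^-1)%g = 1%g by rewrite pclassM pclassV AB mulgV.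
move=> /pclass_eq1/(sc_center i) sc.
by rewrite -[A](mulgVK B); apply: scM.
Qed.

Let cong_subgroup i : subgroup (congruence i).
Proof.
split.
- by exists 1%g; split=> //; exists 1; rewrite red1.
- by move=> _ _ [A [-> sA]] [B [-> sB]]; rewrite -pclassM; apply/congE/scM.
- by move=> _ [A [-> sA]]; rewrite -pclassV; apply/congE/scV.
Qed.

Let cong_normal i : normal (congruence i).
Proof.
move=> g _ [A [-> [a aE]]]; have [B ->] := pclass_surj g.
rewrite -pclassV -!pclassM; apply/congE; exists a.
by rewrite !redM aE -mulmxA mul_scalar_mx -scalemxAr redV' scalemx1.
Qed.

Let cong_finite i : finite_set (lcosets (congruence i)).
Proof.
have [rep repP] := choice (@pclass_surj k).
apply: (@finite_index _ _ (M i) (fun g => reduction i (rep g))) => //.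
move=> g h e; rewrite {1}(repP g) {1}(repP h) -pclassV -pclassM; apply/congE.
by exists 1; rewrite redM -e redV.
Qed.

Let intr_eq0 i (c : int) : c%:~R = 0 :> 'F_(q i) -> (q i %| `|c|)%N.
Proof.
rewrite (dvdn_pcharf (pchar_Fp (qp i))); case: c => m /=; first by rewrite -pmulrn => ->.
by rewrite NegzE mulrNz -pmulrn => /eqP; rewrite oppr_eq0.
Qed.

Let intr_dvd i (c : int) : (q i %| `|c|)%N -> c%:~R = 0 :> 'F_(q i).
Proof.
rewrite (dvdn_pcharf (pchar_Fp (qp i))); case: c => m /=; first by rewrite -pmulrn => /eqP.
by rewrite NegzE mulrNz -pmulrn => /eqP->; rewrite oppr0.
Qed.

Let cong_residual g : g <> 1%g -> exists i0, forall i, (i0 <= i)%N -> ~ congruence i g.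
Proof.
have [A ->] := pclass_surj g => A1.
pose b := (\sum_x \sum_y `|(val A x y)%R|)%N.
have bP x y : (`|(val A x y)%R| <= b)%N.
  rewrite /b (bigD1 x) //= (bigD1 y) //= -addnA leq_addr //.
exists (b + b)%N => i bi /congE[a aE]; apply: A1; apply/pclass_eq1/scalar_center.
have qi : (b + b < q i)%N := leq_ltn_trans bi (pool_gt i pool).
have small (c : int) : (`|c| <= b + b)%N -> c%:~R = 0 :> 'F_(q i) -> c = 0.
  move=> cb /intr_eq0 d; apply/eqP; rewrite -absz_eq0; apply: contraLR isT => c0.
  rewrite -lt0n in c0; have := dvdn_leq c0 d.
  by rewrite leqNgt (leq_ltn_trans cb qi).
have ent x y : (val A x y)%:~R = a *+ (x == y) :> 'F_(q i).
  by move/matrixP: aE => /(_ x y); rewrite !mxE.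
apply/is_scalar_mxP; exists (val A 0 0); apply/matrixP => x y; rewrite !mxE.
have [<-|xy] := eqVneq x y; last first.
  apply: small; first exact: leq_trans (bP x y) (leq_addr _ _).
  by rewrite ent (negPf xy).
rewrite mulr1n; apply/eqP; rewrite -subr_eq0; apply/eqP/small.
  by have := bP x x; have := bP 0 0; move: (val A x x) (val A 0 0) (b) => u v w; clear; lia.
by rewrite rmorphB /= !ent !eqxx subrr.
Qed.

Let i0 : 'I_k := Ordinal (isT : 0 < n.+3)%N.
Let i1 : 'I_k := Ordinal (isT : 1 < n.+3)%N.
Let i2 : 'I_k := Ordinal (isT : 2 < n.+3)%N.

Let cong_elem i a b (c : int) : a != b -> (congruence i (pc (elem a b c)) <-> (q i %| `|c|)%N).
Proof.
move=> ab; split=> [/congE[x /matrixP/(_ a b)]|d]; last first.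
  apply/congE; exists 1; apply/matrixP => u v; rewrite !mxE val_elem // !mxE rmorphD rmorphM /=.
  by rewrite (intr_dvd d) mul0r addr0 rmorph_nat.
rewrite !mxE val_elem // !mxE (negPf ab) !eqxx /= mulr1 add0r mulr0n.
exact: intr_eq0.
Qed.

(* The congruence j-orbit of [phi t] is almost invariant under the p-th powers of the
   elementary matrices, which act on T like generators of (Z/N)^2, hence under [Y]. *)
Lemma congruence_separated : separated_family congruence.
Proof.
move=> I' j jI'; pose p := q j.
pose ep := (elem i0 i1 p%:Z); pose fp := (elem i1 i0 p%:Z).
pose X1 := elem i0 i2 p%:Z; pose X2 := elem i1 i2 p%:Z; pose Y := elem i0 i2 1.
exists [:: pc ep; pc fp; pc X1; pc X2; pc Y], (100 * 100 * p ^ 2)%N.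
move=> I T T' act act' aT aT' sT sT' jI T0 phi small.
have N0 : (0 < \prod_(i <- I) q i)%N by apply: prodn_gt0 => i; exact: prime_gt0.
(* The modulus N + 1 is the product over I, so that the elementary matrices with entry in column i2
   act on T through (Z / (N + 1))^2; it is prime to p because j is not in I. *)
have [N NE] : exists N, (\prod_(i <- I) q i)%N = N.+1 by exists (\prod_(i <- I) q i).-1%N; rewrite prednK.
have dN i : i \in I -> (q i %| N.+1)%N.
  by move=> iI; rewrite -NE (big_rem i) //= dvdn_mulr.
have pN : coprime p N.+1.
  rewrite prime_coprime ?qp // -NE; elim: I jI {sT N0 NE dN} => [|i I IH]; first by rewrite big_nil gtnNdvd // (prime_gt1 (qp j)).
  rewrite inE negb_or => /andP[ji jI]; rewrite big_cons Euclid_dvdM ?qp // negb_or IH // andbT.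
  rewrite dvdn_prime2 ?qp //; apply: contraNneq ji => /(pool_inj pool) ->//.
have [z zP] := exists_prim_root R[i] (ltn0Sn N).
pose X (c : int) := act (pc (elem i0 i2 c)); pose W (c : int) := act (pc (elem i1 i2 c)).
have XD c c' t : X (c + c') t = X c (X c' t).
  by rewrite /X elemD // pclassM aT.2.
have WD c c' t : W (c + c') t = W c (W c' t).
  by rewrite /W elemD // pclassM aT.2.
have Xid c t : (N.+1 %| `|c|)%N -> X c t = t.
  move=> d; apply/sT => i iI; apply/cong_elem => //; exact: dvdn_trans (dN i iI) d.
have Wid c t : (N.+1 %| `|c|)%N -> W c t = t.
  move=> d; apply/sT => i iI; apply/cong_elem => //; exact: dvdn_trans (dN i iI) d.
have XW c c' t : X c (W c' t) = W c' (X c t).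
  by rewrite /X /W -!aT.2 -!pclassM elem_comm.
have Nm (m : nat) : (N.+1 %| `|((m %/ N.+1) * N.+1)%N%:Z|)%N by rewrite absz_nat dvdn_mull.
have Xmod (m : nat) t : X (m %% N.+1)%N%:Z t = X m%:Z t.
  by rewrite [in RHS](divn_eq m N.+1) PoszD XD (Xid _ _ (Nm m)).
have Wmod (m : nat) t : W (m %% N.+1)%N%:Z t = W m%:Z t.
  by rewrite [in RHS](divn_eq m N.+1) PoszD WD (Wid _ _ (Nm m)).
pose al (v : 'I_N.+1 * 'I_N.+1) t := X (val v.1)%:Z (W (val v.2)%:Z t).
have al0 t : al 0 t = t by rewrite /al /= Wid // Xid.
have alD v w t : al (v + w) t = al v (al w t).
  rewrite /al /= Xmod Wmod !PoszD XD WD; congr (X _ _).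
  by rewrite !XW.
have valM (x : 'I_N.+1) m : val (x *+ m) = ((x * m) %% N.+1)%N by rewrite Zp_mulrn.
have gal (v : 'I_N.+1 * 'I_N.+1) t : act (pc ep) (al v t) = al ((v.1 + v.2 *+ p), v.2) (act (pc ep) t).
  rewrite /al /= Xmod PoszD XD valM Xmod /X /W -!aT.2 -!pclassM PoszM; congr (act (pc _) _).
  rewrite ?mulgA [(ep * elem i0 i2 _)%g]elem_comm // -!mulgA; congr (_ * _)%g.
  by rewrite elem_commutator // mulrC.
have hal (v : 'I_N.+1 * 'I_N.+1) t : act (pc fp) (al v t) = al (v.1, (v.2 + v.1 *+ p)) (act (pc fp) t).
  rewrite /al /= Wmod PoszD WD valM Wmod /X /W -!aT.2 -!pclassM PoszM; congr (act (pc _) _).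
  rewrite ?mulgA [(fp * elem i0 i2 _)%g]elem_commutator // -!mulgA.
  rewrite [(fp * elem i1 i2 _)%g]elem_comm // !mulgA; congr (_ * _)%g.
  rewrite [(elem i1 i2 _ * elem i0 i2 _)%g]elem_comm // -!mulgA; congr (_ * _)%g.
  by rewrite -!elemD // addrC mulrC.
have X1E t : X (val (inord 1 : 'I_N.+1))%:Z t = X 1 t.
  case: (posnP N) => [N0'|N1]; last by rewrite /= inordK.
  by rewrite !Xid //; rewrite N0' dvd1n.
have W1E t : W (val (inord 1 : 'I_N.+1))%:Z t = W 1 t.
  case: (posnP N) => [N0'|N1]; last by rewrite /= inordK.
  by rewrite !Wid //; rewrite N0' dvd1n.
have XM (m : nat) t : X ((val (inord 1 : 'I_N.+1) * m)%N)%:Z t = X m%:Z t.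
  elim: m t => [|m IH] t; first by rewrite muln0.
  by rewrite mulnS PoszD XD IH X1E -XD -PoszD add1n.
have WM (m : nat) t : W ((val (inord 1 : 'I_N.+1) * m)%N)%:Z t = W m%:Z t.
  elim: m t => [|m IH] t; first by rewrite muln0.
  by rewrite mulnS PoszD WD IH W1E -WD -PoszD add1n.
have al1 t : al (inord 1 *+ p, 0) t = act (pc X1) t.
  by rewrite /al /= valM Xmod XM Wid.
have al2 t : al (0, inord 1 *+ p) t = act (pc X2) t.
  by rewrite /al /= valM Wmod WM Xid.
have alY t : al (inord 1, 0) t = act (pc Y) t.
  by rewrite /al X1E Wid.
(* The J_j-orbit of phi t: an element of J_j changes it only at points where phi is not equivariant
   under that element. *)
pose Phi t := [set tau | `[< exists g, congruence j g /\ tau = act' g (phi t) >]].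
have [J1 JM JV] := cong_subgroup j.
have PhiE g t : congruence j g -> phi (act g t) = act' g (phi t) -> Phi (act g t) = Phi t.
  move=> Jg e; apply/setP => tau; rewrite !inE; apply/asboolP/asboolP => -[h [Jh ->]].
    by exists (h * g)%g; split; [exact: JM|rewrite e aT'.2].
  by exists (h * g^-1)%g; split; [apply: JM => //; exact: JV|rewrite e -aT'.2 mulgVK].
have Jp a b : a != b -> congruence j (pc (elem a b p%:Z)).
  by move=> ab; apply/cong_elem.
have mv (f : T -> T) g : (forall t, f t = act g t) -> congruence j g ->
    g \in [:: pc ep; pc fp; pc X1; pc X2; pc Y] ->
    10000%:R * p%:R ^+ 2 * #|[set t | Phi (f t) != Phi t]|%:R <= #|T|%:R :> R.
  move=> fE Jg /small; rewrite -(ler_nat R) !natrM -(expr2 p%:R); apply: le_trans.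
  rewrite (_ : 100%:R * 100%:R = 10000%:R :> R); last by lra.
  rewrite ler_wpM2l ?mulr_ge0 ?exprn_ge0 // ler_nat subset_leq_card //.
  apply/fintype.subsetP => t; rewrite !inE fE; apply: contraNN => /eqP e.
  by apply/eqP; exact: PhiE.
have p5 : (5 <= p)%N by apply: leq_trans (pool_ge pool j); rewrite (@leq_trans (2 ^ 3)) // leq_exp2l.
have mem5 (U : eqType) (x1 x2 x3 x4 x5 : U) : let s := [:: x1; x2; x3; x4; x5] in
    [/\ x1 \in s, x2 \in s, x3 \in s, x4 \in s & x5 \in s].
  by rewrite /= !inE !eqxx !orbT.
have [ine inf in1 in2 Yin] := mem5 _ (pc ep) (pc fp) (pc X1) (pc X2) (pc Y).
have main := relative_T zP al0 alD p5 pN (gaction_inj (g := pc ep) aT) (gaction_inj (g := pc fp) aT)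
  gal hal (mv (act (pc ep)) (pc ep) (fun _ => erefl) (Jp i0 i1 isT) ine)
  (mv (act (pc fp)) (pc fp) (fun _ => erefl) (Jp i1 i0 isT) inf)
  (mv _ _ al1 (Jp i0 i2 isT) in1) (mv _ _ al2 (Jp i1 i2 isT) in2).
have errY := small _ Yin.
(* If Y preserves the orbit and phi is equivariant under Y at t, then Y agrees at phi t with an
   element of J_j. The stabilizer there is contained in J_j, so Y would be in J_j, although its
   entry 1 is not divisible by p. *)
have cover : (#|T| <= #|[set t | Phi (al (inord 1, 0%R) t) != Phi t]| +
    #|[set t | phi (act (pc Y) t) != act' (pc Y) (phi t)]|)%N.
  rewrite -cardsT; apply: leq_trans (leq_card_setU _ _); apply: subset_leq_card.
  apply/fintype.subsetP => t _; rewrite !inE alY orbC -implyNb negbK; apply/implyP => /eqP e.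
  apply/eqP => PE; have : phi (act (pc Y) t) \in Phi (act (pc Y) t).
    by rewrite inE; apply/asboolP; exists 1%g; rewrite aT'.1.
  rewrite PE inE => /asboolP[h [Jh]]; rewrite e => /esym/(gaction_eq _ _ _ aT')/sT'/(_ j jI') JY.
  have /cong_elem : congruence j (pc Y) by rewrite -[pc Y](mulVKg h); apply: JM.
  by move=> /(_ isT); rewrite dvdn1 => /eqP q1; have := prime_gt1 (qp j); rewrite q1.
move: main; rewrite -natrM ler_nat => main.
have p1 : (4 <= 100 * 100 * p ^ 2)%N.
  by rewrite -[4%N]muln1 leq_mul ?expn_gt0 ?prime_gt0 ?qp.
have := leq_trans (leq_mul p1 (leqnn #|[set t | phi (act (pc Y) t) != act' (pc Y) (phi t)]|)) errY.
move: T0 main cover; move: #|T| #|[set t | Phi _ != _]| #|[set t | phi _ != _]| => x y w; clear; lia.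
Qed.

Lemma congruence_good_family : good_family congruence.
Proof.
split.
- exact: cong_subgroup.
- exact: cong_normal.
- exact: cong_finite.
- exact: cong_residual.
- exact: congruence_separated.
Qed.
End Congruence.

(** * Entropy of profinite actions *)


From mathcomp Require Import finmap.
From mathcomp Require Import all_classical all_reals all_analysis.
Require Import Defs.

Import numFieldNormedType.Exports.
Local Open Scope classical_set_scope.

Section Chains.
Variables (G : groupType) (J : nat -> set G).
Hypothesis goodJ : good_family J.

Let sJ i : subgroup (J i). Proof. by case: goodJ. Qed.
Let nJ i : normal (J i). Proof. by case: goodJ. Qed.
Let fJ i : finite_set (lcosets (J i)). Proof. by case: goodJ. Qed.

Definition truncation (S : set nat) (n : nat) : set G :=
  [set g | forall i, (i < n)%N -> S i -> J i g].

Let trunc_subgroup S n : subgroup (truncation S n).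
Proof.
split.
- by move=> i _ _; case: (sJ i).
- by move=> x y Hx Hy i ii Si; case: (sJ i) => _ M _; apply: M; [exact: Hx|exact: Hy].
- by move=> x Hx i ii Si; case: (sJ i) => _ _ V; apply: V; exact: Hx.
Qed.

Let trunc_normal S n : normal (truncation S n).
Proof. by move=> g x Hx i ii Si; apply: nJ; exact: Hx. Qed.

Let finite_lcosetsI (A B : set G) : subgroup A -> subgroup B ->
  finite_set (lcosets A) -> finite_set (lcosets B) -> finite_set (lcosets (A `&` B)).
Proof.
move=> sA sB fA fB.
have sAB : subgroup (A `&` B).
  have [A1 AM AV] := sA; have [B1 BM BV] := sB.
  split=> [|x y [? ?] [? ?]|x [? ?]]; first by split.
    by split; [exact: AM|exact: BM].
  by split; [exact: AV|exact: BV].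
apply: (@sub_finite_set _ _ [set (X `&` Y) | X in lcosets A & Y in lcosets B]).
  move=> _ [g _ <-]; exists (lcoset A g); first by exists g.
  exists (lcoset B g); first by exists g.
  apply/seteqP; split=> x.
    move=> [/(lcosetE sA) xA /(lcosetE sB) xB]; apply/(lcosetE sAB); by split.
  by move=> /(lcosetE sAB)[xA xB]; split; [apply/(lcosetE sA)|apply/(lcosetE sB)].
exact: finite_image2.
Qed.

Let trunc_finite S n : finite_set (lcosets (truncation S n)).
Proof.
elim: n => [|n IH].
  rewrite (_ : truncation S 0 = setT); last by apply/seteqP; split.
  apply: (@sub_finite_set _ _ [set setT]); last exact: finite_set1.
  move=> _ [g _ <-]; apply/seteqP; split=> // x _; apply/lcosetE => //.
have -> : truncation S n.+1 = truncation S n `&` (if `[< S n >] then J n else setT).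
  apply/seteqP; split=> g.
    move=> H; split; first by move=> i ii; apply: H; exact: ltnW.
    by case: asboolP => // Sn; exact: H.
  move=> [H Hn] i; rewrite ltnS leq_eqVlt => /orP[/eqP->|]; last exact: H.
  by move=> /asboolP Sn; move: Hn; rewrite Sn.
apply: finite_lcosetsI => //; case: asboolP => // _.
apply: (@sub_finite_set _ _ [set setT]); last exact: finite_set1.
move=> _ [g _ <-]; apply/seteqP; split=> // x _; apply/lcosetE => //.
Qed.

Let trunc_desc S n : truncation S n.+1 `<=` truncation S n.
Proof. by move=> g H i ii; apply: H; exact: ltnW. Qed.

Definition truncation_chain (S : set nat) : chain G :=
  Chain (trunc_subgroup S) (trunc_finite S) (trunc_desc (S := S)).

Lemma truncation_chain_normal S : normal_chain (truncation_chain S).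
Proof. exact: trunc_normal. Qed.

Lemma level_act_fix S n g (c : level (truncation_chain S) n) :
  level_act g c = c <-> truncation S n g.
Proof.
have [h ->] := cls_surj c; rewrite level_act_cls cls_eq /=.
have [_ _ V] := trunc_subgroup S n; rewrite invgM.
split=> Hg.
  have := V _ (trunc_normal h Hg).
  by rewrite !mulgA mulgV mul1g mulgK invgK.
by have := trunc_normal h^-1%g (V _ Hg); rewrite invgK.
Qed.

Definition truncation_index (S : set nat) n : seq nat := [seq i <- iota 0 n | `[< S i >]].

Lemma mem_truncation_index S n i : (i \in truncation_index S n) <-> (i < n)%N /\ S i.
Proof.
rewrite mem_filter mem_iota add0n /=; split=> [/andP[/asboolP]//|[ii Si]].
by rewrite ii andbT; apply/asboolP.
Qed.

Lemma level_stabilizers S n :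
  stabilizers J (@level_act G (truncation_chain S) n) (truncation_index S n).
Proof.
move=> t g; rewrite level_act_fix; split=> H i.
  by move=> /mem_truncation_index[]; exact: H.
by move=> ii Si; apply: H; apply/mem_truncation_index.
Qed.

Lemma level_gaction S n : gaction (@level_act G (truncation_chain S) n).
Proof. by split=> [t|g h t]; [exact: level_act1|exact: level_actM]. Qed.

Lemma truncation_free (R : realType) (S : set nat) :
  (forall i0, exists2 i, (i0 <= i)%N & S i) -> free_action (profinite_action R (truncation_chain S)).
Proof.
move=> Sinf g g1; rewrite (_ : [set x | _] = set0) ?measure0 //.
apply/seteqP; split=> // x /= gx.
have [_ _ _ /(_ g g1)[i0 i0P] _] := goodJ.
have [i ii Si] := Sinf i0; apply: (i0P i ii).
have : level_act g (coord i.+1 x) = coord i.+1 x by rewrite -[RHS]/(coord i.+1 x) -[in RHS]gx.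
by move=> /level_act_fix; apply.
Qed.

End Chains.

Section GeneratedAlgebra.
Variables (R : realType) (G : groupType) (a : pmp_action R G).
Variables (alpha : set (set a)) (E : set G).
Hypotheses (fpa : finite_partition alpha) (E1 : E 1%g).
Local Notation P := (join_translates alpha E).

Lemma partition_block (x : a) : exists2 A, alpha A & A x.
Proof.
by case: fpa => _ _ [cov _ _]; have : [set: a] x by []; rewrite -cov => -[A aA Ax]; exists A.
Qed.

Lemma partition_eq A B x : alpha A -> alpha B -> A x -> B x -> A = B.
Proof. by case: fpa => _ _ [_ /trivIsetP tr _] aA aB Ax Bx; apply: contrapT => /eqP AB;
  have := tr _ _ aA aB AB; move=> /seteqP[+ _] => /(_ x); apply. Qed.

Lemma translateE g A (x : a) : translate g A x <-> A (pmp_act g^-1%g x).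
Proof.
split=> [[y Ay <-]|Ax]; first by rewrite -pmp_actM mulVg pmp_act1.
by exists (pmp_act g^-1%g x) => //; rewrite -pmp_actM mulgV pmp_act1.
Qed.

Lemma join_block (x : a) : exists2 B, P B & B x.
Proof.
have /choice[c cP] : forall f, exists A, alpha A /\ A (pmp_act f^-1%g x).
  by move=> f; have [A aA Ax] := partition_block (pmp_act f^-1%g x); exists A.
exists (\bigcap_(f in E) translate f (c f)); last first.
  by move=> f Ef; apply/translateE; have [] := cP f.
split; last by exists c; split => // f _; have [] := cP f.
by exists x => f Ef; apply/translateE; have [] := cP f.
Qed.

Lemma saturated_algebra (V : set a) :
  (forall B x y, P B -> B x -> B y -> V x -> V y) -> generated_algebra P V.
Proof.
move=> sat; exists [set B | P B /\ B `<=` V]; first by move=> B [].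
apply/seteqP; split=> x; last by move=> [B [_ BV] /BV].
move=> Vx; have [B PB Bx] := join_block x; exists B => //; split=> // y By.
exact: sat PB Bx By Vx.
Qed.

Lemma algebra_saturated V B x y : generated_algebra P V -> P B -> B x -> B y -> V x -> V y.
Proof.
move=> [Q QP ->] PB Bx By [B' QB' B'x]; exists B' => //.
have [_ [c [ca BE]]] := PB; have [_ [c' [ca' BE']]] := QP _ QB'.
rewrite BE' => f Ef.
have cf : c f = c' f.
  apply: (@partition_eq _ _ (pmp_act f^-1%g x)); [exact: ca|exact: ca'| |].
    by apply/translateE; move: Bx; rewrite BE; apply.
  by apply/translateE; move: B'x; rewrite BE'; apply.
by rewrite -cf; move: By; rewrite BE; apply.
Qed.

Lemma translate_algebra A f : alpha A -> E f -> generated_algebra P (translate f A).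
Proof.
move=> aA Ef; apply: saturated_algebra => B x y [_ [c [ca ->]]] Bx By /translateE Ax.
have e : c f = A.
  apply: (@partition_eq _ _ (pmp_act f^-1%g x)) => //; first exact: ca.
  by apply/translateE/Bx.
by rewrite -e; exact: By.
Qed.

Lemma block_algebra A : alpha A -> generated_algebra P A.
Proof.
move=> aA; have := translate_algebra aA E1.
rewrite (_ : translate 1%g A = A) //; apply/seteqP; split=> x.
  by move=> /translateE; rewrite invg1 pmp_act1.
by move=> Ax; apply/translateE; rewrite invg1 pmp_act1.
Qed.

Lemma algebraC V : generated_algebra P V -> generated_algebra P (~` V).
Proof.
move=> aV; apply: saturated_algebra => B x y PB Bx By nV Vy; apply: nV.
exact: (algebra_saturated aV PB By Bx Vy).
Qed.

Lemma algebraU V W : generated_algebra P V -> generated_algebra P W -> generated_algebra P (V `|` W).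
Proof.
move=> aV aW; apply: saturated_algebra => B x y PB Bx By [Vx|Wx].
  by left; exact: (algebra_saturated aV PB Bx By).
by right; exact: (algebra_saturated aW PB Bx By).
Qed.

Lemma algebra0 : generated_algebra P set0.
Proof. by apply: saturated_algebra. Qed.

Variables (T : finType) (phi : set a -> {set T}).
Hypothesis hom : measure_algebra_hom P phi.

Lemma hom0 : phi set0 = finset.set0.
Proof. by case: hom => _ _ H0; apply: H0; [exact: algebra0|rewrite measure0]. Qed.

Lemma homI V W : generated_algebra P V -> generated_algebra P W ->
  phi (V `&` W) = (phi V :&: phi W)%SET.
Proof.
case: hom => HU HC _ aV aW.
have -> : V `&` W = ~` (~` V `|` ~` W) by rewrite setCU !setCK.
rewrite HC; last by apply: algebraU; exact: algebraC.
rewrite HU; [|exact: algebraC|exact: algebraC].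
by rewrite !HC // finset.setCU !finset.setCK.
Qed.

Lemma hom_cover (c : T) : exists2 A, alpha A & c \in phi A.
Proof.
case: fpa => /finite_seqP[s sE] _ _; case: hom => HU HC H0.
have key (l : seq (set a)) : (forall A, A \in l -> alpha A) ->
    generated_algebra P (\big[setU/set0]_(A <- l) A) /\
    (c \in phi (\big[setU/set0]_(A <- l) A) -> exists2 A, A \in l & c \in phi A).
  elim: l => [|A l IH] la; first by rewrite big_nil hom0 inE; split => //; exact: algebra0.
  have [|gl IHl] := IH; first by move=> B Bl; apply: la; rewrite inE Bl orbT.
  have gA : generated_algebra P A by apply/block_algebra/la; rewrite mem_head.
  rewrite big_cons; split; first exact: algebraU.
  rewrite HU // finset.inE => /orP[cA|/IHl[B Bl cB]]; first by exists A => //; rewrite mem_head.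
  by exists B => //; rewrite inE Bl orbT.
have sa A : A \in s -> alpha A by move=> As; rewrite sE.
have [_ H] := key s sa.
have [|A As cA] := H; last by exists A => //; exact: sa.
rewrite (_ : \big[setU/set0]_(A <- s) A = ~` set0).
  by rewrite HC ?hom0 ?finset.inE //; exact: algebra0.
apply/seteqP; split=> x; first by move=> _ [].
move=> _; have [A aA Ax] := partition_block x.
have mem (l : seq (set a)) B : B \in l -> B x -> (\big[setU/set0]_(C <- l) C) x.
  elim: l => // C l IH; rewrite inE big_cons => /orP[/eqP->|Bl] Bx; first by left.
  by right; exact: IH.
by apply: (mem s A) => //; move: aA; rewrite sE.
Qed.

End GeneratedAlgebra.

(** * No homomorphisms into another approximation *)

Section Distinct.
Variables (R : realType) (U : set_system nat) (F G : groupType).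
Variables (pi : {multiplicative F -> G}) (rho : G -> F).
Hypothesis rho_section : forall g : G, pi (rho g) = g.
Variables (J : nat -> set G) (goodJ : good_family J) (S S' : set nat) (j : nat).
Hypotheses (S'j : S' j) (Sj : ~ S j).
Local Notation H := (truncation_chain goodJ S).
Local Notation H' := (truncation_chain goodJ S').
Local Notation a := (profinite_action R H').

(** xi is refined by the cylinders of level j + 1, the first level that involves J_j. A homomorphism
    phi assigns to each point c of a level of H a block A with c in phi A, hence a coset at level j
    + 1 of H'; this map would be almost equivariant, against [separated_family]. *)
Lemma hom_count_eq0 (xi : set (set a)) : finite_partition xi ->
  exists alpha E delta, [/\ finite_partition alpha, refines alpha xi, finite_set E /\ E 1%g,
    0 < delta & forall n, sofic_hom_count rho xi alpha E delta (level_action pi H n) = 0%N].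
Proof.
move=> fxi; pose m := j.+1.
pose cyl (e : level H' m) : set a := [set x : invlim_space H' | coord m x = e].
pose alpha : set (set a) := [set A | A !=set0 /\ exists B e, xi B /\ A = B `&` cyl e].
have [fin mes [cov tr ne]] := fxi.
have cylm e : measurable (cyl e).
  apply: sub_sigma_algebra; exists m, (finset.set1 e); apply/seteqP; split=> x /=.
    by move=> xe; rewrite finset.inE xe.
  by rewrite finset.inE => /eqP.
have fpa : finite_partition alpha.
  split.
  - apply: (@sub_finite_set _ _ [set (B `&` cyl e) | B in xi & e in [set: level H' m]]).
      by move=> A [_ [B [e [xB ->]]]]; exists B => //; exists e.
    by apply: finite_image2 => //; exact: finite_finset.
  - by move=> A [_ [B [e [xB ->]]]]; apply: measurableI => //; exact: mes.
  split.
  - apply/seteqP; split=> // x _; have [B xB Bx] := partition_block fxi x.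
    exists (B `&` cyl (coord m x)) => //; split; first by exists x.
    by exists B, (coord m x).
  - apply/trivIsetP => A A' [_ [B [e [xB ->]]]] [_ [B' [e' [xB' ->]]]] ne'.
    apply/seteqP; split=> // x [[Bx ex] [Bx' ex']]; move/eqP: ne'; apply.
    by rewrite (partition_eq fxi xB xB' Bx Bx') -ex -ex'.
  - by move=> A [].
have ref : refines alpha xi by move=> A [_ [B [e [xB ->]]]]; exists B => //; exact: subIsetl.
have jI : j \in truncation_index S' m by apply/mem_truncation_index.
have [_ _ _ _ sep] := goodJ; have [E0 [d sepE]] := sep _ _ jI.
have [fa _ _] := fpa; have /finite_seqP[s sE] := fa.
(* The map fails to be equivariant only where some block does, so its errors add up to at most (size
   s) delta, and (size s) d delta < 1. *)
pose delta : R := ((size s).+1 * d.+1)%:R^-1.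
have delta0 : 0 < delta by rewrite invr_gt0 ltr0n.
pose E : set G := [set` (1%g :: E0)].
have E1 : E 1%g by rewrite /E /= mem_head.
exists alpha, E, delta; split => //.
  by split=> //; rewrite /E; exact: finite_seq.
move=> n; apply/eqP; rewrite /sofic_hom_count cards_eq0; apply/eqP/setP => w.
rewrite !finset.inE; apply/negbTE/negP => /asboolP[phi [hom small _] _].
have Phi_ex (c : level H n) : exists p : set a * level H' m,
    [/\ alpha p.1, c \in phi p.1 & p.1 `<=` cyl p.2].
  have [A aA cA] := hom_cover fpa E1 hom c; have [_ [B [e [xB AE]]]] := aA.
  by exists (A, e); split=> //=; rewrite AE; exact: subIsetr.
have [Psi PsiP] := choice Phi_ex.
pose Phi c := (Psi c).2.
have nin : j \notin truncation_index S n by apply/negP => /mem_truncation_index[].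
have K := sepE (truncation_index S n) _ _ _ _ (level_gaction goodJ S n)
  (level_gaction goodJ S' m) (@level_stabilizers G J goodJ S n) (@level_stabilizers G J goodJ S' m)
  nin (level_gt0 H n) Phi.
apply: K; move=> g gE; have Eg : E g by rewrite /E /= in_cons gE orbT.
pose bad A := symdiff (@level_act G H n g @: phi A)%SET (phi (translate g A)).
have badP A : alpha A -> (#|bad A|%:R <= delta * #|level H n|%:R :> R).
  move=> aA; have := small A g aA Eg; rewrite /ncounting ltr_pdivrMr; last first.
    by rewrite ltr0n level_gt0.
  move=> /ltW; rewrite /bad.
  rewrite (_ : (fin_act (rho g) @: phi A)%SET = (@level_act G H n g @: phi A)%SET) //.
  by apply: eq_imset => c; rewrite /fin_act /= rho_section.
have incl : (#|[set c | Phi (level_act g c) != level_act g (Phi c)]%SET| <=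
    \sum_(A <- s) #|bad A|)%N.
  rewrite -(card_imset _ (@level_act_inj G H n g)).
  apply: (@leq_trans #|(\bigcup_(A <- s) bad A)%SET|).
    apply/subset_leq_card/fintype.subsetP => _ /imsetP[c + ->]; rewrite finset.inE => /eqP nc.
    have [aA cA Ae] := PsiP c; have [aA' cA' Ae'] := PsiP (level_act g c).
    rewrite (big_rem (Psi c).1) /=; last by move: aA; rewrite sE.
    rewrite finset.inE; apply/orP; left; rewrite !finset.inE; apply/orP; left.
    rewrite imset_f // andbT; apply/negP => cgA; apply: nc.
    have gA := translate_algebra fpa aA Eg.
    have := homI fpa hom (block_algebra fpa E1 aA') gA => /setP/(_ (level_act g c)).
    rewrite finset.inE cA' cgA /= => inI.
    (* The image of this intersection under phi contains the point [level_act g c], so it is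
       nonempty; any x in it has both cosets as its coordinate. *)
    have [x [A'x gx]] : (Psi (level_act g c)).1 `&` translate g (Psi c).1 !=set0.
      apply/set0P; apply/eqP => e; move: inI; rewrite e (hom0 fpa hom) finset.inE.
      by [].
    have /= e1 := Ae' _ A'x; move/translateE: gx => /Ae /= e2.
    rewrite /Phi -e1 -e2 coord_act -level_actM mulgV level_act1 //.
  elim: (s) => [|A l IH]; first by rewrite !big_nil cards0.
  rewrite !big_cons; apply: leq_trans (leq_card_setU _ _) _; exact: leq_add.
have sumb : ((\sum_(A <- s) #|bad A|)%N%:R <= (size s)%:R * (delta * #|level H n|%:R) :> R).
  have sa A : A \in s -> alpha A by move=> As; rewrite sE.
  rewrite natr_sum big_seq; apply: (@le_trans _ _ (\sum_(A <- s | A \in s) delta * #|level H n|%:R)).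
    by apply: ler_sum => A /sa; exact: badP.
  by rewrite -big_seq big_const_seq count_predT iter_addr_0 mulr_natl.
rewrite -(ler_nat R) natrM.
have He : #|[set c | Phi (level_act g c) != level_act g (Phi c)]%SET|%:R <=
    (size s)%:R * (delta * #|level H n|%:R) :> R by apply: le_trans sumb; rewrite ler_nat.
have N0 : 0 < #|level H n|%:R :> R by rewrite ltr0n level_gt0.
have dE : (size s).+1%:R * d.+1%:R * delta = 1 by rewrite /delta natrM mulfV // -natrM pnatr_eq0.
have s0 : 0 <= (size s)%:R :> R by []. have d0 : 0 <= d%:R :> R by [].
rewrite -!natr1 in dE.
apply: le_trans (ler_wpM2l d0 He) _; rewrite mulrA mulrA -[leRHS]mul1r ler_pM2r //.
move: s0 d0 delta0 dE; move: ((size s)%:R : R) (d%:R : R) (delta) => x y t x0 y0 t0 dE.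
have : 0 <= (x + y + 1) * t by rewrite mulr_ge0 ?addr_ge0 // ltW.
lra.
Qed.
End Distinct.

(** * Approximation of measurable sets by cylinders *)

Section Approximation.
Variables (R : realType) (G : groupType) (H : chain G).
Local Notation X := (invlim_space H).
Local Notation mu := (invlim_measure R (H := H)).

Definition sdiff (T : Type) (A B : set T) : set T := (A `\` B) `|` (B `\` A).

Definition cyl n (S : {set level H n}) : set X := [set x | coord n x \in S].

Lemma cyl_measurable n S : measurable (@cyl n S).
Proof. by apply: sub_sigma_algebra; exists n, S. Qed.

Lemma sdiff_measurable (A B : set X) : measurable A -> measurable B -> measurable (sdiff A B).
Proof. by move=> mA mB; apply: measurableU; exact: measurableD. Qed.

Definition approximable (A : set X) : Prop := measurable A /\
  forall e : R, 0 < e -> exists n S, (mu (sdiff A (@cyl n S)) <= e%:E)%E.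

Lemma approximableC A : approximable A -> approximable (~` A).
Proof.
move=> [mA apA]; split; first exact: measurableC.
move=> e e0; have [n [S leS]] := apA e e0; exists n, (~: S)%SET.
rewrite (_ : sdiff _ _ = sdiff A (cyl S)) //.
apply/seteqP; split=> x; rewrite /sdiff /cyl /setD /= finset.inE.
  by move=> [[nA /negP]|[/negP nS /contrapT Ax]]; [rewrite negbK => ?; right|left].
by move=> [[Ax nS]|[xS nA]]; [right; split; [apply/negP|]|left; split => //; apply/negP; rewrite negbK].
Qed.

Lemma approximableU A B : approximable A -> approximable B -> approximable (A `|` B).
Proof.
move=> [mA apA] [mB apB]; split; first exact: measurableU.
move=> e e0; have e2 : 0 < e / 2%:R by rewrite divr_gt0.
have [n [S leS]] := apA _ e2; have [m [S' leS']] := apB _ e2.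
pose k := maxn n m.
exists k, ((@down G H n k @^-1: S) :|: (@down G H m k @^-1: S'))%SET.
have cE : cyl ((@down G H n k @^-1: S) :|: (@down G H m k @^-1: S'))%SET = cyl S `|` cyl S'.
  rewrite /cyl (cylinderS S (leq_maxl n m)) (cylinderS S' (leq_maxr n m)).
  by apply/seteqP; split=> x /=; rewrite finset.in_setU; [move=> /orP|move=> ?; apply/orP].
rewrite cE; apply: (@le_trans _ _ (mu (sdiff A (cyl S)) + mu (sdiff B (cyl S')))%E).
  apply: le_trans; last first.
    by apply: measureU2; apply: sdiff_measurable => //; exact: cyl_measurable.
  apply: le_measure; rewrite ?inE.
  - by apply: sdiff_measurable; apply: measurableU => //; exact: cyl_measurable.
  - by apply: measurableU; apply: sdiff_measurable => //; exact: cyl_measurable.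
  by move=> x; rewrite /sdiff /setD /=; tauto.
by rewrite (_ : e%:E = (e / 2%:R)%:E + (e / 2%:R)%:E)%E ?leeD // -EFinD -splitr.
Qed.

Lemma approximable_bigcup (F : nat -> set X) : (forall k, approximable (F k)) ->
  approximable (\bigcup_k F k).
Proof.
move=> apF; have mF k : measurable (F k) by case: (apF k).
have mU : measurable (\bigcup_k F k) by exact: bigcupT_measurable.
split => // e e0; have e2 : 0 < e / 2%:R by rewrite divr_gt0.
pose W n := \big[setU/set0]_(k < n) F k.
have apW n : approximable (W n).
  elim: n => [|n IH]; last by rewrite /W big_ord_recr; exact: approximableU.
  rewrite /W big_ord0; split=> // e' e'0; exists 0%N, finset.set0.
  rewrite (_ : sdiff _ _ = set0) ?measure0 ?lee_fin ?ltW //.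
  by apply/seteqP; split=> x //; rewrite /sdiff /cyl /setD /= finset.inE => -[[]|[]].
pose V n := (\bigcup_k F k) `\` W n.
have mW n : measurable (W n) by case: (apW n).
have cV : mu (V n) @[n --> \oo] --> mu (\bigcap_n V n).
  apply: nonincreasing_cvg_mu => //.
  - by apply: (le_lt_trans (probability_le1 _ _)); [exact: measurableD|rewrite ltry].
  - by move=> n; exact: measurableD.
  - by apply: bigcap_measurable => // n _; exact: measurableD.
  - move=> n m nm; apply/subsetPset; apply: setDS; rewrite /W.
    rewrite -!bigcup_mkord; apply: bigcup_subset => k /= kn; exact: leq_trans kn nm.
have V0 : \bigcap_n V n = set0.
  apply/seteqP; split=> // x Vx; have [[k _ Fk] _] := Vx 0%N I.
  have [_] := Vx k.+1 I; apply; rewrite /W -bigcup_mkord; exists k => //=.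
move: cV; rewrite V0 measure0 => cV.
have [n nV] : exists n, (mu (V n) <= (e / 2%:R)%:E)%E.
  have fV n : mu (V n) \is a fin_num by apply: fin_num_measure; exact: measurableD.
  have cv : (fine \o (fun n => mu (V n))) n @[n --> \oo] --> (0 : R) by apply: (fine_cvg cV).
  have [n _ /(_ n (leqnn n)) nV] := cvgr_lt (0 : R) cv (e / 2%:R) e2.
  by exists n; rewrite -(fineK (fV n)) lee_fin ltW.
have [_ /(_ _ e2)[m [S leS]]] := apW n; exists m, S.
apply: (@le_trans _ _ (mu (V n) + mu (sdiff (W n) (cyl S)))%E).
  apply: le_trans; last first.
    apply: measureU2; first exact: measurableD.
    by apply: sdiff_measurable => //; exact: cyl_measurable.
  apply: le_measure; rewrite ?inE.
  - by apply: sdiff_measurable => //; exact: cyl_measurable.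
  - apply: measurableU; first exact: measurableD.
    by apply: sdiff_measurable => //; exact: cyl_measurable.
  have WU : W n `<=` \bigcup_k F k by rewrite /W -bigcup_mkord; exact: bigcup_subset.
  move=> x; rewrite /sdiff /V /setD /=; have := WU x; have [] := pselect (W n x); tauto.
by rewrite (_ : e%:E = (e / 2%:R)%:E + (e / 2%:R)%:E)%E ?leeD // -EFinD -splitr.
Qed.

Lemma measurable_approximable (A : set X) : measurable A -> approximable A.
Proof.
move=> mA; suff : @measurable _ X `<=` approximable by apply.
apply: smallest_sub.
  split=> [|B apB|F apF].
  - split=> // e e0; exists 0%N, finset.set0.
    rewrite (_ : sdiff _ _ = set0) ?measure0 ?lee_fin ?ltW //.
    by apply/seteqP; split=> x //; rewrite /sdiff /cyl /setD /= finset.inE => -[[]|[]].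
  - by rewrite setTD; exact: approximableC.
  - exact: approximable_bigcup.
move=> _ [n [S ->]]; split; first exact: (@cyl_measurable n S).
move=> e e0; exists n, S; rewrite (_ : sdiff _ _ = set0) ?measure0 ?lee_fin ?ltW //.
by apply/seteqP; split=> x //; rewrite /sdiff /cyl /setD /=; tauto.
Qed.

Lemma approximation_level (s : seq (set X)) (e : R) : 0 < e ->
  (forall A, A \in s -> measurable A) ->
  exists n0, forall n, (n0 <= n)%N -> exists S : set X -> {set level H n},
    forall A, A \in s -> (mu (sdiff A (cyl (S A))) <= e%:E)%E.
Proof.
move=> e0; elim: s => [|A s IH] ms; first by exists 0%N => n _; exists (fun _ => finset.set0).
have [|n0 n0P] := IH; first by move=> B Bs; apply: ms; rewrite inE Bs orbT.
have [_ /(_ _ e0)[m [SA leA]]] := measurable_approximable (ms A (mem_head _ _)).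
exists (maxn n0 m) => n; rewrite geq_max => /andP[nn0 nm].
have [S SP] := n0P n nn0.
exists (fun B => if `[< B = A >] then (@down G H m n @^-1: SA)%SET else S B) => B.
case: asboolP => [-> _|BA]; first by rewrite /cyl -(cylinderS SA nm).
by rewrite inE => /orP[/eqP//|]; exact: SP.
Qed.

Lemma measure_bigU_le (s : seq (set X)) (e : R) :
  (forall A, A \in s -> measurable A /\ (mu A <= e%:E)%E) ->
  measurable (\big[setU/set0]_(A <- s) A) /\
  (mu (\big[setU/set0]_(A <- s) A) <= ((size s)%:R * e)%:E)%E.
Proof.
elim: s => [|A s IH] ms; first by rewrite big_nil measure0 mul0r; split.
have [|mU leU] := IH; first by move=> B Bs; apply: ms; rewrite inE Bs orbT.
have [mA leA] := ms A (mem_head _ _).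
rewrite big_cons; split; first exact: measurableU.
apply: le_trans (measureU2 _ mA mU) _.
by rewrite /= -natr1 mulrDl mul1r addrC EFinD leeD.
Qed.

End Approximation.

Section JoinFinite.
Variables (R : realType) (G : groupType) (a : pmp_action R G).
Variables (alpha : set (set a)) (E : set G).
Hypotheses (fpa : finite_partition alpha) (fE : finite_set E).

Lemma translate_preimage (g : G) (A : set a) : translate g A = pmp_act g^-1%g @^-1` A.
Proof. by apply/seteqP; split=> x /translateE. Qed.

Lemma join_translates_finite : finite_set (join_translates alpha E).
Proof.
have [fa _ _] := fpa; move: fE => /finite_seqP[l ->].
apply: (@sub_finite_set _ _ [set B | exists c : G -> set a,
    (forall f, f \in l -> alpha (c f)) /\ B = \bigcap_(f in [set` l]) translate f (c f)]).
  by move=> B [_ [c [ca ->]]]; exists c.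
elim: l => [|f l IH].
  apply: (@sub_finite_set _ _ [set setT]); last exact: finite_set1.
  by move=> _ [c [_ ->]]; apply/seteqP; split=> // x _ f.
apply: (@sub_finite_set _ _ [set (translate f A `&` B) | A in alpha & B in
  [set B | exists c : G -> set a, (forall f, f \in l -> alpha (c f)) /\
      B = \bigcap_(f in [set` l]) translate f (c f)]]).
  move=> _ [c [ca ->]]; exists (c f); first by apply: ca; rewrite mem_head.
  exists (\bigcap_(f in [set` l]) translate f (c f)).
    by exists c; split=> // g gl; apply: ca; rewrite in_cons gl orbT.
  apply/seteqP; split=> x.
    move=> [fx lx] g /=; rewrite in_cons => /orP[/eqP->//|gl]; exact: lx.
  move=> H; split; first by apply: H; rewrite /= mem_head.
  by move=> g gl; apply: H; rewrite /= in_cons; apply/orP; right.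
exact: finite_image2.
Qed.

Lemma join_translates_measurable B : join_translates alpha E B -> measurable B.
Proof.
move=> [_ [c [ca ->]]]; have [_ ma _] := fpa.
rewrite -[X in measurable X]setCK setC_bigcap; apply: measurableC.
apply: fin_bigcup_measurable => // f Ef; apply: measurableC; rewrite translate_preimage.
rewrite -[X in measurable X]setTI; apply: pmp_measurable => //; apply: ma; exact: ca.
Qed.
End JoinFinite.

(** * Homomorphisms into the approximation by the same chain *)

Section SelfHom.
Variables (R : realType) (F G : groupType) (pi : {multiplicative F -> G}) (rho : G -> F).
Hypothesis rho_section : forall g : G, pi (rho g) = g.
Variable H : chain G.
Local Notation a := (profinite_action R H).
Local Notation mu := (invlim_measure R (H := H)).
Local Notation nc := (ncounting R).

Let nc_le n (X Y Z : {set level H n}) : (forall c, c \notin Z -> (c \in X) = (c \in Y)) ->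
  `|nc X - nc Y| <= nc Z.
Proof.
move=> XY; have le (A B : {set level H n}) : (forall c, c \notin Z -> c \in A -> c \in B) -> nc A <= nc B + nc Z.
  move=> AB; rewrite /ncounting -mulrDl ler_wpM2r ?invr_ge0 // -natrD ler_nat.
  apply: leq_trans (leq_card_setU B Z); apply/subset_leq_card/fintype.subsetP => c cA.
  rewrite finset.inE; have [cZ|cZ] := boolP (c \in Z); first by rewrite orbT.
  by rewrite AB.
have h1 : nc X <= nc Y + nc Z by apply: le => c /XY ->.
have h2 : nc Y <= nc X + nc Z by apply: le => c /XY ->.
by rewrite ler_norml; apply/andP; split; lra.
Qed.

Let mu_fin (A : set a) : measurable A -> mu A \is a fin_num.
Proof. exact: (@fin_num_measure _ _ _ (pmp_mu a)). Qed.

Let mu_cyl n (S : {set level H n}) : mu (cyl S) = (nc S)%:E.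
Proof. exact: invlim_measureE. Qed.

Let cylm n (S : {set level H n}) : measurable (cyl S) := cyl_measurable S.

Let mu_sdiff n (B : set a) (S : {set level H n}) (e : R) : measurable B ->
  (mu (sdiff B (cyl S)) <= e%:E)%E -> `|nc S - fine (mu B)| <= e.
Proof.
move=> mB le; have mS := cylm S; have md := sdiff_measurable mB mS.
have h1 : (mu B <= mu (cyl S) + e%:E)%E.
  apply: le_trans (leeD2l _ le); apply: le_trans (measureU2 _ mS md).
  apply: le_measure; rewrite ?inE //; first exact: measurableU.
  by move=> x Bx; have [Sx|nSx] := pselect (cyl S x); [left|right; left].
have h2 : (mu (cyl S) <= mu B + e%:E)%E.
  apply: le_trans (leeD2l _ le); apply: le_trans (measureU2 _ mB md).
  apply: le_measure; rewrite ?inE //; first exact: measurableU.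
  by move=> x Sx; have [Bx|nBx] := pselect (B x); [left|right; right].
move: h1 h2; rewrite mu_cyl -(fineK (mu_fin mB)) -!EFinD !lee_fin ler_norml.
by move=> h1 h2; apply/andP; split; lra.
Qed.

(* [phi V] is the preimage of V under a section of [coord n] which avoids, whenever it
   can, the points where the given sets differ from their approximating cylinders. *)
Lemma self_hom (alpha : set (set a)) (E : set G) (delta : R) :
  finite_partition alpha -> finite_set E -> E 1%g -> 0 < delta ->
  exists n0, forall n, (n0 <= n)%N -> exists phi : set a -> {set level_action pi H n},
    sofic_hom rho alpha E delta phi.
Proof.
move=> fpa fE E1 delta0; pose P := join_translates alpha E.
have fP : finite_set P := join_translates_finite fpa fE.
have mP B : P B -> measurable B by exact: join_translates_measurable.
have [fa ma _] := fpa; have /finite_seqP[sa saE] := fa; have /finite_seqP[sE sEE] := fE.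
pose sP : seq (set a) := fset_set P.
have sPE B : B \in sP <-> P B by rewrite /sP in_fset_set // inE.
have saP A : A \in sa <-> alpha A by rewrite saE.
have sEP f : f \in sE <-> E f by rewrite sEE.
pose K := (size sE * size sa + size sP)%N.
(* K counts the exceptional sets, each of measure at most e, so their union D has measure at most
   eta. Each condition below costs at most 2 eta, and the sum over [sP] stays below delta. *)
pose eta := delta / (2%:R * (size sP).+2%:R); pose e := eta / K.+1%:R.
have eta0 : 0 < eta by rewrite divr_gt0 // mulr_gt0 ?ltr0n.
have e0 : 0 < e by rewrite divr_gt0 ?ltr0n.
have e_eta : e <= eta by rewrite ler_pdivrMr ?ltr0n // ler_peMr ?ler1n // ltW.
have Ke : K%:R * e <= eta.
  by rewrite /e mulrCA ler_piMr ?(ltW eta0) // ler_pdivrMr ?ltr0n // mul1r ler_nat.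
have [|n0 n0P] := approximation_level (s := sa ++ sP) e0.
  by move=> A; rewrite mem_cat => /orP[/saP/ma|/sPE/mP].
exists n0 => n nn0; have [S SP] := n0P n nn0.
pose D := \big[setU/set0]_(A <- [seq @invlim_act G H f^-1%g @^-1` sdiff A (cyl (S A)) | f <- sE, A <- sa] ++
   [seq sdiff B (cyl (S B)) | B <- sP]) A.
have [mD leD] : measurable D /\ (mu D <= eta%:E)%E.
  have [|mD leD] := @measure_bigU_le R G H ([seq @invlim_act G H f^-1%g @^-1` sdiff A (cyl (S A)) | f <- sE, A <- sa] ++
     [seq sdiff B (cyl (S B)) | B <- sP]) e.
    move=> V; rewrite mem_cat => /orP[/allpairsP[[f A] [/= fs As ->]]|/mapP[B Bs ->]]; last first.
      split; first exact: (sdiff_measurable (mP B ((sPE B).1 Bs)) (cylm _)).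
      by apply: SP; rewrite mem_cat Bs orbT.
    have md : measurable (sdiff A (cyl (S A))).
      exact: (sdiff_measurable (ma A ((saP A).1 As)) (cylm _)).
    split.
      rewrite -[X in measurable X]setTI; exact: (@pmp_measurable R G a f^-1%g _ _ md).
    rewrite (@pmp_preserving R G a f^-1%g _ md); apply: SP; by rewrite mem_cat As.
  split=> //; apply: le_trans leD _; rewrite lee_fin size_cat size_allpairs size_map.
  exact: Ke.
(* The section will avoid the null blocks everywhere, so that phi sends null sets exactly to the
   empty set. *)
pose Z := \big[setU/set0]_(B <- [seq B <- sP | `[< mu B = 0%E >]]) B.
have [mZ leZ] : measurable Z /\ (mu Z <= 0%:E)%E.
  have [|mZ leZ] := @measure_bigU_le R G H [seq B <- sP | `[< mu B = 0%E >]] 0.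
    move=> B; rewrite mem_filter => /andP[/asboolP -> /sPE/mP mB]; by split.
  by split=> //; apply: le_trans leZ _; rewrite mulr0.
have mem (l : seq (set a)) V x : V \in l -> V x -> (\big[setU/set0]_(C <- l) C) x.
  elim: l => // C l IH; rewrite inE big_cons => /orP[/eqP->|Vl] Vx; first by left.
  by right; exact: IH.
(* Points with no lift outside Z and D; their cylinder lies in that union, so their proportion is at
   most eta. *)
pose bad := [set c : level H n | `[< forall x : a, coord n x = c -> Z x \/ D x >]]%SET.
have nbad : nc bad <= eta.
  rewrite -lee_fin -mu_cyl; apply: (@le_trans _ _ (mu (Z `|` D))).
    apply: le_measure; rewrite ?inE; [exact: cylm|exact: measurableU|].
    by move=> x; rewrite /cyl /= finset.inE => /asboolP; apply.
  apply: le_trans (measureU2 _ mZ mD) _; rewrite -[leRHS]add0e; exact: leeD.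
(* A lift outside Z exists even over bad points, since each fibre of [coord n] has positive
   measure. *)
have sec_ex (c : level H n) : exists x : a, [/\ coord n x = c, ~ Z x & c \notin bad -> ~ D x].
  have [cb|] := boolP (c \in bad); last first.
    rewrite finset.inE => /asboolP/existsNP[x /not_implyP[xc /not_orP[nZ nD]]].
    by exists x.
  apply: contrapT => no.
  have sub : cyl (finset.set1 c) `<=` Z.
    move=> x; rewrite /cyl /= finset.inE => /eqP xc; apply: contrapT => nZ; apply: no.
    by exists x.
  have : (mu (cyl (finset.set1 c)) <= 0%:E)%E.
    have mc : measurable (cyl (finset.set1 c)) := cyl_measurable (finset.set1 c).
    by apply: le_trans leZ; apply: le_measure => //; rewrite inE.
  rewrite mu_cyl lee_fin /ncounting finset.cards1 div1r leNgt invr_gt0 ltr0n.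
  by rewrite level_gt0.
have [sec secP] := choice sec_ex.
pose phi (V : set a) := [set c : level H n | `[< V (sec c) >]]%SET.
have phiE V c : (c \in phi V) <-> V (sec c).
  by rewrite finset.inE; split => /asboolP.
have good A c : A \in sP -> c \notin bad -> (A (sec c) <-> c \in S A).
  move=> AP cb; have [sc _ /(_ cb) nD] := secP c.
  have nd : ~ sdiff A (cyl (S A)) (sec c).
    by move=> d; apply: nD; apply: (mem _ _ _ _ d); rewrite mem_cat; apply/orP; right; exact: map_f.
  rewrite -[in X in _ <-> X]sc; split=> H'; apply: contrapT => nH'; apply: nd; [left|right]; by split.
have goodA A f c : alpha A -> E f -> c \notin bad ->
    (A (invlim_act f^-1%g (sec c)) <-> level_act f^-1%g c \in S A).
  move=> aA Ef cb; have [sc _ /(_ cb) nD] := secP c.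
  have nd : ~ sdiff A (cyl (S A)) (invlim_act f^-1%g (sec c)).
    move=> d; apply: nD.
    apply: (mem _ (@invlim_act G H f^-1%g @^-1` sdiff A (cyl (S A)))) => //.
    by rewrite mem_cat; apply/orP; left; apply: allpairs_f; [apply/sEP|apply/saP].
  rewrite -[in X in _ <-> X]sc -coord_act.
  split=> H'; apply: contrapT => nH'; apply: nd; [left|right]; by split.
exists phi; split.
- split.
  + move=> A B _ _; apply/setP => c; rewrite finset.in_setU; apply/idP/orP.
      by move=> /phiE[] ?; [left|right]; apply/phiE.
    by move=> [] /phiE ?; apply/phiE; [left|right].
  + move=> A _; apply/setP => c; rewrite finset.in_setC; apply/idP/negP.
      by move=> /phiE nA /phiE.
    by move=> nA; apply/phiE => Ac; apply: nA; apply/phiE.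
  + move=> A [Q QP AE] A0; apply/setP => c; rewrite finset.in_set0; apply/negP => /phiE.
    rewrite AE => -[B QB Bc]; have [_ nZ _] := secP c; apply: nZ.
    have PB : P B := QP _ QB.
    apply: (mem _ B) => //; rewrite mem_filter; apply/andP; split; last exact/sPE.
    apply/asboolP/eqP; rewrite eq_le measure_ge0 andbT -A0.
    have mA : measurable A.
      rewrite AE; apply: fin_bigcup_measurable => [|V QV]; last exact: (mP V (QP V QV)).
      exact: sub_finite_set fP.
    apply: le_measure; rewrite ?inE //; first exact: mP.
    by rewrite AE => x Bx; exists B.
- move=> A f aA Ef.
  apply: (@le_lt_trans _ _ (2%:R * eta)); last first.
    rewrite /eta mulrA [2%:R * _]mulrC -mulrA -[ltRHS]mulr1 ltr_pM2l // invfM mulrA mulfV // mul1r.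
    by rewrite invf_lt1 ?ltr0n // ltr1n.
  have incl : (#|symdiff (@level_act G H n f @: phi A)%SET (phi (translate f A))| <= #|bad| + #|bad|)%N.
    rewrite -{2}(card_imset bad (@level_act_inj G H n f)).
    apply: leq_trans (leq_card_setU _ _); apply/subset_leq_card/fintype.subsetP => c'.
    pose c := level_act f^-1%g c'.
    have cE : c' = level_act f c by rewrite /c -level_actM mulgV level_act1.
    rewrite [c' \in bad :|: _]finset.in_setU; apply: contraLR; rewrite negb_or => /andP[b1 b2].
    have b2' : c \notin bad by apply: contraNN b2 => cb; rewrite cE imset_f.
    have e1 : c' \in (@level_act G H n f @: phi A)%SET <-> c \in phi A.
      split=> [/imsetP[d dA c'd]|cA]; last by rewrite cE imset_f.
      by rewrite /c c'd -level_actM mulVg level_act1.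
    have e2 : c \in phi A <-> c \in S A.
      have := goodA A 1%g c aA E1 b2'; rewrite invg1 level_act1 invlim_act1 => h.
      by split=> [/phiE/h|/h/phiE].
    have e3 : c' \in phi (translate f A) <-> c \in S A.
      have h := goodA A f c' aA Ef b1.
      split=> [/phiE/translateE/h//|/h h']; apply/phiE/translateE; exact: h'.
    have e4 : (c' \in (@level_act G H n f @: phi A)%SET) = (c' \in phi (translate f A)).
      by apply/idP/idP => [/e1/e2/e3|/e3/e2/e1].
    by rewrite /symdiff finset.inE !finset.in_setD e4; case: (_ \in _).
  rewrite [X in nc (symdiff X _)](_ : _ = (@level_act G H n f @: phi A)%SET); last first.
    by apply: eq_imset => c; rewrite /fin_act /= rho_section.
  apply: (@le_trans _ _ (nc bad + nc bad)); last by lra.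
  by rewrite /ncounting -mulrDl ler_wpM2r ?invr_ge0 // -natrD ler_nat.
- rewrite fsbig_finite //=.
  have term B : B \in sP -> `|nc (phi B) - fine (mu B)| <= 2%:R * eta.
    move=> BP; have mB : measurable B := mP B ((sPE B).1 BP).
    have h1 : `|nc (phi B) - nc (S B)| <= nc bad.
      by apply: nc_le => c cb; apply/idP/idP => [/phiE/(good _ _ BP cb)|/(good _ _ BP cb)/phiE].
    have h2 : `|nc (S B) - fine (mu B)| <= e.
      by apply: mu_sdiff => //; apply: SP; rewrite mem_cat BP orbT.
    have := ler_normD (nc (phi B) - nc (S B)) (nc (S B) - fine (mu B)).
    rewrite addrA subrK => h3; lra.
  apply: (@le_lt_trans _ _ (\sum_(B <- sP | B \in sP) 2%:R * eta)).
    by rewrite big_seq; apply: ler_sum => B; exact: term.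
  have s0 : 0 < (size sP).+2%:R :> R by rewrite ltr0n.
  have e2 : 2%:R * eta = delta / (size sP).+2%:R.
    by rewrite /eta mulrCA invfM mulVKf // pnatr_eq0.
  rewrite -big_seq big_const_seq count_predT iter_addr_0 e2 -[_ *+ _]mulr_natr.
  rewrite -mulrA -[ltRHS]mulr1 ltr_pM2l // mulrC ltr_pdivrMr // mul1r ltr_nat.
  by rewrite ltnS leqnSn.
Qed.

(** Every homomorphism sends the whole space to the whole level, so for the trivial partition the
    count only detects existence. *)
Lemma hom_count_trivial (alpha : set (set a)) (E : set G) (delta : R) :
  finite_partition alpha -> finite_set E -> E 1%g -> 0 < delta ->
  exists n0, forall n, (n0 <= n)%N ->
    sofic_hom_count rho [set setT] alpha E delta (level_action pi H n) = 1%N.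
Proof.
move=> fpa fE E1 d0; have [n0 n0P] := self_hom fpa fE E1 d0.
exists n0 => n /n0P[phi homphi].
pose full : {ffun fset_set [set (setT : set a)] -> {set level_action pi H n}} :=
  [ffun => [set: level_action pi H n]%SET].
rewrite /sofic_hom_count -(finset.cards1 full); congr #|pred_of_set _|.
have val1 (C : fset_set [set (setT : set a)]) : val C = setT.
  by have := valP C; rewrite in_fset_set ?inE //; exact: finite_set1.
have homT (psi : set a -> {set level_action pi H n}) : sofic_hom rho alpha E delta psi -> psi setT = [set: level_action pi H n]%SET.
  move=> [hom _ _]; have h0 := hom0 fpa hom; have [_ HC _] := hom.
  by rewrite -setC0 HC ?h0 ?finset.setC0 //; exact: algebra0.
apply/setP => s; rewrite !finset.inE; apply/asboolP/eqP => [[psi hpsi sE]|->].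
  by apply/ffunP => C; rewrite sE ffunE val1 homT.
by exists phi => // C; rewrite ffunE val1 homT.
Qed.

End SelfHom.

Lemma ultrafilter_tail (U : set_system nat) : nonprincipal_ultrafilter U ->
  forall n0, U [set n | (n0 <= n)%N].
Proof.
move=> [UU np]; elim=> [|n0 IH].
  by rewrite (_ : [set _ | _] = setT); [exact: filterT|apply/seteqP; split].
have [/np//|nU] := in_ultra_setVsetC [set n0] UU.
apply: filterS (filterI IH nU) => n [/= le ne]; rewrite ltn_neqAle le andbT.
by apply/eqP => e; apply: ne.
Qed.

Section EntropyValues.
Variables (R : realType) (U : set_system nat) (hU : nonprincipal_ultrafilter U).
Variables (F G : groupType) (rho : G -> F) (a : pmp_action R G) (Sigma : nat -> fin_action F).

Let UU : UltraFilter U. Proof. by case: hU. Qed.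
Let PU : ProperFilter U. Proof. exact: ultra_proper. Qed.
Let FU : Filter U. Proof. by case: PU. Qed.

Lemma entropy_at_zero xi alpha E delta n0 :
  (forall n, (n0 <= n)%N -> sofic_hom_count rho xi alpha E delta (Sigma n) = 1%N) ->
  sofic_entropy_at rho (a := a) U Sigma xi alpha E delta = 0%E.
Proof.
move=> c1; apply: (@lim_near_cst _ (@ereal_hausdorff R) nat U PU).
apply: (@filterS nat U FU [set n | (n0 <= n)%N]); last exact: ultrafilter_tail.
move=> n nn0.
change ((#|Sigma n|%:R^-1)%:E * lne (sofic_hom_count rho xi alpha E delta (Sigma n))%:R%:E = 0 :> \bar R)%E.
by rewrite c1 // [X in lne X](_ : _ = 1%E) // lne1 mule0.
Qed.

Lemma entropy_at_Ny xi alpha E delta :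
  (forall n, sofic_hom_count rho xi alpha E delta (Sigma n) = 0%N) ->
  sofic_entropy_at rho (a := a) U Sigma xi alpha E delta = -oo%E.
Proof.
move=> c0; apply: (@lim_near_cst _ (@ereal_hausdorff R) nat U PU).
apply: (@filterS nat U FU [set: nat]); last exact: (@filterT _ U FU).
move=> n _.
change ((#|Sigma n|%:R^-1)%:E * lne (sofic_hom_count rho xi alpha E delta (Sigma n))%:R%:E = -oo :> \bar R)%E.
rewrite c0 le0_lneNy // gt0_muleNy // lte_fin invr_gt0 ltr0n.
exact: fin_space_gt0.
Qed.

End EntropyValues.

Section GoodFamilyEntropy.
Variables (R : realType) (U : set_system nat) (hU : nonprincipal_ultrafilter U).
Variables (F G : groupType) (pi : {multiplicative F -> G}) (rho : G -> F).
Hypothesis rho_section : forall g : G, pi (rho g) = g.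

(** The trivial partition suffices as a lower bound for the supremum: its count is 1 for large n,
    and log 1 = 0. *)
Lemma entropy_self (H : chain G) :
  (0 <= sofic_entropy rho (profinite_action R H) U (level_action pi H))%E.
Proof.
pose a := profinite_action R H.
have fT : finite_partition [set (setT : set a)].
  split; first exact: finite_set1.
    by move=> A ->; exact: measurableT.
  split.
  - by apply/seteqP; split=> // x _; exists setT.
  - by apply/trivIsetP => A B -> -> /eqP.
  - by move=> A ->; exists (invlim_cls H 1%g).
rewrite /sofic_entropy; set V := (X in (_ <= ereal_sup X)%E).
suff [v Vv v0] : exists2 v, V v & (0 <= v)%E by apply: le_trans v0 (ereal_sup_ubound Vv).
exists (ereal_inf [set ereal_inf [set ereal_inf [set sofic_entropy_at rho U (level_action pi H) [set (setT : set a)] alpha E delta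
   | delta in [set delta : R | 0 < delta]] | E in [set E : set G | finite_set E /\ E 1%g]]
   | alpha in [set alpha | finite_partition alpha /\ refines alpha [set (setT : set a)]]]).
  by exists [set (setT : set a)].
apply: le_ereal_inf_tmp => _ [alpha [fpa _] <-].
apply: le_ereal_inf_tmp => _ [E [fE E1] <-].
apply: le_ereal_inf_tmp => _ [delta d0 <-].
have [n0 n0P] := hom_count_trivial rho_section fpa fE E1 d0.
by rewrite (entropy_at_zero hU n0P).
Qed.

Lemma entropy_distinct (J : nat -> set G) (goodJ : good_family J) (S S' : set nat) j :
  S' j -> ~ S j ->
  sofic_entropy rho (profinite_action R (truncation_chain goodJ S')) U
    (level_action pi (truncation_chain goodJ S)) = -oo%E.
Proof.
move=> S'j Sj; apply/eqP; rewrite eq_le leNye andbT.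
apply: ge_ereal_sup => _ [xi fxi <-].
have [alpha [E [delta [fpa ref [fE E1] d0 c0]]]] :=
  hom_count_eq0 rho_section S'j Sj fxi.
rewrite -(entropy_at_Ny hU c0).
apply: ge_ereal_inf; eexists; first by exists alpha; [split|reflexivity].
apply: ge_ereal_inf; eexists; first by exists E; [split|reflexivity].
apply: ge_ereal_inf; eexists; first by exists delta; [exact: d0|reflexivity].
exact: lexx.
Qed.

End GoodFamilyEntropy.

Section Transport.
Variables (G K : groupType) (f : {multiplicative G -> K}).
Hypothesis fbij : bijective f.

Lemma good_family_transport (J : nat -> set K) : good_family J ->
  good_family (fun i => [set g | J i (f g)]).
Proof.
case: fbij => f' fK f'K [sJ nJ fJ rJ sepJ].
have f1 := multiplicative1 f; have fV := multiplicativeV f.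
have f'M x y : f' (x * y)%g = (f' x * f' y)%g.
  by apply: (can_inj fK); rewrite gmulfM !f'K.
split.
- move=> i; have [J1 JM JV] := sJ i; split=> [|x y|x] /=; first by rewrite f1.
    by rewrite gmulfM; exact: JM.
  by rewrite fV; exact: JV.
- by move=> i g x /= Jx; rewrite !gmulfM fV; exact: nJ.
- move=> i; apply: (@sub_finite_set _ _ ((fun X => f @^-1` X) @` lcosets (J i))); last exact: finite_image.
  move=> _ [g _ <-]; exists (lcoset (J i) (f g)); first by exists (f g).
  have sJi : subgroup [set g | J i (f g)].
    have [J1 JM JV] := sJ i; split=> [|x y|x] /=; first by rewrite f1.
      by rewrite gmulfM; exact: JM.
    by rewrite fV; exact: JV.
  apply/seteqP; split=> x /=.
    by move=> /(lcosetE (sJ i)) h; apply/(lcosetE sJi); rewrite /= gmulfM fV.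
  by move=> /(lcosetE sJi) /=; rewrite gmulfM fV => h; apply/(lcosetE (sJ i)).
- move=> g g1; apply: rJ => fg; apply: g1; apply: (can_inj fK); by rewrite fg f1.
move=> I' j jI'; have [E [d Ed]] := sepJ I' j jI'; exists (map f' E), d.
move=> I T T' act act' [a1 aM] [a1' aM'] sT sT' jI T0 phi small.
have f'1 : f' 1%g = 1%g by rewrite -f1 fK.
apply: (Ed I T T' (fun k => act (f' k)) (fun k => act' (f' k)) _ _ _ _ jI T0 phi).
- by split=> [t|g h t]; rewrite ?f'1 // f'M.
- by split=> [t|g h t]; rewrite ?f'1 // f'M.
- by move=> t g; rewrite sT; split=> H i /H /=; rewrite f'K.
- by move=> t g; rewrite sT'; split=> H i /H /=; rewrite f'K.
- by move=> g gE; apply: small; exact: map_f.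
Qed.
End Transport.

(** * Infinite incomparable sets of integers *)

Section Antichain.
Variable R : realType.

(* No two of these sets are comparable. *)
Definition cut_code (r : R) : set nat :=
  [set i | exists x : rat, i = choice.pickle (x, (ratr x < r :> R))].

Lemma injective_unbounded (f : nat -> nat) : injective f -> forall i0, exists m, (i0 <= f m)%N.
Proof.
move=> fI i0; apply: contrapT => no.
have lt m : (f m < i0)%N by rewrite ltnNge; apply/negP => h; apply: no; exists m.
have gI : injective (fun m : 'I_i0.+1 => Ordinal (lt m)).
  by move=> x y /(congr1 val) /= /fI /val_inj.
by have := leq_card _ gI; rewrite !card_ord ltnn.
Qed.

Lemma cut_code_infinite r i0 : exists2 i, (i0 <= i)%N & cut_code r i.
Proof.
have fI : injective (fun m : nat => choice.pickle ((m%:R : rat), ((ratr (m%:R : rat) : R) < r))).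
  move=> x y /(pcan_inj (@choice.pickleK _)) [/eqP + _].
  by rewrite eqr_nat => /eqP.
have [m im] := injective_unbounded fI i0.
by exists (choice.pickle ((m%:R : rat), ((ratr (m%:R : rat) : R) < r))) => //; exists m%:R.
Qed.

(** A code records a rational together with the truth value of its comparison with r. A rational
    that separates r and s gets opposite values, so either set contains a code missing in the
    other. *)
Lemma cut_code_antichain r s : r <> s -> exists2 j, cut_code s j & ~ cut_code r j.
Proof.
move=> rs; have [x xrs] : exists x : rat, (ratr x < r :> R) != (ratr x < s :> R).
  case: (ltgtP r s) => [lt|lt|//].
    have [x] := rat_in_itvoo lt; rewrite in_itv /= => /andP[rx xs].
    by exists x; rewrite xs ltNge (ltW rx).
  have [x] := rat_in_itvoo lt; rewrite in_itv /= => /andP[sx xr].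
  by exists x; rewrite xr ltNge (ltW sx).
exists (choice.pickle (x, (ratr x < s :> R))); first by exists x.
move=> [y /(pcan_inj (@choice.pickleK _)) [xy e]].
by move: xrs; rewrite e xy eqxx.
Qed.

End Antichain.

Theorem theorem4 (R : realType) (U : set_system nat)
    (hU : nonprincipal_ultrafilter U)
    (F G : groupType) (pi : {multiplicative F -> G}) (rho : G -> F)
    (hF : countable [set: F]%classic) (freeF : free_group F)
    (pi_surj : forall g : G, exists w : F, pi w = g)
    (rho_section : forall g : G, pi (rho g) = g) (rho1 : rho 1%g = 1%g)
    (hG : (countable [set: G]%classic /\ free_group G /\
           (exists x y : G, (x * y)%g <> (y * x)%g)) \/
          (exists k : nat, (2 <= k)%N /\ isomorphic G (PSLZ k))) :
  exists H : R -> chain G,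
    (forall r, normal_chain (H r)) /\
    exists hfree : forall r, free_action (profinite_action R (H r)),
      forall r s : R,
        (-oo < sofic_entropy rho (profinite_action R (H s)) U
                 (Sigma_chain pi (hfree r)))%E <-> r = s.
Proof.
have [J goodJ] : exists J : nat -> set G, good_family J.
  case: hG => [[cG [[S fS] nab]]|[k [k2 [f fbij]]]].
    have [q [r [pool r2]]] := exists_sparse_pool.
    have [a [b [Sa Sb ab]]] := free_basis_two fS nab.
    exact: (free_group_good_family R pool r2 fS Sa Sb ab cG).
  suff [J goodJ] : exists J : nat -> set (PSLZ k), good_family J.
    by exists (fun i => [set g | J i (f g)]); exact: good_family_transport.
  case: k k2 f fbij => [|[|[|n]]] // _ _ _; first exact: (PSL2_good_family R).
  have [q [r [pool r2]]] := exists_sparse_pool.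
  by exists (@congruence q n); exact: (congruence_good_family R pool).
exists (fun r => truncation_chain goodJ (cut_code r)); split.
  by move=> r; exact: truncation_chain_normal.
exists (fun r => @truncation_free G J goodJ R (cut_code r) (cut_code_infinite r)) => r s; split.
  apply: contraPP => rs; have [j js jr] := cut_code_antichain rs.
  rewrite [sofic_entropy _ _ _ _](_ : _ = -oo%E) ?ltxx //.
  exact: (@entropy_distinct R U hU F G pi rho rho_section J goodJ _ _ j js jr).
move=> ->; apply: (@lt_le_trans _ _ 0%E); first exact: ltNyr.
exact: (@entropy_self R U hU F G pi rho rho_section (truncation_chain goodJ (cut_code s))).
Qed.
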